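(* Let $\mathcal{G}$ be a Hausdorff, second countable, $\sigma$-compact LCA group. Let $\sigma$ be a symbol on the phase space $\mathcal{G}\times\widehat{\mathcal{G}}$ such that, for some $0<p<\infty$, $$\sigma\in\bigcap_{\gamma>0}M^{p,\gamma}(\mathcal{G}\times\widehat{\mathcal{G}}).$$ If $\lambda\in\sigma_P(\mathrm{Op}_0(\sigma))\setminus\{0\}$, then any eigenfunction $f\in L^2(\mathcal{G})$ of $\mathrm{Op}_0(\sigma)$ with eigenvalue $\lambda$ satisfies $f\in\bigcap_{\gamma>0}M^\gamma(\mathcal{G})$.
   Context: Setting. $\mathcal{G}$ is written additively; $\widehat{\mathcal{G}}$ is its dual group, $\langle\xi,x\rangle=\xi(x)$; $dx$, $d\xi$ dual Haar measures. $\hat f(\xi)=\int_{\mathcal{G}}f(x)\overline{\langle\xi,x\rangle}dx$. $T_xf(y)=f(y-x)$, $M_\xi f(y)=\langle\xi,y\rangle f(y)$, $\pi(x,\xi)=M_\xi T_x$, $V_gf(x,\xi)=\langle f,\pi(x,\xi)g\rangle$. The same notions are used on the LCA group $\mathcal{G}\times\widehat{\mathcal{G}}$, whose dual is $\widehat{\mathcal{G}}\times\mathcal{G}$. By the structure theorem fix $\mathcal{G}\cong\mathbb{R}^d\times\mathcal{G}_0$, $\mathcal{G}_0$ an LCA group with compact open subgroup $\mathcal{K}$. Gaussian: $\varphi(x_1,x_2)=e^{-\pi x_1^2}\chi_{\mathcal{K}}(x_2)$; $\mathcal{S}_{\mathcal{C}}(\mathcal{G})=\mathrm{span}\{\pi(x,\xi)\varphi\}$.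 On $\mathcal{G}\times\widehat{\mathcal{G}}\cong\mathbb{R}^{2d}\times(\mathcal{G}_0\times\widehat{\mathcal{G}}_0)$ one uses the compact open subgroup $\mathcal{K}\times\mathcal{K}^\perp$. $S_0(\mathcal{G})=\{f\in L^2(\mathcal{G}):V_\varphi f\in L^1\}$ with norm $\|V_\varphi f\|_{L^1}$; $S_0'(\mathcal{G})$ is the space of continuous antilinear functionals on it. Modulation spaces (unweighted). $\|F\|_{L^{p,q}}=(\int_{\widehat{\mathcal{G}}}(\int_{\mathcal{G}}|F(x,\xi)|^pdx)^{q/p}d\xi)^{1/q}$ (usual modifications for $\infty$); $\mathsf{M}_QF(\mathbf{x})=\operatorname{ess\,sup}_{\mathbf{y}\in\mathbf{x}+Q}|F(\mathbf{y})|$, $Q$ a measurable relatively compact unit neighbourhood. For $0<p,q\le\infty$, $M^{p,q}(\mathcal{G})=\{f\in S_0'(\mathcal{G}):\mathsf{M}_QV_gf\in L^{p,q}\}$ with $\|f\|_{M^{p,q}}=\|\mathsf{M}_QV_gf\|_{L^{p,q}}$, $g\in\mathcal{S}_{\mathcal{C}}(\mathcal{G})\setminus\{0\}$ fixed (independent of $g,Q$ up to equivalence); $M^p=M^{p,p}$. $M^{p,q}(\mathcal{G}\times\widehat{\mathcal{G}})$ is the same with $\mathcal{G}$ replaced by $\mathcal{G}\times\widehat{\mathcal{G}}$. Kohn–Nirenberg operator. With $R(f,g)(x,\xi)=f(x)\overline{\hat g(\xi)}\,\overline{\langle\xi,x\rangle}$, $\mathrm{Op}_0(\sigma)\colon S_0(\mathcal{G})\to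 S_0'(\mathcal{G})$ is defined by $\langle\mathrm{Op}_0(\sigma)f,g\rangle=\langle\sigma,R(g,f)\rangle$, $f,g\in S_0(\mathcal{G})$; for the symbols considered it extends to a bounded operator on $L^2(\mathcal{G})$. Point spectrum: for a bounded linear operator $T$ on $L^2(\mathcal{G})$, $\sigma_P(T)=\{\lambda\in\mathbb{C}:\exists f\in L^2(\mathcal{G})\setminus\{0\},\ Tf=\lambda f\}$; such $f$ is an eigenfunction with eigenvalue $\lambda$. *)

(* Defs.v *)
From HB Require Import structures.
From mathcomp Require Import all_boot all_order all_algebra.
From mathcomp Require Import all_classical all_reals all_analysis.
From mathcomp Require Import measurable_realfun ess_sup_inf complex ring.

Set Implicit Arguments.
Unset Strict Implicit.
Unset Printing Implicit Defensive.

Import Order.TTheory GRing.Theory Num.Theory.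
Import numFieldNormedType.Exports Normc.

Local Open Scope classical_set_scope.
Local Open Scope ring_scope.
Local Open Scope complex_scope.

(** * Locally compact abelian groups and their Borel sets *)

(* The product of two topological abelian groups is only an instance of
   [PreTopologicalZmodule] in the library (abelian group + topology), which is
   why the time-frequency notions below are stated for that structure. *)
Notation preTopologicalZmodType := PreTopologicalZmodule.type.

HB.instance Definition _ (G H : preTopologicalZmodType) :=
  Topological.on (G * H)%type.

Definition borel (G : preTopologicalZmodType) : Type := G.

Section Borel.
Variable G : preTopologicalZmodType.
HB.instance Definition _ := Choice.copy (borel G) G.
HB.instance Definition _ := isPointed.Build (borel G) (0 : G).
HB.instance Definition _ := Measurable.copy (borel G)
  (g_sigma_algebraType (@open G : set (set (borel G)))).
End Borel.

Definition is_lca (G : topologicalZmodType) :=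
  hausdorff_space G /\ locally_compact [set: G].

Definition sigma_compact (T : topologicalType) :=
  exists K : (set T)^nat, (forall n, compact (K n)) /\ \bigcup_n K n = setT.

Section Haar.
Variables (R : realType) (G : preTopologicalZmodType).

(* Regularity is automatic on the second countable groups considered. *)
Definition is_haar (mu : set (borel G) -> \bar R) :=
  [/\ forall (x : G) (E : set (borel G)), measurable E ->
        mu [set (x + y : G) | y in E] = mu E,
      forall K : set G, compact K -> (mu K < +oo)%E
    & forall U : set G, open U -> U !=set0 -> (0 < mu U)%E].

End Haar.

(** * The dual group *)

Section Dual.
Variables (R : realType) (G : topologicalZmodType).

Definition is_character (chi : G -> R[i]) :=
  [/\ continuous (chi : G -> R[i]^o),
      forall x y, chi (x + y) = chi x * chi y
    & forall x, `|chi x| = 1].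

Record dual := Dual { character :> G -> R[i]; _ : is_character character }.

Lemma characterP (chi : dual) : is_character chi. Proof. by case: chi. Qed.

Lemma dual_eq (chi psi : dual) : chi =1 psi -> chi = psi.
Proof.
case: chi psi => [f Hf] [g Hg] /= /funext fg; rewrite fg in Hf *.
by congr Dual; exact: Prop_irrelevance.
Qed.

HB.instance Definition _ := gen_eqMixin dual.
HB.instance Definition _ := gen_choiceMixin dual.

Lemma character_neq0 (chi : dual) x : chi x != 0.
Proof.
have [_ _ /(_ x) h] := characterP chi.
by rewrite -normr_eq0 h oner_eq0.
Qed.

Fact is_character1 : is_character (fun=> 1).
Proof.
by split => [||x]; [exact: cst_continuous|move=> *; rewrite mulr1|rewrite normr1].
Qed.

Fact is_characterM (chi psi : dual) : is_character (fun x => chi x * psi x).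
Proof.
have [c1 m1 n1] := characterP chi; have [c2 m2 n2] := characterP psi.
split => [x|x y|x].
- exact: (@continuousM _ _ (chi : G -> R[i]^o) psi x (c1 x) (c2 x)).
- by rewrite m1 m2 mulrACA.
- by rewrite normrM n1 n2 mulr1.
Qed.

Fact is_characterV (chi : dual) : is_character (fun x => (chi x)^-1).
Proof.
have [c1 m1 n1] := characterP chi.
split => [x|x y|x].
- exact: (@continuousV _ _ (chi : G -> R[i]^o) x (character_neq0 chi x) (c1 x)).
- by rewrite m1 invfM.
- by rewrite normfV n1 invr1.
Qed.

(* The group law of the dual group is pointwise multiplication of characters,
   written additively. *)
Let add (chi psi : dual) := Dual (is_characterM chi psi).
Let opp (chi : dual) := Dual (is_characterV chi).
Let zero := Dual is_character1.

Fact dual_addA : associative add.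
Proof. by move=> ? ? ?; apply: dual_eq => x /=; rewrite mulrA. Qed.
Fact dual_addC : commutative add.
Proof. by move=> ? ?; apply: dual_eq => x /=; rewrite mulrC. Qed.
Fact dual_add0 : left_id zero add.
Proof. by move=> ?; apply: dual_eq => x /=; rewrite mul1r. Qed.
Fact dual_addN : left_inverse zero opp add.
Proof.
by move=> chi; apply: dual_eq => x /=; rewrite mulVf ?character_neq0.
Qed.

HB.instance Definition _ :=
  GRing.isZmodule.Build dual dual_addA dual_addC dual_add0 dual_addN.

HB.instance Definition _ := isPointed.Build dual 0.

HB.instance Definition _ := Topological.copy dual
  (initial_topology (character : dual -> {compact-open, G -> R[i]^o})).

Lemma dual_nbhsP (chi : dual) (K : set G) (e : R[i]) : compact K -> 0 < e ->
  nbhs chi [set psi : dual | forall x, K x -> `|chi x - psi x| < e].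
Proof.
move=> cK e0.
have [cchi _ _] := characterP chi.
have h : {compact-open, (character @ nbhs chi) --> (chi : G -> R[i]^o)}.
  exact: (@initial_continuous _ _ (character : dual -> {compact-open, G -> R[i]^o}) chi).
have FF : Filter (character @ nbhs chi) by exact: fmap_filter.
have := (@fam_cvgP G R[i]^o compact _ _ FF).1 ((@compact_open_fam_compactP G R[i]^o chi _ cchi FF).1 h) K cK.
move=> /(_ [set psi : G -> R[i] | forall x, K x -> `|chi x - psi x| < e]); apply.
apply/uniform_nbhs; exists [set z : R[i]^o * R[i]^o | `|z.1 - z.2| < e]; split => //.
by rewrite -entourage_ballE; exists e.
Qed.

Lemma dual_sub_continuous : continuous (fun x : dual * dual => x.1 - x.2).
Proof.
apply: (@continuous_comp_initial _ _ _
  (character : dual -> {compact-open, G -> R[i]^o})) => -[a b].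
have [cab _ _] := characterP (a - b).
have FF :
    Filter ((character \o (fun x : dual * dual => x.1 - x.2)) @ nbhs (a, b)).
  exact: fmap_filter.
apply: (@compact_open_fam_compactP G R[i]^o (a - b) _ cab FF).2.
apply: (@fam_cvgP G R[i]^o compact _ _ FF).2 => K cK P /uniform_nbhs[E []].
rewrite -entourage_ballE => -[e /= e0 eE] EP.
have e20 : 0 < e / 2 by rewrite divr_gt0.
have : nbhs (a, b) [set z : dual * dual |
    (forall x, K x -> `|a x - z.1 x| < e / 2) /\
    (forall x, K x -> `|b x - z.2 x| < e / 2)].
  exists ([set c : dual | forall x, K x -> `|a x - c x| < e / 2],
          [set c : dual | forall x, K x -> `|b x - c x| < e / 2]).
    by split; apply: dual_nbhsP.
  by move=> z [].
apply: filterS => -[c d] /= [ac bd]; apply: EP => x Kx; apply: eE => /=.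
change (`|a x * (b x)^-1 - c x * (d x)^-1| < e).
have n1 (u : dual) : `|u x| = 1 by have [_ _ ->] := characterP u.
have u0 := character_neq0 ^~ x.
have -> : a x * (b x)^-1 - c x * (d x)^-1 =
    (b x)^-1 * (a x - c x) - c x * (b x)^-1 * (d x)^-1 * (b x - d x).
  by field; rewrite !u0.
apply: le_lt_trans (ler_normB _ _) _; rewrite [ltRHS]splitr ltrD//.
  by rewrite normrM normfV n1 invr1 mul1r ac.
by rewrite !normrM !normfV !n1 invr1 !mul1r bd.
Qed.

HB.instance Definition _ :=
  PreTopologicalNmodule_isTopologicalZmodule.Build dual dual_sub_continuous.

End Dual.

(** * Integration of complex-valued functions *)

Section ComplexIntegration.
Context d (T : measurableType d) (R : realType).
Variable mu : {measure set T -> \bar R}.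
Implicit Types (f g : T -> R[i]) (p : \bar R).

Definition cmeasurable f :=
  measurable_fun setT (fun x => complex.Re (f x)) /\
  measurable_fun setT (fun x => complex.Im (f x)).

Definition cintegral f : R[i] :=
  (\int[mu]_x complex.Re (f x)) +i* (\int[mu]_x complex.Im (f x)).

Definition cLnorm p f : \bar R := Lnorm mu p (fun x => (normc (f x))%:E).

Definition in_L p f := cmeasurable f /\ (cLnorm p f < +oo)%E.

Definition L2_inner f g : R[i] := cintegral (fun x => f x * (g x)^*).

(* Elements of L^2 are represented by functions, so linearity and eigenvalue
   equations hold up to almost everywhere equality. *)
Definition bounded_L2_operator (A : (T -> R[i]) -> (T -> R[i])) :=
  [/\ forall f, in_L 2%:E f -> in_L 2%:E (A f),
      forall (a : R[i]) f g, in_L 2%:E f -> in_L 2%:E g ->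
        {ae mu, forall x, A (fun y => a * f y + g y) x = a * A f x + A g x}
    & exists C : R, forall f, in_L 2%:E f ->
        (cLnorm 2%:E (A f) <= C%:E * cLnorm 2%:E f)%E].

Definition eigenfunction (A : (T -> R[i]) -> (T -> R[i])) (lambda : R[i]) f :=
  [/\ in_L 2%:E f, ~ {ae mu, forall x, f x = 0}
    & {ae mu, forall x, A f x = lambda * f x}].

Definition point_spectrum (A : (T -> R[i]) -> (T -> R[i])) : set R[i] :=
  [set lambda | exists f, eigenfunction A lambda f].

End ComplexIntegration.

(** * Time-frequency analysis *)

(* An abelian group together with (a group identified with) its dual, the
   duality pairing, a pair of Haar measures and the reference Gaussian. *)
Record tf_space (R : realType) := TFSpace {
  time : preTopologicalZmodType;
  freq : preTopologicalZmodType;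
  pairing : freq -> time -> R[i];
  haar : {sigma_finite_measure set (borel time) -> \bar R};
  dual_haar : {sigma_finite_measure set (borel freq) -> \bar R};
  gauss : time -> R[i] }.

Section TimeFrequency.
Variables (R : realType) (P : tf_space R).
Local Notation X := (time P).
Local Notation X' := (freq P).
Local Notation mu := (haar P).
Local Notation nu := (dual_haar P).
Local Notation mu_nu := (mu \x nu)%E.
Implicit Types (f g : X -> R[i]) (u : (X -> R[i]) -> R[i]).
Implicit Types (Q : set (X * X')) (F : X * X' -> \bar R) (p q : \bar R).

Definition fourier f (xi : X') : R[i] :=
  cintegral mu (fun x => f x * (pairing xi x)^*).

(* This normalizes [dual_haar P] as the dual measure of [haar P]. *)
Definition fourier_inversion :=
  forall f, continuous (f : X -> R[i]^o) ->
    in_L mu 1%:E f -> in_L nu 1%:E (fourier f) ->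
    forall x : X, f x = cintegral nu (fun xi => fourier f xi * pairing xi x).

Definition tfshift (z : X * X') g : X -> R[i] :=
  fun y => pairing z.2 y * g (y - z.1).

Definition stft g f (z : X * X') : R[i] := L2_inner mu f (tfshift z g).

Definition S_C : set (X -> R[i]) :=
  [set g | exists n (c : 'I_n -> R[i]) (z : 'I_n -> X * X'),
    g = fun y => \sum_(k < n) c k * tfshift (z k) (gauss (t:=P)) y].

Definition S0 : set (X -> R[i]) :=
  [set f | in_L mu 2%:E f /\ in_L mu_nu 1%:E (stft (gauss (t:=P)) f)].

Definition S0_norm f : \bar R := cLnorm mu_nu 1%:E (stft (gauss (t:=P)) f).

Definition S0_dual : set ((X -> R[i]) -> R[i]) :=
  [set u | (forall (a : R[i]) f g, S0 f -> S0 g ->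
              u (fun x => a * f x + g x) = a^* * u f + u g) /\
           (exists C : R, forall f, S0 f ->
              ((normc (u f))%:E <= C%:E * S0_norm f)%E)].

Definition dual_stft g u (z : X * X') : R[i] := u (tfshift z g).

Definition mixed_norm p q F : \bar R :=
  Lnorm nu q (fun xi => Lnorm mu p (fun x => F (x, xi))).

(* The function is cut off by 0 outside of [z + Q], which does not change the
   essential supremum of a nonnegative function over [z + Q]. *)
Definition local_sup Q (F : X * X' -> R[i]) (z : X * X') : \bar R :=
  ess_sup mu_nu (fun y =>
    if (y - z : X * X') \in Q then (normc (F y))%:E else 0%E).

Definition unit_neighbourhood Q :=
  [/\ measurable (Q : set (borel X * borel X')), precompact Q
    & nbhs (0 : X * X') Q].

Definition window g := S_C g /\ exists x, g x != 0.

Definition modulation g Q p q : set ((X -> R[i]) -> R[i]) :=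
  [set u | [/\ S0_dual u,
    measurable_fun setT
      (local_sup Q (dual_stft g u) : borel X * borel X' -> \bar R)
    & (mixed_norm p q (local_sup Q (dual_stft g u)) < +oo)%E]].

(* L^2 functions are identified with elements of [S0_dual]. *)
Definition L2_functional f : (X -> R[i]) -> R[i] := fun g => L2_inner mu f g.

Definition rihaczek f g (z : X * X') : R[i] :=
  f z.1 * (fourier g z.2)^* * (pairing z.2 z.1)^*.

Definition Op0 (sigma : (X * X' -> R[i]) -> R[i]) f : (X -> R[i]) -> R[i] :=
  fun g => sigma (rihaczek g f).

(* [A] is the extension of [Op0 sigma] to a bounded operator on L^2; it is
   unique because [S0] is dense in L^2. *)
Definition bounded_extension_Op0 (sigma : (X * X' -> R[i]) -> R[i])
    (A : (X -> R[i]) -> (X -> R[i])) :=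
  bounded_L2_operator mu A /\
  forall f, S0 f -> forall g, S0 g -> L2_functional (A f) g = Op0 sigma f g.

End TimeFrequency.

(** * The structure theorem and Gaussians *)

Section Gaussian.
Variable R : realType.

Definition dot n (u v : 'rV[R]_n) : R := \sum_(k < n) u 0 k * v 0 k.

Definition cis (t : R) : R[i] := cos t +i* sin t.

Record lca_structure (G : topologicalZmodType) := LcaStructure {
  rdim : nat;
  core : topologicalZmodType;
  core_lca : is_lca core;
  coord : G -> 'rV[R]_rdim * core;
  coord_inv : 'rV[R]_rdim * core -> G;
  coordK : cancel coord coord_inv;
  coord_invK : cancel coord_inv coord;
  coordD : forall x y, coord (x + y) = coord x + coord y;
  coord_continuous : continuous coord;
  coord_inv_continuous : continuous coord_inv;
  cpt : set core;
  cpt_compact : compact cpt;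
  cpt_open : open cpt;
  cpt0 : cpt 0;
  cptB : forall x y, cpt x -> cpt y -> cpt (x - y) }.

Definition gaussian (T S : Type) n (c : T -> 'rV[R]_n * S) (K : set S) (x : T)
    : R[i] :=
  (expR (- pi * dot (c x).1 (c x).1) * \1_K (c x).2)%:C.

Section DualCoordinates.
Variables (G : topologicalZmodType) (s : lca_structure G).

(* The identification of the dual of [G] with R^d x (dual of G_0): the
   coordinates of [xi] are the unique pair [(w, chi)] such that
   [xi x = exp(2 pi i w . x_1) * chi x_2] for [x] of coordinates [(x_1, x_2)]. *)
Definition dual_coord (xi : dual R G) : 'rV[R]_(rdim s) * dual R (core s) :=
  get [set w : 'rV[R]_(rdim s) * dual R (core s) |
    forall x : G, xi x =
      cis (2 * pi * dot w.1 (coord s x).1) * w.2 (coord s x).2].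

Definition annihilator : set (dual R (core s)) :=
  [set chi | forall k, cpt k -> chi k = 1].

Definition phase_coord (z : G * dual R G)
    : 'rV[R]_(rdim s + rdim s) * (core s * dual R (core s)) :=
  (row_mx (coord s z.1).1 (dual_coord z.2).1,
   ((coord s z.1).2, (dual_coord z.2).2)).

End DualCoordinates.

Variables (G : topologicalZmodType) (s : lca_structure G).

Definition group_tf
    (mu : {sigma_finite_measure set (borel G) -> \bar R})
    (nu : {sigma_finite_measure set (borel (dual R G)) -> \bar R}) :=
  TFSpace (fun (xi : dual R G) (x : G) => xi x) mu nu
    (gaussian (coord s) (@cpt _ s)).

(* The dual of [G * dual G] is identified with [dual G * G]. *)
Definition phase_tf
    (mu2 : {sigma_finite_measure set (borel (G * dual R G)%type) -> \bar R})
    (nu2 : {sigma_finite_measure set (borel (dual R G * G)%type) -> \bar R}) :=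
  TFSpace (fun (w : dual R G * G) (z : G * dual R G) => w.1 z.1 * z.2 w.2)
    mu2 nu2 (gaussian (@phase_coord G s) (@cpt _ s `*` @annihilator G s)).

End Gaussian.

(* The Haar measure of a product, on its Borel sets: for second countable
   groups the condition on rectangles determines it. *)
Definition is_product_measure (R : realType) (G H : preTopologicalZmodType)
    (mu : set (borel G) -> \bar R) (nu : set (borel H) -> \bar R)
    (rho : set (borel (G * H)%type) -> \bar R) :=
  forall (E : set (borel G)) (F : set (borel H)),
    measurable E -> measurable F -> rho (E `*` F) = (mu E * nu F)%E.

(* Main.v *)
Require Import Defs.
From HB Require Import structures.
From mathcomp Require Import all_boot all_order all_algebra.
From mathcomp Require Import all_classical all_reals all_analysis.
From mathcomp Require Import measurable_realfun ess_sup_inf complex.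
From mathcomp Require Import ring lra.
Set Implicit Arguments.
Unset Strict Implicit.
Unset Printing Implicit Defensive.
Import Order.TTheory GRing.Theory Num.Theory.
Import numFieldNormedType.Exports Normc.
Local Open Scope classical_set_scope.
Local Open Scope complex_scope.
Local Open Scope ring_scope.

(* Let [V f] be the short-time Fourier transform of the eigenfunction [f] with the
   Gaussian window phi. The eigenvalue equation and the reconstruction of [f] from
   [V f] bound |V f (z)| by the integral of |V f (w)| |<A pi(w) phi, pi(z) phi>|.
   This kernel is the modulus of the short-time Fourier transform of sigma, with
   window R(phi, phi), at a point depending linearly on (z, w), and passing to the
   window [g2] costs a convolution with a Gaussian. By Hoelder's inequality the
   resulting inequality takes the local maximal functions of V f from L^q to L^r,
   where r = q (1 - t / p) and t > 0 may be as small as we like because sigma lies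
   in every M^(p,gamma). As V f is in L^2, iteration reaches all exponents. *)

(** For exponents below 1 an integral inequality cannot be raised to a power under the integral
    sign. Local maximal functions repair this: if each value of the integrand is dominated by a
    maximized integrand on a set of fixed measure, the power t <= 1 of the integral is bounded by
    the integral of the power t of the latter. Hence the suprema over compact sets, for f as well as
    for the symbol. Splitting off the power r - t before Hoelder's inequality keeps q / r and p / t
    conjugate even when q, r and p are below 1; the norm that remains in the frequency variable of
    the symbol has exponent t, the small gamma of the hypothesis. The window change is forced
    because R(phi, phi) is in general no finite combination of shifts of the Gaussian. The symbol is
    only a functional on S_0, so it is moved under integrals through Riemann sums in the norm of
    S_0. No Lebesgue measure appears: Gaussians on the group and on its dual are handled through an
    additive coordinate and the invariance of the measure. *)

Notation mfunT := (measurable_fun setT).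
Notation sfm R X := {sigma_finite_measure set (borel X) -> \bar R}.
Notation bcmeas R X := (@cmeasurable _ (borel X) R).
Notation mcompT := measurableT_comp.
Notation mEFinP := measurable_EFinP.
Notation ge0_intZ := ge0_integralZl_EFin.

Lemma eqW d (T : porderType d) (x y : T) : x = y -> (x <= y)%O. Proof. by move=> ->. Qed.

(** * Modulus, conjugate, real and imaginary parts *)

Section Normc.
Variable R : realType.
Implicit Types x y : R[i].

Lemma normcM' x y : normc (x * y) = normc x * normc y. Proof. exact: normcM. Qed.
Lemma normcN' x : normc (- x) = normc x. Proof. exact: (@normcN R x). Qed.
Lemma normcD_le x y : normc (x + y) <= normc x + normc y. Proof. exact: le_normcD. Qed.
Lemma normcB_le x y : normc (x - y) <= normc x + normc y.
Proof. by rewrite -(normcN' y) normcD_le. Qed.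
Lemma normc_ge0 x : 0 <= normc x. Proof. by case: x => a b /=; rewrite sqrtr_ge0. Qed.
Lemma conjE x : x^* = conjc x. Proof. by []. Qed.
Lemma normc_conj x : normc x^* = normc x. Proof. by rewrite conjE; case: x => a b /=; rewrite sqrrN. Qed.
Lemma normc_real (a : R) : normc a%:C = `|a|. Proof. by rewrite /= expr0n addr0 sqrtr_sqr. Qed.
Lemma normr_normc x : `|x| = (normc x)%:C. Proof. by case: x. Qed.
Lemma Re_le_normc x : `|complex.Re x| <= normc x.
Proof.
case: x => a b /=; rewrite -sqrtr_sqr ler_wsqrtr// lerDl sqr_ge0//.
Qed.
Lemma Im_le_normc x : `|complex.Im x| <= normc x.
Proof.
case: x => a b /=; rewrite -sqrtr_sqr ler_wsqrtr// lerDr sqr_ge0//.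
Qed.
Lemma normc_eq0 x : (normc x == 0) = (x == 0).
Proof. by apply/eqP/eqP => [/eq0_normc//|->]; rewrite normc0. Qed.
Lemma mulc_conj x : x * x^* = (normc x ^+ 2)%:C.
Proof.
rewrite conjE; case: x => a b /=; rewrite sqr_sqrtr ?addr_ge0 ?sqr_ge0//; apply/eqP; rewrite eq_complex /=; apply/andP; split; apply/eqP; ring.
Qed.
Lemma conjcD x y : (x + y)^* = x^* + y^*. Proof. exact: rmorphD. Qed.
Lemma conjcM x y : (x * y)^* = x^* * y^*. Proof. exact: rmorphM. Qed.
Lemma ReM x y : complex.Re (x * y) = complex.Re x * complex.Re y - complex.Im x * complex.Im y.
Proof. by case: x y => a b [c d]. Qed.
Lemma ImM x y : complex.Im (x * y) = complex.Re x * complex.Im y + complex.Im x * complex.Re y.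
Proof. by case: x y => a b [c d]. Qed.
Lemma ReD x y : complex.Re (x + y) = complex.Re x + complex.Re y.
Proof. by case: x y => a b [c d]. Qed.
Lemma ImD x y : complex.Im (x + y) = complex.Im x + complex.Im y.
Proof. by case: x y => a b [c d]. Qed.
Lemma normc_le_ReIm x : normc x <= `|complex.Re x| + `|complex.Im x|.
Proof.
case: x => a b; have -> : a +i* b = a%:C + 'i * b%:C by apply/eqP; rewrite eq_complex /= !(mul0r, mulr0, mul1r, addr0, subr0, add0r) !eqxx.
apply: le_trans (normcD_le _ _) _; rewrite normcM' !normc_real ReD ImD ReM ImM /= expr0n expr1n add0r sqrtr1.
by rewrite !(mul0r, mul1r, mulr0, subr0, addr0, add0r).
Qed.
Lemma ReN x : complex.Re (- x) = - complex.Re x. Proof. by case: x. Qed.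
Lemma ImN x : complex.Im (- x) = - complex.Im x. Proof. by case: x. Qed.
Lemma Re_conj x : complex.Re x^* = complex.Re x. Proof. by rewrite conjE; case: x. Qed.
Lemma Im_conj x : complex.Im x^* = - complex.Im x. Proof. by rewrite conjE; case: x. Qed.
Lemma complexP x y : complex.Re x = complex.Re y -> complex.Im x = complex.Im y -> x = y.
Proof. by case: x y => a b [c d] /= -> ->. Qed.
Lemma normcB_sym x y : normc (x - y) = normc (y - x).
Proof. by rewrite -normcN' opprB. Qed.
Lemma normc_dist x y : `|normc x - normc y| <= normc (x - y).
Proof.
rewrite ler_norml; apply/andP; split; last first.
  by rewrite lerBlDr -{1}(subrK y x) normcD_le.
by rewrite lerNl opprB lerBlDr normcB_sym -{1}(subrK x y) normcD_le.
Qed.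

End Normc.

(** * Measurable complex-valued functions *)

Section CMeasurable.
Context d (T : measurableType d) (R : realType).
Implicit Types f g : T -> R[i].

Lemma cmeas_cst c : cmeasurable (fun _ : T => c : R[i]).
Proof. by split; exact: measurable_cst. Qed.
Lemma cmeasD f g : cmeasurable f -> cmeasurable g -> cmeasurable (fun x => f x + g x).
Proof.
move=> [a b] [a' b']; split.
  by under eq_fun do rewrite ReD; exact: measurable_funD.
by under eq_fun do rewrite ImD; exact: measurable_funD.
Qed.
Lemma cmeasN f : cmeasurable f -> cmeasurable (fun x => - f x).
Proof.
move=> [a b]; split.
  by under eq_fun do rewrite ReN; exact: mcompT.
by under eq_fun do rewrite ImN; exact: mcompT.
Qed.
Lemma cmeasM f g : cmeasurable f -> cmeasurable g -> cmeasurable (fun x => f x * g x).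
Proof.
move=> [a b] [a' b']; split.
  by under eq_fun do rewrite ReM; apply: measurable_funB; exact: measurable_funM.
by under eq_fun do rewrite ImM; apply: measurable_funD; exact: measurable_funM.
Qed.
Lemma cmeasB f g : cmeasurable f -> cmeasurable g -> cmeasurable (fun x => f x - g x).
Proof. by move=> mf mg; apply: cmeasD => //; exact: cmeasN. Qed.
Lemma cmeas_conj f : cmeasurable f -> cmeasurable (fun x => (f x)^*).
Proof.
move=> [a b]; split; first by under eq_fun do rewrite Re_conj.
by under eq_fun do rewrite Im_conj; exact: mcompT.
Qed.
Lemma cmeas_real (f : T -> R) : mfunT f -> cmeasurable (fun x => (f x)%:C).
Proof. by move=> mf; split => //; exact: measurable_cst. Qed.
Lemma cmeas_comp d' (T' : measurableType d') (h : T' -> T) f :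
  mfunT h -> cmeasurable f -> cmeasurable (fun x => f (h x)).
Proof. by move=> mh [a b]; split; [exact: (mcompT a mh)|exact: (mcompT b mh)]. Qed.
Lemma cmeas_sum n (F : 'I_n -> T -> R[i]) : (forall k, cmeasurable (F k)) ->
  cmeasurable (fun x => \sum_(k < n) F k x).
Proof.
elim: n F => [|n IH] F mF; first by under eq_fun do rewrite big_ord0; exact: cmeas_cst.
by under eq_fun do rewrite big_ord_recr; apply: cmeasD => //; exact: IH.
Qed.
Lemma mnormc f : cmeasurable f -> mfunT (fun x => normc (f x)).
Proof.
move=> [a b].
have -> : (fun x => normc (f x)) = (fun x => Num.sqrt (complex.Re (f x) ^+ 2 + complex.Im (f x) ^+ 2)).
  by apply/funext => x; case: (f x).
apply: (@mcompT _ _ _ _ _ _ (@Num.sqrt R)).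
  by apply: continuous_measurable_fun; exact: sqrt_continuous.
by apply: measurable_funD; exact: measurable_funX.
Qed.
Lemma menormc f : cmeasurable f -> mfunT (fun x => (normc (f x))%:E).
Proof. by move=> mf; apply/mEFinP; exact: mnormc. Qed.
Lemma cmeas_indic (A : set T) : measurable A -> cmeasurable (fun x => (\1_A x)%:C : R[i]).
Proof. by move=> mA; apply: cmeas_real; exact: measurable_indic. Qed.

End CMeasurable.

(** * Integrals of complex-valued functions *)

Section CIntegral.
Context d (T : measurableType d) (R : realType) (mu : {measure set T -> \bar R}).
Implicit Types f g : T -> R[i].

Definition cinteg f := cmeasurable f /\ (\int[mu]_x (normc (f x))%:E < +oo)%E.

Lemma in_L1P f : in_L mu 1%:E f <-> cinteg f.
Proof.
rewrite /in_L /cLnorm Lnorm1 /cinteg; split=> -[h1 h2]; split=> //.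
  by under eq_integral do rewrite -[(normc _)%:E]gee0_abs ?lee_fin ?normc_ge0//.
by under eq_integral do rewrite gee0_abs ?lee_fin ?normc_ge0//.
Qed.
Lemma ge0_le_int (f g : T -> \bar R) : mfunT f -> mfunT g ->
  (forall x, (0 <= f x)%E) -> (forall x, (f x <= g x)%E) -> (\int[mu]_x f x <= \int[mu]_x g x)%E.
Proof. by move=> mf mg f0 fg; apply: ge0_le_integral => // x _. Qed.
Lemma cinteg_le f (g : T -> R) : cmeasurable f -> mfunT g ->
  (forall x, normc (f x) <= g x) -> (\int[mu]_x (g x)%:E < +oo)%E -> cinteg f.
Proof.
move=> mf mg fg ig; split=> //; apply: le_lt_trans ig; apply: ge0_le_int.
- exact: menormc.
- exact/mEFinP.
- by move=> x; rewrite lee_fin normc_ge0.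
- by move=> x; rewrite lee_fin.
Qed.
Lemma cinteg_Re f : cinteg f -> mu.-integrable setT (EFin \o (fun x => complex.Re (f x))).
Proof.
move=> [[a b] c]; apply/integrableP; split; first exact/mEFinP.
apply: le_lt_trans c; apply: ge0_le_int.
- by apply: mcompT => //; exact/mEFinP.
- exact: menormc.
- by [].
- by move=> x /=; rewrite lee_fin Re_le_normc.
Qed.
Lemma cinteg_Im f : cinteg f -> mu.-integrable setT (EFin \o (fun x => complex.Im (f x))).
Proof.
move=> [[a b] c]; apply/integrableP; split; first exact/mEFinP.
apply: le_lt_trans c; apply: ge0_le_int.
- by apply: mcompT => //; exact/mEFinP.
- exact: menormc.
- by [].
- by move=> x /=; rewrite lee_fin Im_le_normc.
Qed.
Lemma cintegD f g : cinteg f -> cinteg g -> cinteg (fun x => f x + g x).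
Proof.
move=> [mf If] [mg Ig]; split; first exact: cmeasD.
apply: (@le_lt_trans _ _ (\int[mu]_x ((normc (f x))%:E + (normc (g x))%:E))%E).
  apply: ge0_le_int.
  - by apply: menormc; exact: cmeasD.
  - by apply: emeasurable_funD; exact: menormc.
  - by move=> x; rewrite lee_fin normc_ge0.
  - by move=> x; rewrite lee_fin normcD_le.
have nn (h : T -> R[i]) x : setT x -> (0 <= (normc (h x))%:E)%E by rewrite lee_fin normc_ge0.
by rewrite (ge0_integralD mu measurableT (nn f) (menormc mf) (nn g) (menormc mg)) lte_add_pinfty.
Qed.
Lemma cintegZ c f : cinteg f -> cinteg (fun x => c * f x).
Proof.
move=> [mf If]; split; first by apply: cmeasM => //; exact: cmeas_cst.
under eq_integral do rewrite normcM' EFinM.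
rewrite ge0_intZ ?normc_ge0//; [|by move=> x _; rewrite lee_fin normc_ge0|exact: menormc].
by rewrite lte_mul_pinfty// lee_fin normc_ge0.
Qed.
Lemma cintegN f : cinteg f -> cinteg (fun x => - f x).
Proof. by move=> /(cintegZ (-1)); under eq_fun do rewrite mulN1r. Qed.
Lemma cintegB f g : cinteg f -> cinteg g -> cinteg (fun x => f x - g x).
Proof. by move=> If Ig; apply: cintegD => //; exact: cintegN. Qed.
Lemma cinteg_conj f : cinteg f -> cinteg (fun x => (f x)^*).
Proof.
move=> [mf If]; split; first exact: cmeas_conj.
by under eq_integral do rewrite normc_conj.
Qed.
Lemma int_normc_ge0 f : (0 <= \int[mu]_x (normc (f x))%:E)%E.
Proof. by apply: integral_ge0 => x _; rewrite lee_fin normc_ge0. Qed.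
Lemma cintegMr f g (M : R) : cinteg f -> cmeasurable g -> (forall x, normc (g x) <= M) ->
  cinteg (fun x => f x * g x).
Proof.
move=> [mf If] mg gM; have c0 : 0 <= Num.max M 0 by rewrite le_max lexx orbT.
apply: (@cinteg_le _ (fun x => Num.max M 0 * normc (f x))).
- exact: cmeasM.
- by apply: measurable_funM; [exact: measurable_cst|exact: mnormc].
- by move=> x; rewrite normcM' mulrC ler_wpM2r ?normc_ge0// le_max gM.
under eq_integral do rewrite EFinM.
rewrite ge0_intZ//; [|by move=> x _; rewrite lee_fin normc_ge0|exact: menormc].
by rewrite lte_mul_pinfty.
Qed.
Lemma cinteg0 : cinteg (fun _ : T => 0 : R[i]).
Proof. by split; [exact: cmeas_cst|under eq_integral do rewrite normc0; rewrite integral0]. Qed.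
Lemma cinteg_sum n (F : 'I_n -> T -> R[i]) : (forall k, cinteg (F k)) ->
  cinteg (fun x => \sum_(k < n) F k x).
Proof.
elim: n F => [|n IH] F mF; first by under eq_fun do rewrite big_ord0; exact: cinteg0.
by under eq_fun do rewrite big_ord_recr; apply: cintegD => //; exact: IH.
Qed.
Lemma cint_ext f g : f =1 g -> cintegral mu f = cintegral mu g.
Proof. by move=> /funext ->. Qed.
Lemma cintD f g : cinteg f -> cinteg g ->
  cintegral mu (fun x => f x + g x) = cintegral mu f + cintegral mu g.
Proof.
move=> If Ig; apply: complexP => /=.
  by under eq_fun do rewrite ReD; rewrite RintegralD//; exact: cinteg_Re.
by under eq_fun do rewrite ImD; rewrite RintegralD//; exact: cinteg_Im.
Qed.
Lemma cintZ c f : cinteg f ->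
  cintegral mu (fun x => c * f x) = c * cintegral mu f.
Proof.
move=> If; have iR := cinteg_Re If; have iI := cinteg_Im If.
have Z (r : R) (h : T -> R) : mu.-integrable setT (EFin \o h) -> mu.-integrable setT (EFin \o (fun x => r * h x)).
  by move=> hi; have := integrableZl measurableT r hi; apply: eq_integrable.
apply: complexP => /=.
  under eq_fun do rewrite ReM; rewrite RintegralB//; [|exact: Z|exact: Z].
  by rewrite !RintegralZl// ReM.
under eq_fun do rewrite ImM; rewrite RintegralD//; [|exact: Z|exact: Z].
by rewrite !RintegralZl// ImM.
Qed.
Lemma cintZr c f : cinteg f ->
  cintegral mu (fun x => f x * c) = cintegral mu f * c.
Proof. by move=> If; rewrite mulrC -cintZ//; apply: cint_ext => x; rewrite mulrC. Qed.
Lemma cintN f : cinteg f -> cintegral mu (fun x => - f x) = - cintegral mu f.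
Proof. by move=> If; rewrite -mulN1r -cintZ//; apply: cint_ext => x; rewrite mulN1r. Qed.
Lemma cintB f g : cinteg f -> cinteg g ->
  cintegral mu (fun x => f x - g x) = cintegral mu f - cintegral mu g.
Proof. by move=> If Ig; rewrite cintD// ?cintN//; exact: cintegN. Qed.
Lemma cint0 : cintegral mu (fun=> 0) = 0.
Proof. by apply: complexP => /=; rewrite /Rintegral integral0. Qed.
Lemma cint_sum n (F : 'I_n -> T -> R[i]) : (forall k, cinteg (F k)) ->
  cintegral mu (fun x => \sum_(k < n) F k x) = \sum_(k < n) cintegral mu (F k).
Proof.
elim: n F => [|n IH] F mF; first by under eq_fun do rewrite big_ord0; rewrite big_ord0 cint0.
under eq_fun do rewrite big_ord_recr; rewrite cintD//; last exact: cinteg_sum.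
by rewrite IH// big_ord_recr.
Qed.
Lemma cint_conj f : cinteg f -> cintegral mu (fun x => (f x)^*) = (cintegral mu f)^*.
Proof.
move=> If; apply: complexP; rewrite ?Re_conj ?Im_conj /=; first by under eq_fun do rewrite Re_conj.
under eq_fun do rewrite Im_conj -mulN1r.
by rewrite RintegralZl ?mulN1r//; exact: cinteg_Im.
Qed.
Lemma ae_eq_cintegral f g : cmeasurable f -> cmeasurable g -> {ae mu, forall x, f x = g x} ->
  cintegral mu f = cintegral mu g.
Proof.
move=> [a b] [a' b'] fg; apply: complexP; congr fine; apply: ae_eq_integral => //; try exact/mEFinP.
  by apply: filterS fg => x /= ->.
by apply: filterS fg => x /= ->.
Qed.
(** A unimodular factor [c] makes the integral real and nonnegative; the real part of [c * f] is
    then bounded by the modulus. *)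
Lemma normc_cintegral f : cinteg f -> ((normc (cintegral mu f))%:E <= \int[mu]_x (normc (f x))%:E)%E.
Proof.
move=> If; have [mf fi] := If; set I := cintegral mu f.
have [->|I0] := eqVneq I 0; first by rewrite normc0; apply: integral_ge0 => x _; rewrite lee_fin normc_ge0.
have nI : 0 < normc I by rewrite lt_def normc_eq0 I0 normc_ge0.
pose c := I^* / (normc I)%:C.
have cI : c * I = (normc I)%:C.
  rewrite /c mulrAC [_ * I]mulrC mulc_conj expr2 rmorphM /= -mulrA divff ?mulr1//.
  by apply/eqP => -[/eqP]; rewrite gt_eqF.
have nc : normc c = 1.
  by rewrite /c normcM' normc_conj normcV normc_real gtr0_norm// divff// gt_eqF.
have Icf := cintegZ c If.
have : (normc I) = \int[mu]_x complex.Re (c * f x).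
  by rewrite (_ : \int[mu]_x _ = complex.Re (cintegral mu (fun x => c * f x)))// cintZ// cI.
move=> ->; rewrite /Rintegral fineK; last exact: integrable_fin_num (cinteg_Re Icf).
have iN : mu.-integrable setT (fun x => (normc (f x))%:E).
  apply/integrableP; split; first exact: menormc.
  by under eq_integral do rewrite gee0_abs ?lee_fin ?normc_ge0//.
apply: le_integral => //; first exact: cinteg_Re.
move=> x _; rewrite lee_fin; apply: le_trans (ler_norm _) _.
by rewrite (le_trans (Re_le_normc _))// normcM' nc mul1r.
Qed.
(** Integrability need not be checked beforehand: an infinite right-hand side makes the bound
    trivial. *)
Lemma normc_cintegral_le f (g : T -> R) : cmeasurable f -> mfunT g ->
  (forall x, normc (f x) <= g x) -> ((normc (cintegral mu f))%:E <= \int[mu]_x (g x)%:E)%E.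
Proof.
move=> mf mg fg.
have [ig|] := ltP (\int[mu]_x (g x)%:E)%E +oo%E; last by rewrite leye_eq => /eqP ->; rewrite leey.
apply: le_trans (normc_cintegral (cinteg_le mf mg fg ig)) _.
apply: ge0_le_int => //; [exact: menormc|exact/mEFinP|].
by move=> x; rewrite lee_fin normc_ge0.
Qed.

End CIntegral.

(** * Fubini's theorem for complex-valued functions, and iterated products of measures *)

Section Fubini.
Context d1 d2 (T1 : measurableType d1) (T2 : measurableType d2) (R : realType).
Variables (m1 : {sigma_finite_measure set T1 -> \bar R}) (m2 : {sigma_finite_measure set T2 -> \bar R}).
Implicit Types f : T1 * T2 -> R[i].

(** Tonelli's measurability is applied to the positive and the negative part; [fine] then turns
    infinite values into 0, so divergent inner integrals do no harm. *)
Lemma measurable_Rparam (f : T1 * T2 -> R) : mfunT f ->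
  mfunT (fun x => \int[m2]_y f (x, y)).
Proof.
move=> mf; apply: (mcompT (fine_measurable measurableT)) => /=.
have mp : mfunT (fubini_F m2 (EFin \o f)^\+%E).
  by apply: measurable_fun_fubini_tonelli_F => //; apply: measurable_funepos; exact/mEFinP.
have mn : mfunT (fubini_F m2 (EFin \o f)^\-%E).
  by apply: measurable_fun_fubini_tonelli_F => //; apply: measurable_funeneg; exact/mEFinP.
rewrite (_ : (fun x => _) = (fubini_F m2 (EFin \o f)^\+ \- fubini_F m2 (EFin \o f)^\-)%E).
  exact: emeasurable_funB.
by apply/funext => x; rewrite integralE; congr (_ - _)%E; apply: eq_integral => y _; rewrite ?funeposE ?funenegE.
Qed.
Lemma cmeas_param f : cmeasurable f -> cmeasurable (fun x => cintegral m2 (fun y => f (x, y))).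
Proof.
move=> [a b]; split; first exact: (measurable_Rparam a).
exact: (measurable_Rparam b).
Qed.
Lemma measurable_swap : mfunT (fun z : T2 * T1 => (z.2, z.1)).
Proof. by apply: measurable_fun_pair; [exact: measurable_snd|exact: measurable_fst]. Qed.
(** The inner real integral is the [fine] of an extended integral that is finite only almost
    everywhere, so the two outer integrands are compared almost everywhere. *)
Lemma Rfubini (f : T1 * T2 -> R) : (m1 \x m2)%E.-integrable setT (EFin \o f) ->
  \int[m1]_x \int[m2]_y f (x, y) = \int[(m1 \x m2)%E]_z f z.
Proof.
move=> If; have /integrableP[/mEFinP mf _] := If.
rewrite /Rintegral -integral12_prod_meas1//; congr fine.
have IF := integrable_fubini_F If.
apply: ae_eq_integral => //.
- by apply/mEFinP; exact: measurable_Rparam.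
- exact: measurable_int IF.
- have := integrable_ae measurableT IF.
  by apply: filterS => x /(_ I) h _; rewrite fineK.
Qed.
Lemma cfubini1 f : cinteg (m1 \x m2)%E f ->
  cintegral m1 (fun x => cintegral m2 (fun y => f (x, y))) = cintegral (m1 \x m2)%E f.
Proof.
move=> If; apply: complexP => /=.
  exact: (Rfubini (cinteg_Re If)).
exact: (Rfubini (cinteg_Im If)).
Qed.
Lemma integrable_swap (f : T1 * T2 -> \bar R) : (m1 \x m2)%E.-integrable setT f ->
  (m2 \x m1)%E.-integrable setT (fun z => f (z.2, z.1)).
Proof.
move=> /integrableP[mf If].
have mfs : mfunT (fun z : T2 * T1 => f (z.2, z.1)).
  exact: (mcompT mf measurable_swap).
apply/integrableP; split => //; apply: le_lt_trans If.
rewrite (fubini_tonelli1 (m1:=m2) (m2:=m1))//; last exact: mcompT.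
by rewrite (fubini_tonelli2 (m1:=m1) (m2:=m2))//; exact: mcompT.
Qed.
Lemma Rfubini2 (f : T1 * T2 -> R) : (m1 \x m2)%E.-integrable setT (EFin \o f) ->
  \int[m2]_y \int[m1]_x f (x, y) = \int[(m1 \x m2)%E]_z f z.
Proof.
move=> If; have /integrableP[/mEFinP mf _] := If.
rewrite /Rintegral -integral21_prod_meas1//; congr fine.
have IG : m2.-integrable setT (fubini_G m1 (EFin \o f)).
  exact: (integrable_fubini_F (integrable_swap If)).
apply: ae_eq_integral => //.
- apply/mEFinP; apply: (mcompT (fine_measurable measurableT)) => /=.
  exact: measurable_int IG.
- exact: measurable_int IG.
- have := integrable_ae measurableT IG.
  by apply: filterS => x /(_ I) h _; rewrite fineK.
Qed.
Lemma cfubini2 f : cinteg (m1 \x m2)%E f ->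
  cintegral m2 (fun y => cintegral m1 (fun x => f (x, y))) = cintegral (m1 \x m2)%E f.
Proof.
move=> If; apply: complexP => /=.
  exact: (Rfubini2 (cinteg_Re If)).
exact: (Rfubini2 (cinteg_Im If)).
Qed.
Lemma cinteg_param f : cinteg (m1 \x m2)%E f ->
  cinteg m1 (fun x => cintegral m2 (fun y => f (x, y))).
Proof.
move=> [mf If]; split; first exact: cmeas_param.
have mn := menormc mf.
have nn : forall x : T1 * T2, (0 <= (normc (f x))%:E)%E by move=> x; rewrite lee_fin normc_ge0.
apply: le_lt_trans If; rewrite (fubini_tonelli1 (m1:=m1) (m2:=m2))//.
apply: ge0_le_int => //.
- by apply: menormc; exact: cmeas_param.
- exact: measurable_fun_fubini_tonelli_F.
- by move=> x; rewrite lee_fin normc_ge0.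
- move=> x; apply: normc_cintegral_le => //.
    by apply: (cmeas_comp _ mf); exact: measurable_pair1.
  apply: (@mcompT _ _ _ _ _ _ (fun z => normc (f z))) => //; exact: mnormc.
Qed.

End Fubini.

(** The product measure under a name of its own, so that it can carry a sigma-finite structure and
    be a factor of further products. *)
Definition prodm d1 d2 (T1 : measurableType d1) (T2 : measurableType d2) (R : realType)
  (m1 : {sigma_finite_measure set T1 -> \bar R}) (m2 : {sigma_finite_measure set T2 -> \bar R})
  := (m1 \x m2)%E.
Section Prodm.
Context d1 d2 (T1 : measurableType d1) (T2 : measurableType d2) (R : realType).
Variables (m1 : {sigma_finite_measure set T1 -> \bar R}) (m2 : {sigma_finite_measure set T2 -> \bar R}).
HB.instance Definition _ := Measure.on (prodm m1 m2).
Lemma prodm_sigma_finite : sigma_finite setT (prodm m1 m2).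
Proof.
have [F FT Fm] := sigma_finiteT m1; have [G GT Gm] := sigma_finiteT m2.
have [F' [FT' Fmono Fm']] := (sigma_finiteP setT m1).1 (ex_intro2 _ _ F FT Fm).
have [G' [GT' Gmono Gm']] := (sigma_finiteP setT m2).1 (ex_intro2 _ _ G GT Gm).
exists (fun n => F' n `*` G' n).
  apply/seteqP; split=> // -[x y] _.
  have [i _ Fi] : (\bigcup_i F' i) x by rewrite -FT'.
  have [j _ Gj] : (\bigcup_i G' i) y by rewrite -GT'.
  exists (maxn i j) => //; split => /=.
    by have /subsetPset := Fmono _ _ (leq_maxl i j); exact.
  by have /subsetPset := Gmono _ _ (leq_maxr i j); exact.
move=> n; have [a b] := Fm' n; have [a' b'] := Gm' n; split; first exact: measurableX.
by rewrite /prodm product_measure1E// lte_mul_pinfty// ge0_fin_numE.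
Qed.
HB.instance Definition _ := Measure_isSigmaFinite.Build _ _ _ (prodm m1 m2) prodm_sigma_finite.
End Prodm.

(** * Countable bases, given as enumerations of open sets *)

Definition countable_base (X : topologicalType) (B : nat -> set X) :=
  (forall n, open (B n)) /\ forall (x : X) U, nbhs x U -> exists n, B n x /\ B n `<=` U.
Definition csb (X : topologicalType) := exists B : nat -> set X, countable_base B.

Lemma csb_second_countable (X : topologicalType) : @second_countable X -> csb X.
Proof.
move=> [B cB [oB bB]].
have [[b0 Bb0]|B0] := pselect (B !=set0).
  have [f fB] := countable_injP _ cB.
  pose g n := if pselect (exists V, B V /\ f V = n) is left P then projT1 (cid P) else b0.
  have gB n : B (g n) by rewrite /g; case: pselect => // P; case: (cid P) => /= V [].
  exists g; split; first by move=> n; exact: oB.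
  move=> x U xU; have [V [BV Vx] VU] := bB x U xU.
  exists (f V); suff -> : g (f V) = V by [].
  rewrite /g; case: pselect => [P|]; last by case; exists V.
  by case: (cid P) => /= W [BW fW]; apply: fB; rewrite ?inE.
exists (fun=> set0); split; first by move=> _; exact: open0.
move=> x U xU; have [V [BV _] _] := bB x U xU.
by case: B0; exists V.
Qed.

Lemma open_setX (X Y : topologicalType) (A : set X) (B : set Y) : open A -> open B -> open (A `*` B).
Proof.
move=> oA oB; rewrite openE => -[x y] [/= Ax By]; exists (A, B) => //.
by split; exact: open_nbhs_nbhs.
Qed.

Lemma csb_prod (X Y : topologicalType) : csb X -> csb Y -> csb (X * Y)%type.
Proof.
move=> [B [oB bB]] [C [oC bC]].
pose D n : set (X * Y) := if @unpickle (nat * nat)%type n is Some (i, j) then B i `*` C j else set0.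
exists D; split=> [n|[x y] U [[V W] /= [xV yW] VWU]].
  by rewrite /D; case: unpickle => [[i j]|]; [exact: open_setX|exact: open0].
have [i [Bx BV]] := bB _ _ xV; have [j [Cy CW]] := bC _ _ yW.
exists (pickle (i, j)); rewrite /D pickleK; split => //.
by move=> [x' y'] [/= Bx' Cy']; apply: VWU; split; [exact: BV|exact: CW].
Qed.

(** One centre is chosen for each basic set that fits into some [W x]; every point lies in such a
    basic set. *)
Lemma csb_lindelof (X : topologicalType) (x0 : X) (W : X -> set X) : csb X -> (forall x, nbhs x (W x)) ->
  exists c : nat -> X, forall y, exists n, W (c n) y.
Proof.
move=> [B [oB bB]] nW.
pose c n := if pselect (exists x, B n `<=` W x) is left P then projT1 (cid P) else x0.
exists c => y; have [n [Bny BW]] := bB _ _ (nW y); exists n.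
rewrite /c; case: pselect => [P|]; last by case; exists y.
by case: (cid P) => /= x; exact.
Qed.

(** * Measurability tested on open sets, and continuity of real part, imaginary part and modulus *)

Section MeasurableOpen.
Context d (M : measurableType d) (R : realType).

Lemma measurable_fun_gt (f : M -> \bar R) :
  (forall r : R, measurable [set x | (r%:E < f x)%E]) -> mfunT f.
Proof.
move=> mf; apply: (measurability _ (ErealGenOInfty.measurableE R)).
move=> /= _ [_ [a ->]] <-; apply: measurableI => //.
by rewrite preimage_itvoy; exact: mf.
Qed.

Lemma measurable_fun_oo (f : M -> R) :
  (forall U : set R, open U -> measurable (f @^-1` U)) -> mfunT f.
Proof.
move=> mf; apply: (measurability _ (RGenOpens.measurableE R)).
by move=> _ [_ [a [b ->] <-]]; apply: measurableI => //; apply: mf; exact: interval_open.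
Qed.

Lemma cmeas_open (f : M -> R[i]) :
  (forall U : set R, open U -> measurable ((fun x => complex.Re (f x)) @^-1` U)) ->
  (forall U : set R, open U -> measurable ((fun x => complex.Im (f x)) @^-1` U)) -> cmeasurable f.
Proof. by move=> a b; split; exact: measurable_fun_oo. Qed.

End MeasurableOpen.

Section ReImContinuous.
Variable R : realType.

Lemma continuous_Re : continuous (@complex.Re R : R[i]^o -> R).
Proof.
move=> x U /nbhs_ballP[e /= e0 eU]; apply/(@nbhs_ballP _ R[i]^o); exists e%:C => /=; first by rewrite ltcR.
move=> y xy; apply: eU; have {}xy : `|x - y| < e%:C by [].
rewrite /ball /= -ReN -ReD; apply: le_lt_trans (Re_le_normc _) _.
by move: xy; rewrite normr_normc ltcR.
Qed.
Lemma continuous_Im : continuous (@complex.Im R : R[i]^o -> R).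
Proof.
move=> x U /nbhs_ballP[e /= e0 eU]; apply/(@nbhs_ballP _ R[i]^o); exists e%:C => /=; first by rewrite ltcR.
move=> y xy; apply: eU; have {}xy : `|x - y| < e%:C by [].
rewrite /ball /= -ImN -ImD; apply: le_lt_trans (Im_le_normc _) _.
by move: xy; rewrite normr_normc ltcR.
Qed.
Lemma continuous_normc : continuous (@normc R : R[i]^o -> R).
Proof.
move=> x U /nbhs_ballP[e /= e0 eU]; apply/(@nbhs_ballP _ R[i]^o); exists e%:C => /=; first by rewrite ltcR.
move=> y xy; apply: eU; have {}xy : `|x - y| < e%:C by [].
rewrite /ball /=; apply: le_lt_trans (normc_dist _ _) _.
by move: xy; rewrite normr_normc ltcR.
Qed.

End ReImContinuous.

(** * Borel sets of groups and of their products *)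

Section Borel.

Lemma open_mborel (Z : preTopologicalZmodType) (U : set Z) : open U -> measurable (U : set (borel Z)).
Proof. by move=> oU; apply: sub_sigma_algebra. Qed.

Lemma ccont_mborel (X Y : preTopologicalZmodType) (f : X -> Y) :
  continuous f -> mfunT (f : borel X -> borel Y).
Proof.
move=> /continuousP cf; apply: measurability (erefl : @measurable _ (borel Y) = <<s @open Y >>) _ => _ [U oU <-].
by rewrite setTI; apply: open_mborel; exact: cf.
Qed.

Variables X Y : preTopologicalZmodType.
Hypotheses (cX : csb X) (cY : csb Y).

(** A countable base makes an open set a countable union of open rectangles. This is what identifies
    the Borel sets of a product with the product of the Borel sets. *)
Lemma open_mprod (U : set (X * Y)) : open U -> measurable (U : set (borel X * borel Y)).
Proof.
move=> oU; have [B [oB bB]] := cX; have [C [oC bC]] := cY.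
pose D (k : nat * nat) : set (borel X * borel Y) := if pselect (B k.1 `*` C k.2 `<=` U) then B k.1 `*` C k.2 else set0.
have -> : (U : set (borel X * borel Y)) = \bigcup_k D k.
  apply/seteqP; split.
    move=> [x y] Uxy; have [[V W] /= [xV yW] VWU] := open_nbhs_nbhs (conj oU Uxy).
    have [i [Bx BV]] := bB _ _ xV; have [j [Cy CW]] := bC _ _ yW.
    exists (i, j) => //; rewrite /D; case: pselect => //; case => -[x' y'] [/= Bx' Cy'].
    by apply: VWU; split; [exact: BV|exact: CW].
  by move=> z [k _]; rewrite /D; case: pselect => // h; exact: h.
apply: countable_bigcupT_measurable => // k.
rewrite /D; case: pselect => h; last exact: measurable0.
by apply: measurableX; exact: open_mborel.
Qed.

Lemma measurable_prod_of_borel : mfunT (id : borel (X * Y)%type -> borel X * borel Y).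
Proof.
apply/measurable_fun_pairP; split; apply: ccont_mborel => -[x y] /=.
  exact: cvg_fst.
exact: cvg_snd.
Qed.

Lemma mborel_of_prod : mfunT (id : borel X * borel Y -> borel (X * Y)%type).
Proof.
apply: measurability (erefl : @measurable _ (borel (X * Y)%type) = <<s @open (X * Y)%type >>) _ => _ [U oU <-].
by rewrite setTI; exact: open_mprod.
Qed.

Lemma continuous_measurable_prod (Z : preTopologicalZmodType) (f : X * Y -> Z) :
  continuous f -> mfunT (f : borel X * borel Y -> borel Z).
Proof.
move=> cf; apply: (mcompT (ccont_mborel cf)).
exact: mborel_of_prod.
Qed.

End Borel.

Section ContinuousC.
Variables (R : realType) (X Y : preTopologicalZmodType).

Lemma continuous_cmeasurable (f : X -> R[i]) : continuous (f : X -> R[i]^o) -> bcmeas R X f.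
Proof.
move=> cf; apply: cmeas_open => U oU; apply: open_mborel.
  by apply: (continuousP _).1 => // x; exact: (continuous_comp (cf x) (@continuous_Re R (f x))).
by apply: (continuousP _).1 => // x; exact: (continuous_comp (cf x) (@continuous_Im R (f x))).
Qed.

Lemma continuous_cmeas_prod (cX : csb X) (cY : csb Y) (f : X * Y -> R[i]) : continuous (f : X * Y -> R[i]^o) ->
  @cmeasurable _ (borel X * borel Y)%type R f.
Proof.
move=> cf; apply: cmeas_open => U oU; apply: open_mprod => //.
  by apply: (continuousP _).1 => // x; exact: (continuous_comp (cf x) (@continuous_Re R (f x))).
by apply: (continuousP _).1 => // x; exact: (continuous_comp (cf x) (@continuous_Im R (f x))).
Qed.

Lemma ccont_mR (f : X -> R) : continuous f -> mfunT (f : borel X -> R).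
Proof. by move=> /continuousP cf; apply: measurable_fun_oo => U oU; apply: open_mborel; exact: cf. Qed.

End ContinuousC.

(** * Integrals under measure-preserving maps; the product Haar measure as a product measure *)

Section MeasurePreserving.
Context d1 d2 (T1 : measurableType d1) (T2 : measurableType d2) (R : realType).
Variables (m1 : {measure set T1 -> \bar R}) (m2 : {measure set T2 -> \bar R}).
Variable h : T1 -> T2.
Hypotheses (mh : mfunT h) (hE : forall E, measurable E -> m1 (h @^-1` E) = m2 E).

Lemma ge0_integral_mp (f : T2 -> \bar R) : mfunT f -> (forall x, (0 <= f x)%E) ->
  (\int[m1]_x f (h x) = \int[m2]_x f x)%E.
Proof.
move=> mf f0; rewrite -[LHS](@ge0_integral_pushforward _ _ _ _ _ h mh m1 setT f)//.
by apply: eq_measure_integral => A mA _; exact: hE.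
Qed.

Lemma Rintegral_mp (f : T2 -> R) : mfunT f -> \int[m1]_x f (h x) = \int[m2]_x f x.
Proof.
move=> mf; rewrite /Rintegral; congr fine; rewrite integralE [RHS]integralE.
have me : mfunT (EFin \o f) by exact/mEFinP.
congr (_ - _)%E.
  by rewrite -(ge0_integral_mp (measurable_funepos me))//; apply: eq_integral => x _; rewrite !funeposE.
by rewrite -(ge0_integral_mp (measurable_funeneg me))//; apply: eq_integral => x _; rewrite !funenegE.
Qed.

Lemma cint_mp (f : T2 -> R[i]) : cmeasurable f -> cintegral m1 (fun x => f (h x)) = cintegral m2 f.
Proof. by move=> [a b]; apply: complexP; [exact: Rintegral_mp a|exact: Rintegral_mp b]. Qed.

Lemma cinteg_mp (f : T2 -> R[i]) : cinteg m2 f -> cinteg m1 (fun x => f (h x)).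
Proof.
move=> [mf If]; split; first exact: (cmeas_comp mh mf).
rewrite (ge0_integral_mp (menormc mf))//.
by move=> x; rewrite lee_fin normc_ge0.
Qed.

End MeasurePreserving.

Section ProductMeasure.
Variables (R : realType) (X Y : preTopologicalZmodType).
Hypotheses (cX : csb X) (cY : csb Y).
Variables (mu : sfm R X)
  (nu : sfm R Y)
  (rho : sfm R (X * Y)%type).
Hypothesis rhoE : is_product_measure mu nu rho.

(** The pushforward of [rho] to the product sigma-algebra agrees with the product measure on
    rectangles, and a product of sigma-finite measures is determined by them. *)
Lemma is_product_measureE (E : set (borel X * borel Y)) : measurable E -> rho E = (mu \x nu)%E E.
Proof.
move=> mE.
have H := @product_measure_unique _ _ _ _ _ mu nu (pushforward rho (id : borel (X * Y)%type -> borel X * borel Y)).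
by rewrite (H (measurable_prod_of_borel (X := X) (Y := Y))) // => A B mA mB; exact: rhoE.
Qed.

Lemma ge0_integral_product (f : X * Y -> \bar R) : mfunT (f : borel X * borel Y -> \bar R) ->
  (forall x, (0 <= f x)%E) -> (\int[rho]_x f x = \int[mu \x nu]_x f x)%E.
Proof.
move=> mf f0; apply: (ge0_integral_mp (measurable_prod_of_borel (X := X) (Y := Y)) _ mf f0).
by move=> E mE; exact: is_product_measureE.
Qed.

Lemma cint_product (f : X * Y -> R[i]) : cmeasurable (f : borel X * borel Y -> R[i]) ->
  cintegral rho f = cintegral (mu \x nu)%E f.
Proof.
move=> mf; apply: (cint_mp (measurable_prod_of_borel (X := X) (Y := Y)) _ mf).
by move=> E mE; exact: is_product_measureE.
Qed.

End ProductMeasure.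

(** * Topological groups with an invariant measure *)

Definition tgroup (X : preTopologicalZmodType) := continuous (fun z : X * X => z.1 - z.2).

Section TGroup.
Variable X : preTopologicalZmodType.
Hypothesis tX : tgroup X.

Lemma cpair (T Y Z : topologicalType) (f : T -> Y) (g : T -> Z) :
  continuous f -> continuous g -> continuous (fun x => (f x, g x)).
Proof. by move=> cf cg x; apply: cvg_pair; [exact: cf|exact: cg]. Qed.
Lemma tgroup_subf (T : topologicalType) (f g : T -> X) : continuous f -> continuous g -> continuous (fun x => f x - g x).
Proof. by move=> cf cg x; apply: (@continuous_comp _ _ _ (fun x => (f x, g x)) (fun z => z.1 - z.2)); [exact: cpair|exact: tX]. Qed.
Lemma tgroup_oppf (T : topologicalType) (f : T -> X) : continuous f -> continuous (fun x => - f x).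
Proof.
move=> cf; have -> : (fun x => - f x) = (fun x => 0 - f x) by apply/funext => x; rewrite sub0r.
by apply: tgroup_subf => // x; exact: cvg_cst.
Qed.
Lemma tgroup_addf (T : topologicalType) (f g : T -> X) : continuous f -> continuous g -> continuous (fun x => f x + g x).
Proof.
move=> cf cg; have -> : (fun x => f x + g x) = (fun x => f x - (- g x)) by apply/funext => x; rewrite opprK.
by apply: tgroup_subf => //; exact: tgroup_oppf.
Qed.
Lemma tgroup_shift (a : X) : continuous (fun x => x + a).
Proof. by apply: tgroup_addf => // x; [exact: cvg_id|exact: cvg_cst]. Qed.
Lemma nbhs_shift (a : X) (U : set X) : nbhs (0 : X) U -> nbhs a [set y | U (y - a)].
Proof.
by move=> U0; have := @tgroup_shift (- a) a; rewrite /continuous_at subrr => /(_ _ U0).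
Qed.
Lemma open_shift (a : X) (U : set X) : open U -> open [set y | U (y + a)].
Proof. by move=> oU; apply: (continuousP _).1 => //; exact: tgroup_shift. Qed.

Hypothesis cX : csb X.
Context d (M : measurableType d).
Lemma msubf (f g : M -> borel X) : mfunT f -> mfunT g ->
  mfunT (fun x => (f x - g x : X) : borel X).
Proof.
move=> mf mg; have h := continuous_measurable_prod cX cX tX.
exact: (mcompT h (measurable_fun_pair mf mg)).
Qed.
Lemma maddf (f g : M -> borel X) : mfunT f -> mfunT g ->
  mfunT (fun x => (f x + g x : X) : borel X).
Proof.
have cf : continuous (fst : X * X -> X) by move=> z; exact: cvg_fst.
have cs : continuous (snd : X * X -> X) by move=> z; exact: cvg_snd.
move=> mf mg; have h := continuous_measurable_prod cX cX (tgroup_addf cf cs).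
exact: (mcompT h (measurable_fun_pair mf mg)).
Qed.
Lemma measurable_oppf (f : M -> borel X) : mfunT f ->
  mfunT (fun x => (- f x : X) : borel X).
Proof.
move=> mf; have h := ccont_mborel (tgroup_oppf (f := id) (fun x => @cvg_id _ _)).
exact: (mcompT h mf).
Qed.

End TGroup.

Lemma tgroup_prod (X Y : preTopologicalZmodType) : tgroup X -> tgroup Y -> tgroup (X * Y)%type.
Proof.
move=> tX tY; apply: (cpair (f := fun z : (X * Y) * (X * Y) => z.1.1 - z.2.1)).
  by apply: tgroup_subf => //; move=> z; apply: continuous_comp; first [exact: cvg_fst|exact: cvg_snd].
by apply: tgroup_subf => //; move=> z; apply: continuous_comp; first [exact: cvg_fst|exact: cvg_snd].
Qed.

(** The properties of a Haar measure that the group, its dual and the two phase spaces share. *)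
Record hgroup (R : realType) (X : preTopologicalZmodType) (mu : sfm R X) : Prop := HGroup {
  hg_top : tgroup X;
  hg_csb : csb X;
  hg_inv : forall (x : X) (E : set (borel X)), measurable E -> mu [set (x + y : X) | y in E] = mu E;
  hg_pos : forall U : set X, open U -> U !=set0 -> (0 < mu U)%E }.

Section HGroup.
Variables (R : realType) (X : preTopologicalZmodType) (mu : sfm R X).
Hypothesis hX : hgroup mu.
Let tX := hg_top hX.
Let cX := hg_csb hX.

Lemma mshf (a : X) : mfunT (fun x : borel X => (x + a : X) : borel X).
Proof. by apply: maddf. Qed.
Lemma shift_mp (a : X) (E : set (borel X)) : measurable E -> mu ((fun x : borel X => (x + a : X) : borel X) @^-1` E) = mu E.
Proof.
move=> mE; rewrite -(hg_inv hX (- a) mE); congr (mu _); apply/seteqP; split => x /=.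
  by move=> Ex; exists (x + a : X) => //; rewrite addrCA addNr addr0.
by move=> [y Ey <-]; rewrite addrAC addNr add0r.
Qed.
Lemma int_shift (a : X) (f : X -> \bar R) : mfunT (f : borel X -> _) -> (forall x, (0 <= f x)%E) ->
  (\int[mu]_x f (x + a)%R = \int[mu]_x f x)%E.
Proof. by move=> mf f0; rewrite (ge0_integral_mp (mshf a) (shift_mp a) mf f0). Qed.
Lemma cint_shift (a : X) (f : X -> R[i]) : cmeasurable (f : borel X -> _) ->
  cintegral mu (fun x => f (x + a)) = cintegral mu f.
Proof. by move=> mf; rewrite (cint_mp (mshf a) (shift_mp a) mf). Qed.
Lemma cinteg_shift (a : X) (f : X -> R[i]) : cinteg mu f -> cinteg mu (fun x => f (x + a)).
Proof. exact: (cinteg_mp (mshf a) (shift_mp a)). Qed.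

(** If all sets of a sigma-finite exhaustion were null, so would be the whole group, which is open
    and nonempty. *)
Lemma hg_fin_pos : exists E : set (borel X), [/\ measurable E, (0 < mu E)%E & (mu E < +oo)%E].
Proof.
have [F FT Fm] := sigma_finiteT mu.
have [[n n0]|h] := pselect (exists n, (0 < mu (F n))%E).
  by exists (F n); have [a b] := Fm n; split.
have : (0 < mu [set: X])%E by apply: hg_pos; [|exact: openT|exists 0].
suff -> : mu [set: X] = 0%E by rewrite ltxx.
apply: measure_negligible => //; rewrite (FT : [set: borel X] = _); apply: negligible_bigcup => n.
have [mF _] := Fm n; apply/negligibleP => //; apply/eqP; rewrite eq_le measure_ge0 andbT leNgt.
by apply/negP => n0; apply: h; exists n.
Qed.

(* Double integration of h(y) k(x - y) shows that k and its reflection have the same integral. *)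
Lemma ge0_integral_opp (k : X -> \bar R) : mfunT (k : borel X -> _) -> (forall x, (0 <= k x)%E) ->
  (\int[mu]_x k (- x)%R = \int[mu]_x k x)%E.
Proof.
move=> mk k0; have [E [mE E0 Ey]] := hg_fin_pos.
pose h (x : borel X) : \bar R := (\1_E x)%:E.
have mh : mfunT h by apply/mEFinP; exact: measurable_indic.
have h0 x : (0 <= h x)%E by rewrite lee_fin.
have Ih : (\int[mu]_x h x = mu E)%E by rewrite integral_indic// setIT.
have mko : mfunT (fun x : borel X => k (- x)).
  by apply: (mcompT mk); apply: measurable_oppf.
have A : (mu E * \int[mu]_x k x = mu E * \int[mu]_x k (- x)%R)%E.
  rewrite -Ih muleC -ge0_integralZl//; last exact: integral_ge0.
  transitivity (\int[mu]_y \int[mu]_x (h y * k (x - y)%R))%E.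
    apply: eq_integral => y _; rewrite ge0_integralZl//; last first.
      by apply: (mcompT mk); apply: msubf.
    by rewrite (int_shift (- y) mk k0) muleC.
  rewrite (fubini_tonelli (m1 := mu) (m2 := mu) (fun z : borel X * borel X => h z.1 * k (z.2 - z.1)%R)%E); last 2 first.
    apply: emeasurable_funM; first exact: (mcompT mh measurable_fst).
    apply: (mcompT mk); by apply: msubf.
    by move=> z; rewrite mule_ge0.
  transitivity (\int[mu]_x \int[mu]_y (h (y + x)%R * k (- y)%R))%E.
    apply: eq_integral => x _ /=.
    rewrite -(int_shift x (f := fun y => h y * k (x - y)%R)%E)//; last 2 first.
      apply: emeasurable_funM => //; apply: (mcompT mk).
      by apply: msubf.
      by move=> y; rewrite mule_ge0.
    by apply: eq_integral => y _; rewrite opprD addrCA addrN addr0.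
  rewrite -(fubini_tonelli (m1 := mu) (m2 := mu) (fun z : borel X * borel X => h (z.1 + z.2)%R * k (- z.1)%R)%E); last 2 first.
    apply: emeasurable_funM; last exact: (mcompT mko measurable_fst).
    apply: (mcompT mh); by apply: maddf.
    by move=> z; rewrite mule_ge0.
  rewrite -[RHS]ge0_integralZl//; last exact: integral_ge0.
  apply: eq_integral => y _ /=; rewrite [RHS]muleC -ge0_integralZl//.
  under [RHS]eq_integral do rewrite muleC.
  rewrite -(int_shift y (f := fun x => h x * k (- y)%R)%E).
  - by apply: eq_integral => x _; rewrite addrC.
  - by apply: emeasurable_funM => //; exact: measurable_cst.
  - by move=> x; rewrite mule_ge0.
have Ef : mu E \is a fin_num by rewrite ge0_fin_numE.
have E0' : (0 < fine (mu E)) by apply: fine_gt0; rewrite E0 Ey.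
move: A; rewrite -(fineK Ef) => /(congr1 (fun z => ((fine (mu E))^-1)%:E * z)%E).
by rewrite !muleA -EFinM mulVf ?gt_eqF// !mul1e => ->.
Qed.

Lemma opp_mp (E : set (borel X)) : measurable E -> mu ((fun x : borel X => (- x : X) : borel X) @^-1` E) = mu E.
Proof.
move=> mE; have mi : mfunT (fun x : borel X => (\1_E x)%:E : \bar R).
  by apply/mEFinP; exact: measurable_indic.
have e1 : (\int[mu]_x (\1_E x)%:E = mu E)%E by rewrite integral_indic// setIT.
have mE' : measurable ((fun x : borel X => (- x : X) : borel X) @^-1` E).
  by rewrite -[X in measurable X]setTI; exact: (measurable_oppf tX (f := id)).
set E' := (X in mu X); have e2 : (\int[mu]_x (\1_E' x)%:E = mu E')%E by rewrite integral_indic// setIT.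
by rewrite -e1 -e2 -(ge0_integral_opp mi)// => x; rewrite lee_fin.
Qed.
Lemma measurable_opp : mfunT (fun x : borel X => (- x : X) : borel X).
Proof. exact: (measurable_oppf tX (f := id)). Qed.
Lemma cint_opp (f : X -> R[i]) : cmeasurable (f : borel X -> _) ->
  cintegral mu (fun x => f (- x)) = cintegral mu f.
Proof. by move=> mf; rewrite (cint_mp measurable_opp opp_mp mf). Qed.

End HGroup.

Section MeasurableIntegral.
Context d1 d2 (T1 : measurableType d1) (T2 : measurableType d2) (R : realType).
Variables (m1 : {sigma_finite_measure set T1 -> \bar R}) (m2 : {sigma_finite_measure set T2 -> \bar R}).
Variable f : T1 * T2 -> \bar R.
Hypotheses (mf : mfunT f) (f0 : forall z, (0 <= f z)%E).
Lemma mint1 : mfunT (fun x => \int[m2]_y f (x, y))%E.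
Proof. by have := @measurable_fun_fubini_tonelli_F _ _ _ _ _ m2 f mf f0. Qed.
Lemma mint2 : mfunT (fun y => \int[m1]_x f (x, y))%E.
Proof. by have := @measurable_fun_fubini_tonelli_G _ _ _ _ _ m1 f mf f0. Qed.
Lemma prodm_tonelli1 : (\int[prodm m1 m2]_z f z = \int[m1]_x \int[m2]_y f (x, y))%E.
Proof. exact: (fubini_tonelli1 f mf f0). Qed.
Lemma prodm_tonelli2 : (\int[prodm m1 m2]_z f z = \int[m2]_y \int[m1]_x f (x, y))%E.
Proof. exact: (fubini_tonelli2 f mf f0). Qed.
End MeasurableIntegral.

Lemma prodmE d1 d2 (T1 : measurableType d1) (T2 : measurableType d2) (R : realType)
  (m1 : {sigma_finite_measure set T1 -> \bar R}) (m2 : {sigma_finite_measure set T2 -> \bar R}) A1 A2 :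
  measurable A1 -> measurable A2 -> prodm m1 m2 (A1 `*` A2) = (m1 A1 * m2 A2)%E.
Proof. exact: product_measure1E. Qed.

(** * Real powers, Hoelder's inequality and powers of integrals *)

Section Powers.
Variable R : realType.
Implicit Types x y r s : R.

Lemma powR_le x y r : 0 <= r -> 0 <= x -> x <= y -> x `^ r <= y `^ r.
Proof. by move=> r0 x0 xy; apply: ge0_ler_powR => //; rewrite nnegrE// (le_trans x0). Qed.
Lemma powR_split x r s : 0 <= x -> 0 < s -> s <= r -> x `^ r = x `^ (r - s) * x `^ s.
Proof.
move=> x0 s0 sr; have [->|xn0] := eqVneq x 0.
  by rewrite (powR0 (lt0r_neq0 (lt_le_trans s0 sr))) (powR0 (lt0r_neq0 s0)) mulr0.
by rewrite -powRD ?subrK// xn0 implybT.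
Qed.
(** The product is at most the power r of the larger number. This replaces a product of values at
    two points by terms that involve one point each. *)
Lemma powR_mix x y r t : 0 <= x -> 0 <= y -> 0 < t -> t <= r -> x `^ (r - t) * y `^ t <= x `^ r + y `^ r.
Proof.
move=> x0 y0 t0 tr; have [xy|/ltW yx] := leP x y.
  rewrite (powR_split y0 t0 tr) -[leLHS]add0r lerD ?powR_ge0// ler_wpM2r ?powR_ge0// powR_le// subr_ge0//.
rewrite (powR_split x0 t0 tr) -[leLHS]addr0 lerD ?powR_ge0// ler_wpM2l ?powR_ge0// powR_le ?(ltW t0)//.
Qed.
End Powers.

Section Hoelder.
Context d (T : measurableType d) (R : realType) (mu : {measure set T -> \bar R}).

(** Hoelder's inequality with conjugate exponents q / r and p / t, in a form where q, r, p and t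
    themselves may be below 1. *)
Lemma hoelder_pow (f g : T -> R) (q r p t : R) : 0 < q -> 0 < r -> 0 < p -> 0 < t ->
  r / q + t / p = 1 -> mfunT f -> mfunT g ->
  (forall x, 0 <= f x) -> (forall x, 0 <= g x) ->
  (\int[mu]_x (f x `^ r * g x `^ t)%:E <=
   (\int[mu]_x (f x `^ q)%:E) `^ (r / q) * (\int[mu]_x (g x `^ p)%:E) `^ (t / p))%E.
Proof.
move=> q0 r0 p0 t0 rt mf mg f0 g0.
have mfr : mfunT (fun x => f x `^ r) by apply: (mcompT (measurable_powR r)).
have mgt : mfunT (fun x => g x `^ t) by apply: (mcompT (measurable_powR t)).
have := @hoelder _ _ _ mu _ _ (q / r) (p / t) mfr mgt (divr_gt0 q0 r0) (divr_gt0 p0 t0).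
rewrite !invf_div => /(_ rt).
have N (h : T -> R) (a b : R) : 0 < a -> 0 < b -> (forall x, 0 <= h x) ->
  ('N[mu]_(a / b)%:E[EFin \o (fun x => h x `^ b)%R] = (\int[mu]_x (h x `^ a)%:E) `^ (b / a))%E.
  move=> a0 b0 h0; have ab : a / b != 0 by rewrite gt_eqF// divr_gt0.
  have := powR_Lnorm mu (EFin \o (fun x => h x `^ b)) ab.
  move=> /(congr1 (fun z => z `^ (b / a)))%E.
  have ab1 : a / b * (b / a) = 1 by rewrite mulrA divfK ?divff// gt_eqF.
  rewrite -poweRrM ab1 (poweRe1 (Lnorm_ge0 _ _ _)) => ->; congr (poweR _ _); apply: eq_integral => x _; rewrite /=.
  by rewrite ger0_norm ?powR_ge0// -powRrM mulrC divfK// gt_eqF.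
rewrite !N// Lnorm1; apply: le_trans.
apply: eqW; apply: eq_integral => x _ /=.
by rewrite ger0_norm// mulr_ge0// powR_ge0.
Qed.
End Hoelder.

Section PowerOfIntegral.
Context d (T : measurableType d) (R : realType) (mu : {measure set T -> \bar R}).

(* K is bounded by (I / delta)^(1/t) where I is the integral of L^t, so that K = K^(1-t) K^t can be integrated. *)
Lemma integral_pow_le (K L : T -> R) (t delta : R) (S : T -> set T) : 0 < t -> t <= 1 -> 0 < delta ->
  mfunT K -> mfunT L -> (forall x, 0 <= K x) -> (forall x, 0 <= L x) ->
  (forall x, measurable (S x)) -> (forall x, (delta%:E <= mu (S x))%E) -> (forall x, K x <= L x) ->
  (forall x y, S x y -> K x <= L y) ->
  ((\int[mu]_x (K x)%:E) `^ t <= (delta `^ (t - 1))%:E * \int[mu]_x (L x `^ t)%:E)%E.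
Proof.
move=> t0 t1 d0 mK mL K0 L0 mS dS KL KSL.
have mLt : mfunT (fun x => (L x `^ t)%:E).
  by apply/mEFinP; apply: (mcompT (measurable_powR t)).
have mKt : mfunT (fun x => (K x `^ t)%:E).
  by apply/mEFinP; apply: (mcompT (measurable_powR t)).
have Lt0 x : setT x -> (0 <= (L x `^ t)%:E)%E by rewrite lee_fin powR_ge0.
have [Iy|] := ltP (\int[mu]_x (L x `^ t)%:E)%E +oo%E; last first.
  by rewrite leye_eq => /eqP ->; rewrite gt0_muley ?leey// lte_fin powR_gt0.
have If : (\int[mu]_x (L x `^ t)%:E)%E \is a fin_num by rewrite ge0_fin_numE// integral_ge0.
set i := fine (\int[mu]_x (L x `^ t)%:E)%E.
have iE : (\int[mu]_x (L x `^ t)%:E)%E = i%:E by rewrite /i fineK.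
have i0 : 0 <= i by rewrite -lee_fin -iE integral_ge0.
have Kb x : K x `^ t <= i / delta.
  rewrite ler_pdivlMr// -lee_fin -iE EFinM.
  apply: (@le_trans _ _ ((K x `^ t)%:E * mu (S x))%E).
    by apply: lee_pmul => //; rewrite ?lee_fin ?powR_ge0// ltW.
  rewrite -(integral_cst mu (mS x)).
  apply: (@le_trans _ _ (\int[mu]_(y in S x) (L y `^ t)%:E)%E).
    apply: ge0_le_integral => //.
    - by move=> y _; rewrite lee_fin powR_ge0.
    - exact: measurable_funS mLt.
    - by move=> y Sy; rewrite lee_fin powR_le ?(ltW t0)// KSL.
  exact: ge0_subset_integral.
have Kd x : K x <= (i / delta) `^ ((1 - t) / t) * K x `^ t.
  rewrite -{1}(powRr1 (K0 x)) (powR_split (K0 x) t0 t1) ler_wpM2r ?powR_ge0//.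
  have e : 1 - t = t * ((1 - t) / t) by rewrite mulrC divfK// gt_eqF.
  rewrite [X in X <= _](_ : _ = (K x `^ t) `^ ((1 - t) / t)); last by rewrite -powRrM -e.
  by rewrite powR_le// ?powR_ge0// divr_ge0// ?subr_ge0// ltW.
have IK : (\int[mu]_x (K x)%:E <= ((i / delta) `^ ((1 - t) / t) * i)%:E)%E.
  apply: (@le_trans _ _ (\int[mu]_x (((i / delta) `^ ((1 - t) / t))%:E * (K x `^ t)%:E))%E).
    apply: ge0_le_int => //; first exact/mEFinP.
    by apply: emeasurable_funM => //; exact: measurable_cst.
  rewrite ge0_intZ ?powR_ge0//; last by move=> x _; rewrite lee_fin powR_ge0.
  rewrite EFinM -iE lee_wpmul2l; [by []|by rewrite lee_fin powR_ge0|].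
  apply: ge0_le_int => //; first by move=> x; rewrite lee_fin powR_ge0.
  by move=> x; rewrite lee_fin powR_le// ltW.
rewrite iE; apply: (@le_trans _ _ ((((i / delta) `^ ((1 - t) / t) * i)%:E) `^ t)%E).
  apply: gt0_ler_poweR => //; first exact: ltW.
    by rewrite in_itv /= leey integral_ge0// => x _; rewrite lee_fin.
  by rewrite in_itv /= leey lee_fin mulr_ge0// powR_ge0.
rewrite poweR_EFin -EFinM lee_fin powRM ?powR_ge0// -powRrM divfK ?gt_eqF//.
have [->|in0] := eqVneq i 0; first by rewrite powR0 ?gt_eqF// !mulr0.
have ip : 0 < i by rewrite lt_def in0.
rewrite powRM// ?invr_ge0 ?(ltW d0)// mulrAC -powRD; last by rewrite in0 implybT.
rewrite subrK powRr1// mulrC ler_wpM2r//.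
by rewrite -(powR_inv1 (ltW d0)) -powRrM mulN1r opprB.
Qed.

End PowerOfIntegral.

(** * Local maximal functions of continuous functions *)

Section LocalSup.
Variables (R : realType) (X : preTopologicalZmodType).
Implicit Types (N : set X) (F : X -> R).

(** A true supremum, available because the functions are continuous: it is lower semicontinuous and
    can be evaluated at points. The real [sup] is meaningful for bounded sets only, whence the
    standing bound [c] below. *)
Definition msup N F (z : X) : R := sup [set F (z + h) | h in N].

Variables (N : set X) (F : X -> R) (c : R).
Hypotheses (Fc : forall z, F z <= c) (N0 : N !=set0).

Lemma msup_has_sup z : has_sup [set F (z + h) | h in N].
Proof.
by split; [have [h Nh] := N0; exists (F (z + h)); exists h|exists c => _ [h _ <-]].
Qed.
Lemma le_msup z h : N h -> F (z + h) <= msup N F z.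
Proof. by move=> Nh; apply: sup_upper_bound; [exact: msup_has_sup|exists h]. Qed.
Lemma msup_le z b : (forall h, N h -> F (z + h) <= b) -> msup N F z <= b.
Proof.
move=> H; apply: ge_sup; first by have [] := msup_has_sup z.
by move=> _ [h Nh <-]; exact: H.
Qed.
Lemma msup_ge0 z : (forall z, 0 <= F z) -> 0 <= msup N F z.
Proof. by move=> F0; have [h Nh] := N0; apply: le_trans (le_msup z Nh). Qed.
(** A superlevel set of the supremum is the union over [N] of translated superlevel sets of [F],
    hence open for any [N]. *)
Lemma msup_open (tX : tgroup X) : continuous F -> forall r : R, open [set z | r < msup N F z].
Proof.
move=> cF r; have -> : [set z | r < msup N F z] = \bigcup_(h in N) [set z | r < F (z + h)].
  apply/seteqP; split => z /=; last by move=> [h Nh] /lt_le_trans; apply; exact: le_msup.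
  move=> /(sup_gt (msup_has_sup z).1) [_ [h Nh <-] rh]; by exists h.
apply: bigcup_open => h Nh; have := @open_shift _ tX h [set z | r < F z]; apply.
by apply: ((continuousP F).1 cF [set x | r < x]); exact: open_gt.
Qed.
End LocalSup.

(** In the applications [j] is an identity map that selects the sigma-algebra on the group, Borel or
    product. *)
Lemma measurable_msup (R : realType) (X : preTopologicalZmodType) (d : measure_display) (M : measurableType d)
    (j : M -> X) (N : set X) (F : X -> R) c : (forall U : set X, open U -> measurable (j @^-1` U)) ->
  tgroup X -> (forall z, F z <= c) -> N !=set0 -> continuous F -> mfunT (fun x => msup N F (j x)).
Proof.
move=> jo tX Fc N0 cF; apply/mEFinP; apply: measurable_fun_gt => r.
by rewrite (_ : [set x | _] = j @^-1` [set z | r < msup N F z])//; apply: jo; exact: (msup_open Fc N0 tX cF).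
Qed.

(** * One gain of integrability through Hoelder's inequality *)

Section AmalgamStep.
Variables (R : realType) (Z B : preTopologicalZmodType).
Variables (m : sfm R Z) (n : sfm R B).
Hypotheses (hZ : hgroup m) (hB : hgroup n).
Variables (al be : B -> Z).
Hypotheses (mal : mfunT (al : borel B -> borel Z)) (mbe : mfunT (be : borel B -> borel Z)).
Variables (X0 X : Z -> R) (Y G : Z * B -> R) (C q r p t : R).
Hypotheses (mX0 : mfunT (X0 : borel Z -> R)) (mX : mfunT (X : borel Z -> R)).
Hypotheses (mY : mfunT (Y : borel Z * borel B -> R)) (mG : mfunT (G : borel Z * borel B -> R)).
Hypotheses (X00 : forall z, 0 <= X0 z) (XX : forall z, X0 z <= X z) (Y0 : forall z, 0 <= Y z) (G0 : forall z, 0 <= G z).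
Hypotheses (C0 : 0 <= C) (q0 : 0 < q) (p0 : 0 < p) (t0 : 0 < t) (tr : t <= r) (rE : r / q + t / p = 1).

(** [z] is the phase-space point. In [x], the first component is the integration variable of the
    operator kernel and the second that of the convolution with the Gaussian [G]; [Y] stands for the
    maximal function of the transform of the symbol. *)
Definition amalgam_kernel (z : Z) (x : B * (Z * B)) : R :=
  (X z `^ r + X (z + be x.1) `^ r) * (G x.2 `^ t * Y (z - al x.1 + x.2.1, x.1 + x.2.2) `^ t).

Hypothesis X0le : forall z, ((X0 z `^ t)%:E <=
  C%:E * \int[prodm n (prodm m n)]_x (X (z + be x.1) `^ t * (G x.2 `^ t * Y (z - al x.1 + x.2.1, x.1 + x.2.2) `^ t))%:E)%E.

Hypotheses (Xq : (\int[m]_z (X z `^ q)%:E < +oo)%E) (Gt : (\int[prodm m n]_w (G w `^ t)%:E < +oo)%E).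
Hypothesis Yt : (\int[n]_b (\int[m]_a (Y (a, b) `^ p)%:E) `^ (t / p) < +oo)%E.

Let tZ := hg_top hZ. Let cZ := hg_csb hZ. Let tB := hg_top hB. Let cB := hg_csb hB.
Let T := (borel B * (borel Z * borel B))%type.
Let X_ge0 z : 0 <= X z. Proof. exact: le_trans (XX z). Qed.
Let mT1 : mfunT (fun x : borel Z * T => x.2.1 : borel B).
Proof. exact: (mcompT measurable_fst measurable_snd). Qed.
Let mT2 : mfunT (fun x : borel Z * T => x.2.2).
Proof. exact: (mcompT measurable_snd measurable_snd). Qed.
Let mT21 : mfunT (fun x : borel Z * T => x.2.2.1 : borel Z).
Proof. exact: (mcompT measurable_fst mT2). Qed.
Let mT22 : mfunT (fun x : borel Z * T => x.2.2.2 : borel B).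
Proof. exact: (mcompT measurable_snd mT2). Qed.
Let mshift : mfunT (fun x : borel Z * T => (x.1 + be x.2.1 : Z) : borel Z).
Proof. by apply: maddf => //; exact: (mcompT mbe mT1). Qed.
Let mYarg : mfunT (fun x : borel Z * T =>
  ((x.1 - al x.2.1 + x.2.2.1 : Z) : borel Z, (x.2.1 + x.2.2.2 : B) : borel B)).
Proof.
apply: measurable_fun_pair; last exact: maddf.
by apply: maddf => //; apply: msubf => //; exact: (mcompT mal mT1).
Qed.
Let mpow s (d' : measure_display) (S : measurableType d') (f : S -> R) : mfunT f -> mfunT (fun x => f x `^ s).
Proof. by move=> mf; apply: (mcompT (measurable_powR s)). Qed.
Let mH : mfunT (fun x : borel Z * T => G x.2.2 `^ t * Y (x.1 - al x.2.1 + x.2.2.1, x.2.1 + x.2.2.2) `^ t).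
Proof.
apply: measurable_funM; apply: mpow; first exact: (mcompT mG mT2).
exact: (mcompT mY mYarg).
Qed.
Let mker : mfunT (fun x : borel Z * T => amalgam_kernel x.1 x.2).
Proof.
apply: measurable_funM; last exact: mH.
apply: measurable_funD; apply: mpow; first exact: (mcompT mX measurable_fst).
exact: (mcompT mX mshift).
Qed.
Let r0 : 0 < r. Proof. exact: lt_le_trans tr. Qed.

Let k (b : B) : \bar R := ((\int[m]_a (Y (a, b) `^ p)%:E) `^ (t / p))%E.
Let mk : mfunT (k : borel B -> \bar R).
Proof.
apply: (mcompT (measurable_poweR (t / p))).
have h : mfunT (fun z : borel Z * borel B => (Y z `^ p)%:E) by apply/mEFinP; exact: mpow.
by apply: (@mint2 _ _ _ _ _ m _ h) => x; rewrite lee_fin powR_ge0.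
Qed.
Let NX := ((\int[m]_z (X z `^ q)%:E) `^ (r / q))%E.

(** Hoelder's inequality in [z] for fixed displacements [x]. Translation invariance removes the
    displacement of [X] and that of the first argument of [Y], which leaves the slice norm [k]. The
    2 counts the two terms of the kernel. *)
Lemma amalgam_slice (x : B * (Z * B)) :
  (\int[m]_z (amalgam_kernel z x)%:E <= 2%:E * NX * ((G x.2 `^ t)%:E * k (x.1 + x.2.2)%R))%E.
Proof.
have step (T' : Z -> Z) : mfunT (T' : borel Z -> borel Z) ->
    (\int[m]_z (X (T' z) `^ q)%:E = \int[m]_z (X z `^ q)%:E)%E ->
    (\int[m]_z ((X (T' z) `^ r * Y (z - al x.1 + x.2.1, x.1 + x.2.2) `^ t)%R)%:E <= NX * k (x.1 + x.2.2)%R)%E.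
  move=> mT' eT'; have mYs : mfunT (fun z : borel Z => Y (z - al x.1 + x.2.1, x.1 + x.2.2)).
    apply: (mcompT mY); apply: measurable_fun_pair; last exact: measurable_cst.
    by apply: maddf => //; apply: msubf.
  apply: le_trans (hoelder_pow m q0 r0 p0 t0 rE (mcompT mX mT') mYs (fun z => X_ge0 _) (fun z => Y0 _)) _.
  rewrite eT' /NX /k.
  rewrite -(int_shift hZ (- al x.1 + x.2.1) (f := fun a => (Y (a, x.1 + x.2.2) `^ p)%:E)).
  - by under eq_integral do rewrite -addrA.
  - by apply/mEFinP; apply: mpow; apply: (mcompT mY); exact: measurable_pair2.
  - by move=> z; rewrite lee_fin powR_ge0.
have mYt z1 z2 : mfunT (fun z : borel Z => Y (z - z1 + z2, x.1 + x.2.2) `^ t).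
  apply: mpow; apply: (mcompT mY); apply: measurable_fun_pair; last exact: measurable_cst.
  by apply: maddf => //; apply: msubf.
have mXr : mfunT (fun z : borel Z => X z `^ r) by exact: mpow.
have mXs : mfunT (fun z : borel Z => (z + be x.1 : Z) : borel Z) by apply: maddf.
have mXsr : mfunT (fun z : borel Z => X (z + be x.1) `^ r) by apply: mpow; exact: (mcompT mX mXs).
have mX' (f : borel Z -> R) : mfunT f -> mfunT (fun z : borel Z => (f z * Y (z - al x.1 + x.2.1, x.1 + x.2.2) `^ t)%:E).
  by move=> mf; apply/mEFinP; exact: measurable_funM.
have -> : (\int[m]_z (amalgam_kernel z x)%:E = (G x.2 `^ t)%:E *
    \int[m]_z ((X z `^ r * Y (z - al x.1 + x.2.1, x.1 + x.2.2) `^ t)%:E +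
               (X (z + be x.1)%R `^ r * Y (z - al x.1 + x.2.1, x.1 + x.2.2) `^ t)%:E))%E.
  rewrite -ge0_intZ ?powR_ge0//; last 2 first.
    by move=> z _; rewrite -EFinD lee_fin addr_ge0// mulr_ge0// powR_ge0.
    by apply: emeasurable_funD; exact: mX'.
  apply: eq_integral => z _; rewrite -EFinD -EFinM; congr (_%:E); rewrite /amalgam_kernel; ring.
rewrite ge0_integralD//; last 4 first.
  by move=> z _; rewrite lee_fin mulr_ge0// powR_ge0.
  exact: mX'.
  by move=> z _; rewrite lee_fin mulr_ge0// powR_ge0.
  exact: mX'.
rewrite (_ : (2%:E * NX * _)%E = ((G x.2 `^ t)%:E * (NX * k (x.1 + x.2.2)%R + NX * k (x.1 + x.2.2)%R))%E).
  apply: lee_wpmul2l; first by rewrite lee_fin powR_ge0.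
  apply: leeD; first exact: (step id).
  apply: (step (fun z => z + be x.1) mXs).
  rewrite (int_shift hZ (be x.1) (f := fun a => (X a `^ q)%:E))//; first by apply/mEFinP; exact: mpow.
  by move=> z; rewrite lee_fin powR_ge0.
have kx : (0 <= k (x.1 + x.2.2)%R)%E by exact: poweR_ge0.
have Nx : (0 <= NX)%E by exact: poweR_ge0.
have -> : (NX * k (x.1 + x.2.2)%R + NX * k (x.1 + x.2.2)%R = 2%:E * (NX * k (x.1 + x.2.2)%R))%E.
  have -> : 2%:E = (1 + 1)%:E :> \bar R by [].
  by rewrite EFinD ge0_muleDl ?lee_fin// !mul1e.
by rewrite [RHS]muleCA -!muleA; congr (_ * _)%E; rewrite muleCA.
Qed.

Lemma amalgam_kernel_ge z (x : B * (Z * B)) :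
  X0 z `^ (r - t) * (X (z + be x.1) `^ t * (G x.2 `^ t * Y (z - al x.1 + x.2.1, x.1 + x.2.2) `^ t)) <= amalgam_kernel z x.
Proof.
rewrite /amalgam_kernel mulrA; apply: ler_pM; [by rewrite mulr_ge0 ?powR_ge0|by rewrite mulr_ge0 ?powR_ge0| |by []].
apply: le_trans (powR_mix (X_ge0 z) (X_ge0 _) t0 tr).
by apply: ler_pM; rewrite ?powR_ge0// powR_le// subr_ge0.
Qed.

(** The power r is split as (r - t) + t, and [X0le] is used for the power t only. After Tonelli and
    [amalgam_slice], a translation in the frequency variable separates the integral of the powers of
    [G] from that of the slice norms of [Y]. *)
Lemma amalgam_step : (\int[m]_z (X0 z `^ r)%:E < +oo)%E.
Proof.
have k0 b : (0 <= k b)%E by exact: poweR_ge0.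
have Nx : (0 <= NX)%E by exact: poweR_ge0.
have kk z x : (0 <= (amalgam_kernel z x)%:E)%E.
  by rewrite lee_fin /amalgam_kernel mulr_ge0 ?addr_ge0 ?mulr_ge0 ?powR_ge0.
have mke : mfunT (fun x : borel Z * T => (amalgam_kernel x.1 x.2)%:E) by exact/mEFinP.
apply: (@le_lt_trans _ _ (\int[m]_z (C%:E * \int[prodm n (prodm m n)]_x (amalgam_kernel z x)%:E))%E).
  apply: ge0_le_int.
  - by apply/mEFinP; exact: mpow.
  - apply: emeasurable_funM; first exact: measurable_cst.
    exact: (@mint1 _ _ _ _ _ (prodm n (prodm m n)) _ mke (fun x => kk _ _)).
  - by move=> z; rewrite lee_fin powR_ge0.
  move=> z; rewrite (powR_split (X00 z) t0 tr) EFinM.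
  apply: le_trans (lee_wpmul2l _ (X0le z)) _; first by rewrite lee_fin powR_ge0.
  rewrite muleCA; apply: lee_wpmul2l; first by rewrite lee_fin.
  rewrite -ge0_intZ ?powR_ge0//; last 2 first.
    by move=> x _; rewrite lee_fin !mulr_ge0// powR_ge0.
    apply/mEFinP; apply: measurable_funM; last exact: (mcompT mH (measurable_pair1 z)).
    by apply: mpow; exact: (mcompT mX (mcompT mshift (measurable_pair1 z))).
  apply: ge0_le_int.
  - apply: emeasurable_funM; first exact: measurable_cst.
    apply/mEFinP; apply: measurable_funM; last exact: (mcompT mH (measurable_pair1 z)).
    by apply: mpow; exact: (mcompT mX (mcompT mshift (measurable_pair1 z))).
  - exact: (mcompT mke (measurable_pair1 z)).
  - by move=> x; rewrite -EFinM lee_fin !mulr_ge0// powR_ge0.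
  by move=> x; rewrite -EFinM lee_fin; exact: amalgam_kernel_ge.
rewrite ge0_intZ//; last 2 first.
  by move=> z _; exact: integral_ge0.
  exact: (@mint1 _ _ _ _ _ (prodm n (prodm m n)) _ mke (fun x => kk _ _)).
apply: lte_mul_pinfty; rewrite ?lee_fin//.
rewrite (fubini_tonelli (m1 := m) (m2 := prodm n (prodm m n)) _ mke (fun x => kk _ _)).
have mGt : mfunT (fun x : T => (G x.2 `^ t)%:E).
  by apply/mEFinP; apply: mpow; exact: (mcompT mG measurable_snd).
have mkk : mfunT (fun x : T => k (x.1 + x.2.2)).
  apply: (mcompT mk); apply: maddf => //.
  exact: (mcompT measurable_snd measurable_snd).
have mGk : mfunT (fun x : T => (G x.2 `^ t)%:E * k (x.1 + x.2.2)%R)%E by exact: emeasurable_funM.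
have Gk0 x : (0 <= (G x.2 `^ t)%:E * k (x.1 + x.2.2)%R)%E by rewrite mule_ge0// lee_fin powR_ge0.
apply: (@le_lt_trans _ _ (\int[prodm n (prodm m n)]_x (2%:E * NX * ((G x.2 `^ t)%:E * k (x.1 + x.2.2)%R)))%E).
  apply: ge0_le_int.
  - exact: (@mint2 _ _ _ _ _ m _ mke (fun x => kk _ _)).
  - by apply: emeasurable_funM => //; exact: measurable_cst.
  - by move=> x; exact: integral_ge0.
  - exact: amalgam_slice.
have Nf : NX \is a fin_num by rewrite ge0_fin_numE// poweR_lty.
rewrite ge0_integralZl ?mule_ge0 ?lee_fin//.
apply: lte_mul_pinfty; [by rewrite mule_ge0 ?lee_fin|by rewrite fin_numM|].
rewrite (prodm_tonelli2 n (prodm m n) mGk Gk0).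
have Kf : (\int[n]_b k b)%E \is a fin_num by rewrite ge0_fin_numE// integral_ge0.
rewrite (_ : (fun _ => _) = (fun w => (G w `^ t)%:E * \int[n]_b k b))%E.
  rewrite ge0_integralZr ?integral_ge0//.
  - by rewrite lte_mul_pinfty ?integral_ge0// => [x _|]; rewrite ?lee_fin ?powR_ge0// ge0_fin_numE// integral_ge0// => x _; rewrite lee_fin powR_ge0.
  - by apply/mEFinP; exact: mpow.
  - by move=> x _; rewrite lee_fin powR_ge0.
apply/funext => w; have mks : mfunT (fun b : borel B => k (b + w.2)).
  by apply: (mcompT mk); apply: maddf.
rewrite -(int_shift hB w.2 mk k0).
have := @ge0_intZ _ _ _ n setT measurableT (fun b => k (b + w.2)%R) (fun b _ => k0 _) mks (G w `^ t) (powR_ge0 _ _).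
by [].
Qed.

End AmalgamStep.

(** * Iteration of the gain of integrability *)

Section Amalgam.
Variables (R : realType) (Z B : preTopologicalZmodType).
Variables (m : sfm R Z) (n : sfm R B).
Hypotheses (hZ : hgroup m) (hB : hgroup n).
Variables (al be : B -> Z).
Hypotheses (cal : continuous al) (cbe : continuous be).
Hypotheses (alD : {morph al : x y / x + y >-> x + y}) (beD : {morph be : x y / x + y >-> x + y}).
Variables (F : Z -> R) (V G G2 : Z * B -> R) (C cF cV p : R).
Hypotheses (cnF : continuous F) (cnV : continuous V).
Hypotheses (F0 : forall z, 0 <= F z) (Fc : forall z, F z <= cF) (V0 : forall z, 0 <= V z) (Vc : forall z, V z <= cV).
Hypotheses (mG : mfunT (G : borel Z * borel B -> R)) (mG2 : mfunT (G2 : borel Z * borel B -> R)).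
Hypotheses (G0 : forall z, 0 <= G z) (C0 : 0 <= C) (p0 : 0 < p).
Variables (SZ CZ : set Z) (SB CB : set B).
Hypotheses (oSZ : open SZ) (oSB : open SB) (SZ0 : SZ 0) (SB0 : SB 0) (SZC : SZ `<=` CZ) (SBC : SB `<=` CB).
Hypotheses (kCZ : compact CZ) (kCB : compact CB).
Hypothesis GG : forall w w0, SZ w0.1 -> SB w0.2 -> G w <= G2 (w + w0).
Hypothesis G2t : forall t, 0 < t -> (\int[prodm m n]_w (G2 w `^ t)%:E < +oo)%E.
Hypothesis FV : forall z, ((F z)%:E <=
  C%:E * \int[prodm n (prodm m n)]_x (F (z + be x.1) * (G x.2 * V (z - al x.1 + x.2.1, (x.1 + x.2.2)%R)))%:E)%E.
Hypothesis Vt : forall N : set (Z * B), compact N -> N !=set0 -> forall g : R, 0 < g ->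
  (\int[n]_b (\int[m]_a (msup N V (a, b) `^ p)%:E) `^ (g / p) < +oo)%E.

Let tZ := hg_top hZ. Let cZ := hg_csb hZ. Let tB := hg_top hB. Let cB := hg_csb hB.
Let T := (borel B * (borel Z * borel B))%type.

Lemma measurable_msupZ N : N !=set0 -> mfunT (msup N F : borel Z -> R).
Proof.
move=> N0; apply: (measurable_msup (j := id : borel Z -> Z) _ tZ Fc N0 cnF) => U oU.
exact: open_mborel.
Qed.
Lemma measurable_msupZB N : N !=set0 -> mfunT (msup N V : borel Z * borel B -> R).
Proof.
move=> N0; apply: (measurable_msup (j := id : borel Z * borel B -> Z * B) _ (tgroup_prod tZ tB) Vc N0 cnV) => U oU.
exact: open_mprod.
Qed.

Lemma measure_shift_set (X : preTopologicalZmodType) (mu : sfm R X) (hX : hgroup mu)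
  (S : set X) (x : X) : open S -> measurable ([set y | S (y - x)] : set (borel X)) /\ mu [set y | S (y - x)] = mu S.
Proof.
move=> oS; split; last exact: (shift_mp hX (- x) (open_mborel oS)).
by apply: open_mborel; apply: open_shift => //; exact: hg_top hX.
Qed.

(** The bound on [F (z + h)] is raised to the power t by [integral_pow_le], uniformly for [h] in
    [N]. The result has the form that [amalgam_step] requires, with larger compact sets on the
    right; this is why the hypothesis on the exponent q concerns all compact sets. *)
Lemma amalgam_contract (N : set Z) (t q r : R) : compact N -> N 0 -> 0 < t -> t <= 1 -> t <= r -> 0 < q -> r / q + t / p = 1 ->
  (forall N : set Z, compact N -> N 0 -> (\int[m]_z (msup N F z `^ q)%:E < +oo)%E) ->
  (\int[m]_z (msup N F z `^ r)%:E < +oo)%E.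
Proof.
move=> kN N0 t0 t1 tr q0 rE Fq.
(* [N'] and [N''] contain every displacement of the arguments of [F] and [V] caused by a move of [z]
   in [N] together with moves of the integration variables in [CB] and [CZ]. *)
pose N' : set Z := [set x.1 - be x.2 | x in N `*` CB].
pose N'' : set (Z * B) := [set (x.1.1 + al x.1.2 - x.2.1, - x.1.2 - x.2.2) | x in (N `*` CB) `*` (CZ `*` CB)].
have cf (X Y : topologicalType) : continuous (fst : X * Y -> X) by move=> z; exact: cvg_fst.
have cs (X Y : topologicalType) : continuous (snd : X * Y -> Y) by move=> z; exact: cvg_snd.
have cc (X Y W : topologicalType) (f : X -> Y) (g : Y -> W) : continuous f -> continuous g -> continuous (g \o f).
  by move=> h1 h2 x; apply: continuous_comp; [exact: h1|exact: h2].
have kN' : compact N'.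
  apply: continuous_compact; last exact: compact_setX.
  apply: continuous_subspaceT; exact: (tgroup_subf tZ (@cf Z B) (cc _ _ _ _ _ (@cs Z B) cbe)).
have kN'' : compact N''.
  apply: continuous_compact; last by apply: compact_setX; exact: compact_setX.
  apply: continuous_subspaceT; apply: cpair.
    apply: (tgroup_subf tZ _ (cc _ _ _ _ _ (@cs _ _) (@cf _ _))).
    apply: (tgroup_addf tZ (cc _ _ _ _ _ (@cf _ _) (@cf _ _))).
    exact: (cc _ _ _ _ _ (cc _ _ _ _ _ (@cf _ _) (@cs _ _)) cal).
  apply: (tgroup_subf tB _ (cc _ _ _ _ _ (@cs _ _) (@cs _ _))).
  exact: (tgroup_oppf tB (cc _ _ _ _ _ (@cf _ _) (@cs _ _))).
have be0 : be 0 = 0 by apply: (addrI (be 0)); rewrite -beD !addr0.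
have al0 : al 0 = 0 by apply: (addrI (al 0)); rewrite -alD !addr0.
have alN b : al (- b) = - al b by apply: (addrI (al b)); rewrite -alD !addrN.
have beN b : be (- b) = - be b by apply: (addrI (be b)); rewrite -beD !addrN.
have NN' : N `<=` N' by move=> h Nh; exists (h, 0); [split => //; exact: SBC|rewrite /= be0 subr0].
have N'0 : N' 0 by exact: NN'.
have N''0 : N'' !=set0.
  exists (0, 0); exists ((0, 0), (0, 0)); first by split; split => //=; [exact: SBC|exact: SZC|exact: SBC].
  by rewrite /= al0 !(oppr0, addr0).
have Nn : N !=set0 by exists 0.
have N'n : N' !=set0 by exists 0.
have mal : mfunT (al : borel B -> borel Z) by exact: ccont_mborel.
have mbe : mfunT (be : borel B -> borel Z) by exact: ccont_mborel.
(* A positive real below the measure of the product of [SB], [SZ] and [SB]; that measure may be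
   infinite, and then 1 serves. *)
have [dl [dl0 dlS]] : exists dl : R, 0 < dl /\ (dl%:E <= n SB * (m SZ * n SB))%E.
  have : (0 < n SB * (m SZ * n SB))%E.
    by rewrite !mule_gt0//; apply: hg_pos => //; exists 0.
  case: (n SB * (m SZ * n SB))%E => [x x0|_|//]; first by exists x.
  by exists 1; rewrite leey.
have G20 w : 0 <= G2 w by have := @GG w 0 SZ0 SB0; rewrite addr0; exact: le_trans (G0 w).
have mXF := measurable_msupZ N'n; have mYV := measurable_msupZB N''0.
pose L z (x : T) := msup N' F (z + be x.1) * (G2 x.2 * msup N'' V (z - al x.1 + x.2.1, x.1 + x.2.2)).
pose Y := msup N'' V; pose X := msup N' F.
apply: (@amalgam_step R Z B m n hZ hB al be mal mbe (msup N F) X Y G2 (C `^ t * dl `^ (t - 1)) q r p t) => //.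
- exact: measurable_msupZ.
- by move=> z; exact: (msup_ge0 Fc Nn).
- by move=> z; apply: (msup_le Fc Nn) => h Nh; apply: (le_msup Fc N'n); exact: NN'.
- by move=> z; exact: (msup_ge0 Vc N''0).
- by rewrite mulr_ge0 ?powR_ge0.
- move=> z.
  set J := (X in (_ <= _ * X)%E).
  have J0 : (0 <= J)%E by apply: integral_ge0 => x _; rewrite lee_fin !mulr_ge0 ?powR_ge0.
  have key h : N h -> ((F (z + h) `^ t)%:E <= (C `^ t * dl `^ (t - 1))%:E * J)%E.
    move=> Nh; pose K (x : T) := F (z + h + be x.1) * (G x.2 * V (z + h - al x.1 + x.2.1, x.1 + x.2.2)).
    have mzb : mfunT (fun x : T => (z + be x.1 : Z) : borel Z).
      by apply: maddf => //; exact: (mcompT mbe measurable_fst).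
    have m22 : mfunT (fun x : T => x.2.2 : borel B) by exact: (mcompT measurable_snd measurable_snd).
    have mza c : mfunT (fun x : T => ((c - al x.1 + x.2.1, x.1 + x.2.2) : Z * B) : borel Z * borel B).
      apply: measurable_fun_pair; last exact: maddf.
      apply: maddf => //; last exact: (mcompT measurable_fst measurable_snd).
      by apply: msubf => //; exact: (mcompT mal measurable_fst).
    have mK : mfunT K.
      apply: measurable_funM.
        apply: (mcompT (ccont_mR cnF)); apply: maddf => //.
        exact: (mcompT mbe measurable_fst).
      apply: measurable_funM; first exact: (mcompT mG measurable_snd).
      apply: (mcompT _ (mza (z + h))).
      by apply: measurable_fun_oo => U oU; apply: open_mprod => //; exact: (continuousP V).1.
    have mL : mfunT (L z).
      apply: measurable_funM; first exact: (mcompT mXF mzb).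
      apply: measurable_funM; first exact: (mcompT mG2 measurable_snd).
      exact: (mcompT mYV (mza z)).
    (* The translate of the open box to [x]: at each of its points [L z] dominates the value
       [K x]. *)
    pose S (x : T) : set T := [set y : B | SB (y - x.1)] `*` ([set y : Z | SZ (y - x.2.1)] `*` [set y : B | SB (y - x.2.2)]).
    have KSL x y : S x y -> K x <= L z y.
      move=> [/= s1 [/= s2 s3]].
      have SN' : N' (h - be (y.1 - x.1)) by exists (h, y.1 - x.1) => //; split => //; exact: SBC.
      have SN'' : N'' (h + al (y.1 - x.1) - (y.2.1 - x.2.1), - (y.1 - x.1) - (y.2.2 - x.2.2)).
        by exists ((h, y.1 - x.1), (y.2.1 - x.2.1, y.2.2 - x.2.2)) => //; split; split => //=; [exact: SBC|exact: SZC|exact: SBC].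
      apply: ler_pM => //; first by rewrite mulr_ge0.
        have := le_msup Fc N'n (z + be y.1) SN'; congr (_ <= _); congr F.
        by rewrite beD beN opprD opprK addrACA [be y.1 + _]addrA addrN add0r -addrA.
      apply: ler_pM => //.
        have := @GG x.2 (y.2 - x.2) s2 s3; congr (_ <= G2 _).
        by rewrite addrC subrK; case: (y).
      have := le_msup Vc N''0 (z - al y.1 + y.2.1, y.1 + y.2.2) SN''; congr (_ <= _); congr V.
      have e1 : z - al y.1 + y.2.1 + (h + al (y.1 - x.1) - (y.2.1 - x.2.1)) = z + h - al x.1 + x.2.1.
        rewrite alD alN opprB (addrAC z (- al y.1)) -(addrA (z + y.2.1)).
        rewrite [- al y.1 + _](_ : _ = h - al x.1 + (x.2.1 - y.2.1)); last first.
          by rewrite !addrA [- al y.1 + h]addrC -(addrA h) addNr addr0.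
        by rewrite addrACA subrKC !addrA.
      have e2 : y.1 + y.2.2 + (- (y.1 - x.1) - (y.2.2 - x.2.2)) = x.1 + x.2.2.
        by rewrite !opprB addrACA !subrKC.
      by rewrite -e1 -e2.
    have mes x : measurable (S x).
      apply: measurableX; first exact: (measure_shift_set hB x.1 oSB).1.
      by apply: measurableX; [exact: (measure_shift_set hZ _ oSZ).1|exact: (measure_shift_set hB _ oSB).1].
    have dS x : (dl%:E <= prodm n (prodm m n) (S x))%E.
      have mZ := (measure_shift_set hZ x.2.1 oSZ).1; have mB2 := (measure_shift_set hB x.2.2 oSB).1.
      have mB1 := (measure_shift_set hB x.1 oSB).1.
      have e1 := prodmE n (prodm m n) mB1 (measurableX mZ mB2).
      have e2 := congr1 (fun u => (n [set y : B | SB (y - x.1)%R] * u)%E) (prodmE m n mZ mB2).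
      have e3 := etrans e1 e2; have -> : prodm n (prodm m n) (S x) = (n [set y : B | SB (y - x.1)%R] * (m [set y : Z | SZ (y - x.2.1)%R] * n [set y : B | SB (y - x.2.2)%R]))%E by exact: e3.
      by rewrite (measure_shift_set hB x.1 oSB).2 (measure_shift_set hZ _ oSZ).2 (measure_shift_set hB _ oSB).2.
    have K0 x : 0 <= K x by rewrite !mulr_ge0.
    have L0 x : 0 <= L z x by rewrite !mulr_ge0 ?(msup_ge0 Fc N'n) ?(msup_ge0 Vc N''0).
    have KL x : K x <= L z x by apply: KSL; rewrite /S /= !subrr.
    have IK := integral_pow_le (mu := prodm n (prodm m n)) t0 t1 dl0 mK mL K0 L0 mes dS KL KSL.
    have IK0 : (0 <= \int[prodm n (prodm m n)]_x (K x)%:E)%E by apply: integral_ge0 => x _; rewrite lee_fin.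
    have : ((F (z + h))%:E `^ t <= (C%:E * \int[prodm n (prodm m n)]_x (K x)%:E) `^ t)%E.
      apply: gt0_ler_poweR; first exact: ltW.
      - by rewrite in_itv /= leey lee_fin F0.
      - by rewrite in_itv /= leey mule_ge0 ?lee_fin.
      - exact: FV.
    rewrite poweRM ?lee_fin// !poweR_EFin => /le_trans; apply.
    rewrite EFinM -muleA; apply: lee_wpmul2l; first by rewrite lee_fin powR_ge0.
    apply: (le_trans IK); apply: lee_wpmul2l; first by rewrite lee_fin powR_ge0.
    apply: eqW; apply: eq_integral => x _.
    by rewrite /L !powRM ?mulr_ge0// ?(msup_ge0 Fc N'n) ?(msup_ge0 Vc N''0).
  have : (0 <= (C `^ t * dl `^ (t - 1))%:E * J)%E by rewrite mule_ge0// lee_fin mulr_ge0 ?powR_ge0.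
  move: key; case: (_ * J)%E => [a key a0|_ _|//]; last exact: leey.
  have {}a0 : 0 <= a by [].
  (* The estimate is uniform in [h], so the supremum is bounded by passing through t-th roots. *)
  have : msup N F z <= a `^ t^-1.
    apply: (msup_le Fc Nn) => h Nh; rewrite -[leLHS](powRr1 (F0 _)) -(mulfV (lt0r_neq0 t0)) powRrM.
    by apply: powR_le; rewrite ?invr_ge0 ?(ltW t0) ?powR_ge0//; have := key h Nh; rewrite lee_fin.
  move=> /(powR_le (ltW t0) (msup_ge0 Fc Nn z F0)); by rewrite -powRrM mulVf ?gt_eqF// powRr1.
- exact: Fq.
- exact: G2t.
- exact: Vt.
Qed.

(** [F] is bounded, so the surplus r - q of the exponent only costs a constant. *)
Lemma msup_pow_le (N : set Z) (q r : R) : N !=set0 -> 0 < q -> q <= r ->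
  (\int[m]_z (msup N F z `^ q)%:E < +oo)%E -> (\int[m]_z (msup N F z `^ r)%:E < +oo)%E.
Proof.
move=> N0 q0 qr Iq; have mM := measurable_msupZ N0.
have M0 z : 0 <= msup N F z by exact: (msup_ge0 Fc N0).
have mp (e : R) : mfunT (fun z : borel Z => (msup N F z `^ e)%:E).
  by apply/mEFinP; apply: (mcompT (measurable_powR e)).
apply: (@le_lt_trans _ _ (\int[m]_z ((cF `^ (r - q))%:E * (msup N F z `^ q)%:E))%E).
  apply: ge0_le_int => //; first by apply: emeasurable_funM => //; exact: measurable_cst.
    by move=> z; rewrite lee_fin powR_ge0.
  move=> z; rewrite (powR_split (M0 z) q0 qr) -EFinM lee_fin; apply: ler_wpM2r; first exact: powR_ge0.
  by apply: powR_le; rewrite ?subr_ge0//; apply: (msup_le Fc N0) => h _; exact: Fc.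
rewrite ge0_intZ ?powR_ge0//; last by move=> z _; rewrite lee_fin powR_ge0.
by apply: lte_mul_pinfty => //; rewrite lee_fin powR_ge0.
Qed.

(** The increment t is fixed once and for all, so each contraction multiplies the exponent by the
    same [th] < 1, and finitely many of them bring it below [g]. *)
Lemma amalgam_iterate (q g : R) : 0 < q -> 0 < g ->
  (forall N : set Z, compact N -> N 0 -> (\int[m]_z (msup N F z `^ q)%:E < +oo)%E) ->
  forall N, compact N -> N 0 -> (\int[m]_z (msup N F z `^ g)%:E < +oo)%E.
Proof.
move=> q0 g0 Fq.
(* As t <= p / 2, the ratio [th] is at least 1/2; as moreover t <= g / 2, any exponent s > g
   satisfies t <= s th, which a contraction requires. *)
pose t := Num.min 1 (Num.min (g / 2) (p / 2)).
have t0 : 0 < t by rewrite !lt_min ltr01 !divr_gt0.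
have t1 : t <= 1 by rewrite ge_min lexx.
have tg : t <= g / 2 by rewrite !ge_min lexx orbT.
have tp : t <= p / 2 by rewrite !ge_min lexx !orbT.
pose th := 1 - t / p.
have tp2 : t / p <= 2^-1 by rewrite ler_pdivrMr// mulrC.
have th2 : 2^-1 <= th by rewrite /th; lra.
have th1 : th < 1 by rewrite /th ltrBlDr ltrDl divr_gt0.
have th0 : 0 < th by apply: lt_le_trans th2; rewrite invr_gt0.
have step k : (exists2 s, 0 < s & s <= Num.max g (q * th ^+ k) /\ forall N : set Z, compact N -> N 0 -> (\int[m]_z (msup N F z `^ s)%:E < +oo)%E).
  elim: k => [|k [s s0 [sm Fs]]]; first by exists q => //; rewrite mulr1 le_max lexx orbT; split.
  have [sg|gs] := leP s g; first by exists s => //; rewrite le_max sg; split.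
  have sth : g / 2 <= s * th.
    by apply: ler_pM; rewrite ?invr_ge0// ltW.
  exists (s * th); first by rewrite mulr_gt0.
  split.
    have := sm; rewrite le_max leNgt gs /= => sq.
    by rewrite le_max exprSr mulrA ler_pM2r// sq orbT.
  move=> N kN N0; apply: (@amalgam_contract N t s (s * th)) => //; first exact: le_trans sth.
  by rewrite mulrAC divff ?gt_eqF// mul1r /th subrK.
have [k kg] : exists k, q * th ^+ k <= g.
  have : (fun k => th ^+ k) @ \oo --> (0 : R) by apply: cvg_expr; rewrite ger0_norm// ltW.
  move=> /cvgrPdist_le /(_ (g / q) (divr_gt0 g0 q0)) [k _ H]; exists k.
  have := H k (leqnn k); rewrite sub0r normrN ger0_norm ?exprn_ge0 ?(ltW th0)//.
  by rewrite ler_pdivlMr// mulrC.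
have [s s0 [sm Fs]] := step k.
move=> N kN N0; apply: (@msup_pow_le N s g) => //; [by exists 0| |exact: Fs].
by rewrite (le_trans sm)// ge_max lexx.
Qed.

End Amalgam.

(** * Continuity of integrals that depend on a parameter *)

Section ContinuousReIm.
Variables (R : realType) (T : topologicalType).
Lemma continuousC (f : T -> R[i]) (t0 : T) : {for t0, continuous (fun t => complex.Re (f t))} ->
  {for t0, continuous (fun t => complex.Im (f t))} -> {for t0, continuous (f : T -> R[i]^o)}.
Proof.
move=> cR cI U /nbhs_ballP[e /= e0 eU].
have {}e0 : 0 < complex.Re e /\ e = (complex.Re e)%:C.
  by move: e0; case: (e) => a b; rewrite ltcE /= => /andP[/eqP -> ?].
case: e0 => e0 eE; have e2 : 0 < complex.Re e / 2 by rewrite divr_gt0.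
have /cvgrPdist_lt/(_ _ e2) h1 := cR; have /cvgrPdist_lt/(_ _ e2) h2 := cI.
apply: filterS2 h1 h2 => t h1 h2; apply: eU; rewrite /ball /= normr_normc eE ltcR.
apply: le_lt_trans (normc_le_ReIm _) _.
by rewrite ReD ImD ReN ImN [ltRHS]splitr ltrD.
Qed.

End ContinuousReIm.

Section SequentialContinuity.
Variables (R : realType) (T : topologicalType) (cT : csb T).

(** If continuity failed, points taken from the intersections of the first n basic neighbourhoods of
    [t0] would form a sequence converging to [t0] with images outside a neighbourhood of [F t0]. The
    sequence can be kept in [U], where a domination is available. *)
Lemma csb_continuous_for (S : topologicalType) (F : T -> S) (t0 : T) (U : set T) : nbhs t0 U ->
  (forall u : nat -> T, (forall n, U (u n)) -> u @ \oo --> t0 -> (F \o u) @ \oo --> F t0) -> {for t0, continuous F}.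
Proof.
move=> nU H W nW; apply: contrapT => nF; have [B [oB bB]] := cT.
pose D n : set T := U `&` [set t | forall k, (k <= n)%N -> B k t0 -> B k t].
have nD n : nbhs t0 (D n).
  apply: filterI => //; elim: n => [|n IH].
    have [B0|nB0] := pselect (B 0%N t0); last by apply: nearW => t k; rewrite leqn0 => /eqP ->.
    apply: filterS (open_nbhs_nbhs (conj (oB 0%N) B0)) => t Bt k; by rewrite leqn0 => /eqP ->.
  have [B0|nB0] := pselect (B n.+1 t0).
    apply: filterS2 IH (open_nbhs_nbhs (conj (oB n.+1) B0)) => t h1 h2 k.
    by rewrite leq_eqVlt => /orP[/eqP ->//|]; exact: h1.
  apply: filterS IH => t h1 k; rewrite leq_eqVlt => /orP[/eqP ->//|]; exact: h1.
have ex n : exists t, D n t /\ ~ W (F t).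
  apply: contrapT => h; apply: nF; apply: filterS (nD n) => t Dt.
  by apply: contrapT => nW'; apply: h; exists t.
have [u uP] := choice ex.
have ut : u @ \oo --> t0.
  move=> V /bB[k [Bk BV]]; exists k => // n /= kn; apply: BV.
  by have [[_ h] _] := uP n; exact: h.
have [n _ /(_ n (leqnn n))] := H u (fun n => (uP n).1.1) ut W nW.
by have [_] := uP n.
Qed.

Context d (M : measurableType d) (m : {measure set M -> \bar R}).

(** Dominated convergence speaks of sequences; the countable base turns it into continuity. *)
Lemma Rintegral_continuous (f : T -> M -> R) (t0 : T) (U : set T) (g : M -> R) : nbhs t0 U ->
  (forall t, mfunT (f t)) -> mfunT g -> (\int[m]_y (g y)%:E < +oo)%E ->
  (forall t y, U t -> `|f t y| <= g y) -> (forall y, {for t0, continuous (f ^~ y)}) ->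
  {for t0, continuous (fun t => \int[m]_y f t y)}.
Proof.
move=> nU mf mg ig fg cf; have Ut0 := nbhs_singleton nU.
apply: (csb_continuous_for nU) => u Uu ut.
have g0 y : 0 <= g y by rewrite (le_trans _ (fg t0 y Ut0)).
have ig' : m.-integrable setT (EFin \o g).
  apply/integrableP; split; first exact/mEFinP.
  by under eq_integral do rewrite /= ger0_norm//.
have h := @dominated_cvg _ _ _ m setT measurableT (fun n y => (f (u n) y)%:E) (fun y => (f t0 y)%:E) (EFin \o g).
have {}h : (\int[m]_x (f (u n) x)%:E)%E @[n --> \oo] --> (\int[m]_x (f t0 x)%:E)%E.
  apply: h => //.
  - by move=> n; exact/mEFinP.
  - move=> y _; apply/fine_cvgP; split; first exact: nearW.
    by apply: (cvg_comp u (f ^~ y) ut); exact: cf.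
  - by move=> n y _; rewrite /= lee_fin fg.
apply/fine_cvg; rewrite fineK//; apply: integrable_fin_num => //.
apply: le_integrable ig' => //; first exact/mEFinP.
by move=> y _; rewrite /= lee_fin (ger0_norm (g0 y)) fg.
Qed.

Lemma cint_continuous (f : T -> M -> R[i]) (t0 : T) (U : set T) (g : M -> R) : nbhs t0 U ->
  (forall t, cmeasurable (f t)) -> mfunT g -> (\int[m]_y (g y)%:E < +oo)%E ->
  (forall t y, U t -> normc (f t y) <= g y) -> (forall y, {for t0, continuous (f ^~ y : T -> R[i]^o)}) ->
  {for t0, continuous (fun t => cintegral m (f t) : R[i]^o)}.
Proof.
move=> nU mf mg ig fg cf; apply: continuousC.
  apply: (Rintegral_continuous nU _ mg ig) => [t|t y Ut|y]; first by have [] := mf t.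
    exact: le_trans (Re_le_normc _) (fg _ _ Ut).
  exact: (continuous_comp (cf y) (@continuous_Re R _)).
apply: (Rintegral_continuous nU _ mg ig) => [t|t y Ut|y]; first by have [] := mf t.
  exact: le_trans (Im_le_normc _) (fg _ _ Ut).
exact: (continuous_comp (cf y) (@continuous_Im R _)).
Qed.

End SequentialContinuity.

Section ContinuousComplexOps.
Variables (R : realType) (T : topologicalType).
Implicit Types f g : T -> R[i].
Lemma ccontD f g (t : T) : {for t, continuous (f : T -> R[i]^o)} -> {for t, continuous (g : T -> R[i]^o)} ->
  {for t, continuous (fun t => f t + g t : R[i]^o)}.
Proof. exact: continuousD. Qed.
Lemma ccontM f g (t : T) : {for t, continuous (f : T -> R[i]^o)} -> {for t, continuous (g : T -> R[i]^o)} ->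
  {for t, continuous (fun t => f t * g t : R[i]^o)}.
Proof. exact: continuousM. Qed.
Lemma ccont_conj f (t : T) : {for t, continuous (f : T -> R[i]^o)} ->
  {for t, continuous (fun t => (f t)^* : R[i]^o)}.
Proof.
move=> cf; apply: continuousC.
  have -> : (fun t => complex.Re (f t)^*) = (fun t => complex.Re (f t)) by apply/funext => x; rewrite Re_conj.
  exact: (continuous_comp cf (@continuous_Re R _)).
have -> : (fun t => complex.Im (f t)^*) = (fun t => - complex.Im (f t)) by apply/funext => x; rewrite Im_conj.
by apply: continuousN; exact: (continuous_comp cf (@continuous_Im R _)).
Qed.
Lemma ccont_normc f (t : T) : {for t, continuous (f : T -> R[i]^o)} ->
  {for t, continuous (fun t => normc (f t))}.
Proof. move=> cf; exact: (continuous_comp cf (@continuous_normc R _)). Qed.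
End ContinuousComplexOps.

(** What the group and the phase space have in common; the time-frequency analysis below is carried
    out once for both. *)
Record tf_group (R : realType) (P : tf_space R) : Prop := TfGroup {
  tf_time : hgroup (haar P);
  tf_freq : hgroup (dual_haar P);
  tf_cont : continuous (fun z : freq P * time P => pairing z.1 z.2 : R[i]^o);
  tf_pairDr : forall xi (x y : time P), pairing xi (x + y) = pairing xi x * pairing xi y;
  tf_pairDl : forall (xi eta : freq P) (x : time P), pairing (xi + eta) x = pairing xi x * pairing eta x;
  tf_norm : forall (xi : freq P) (x : time P), normc (pairing xi x) = 1 }.

(** * Time-frequency shifts and the short-time Fourier transform of bounded integrable functions *)

Section TF.
Variables (R : realType) (P : tf_space R).
Hypothesis hP : tf_group P.
Local Notation X := (time P).
Local Notation X' := (freq P).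
Local Notation mu := (haar P).
Local Notation nu := (dual_haar P).
Local Notation mu_nu := (mu \x nu)%E.
Implicit Types (f g : X -> R[i]) (v w z : X * X') (x y : X) (xi eta : X').

Let hX := tf_time hP. Let hX' := tf_freq hP.
Let tX := hg_top hX. Let cX := hg_csb hX. Let tX' := hg_top hX'. Let cX' := hg_csb hX'.

Lemma pairing_conjM xi x : pairing xi x * (pairing xi x)^* = 1.
Proof. by rewrite mulc_conj tf_norm// expr1n. Qed.
Lemma pairing0r xi : pairing xi (0 : X) = 1.
Proof.
have := tf_pairDr hP xi 0 0; rewrite addr0 => e.
have : pairing xi (0 : X) * (pairing xi (0 : X))^* = pairing xi 0 * (pairing xi 0 * (pairing xi (0 : X))^*) by rewrite mulrA -e.
by rewrite pairing_conjM mulr1.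
Qed.
Lemma pairing0l x : pairing (0 : X') x = 1.
Proof.
have := tf_pairDl hP 0 0 x; rewrite addr0 => e.
have : pairing (0 : X') x * (pairing (0 : X') x)^* = pairing 0 x * (pairing 0 x * (pairing (0 : X') x)^*) by rewrite mulrA -e.
by rewrite pairing_conjM mulr1.
Qed.
Lemma pairingNr xi x : pairing xi (- x) = (pairing xi x)^*.
Proof.
rewrite -[LHS]mul1r -(pairing_conjM xi x) mulrAC -tf_pairDr// addrN pairing0r mul1r//.
Qed.
Lemma pairingNl xi x : pairing (- xi) x = (pairing xi x)^*.
Proof.
rewrite -[LHS]mul1r -(pairing_conjM xi x) mulrAC -tf_pairDl// addrN pairing0l mul1r//.
Qed.
Lemma normc_pairing_conj xi x : normc (pairing xi x)^* = 1.
Proof. by rewrite normc_conj tf_norm. Qed.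

Lemma cmeas_pairing : @cmeasurable _ (borel X' * borel X)%type R (fun z : X' * X => pairing z.1 z.2).
Proof. by apply: continuous_cmeas_prod => //; exact: tf_cont. Qed.
Lemma cmeas_pairingf d (M : measurableType d) (f1 : M -> borel X') (f2 : M -> borel X) :
  mfunT f1 -> mfunT f2 -> cmeasurable (fun m => pairing (f1 m) (f2 m)).
Proof.
move=> m1 m2; exact: (cmeas_comp (measurable_fun_pair m1 m2) cmeas_pairing).
Qed.
Lemma cmeas_tfshift d (M : measurableType d) (a : M -> borel X * borel X') (b : M -> borel X) g :
  mfunT a -> mfunT b -> bcmeas R X g ->
  cmeasurable (fun m => tfshift (a m) g (b m)).
Proof.
move=> ma mb mg; apply: cmeasM.
  by apply: cmeas_pairingf => //; exact: (mcompT measurable_snd ma).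
apply: (cmeas_comp _ mg); apply: msubf => //.
exact: (mcompT measurable_fst ma).
Qed.
Lemma cmeas_tfshift1 v g : bcmeas R X g -> bcmeas R X (tfshift v g).
Proof.
move=> mg; apply: (@cmeas_tfshift _ (borel X) (fun=> v) id g) => //; exact: measurable_cst.
Qed.
Lemma continuous_pairing_l x : continuous (fun xi => pairing xi x : R[i]^o).
Proof.
move=> xi; apply: (@continuous_comp _ _ _ (fun xi => (xi, x)) (fun z : X' * X => pairing z.1 z.2 : R[i]^o)).
  by apply: cvg_pair; [exact: cvg_id|exact: cvg_cst].
exact: tf_cont.
Qed.
Lemma continuous_pairing_r xi : continuous (fun x => pairing xi x : R[i]^o).
Proof.
move=> x; apply: (@continuous_comp _ _ _ (fun x => (xi, x)) (fun z : X' * X => pairing z.1 z.2 : R[i]^o)).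
  by apply: cvg_pair; [exact: cvg_cst|exact: cvg_id].
exact: tf_cont.
Qed.

Lemma tfshift_tfshift v w g : tfshift v (tfshift w g) = fun y => (pairing w.2 v.1)^* * tfshift (v + w) g y.
Proof.
apply/funext => y; rewrite /tfshift tf_pairDr// pairingNr tf_pairDl// opprD addrA; ring.
Qed.
Lemma tfshiftZ v c g : tfshift v (fun y => c * g y) = fun y => c * tfshift v g y.
Proof. by apply/funext => y; rewrite /tfshift mulrCA. Qed.
Lemma tfshiftD v f g : tfshift v (fun y => f y + g y) = fun y => tfshift v f y + tfshift v g y.
Proof. by apply/funext => y; rewrite /tfshift mulrDr. Qed.
Lemma tfshift_sum v n (F : 'I_n -> X -> R[i]) : tfshift v (fun y => \sum_(k < n) F k y) = fun y => \sum_(k < n) tfshift v (F k) y.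
Proof. by apply/funext => y; rewrite /tfshift mulr_sumr. Qed.
Lemma tfshift0 g : tfshift (0 : X * X') g = g.
Proof. by apply/funext => y; rewrite /tfshift /= pairing0l mul1r subr0. Qed.
Lemma normc_tfshift v g y : normc (tfshift v g y) = normc (g (y - v.1)).
Proof. by rewrite /tfshift normcM' tf_norm// mul1r. Qed.

(** Such functions are square integrable, and all their pairings with shifts of each other converge
    absolutely. *)
Definition nice f := cinteg mu f /\ exists c : R, forall x, normc (f x) <= c.

Lemma niceD f g : nice f -> nice g -> nice (fun x => f x + g x).
Proof.
move=> [If [c fc]] [Ig [c' gc]]; split; first exact: cintegD.
by exists (c + c') => x; rewrite (le_trans (normcD_le _ _))// lerD.
Qed.
Lemma niceZ c f : nice f -> nice (fun x => c * f x).
Proof.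
move=> [If [k fk]]; split; first exact: cintegZ.
by exists (normc c * k) => x; rewrite normcM' ler_wpM2l// normc_ge0.
Qed.
Lemma niceB f g : nice f -> nice g -> nice (fun x => f x - g x).
Proof.
move=> nf /(niceZ (-1)) ng; have := niceD nf ng; congr nice; apply/funext => x; by rewrite mulN1r.
Qed.
Lemma nice_tfshift v f : nice f -> nice (tfshift v f).
Proof.
move=> [[mf If] [c fc]]; split; last by exists c => x; rewrite normc_tfshift.
split; first exact: cmeas_tfshift1.
under eq_integral do rewrite normc_tfshift.
rewrite (int_shift hX (- v.1) (f := fun x => (normc (f x))%:E)) //; first exact: menormc.
by move=> x; rewrite lee_fin normc_ge0.
Qed.
Lemma nice_cint_bound f g c : nice f -> bcmeas R X g -> (forall x, normc (g x) <= c) ->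
  cinteg mu (fun x => f x * g x).
Proof.
by move=> [If _]; exact: cintegMr.
Qed.
Lemma nice_mul_conj f g : nice f -> nice g -> cinteg mu (fun x => f x * (g x)^*).
Proof.
move=> nf [[mg _] [c gc]]; apply: (@nice_cint_bound f (fun x => (g x)^*) c nf); first exact: cmeas_conj.
by move=> x; rewrite normc_conj.
Qed.
Lemma nice_L2 f : nice f -> in_L mu 2%:E f.
Proof.
move=> nf; have [[mf If] [c fc]] := nf; split => //; rewrite /cLnorm.
apply: (@lty_poweRy _ _ 2) => //; rewrite powR_Lnorm//.
have [_] := nice_mul_conj nf nf; apply: le_lt_trans.
apply: eqW; apply: eq_integral => x _.
rewrite normcM' normc_conj gee0_abs ?lee_fin ?normc_ge0// poweR_EFin; congr (_%:E).
by rewrite -expr2 (powR_mulrn 2 (normc_ge0 _)).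
Qed.

Lemma stft_cinteg f g z : nice f -> nice g -> cinteg mu (fun y => f y * (tfshift z g y)^*).
Proof. by move=> nf ng; apply: nice_mul_conj => //; exact: nice_tfshift. Qed.
Lemma stftD g f1 f2 z : nice g -> nice f1 -> nice f2 -> stft g (fun x => f1 x + f2 x) z = stft g f1 z + stft g f2 z.
Proof.
move=> ng n1 n2; rewrite /stft /L2_inner -cintD; [|exact: stft_cinteg|exact: stft_cinteg].
by apply: cint_ext => x; rewrite mulrDl.
Qed.
Lemma stftZ g c f z : nice g -> nice f -> stft g (fun x => c * f x) z = c * stft g f z.
Proof.
move=> ng n1; rewrite /stft /L2_inner -cintZ; last exact: stft_cinteg.
by apply: cint_ext => x; rewrite mulrA.
Qed.
Lemma stftB g f1 f2 z : nice g -> nice f1 -> nice f2 -> stft g (fun x => f1 x - f2 x) z = stft g f1 z - stft g f2 z.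
Proof.
move=> ng n1 n2; rewrite -mulN1r -stftZ// -stftD//; last exact: niceZ.
by congr stft; apply/funext => x; rewrite mulN1r.
Qed.
Lemma stft_tfshift g f w z : bcmeas R X f -> bcmeas R X g ->
  cinteg mu (fun y => f y * (tfshift (z - w) g y)^*) ->
  stft g (tfshift w f) z = pairing w.2 w.1 * (pairing z.2 w.1)^* * stft g f (z - w).
Proof.
move=> mf mg Ii; rewrite /stft /L2_inner.
have mi : bcmeas R X (fun y => tfshift w f y * (tfshift z g y)^*).
  by apply: cmeasM; [|apply: cmeas_conj]; exact: cmeas_tfshift1.
rewrite -(cint_shift hX w.1 mi).
set k := pairing w.2 w.1 * (pairing z.2 w.1)^*.
rewrite (_ : (fun x => _) = (fun y => k * (f y * (tfshift (z - w) g y)^*))); last first.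
  apply/funext => y; rewrite /tfshift /k.
  rewrite !tf_pairDr// addrK tf_pairDl// pairingNl opprB addrA !conjcM conjCK; ring.
exact: cintZ.
Qed.

(** Dominated convergence, with the modulus of [f] times a bound of the window as dominating
    function. *)
Lemma stft_continuous f : nice f -> forall g, nice g -> continuous (g : X -> R[i]^o) -> continuous (stft g f : X * X' -> R[i]^o).
Proof.
move=> [[mf If] _] g [[mg Ig] [c gc]] cg z.
apply: (@cint_continuous R _ (csb_prod cX cX') _ _ mu (fun z y => f y * (tfshift z g y)^*) z setT (fun y => c * normc (f y))).
- exact: filterT.
- move=> w; apply: cmeasM => //; apply: cmeas_conj; exact: cmeas_tfshift1.
- by apply: measurable_funM; [exact: measurable_cst|exact: mnormc].
- under eq_integral do rewrite EFinM.
  rewrite ge0_intZ//.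
  + by rewrite lte_mul_pinfty// lee_fin (le_trans _ (gc 0))// normc_ge0.
  + by move=> x _; rewrite lee_fin normc_ge0.
  + exact: menormc.
  + by rewrite (le_trans _ (gc 0))// normc_ge0.
- by move=> w y _; rewrite normcM' normc_conj normc_tfshift mulrC ler_wpM2r ?normc_ge0.
- move=> y; apply: ccontM; first exact: cvg_cst.
  apply: ccont_conj; apply: ccontM.
    apply: (@continuous_comp _ _ _ snd (fun xi => pairing xi y : R[i]^o)); first exact: cvg_snd.
    exact: continuous_pairing_l.
  apply: (@continuous_comp _ _ _ (fun z : X * X' => y - z.1) (g : X -> R[i]^o)); last exact: cg.
  by apply: (tgroup_subf tX (f := fun=> y) (g := fst)); [move=> ?; exact: cvg_cst|move=> ?; exact: cvg_fst].
Qed.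

End TF.

Section ProductShift.
Variables (R : realType) (X Y : preTopologicalZmodType).
Variables (mu : sfm R X) (nu : sfm R Y).
Hypotheses (hX : hgroup mu) (hY : hgroup nu).

Lemma mshf2 (w : X * Y) :
  mfunT (fun z : borel X * borel Y => (z + w : X * Y) : borel X * borel Y).
Proof.
apply/measurable_fun_pairP; split.
  by apply: (mcompT (mshf hX w.1) measurable_fst).
by apply: (mcompT (mshf hY w.2) measurable_snd).
Qed.
Lemma int_shift2 (w : X * Y) (f : X * Y -> \bar R) : mfunT (f : borel X * borel Y -> _) ->
  (forall z, (0 <= f z)%E) -> (\int[prodm mu nu]_z f (z + w)%R = \int[prodm mu nu]_z f z)%E.
Proof.
move=> mf f0; have mfs := mcompT mf (mshf2 w).
rewrite (prodm_tonelli1 mu nu mfs (fun z => f0 _)) (prodm_tonelli1 mu nu mf f0) /=.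
rewrite -[RHS](int_shift hX w.1 (f := fun x => \int[nu]_y f (x, y)))%E.
- apply: eq_integral => x _; rewrite -(int_shift hY w.2 (f := fun y => f (x + w.1, y)))//.
  exact: (mcompT mf (measurable_pair1 _)).
- exact: (mint1 nu mf f0).
- by move=> x; exact: integral_ge0.
Qed.
End ProductShift.

(** * Windows, the norm of S_0 and superpositions of time-frequency shifts *)

Section TFGauss.
Variables (R : realType) (P : tf_space R).
Local Notation X := (time P).
Local Notation X' := (freq P).
Local Notation XX := (borel X * borel X')%type.
Local Notation mu := (haar P).
Local Notation nu := (dual_haar P).
Local Notation phi := (gauss (t := P)).

(* Local domination of the short-time Fourier transform is what gives the continuity of the time-frequency shifts in the norm of S_0. *)
Definition locally_dominated (g : X -> R[i]) := exists (G : X * X' -> R) (U : set (X * X')),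
  [/\ mfunT (G : XX -> R), (\int[prodm mu nu]_z (G z)%:E < +oo)%E, nbhs (0 : X * X') U
    & forall z h, U h -> normc (stft phi g (z + h)) <= G z].

Record tf_gauss : Prop := TfGauss {
  tg_nice : nice phi;
  tg_cont : continuous (phi : X -> R[i]^o);
  tg_dom : locally_dominated phi }.

(** A class stable under linear combinations and time-frequency shifts; it therefore contains all of
    S_C. *)
Definition nwin g := nice g /\ locally_dominated g.
Definition S0n g : \bar R := (\int[prodm mu nu]_z (normc (stft phi g z))%:E)%E.
(** The adjoint of the short-time Fourier transform. It is defined pointwise instead of as a
    vector-valued integral. *)
Definition synth (a : X * X' -> R[i]) (g : X -> R[i]) (x : X) : R[i] :=
  cintegral (prodm mu nu) (fun v => a v * tfshift v g x).
End TFGauss.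

Section Synthesis.
Variables (R : realType) (P : tf_space R).
Hypotheses (hP : tf_group P) (gP : tf_gauss P).
Local Notation X := (time P).
Local Notation X' := (freq P).
Local Notation XX := (borel X * borel X')%type.
Local Notation mu := (haar P).
Local Notation nu := (dual_haar P).
Local Notation phi := (gauss (t := P)).
Implicit Types (f g : X -> R[i]) (v w z : X * X') (x y : X).

Let hX := tf_time hP. Let hX' := tf_freq hP.
Let tX := hg_top hX. Let cX := hg_csb hX. Let tX' := hg_top hX'. Let cX' := hg_csb hX'.
Let nphi := tg_nice gP. Let cphi := tg_cont gP.
Let mphi : bcmeas R X phi. Proof. by case: nphi => -[]. Qed.
Let mZ (f : X * X' -> R[i]) : continuous (f : X * X' -> R[i]^o) -> @cmeasurable _ XX R f.
Proof. exact: continuous_cmeas_prod. Qed.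

Lemma S0_normE f : S0_norm f = S0n f.
Proof.
rewrite /S0_norm /cLnorm Lnorm1; apply: eq_integral => z _.
by rewrite gee0_abs// lee_fin normc_ge0.
Qed.
Lemma cmeas_stft f : nice f -> @cmeasurable _ XX R (stft phi f).
Proof. by move=> nf; apply: mZ; exact: stft_continuous. Qed.
Lemma nice_S0 f : nice f -> (S0n f < +oo)%E -> S0 f.
Proof.
move=> nf If; split; first exact: nice_L2.
by apply/in_L1P; split; [exact: cmeas_stft|].
Qed.
Lemma locally_dominated_lty g : nice g -> locally_dominated g -> (S0n g < +oo)%E.
Proof.
move=> ng [G [U [mG IG nU UG]]]; apply: le_lt_trans IG; apply: ge0_le_int.
- by apply: menormc; exact: cmeas_stft.
- exact/mEFinP.
- by move=> z; rewrite lee_fin normc_ge0.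
- by move=> z; rewrite lee_fin; have := UG z 0 (nbhs_singleton nU); rewrite addr0.
Qed.
Lemma nwin_S0 g : nwin g -> S0 g.
Proof. by move=> [ng lg]; apply: nice_S0 => //; exact: locally_dominated_lty. Qed.
Lemma nwin_gauss : nwin phi. Proof. by split => //; exact: tg_dom gP. Qed.
Lemma nwinD f g : nwin f -> nwin g -> nwin (fun x => f x + g x).
Proof.
move=> [nf [G [U [mG IG nU UG]]]] [ng [G' [U' [mG' IG' nU' UG']]]]; split; first exact: niceD.
exists (fun z => G z + G' z), (U `&` U'); split => //; first exact: measurable_funD.
- have G0 z : 0 <= G z by apply: le_trans (UG z 0 (nbhs_singleton nU)); exact: normc_ge0.
  have G0' z : 0 <= G' z by apply: le_trans (UG' z 0 (nbhs_singleton nU')); exact: normc_ge0.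
  under eq_integral do rewrite EFinD.
  rewrite ge0_integralD//; first exact: lte_add_pinfty.
  + by move=> z _; rewrite lee_fin.
  + exact/mEFinP.
  + by move=> z _; rewrite lee_fin.
  + exact/mEFinP.
- exact: filterI.
- move=> z h [Uh U'h]; rewrite stftD//.
  by apply: le_trans (normcD_le _ _) _; apply: lerD; [exact: UG|exact: UG'].
Qed.
Lemma nwinZ c g : nwin g -> nwin (fun x => c * g x).
Proof.
move=> [ng [G [U [mG IG nU UG]]]]; split; first exact: niceZ.
exists (fun z => normc c * G z), U; split => //; first by apply: measurable_funM => //; exact: measurable_cst.
- have G0 z : 0 <= G z by apply: le_trans (UG z 0 (nbhs_singleton nU)); exact: normc_ge0.
  under eq_integral do rewrite EFinM.
  rewrite ge0_intZ ?normc_ge0//; [|by move=> z _; rewrite lee_fin|exact/mEFinP].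
  by rewrite lte_mul_pinfty// lee_fin normc_ge0.
- by move=> z h Uh; rewrite stftZ// normcM' ler_wpM2l ?normc_ge0// UG.
Qed.
Lemma normc_stft_tfshift g w z : nice g -> normc (stft phi (tfshift w g) z) = normc (stft phi g (z - w)).
Proof.
move=> ng; rewrite stft_tfshift//; last exact: stft_cinteg.
  by rewrite !normcM' normc_conj !tf_norm// !mul1r.
by case: ng => -[].
Qed.
Lemma nwin_tfshift w g : nwin g -> nwin (tfshift w g).
Proof.
move=> [ng [G [U [mG IG nU UG]]]]; split; first exact: nice_tfshift.
exists (fun z => G (z - w)), U; split => //.
- by apply: (mcompT mG); exact: (mshf2 hX hX' (- w)).
- have G0 z : 0 <= G z by apply: le_trans (UG z 0 (nbhs_singleton nU)); exact: normc_ge0.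
  rewrite (int_shift2 hX hX' (- w) (f := fun z => (G z)%:E))//.
  exact/mEFinP.
- by move=> z h Uh; rewrite normc_stft_tfshift// addrAC UG.
Qed.
Lemma nwin0 : nwin (fun _ : X => 0).
Proof.
by have := nwinZ 0 nwin_gauss; congr nwin; apply/funext => x; rewrite mul0r.
Qed.
Lemma nwin_sum n (F : 'I_n -> X -> R[i]) : (forall k, nwin (F k)) -> nwin (fun x => \sum_(k < n) F k x).
Proof.
elim: n F => [|n IH] F nF; first by under eq_fun do rewrite big_ord0; exact: nwin0.
by under eq_fun do rewrite big_ord_recr; apply: nwinD => //; exact: IH.
Qed.
Lemma S_C_nwin g : S_C g -> nwin g.
Proof.
move=> [n [c [z ->]]]; apply: nwin_sum => k; apply: nwinZ; apply: nwin_tfshift; exact: nwin_gauss.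
Qed.
Lemma S0n_tfshift w g : nice g -> S0n (tfshift w g) = S0n g.
Proof.
move=> ng; rewrite /S0n; under eq_integral do rewrite normc_stft_tfshift//.
rewrite (int_shift2 hX hX' (- w) (f := fun z => (normc (stft phi g z))%:E))//.
  by apply: menormc; exact: cmeas_stft.
by move=> z; rewrite lee_fin normc_ge0.
Qed.

(** * Minkowski's inequality for parameter integrals in the norm of S_0 *)

Section Minkowski.
Context dV (V : measurableType dV) (mV : {sigma_finite_measure set V -> \bar R}).
Variables (a : V -> R[i]) (H : V -> X -> R[i]) (M : R).
Hypotheses (Ia : cinteg mV a) (mH : @cmeasurable _ (V * borel X)%type R (fun p => H p.1 p.2)).
Hypotheses (M0 : 0 <= M) (HM : forall s x, normc (H s x) <= M) (HI : forall s, (\int[mu]_x (normc (H s x))%:E <= M%:E)%E).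

Let h x := cintegral mV (fun s => a s * H s x).
Let ma : cmeasurable a. Proof. by case: Ia. Qed.
Let mHx x : cmeasurable (fun s => H s x).
Proof. exact: (cmeas_comp (measurable_pair2 (x : borel X)) mH). Qed.
Let mHv s : bcmeas R X (H s).
Proof. exact: (cmeas_comp (measurable_pair1 s) mH). Qed.
Let nH s : nice (H s).
Proof. by split; [split; [exact: mHv|apply: le_lt_trans (HI s) _; rewrite ltry]|exists M]. Qed.
Let ma2 d' (S : measurableType d') : @cmeasurable _ (S * V)%type R (fun p => a p.2).
Proof. exact: (cmeas_comp measurable_snd ma). Qed.
Let mHs : @cmeasurable _ (borel X * V)%type R (fun p => H p.2 p.1).
Proof. by apply: (cmeas_comp _ mH (h := fun p : borel X * V => (p.2, p.1))); exact: measurable_swap. Qed.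
Let IaM (G : V -> \bar R) : mfunT G -> (forall s, (0 <= G s)%E) -> (forall s, (G s <= M%:E)%E) ->
  (\int[mV]_s ((normc (a s))%:E * G s) < +oo)%E.
Proof.
move=> mG G0 GM; apply: (@le_lt_trans _ _ (\int[mV]_s (M%:E * (normc (a s))%:E))%E).
  apply: ge0_le_int.
  - by apply: emeasurable_funM => //; exact: menormc.
  - by apply: emeasurable_funM; [exact: measurable_cst|exact: menormc].
  - by move=> s; rewrite mule_ge0 ?lee_fin ?normc_ge0.
  - by move=> s; rewrite muleC lee_wpmul2r// lee_fin normc_ge0.
rewrite ge0_intZ//; last 2 first.
  by move=> s _; rewrite lee_fin normc_ge0.
  exact: menormc.
by rewrite lte_mul_pinfty ?lee_fin//; case: Ia.
Qed.
Let mh : bcmeas R X h.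
Proof. by apply: (cmeas_param mV (f := fun p : borel X * V => a p.2 * H p.2 p.1)); exact: (cmeasM (@ma2 _ _) mHs). Qed.
Let IaH : cinteg (mu \x mV)%E (fun p : borel X * V => a p.2 * H p.2 p.1).
Proof.
split; first exact: (cmeasM (@ma2 _ _) mHs).
rewrite -/(prodm mu mV) (prodm_tonelli2 mu mV (f := fun p => (normc (a p.2 * H p.2 p.1))%:E)).
- rewrite (_ : (fun s => _) = (fun s => (normc (a s))%:E * \int[mu]_x (normc (H s x))%:E)%E); last first.
    apply/funext => s; under eq_integral do rewrite /= normcM' EFinM.
    by rewrite ge0_intZ ?normc_ge0//; [move=> x _; rewrite lee_fin normc_ge0|exact: menormc].
  apply: IaM => //.
  + apply: (mint1 mu (f := fun p : V * borel X => (normc (H p.1 p.2))%:E)); first exact: menormc.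
    by move=> p; rewrite lee_fin normc_ge0.
  + by move=> s; apply: integral_ge0 => x _; rewrite lee_fin normc_ge0.
- by apply: menormc; exact: (cmeasM (@ma2 _ _) mHs).
- by move=> p; rewrite lee_fin normc_ge0.
Qed.

Lemma nice_param_integral : nice h.
Proof.
split; first exact: (cinteg_param IaH).
exists (fine (\int[mV]_s (M * normc (a s))%:E)) => x; rewrite -lee_fin fineK.
  apply: normc_cintegral_le.
  - exact: cmeasM.
  - by apply: measurable_funM; [exact: measurable_cst|exact: mnormc].
  - by move=> s; rewrite normcM' mulrC ler_wpM2r ?normc_ge0.
rewrite ge0_fin_numE; last by apply: integral_ge0 => s _; rewrite lee_fin mulr_ge0// normc_ge0.
have := IaM (measurable_cst M%:E) (fun _ => ltac:(by rewrite lee_fin)) (fun _ => lexx _).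
by under eq_integral do rewrite -EFinM mulrC.
Qed.

Lemma stft_param_integral z : stft phi h z = cintegral mV (fun s => a s * stft phi (H s) z).
Proof.
have [_ [c pc]] := nphi.
pose F (p : borel X * V) := a p.2 * H p.2 p.1 * (tfshift z phi p.1)^*.
have mF : cmeasurable F.
  apply: cmeasM; first exact: (cmeasM (@ma2 _ _) mHs).
  apply: cmeas_conj; exact: (cmeas_comp measurable_fst (cmeas_tfshift1 hP z mphi)).
have IF : cinteg (mu \x mV)%E F.
  apply: (cintegMr IaH (M := c)) => [|p]; last by rewrite normc_conj normc_tfshift.
  apply: cmeas_conj; exact: (cmeas_comp measurable_fst (cmeas_tfshift1 hP z mphi)).
rewrite /stft /L2_inner.
transitivity (cintegral mu (fun x => cintegral mV (fun s => F (x, s)))).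
  apply: ae_eq_cintegral.
  - by apply: cmeasM => //; apply: cmeas_conj; exact: cmeas_tfshift1.
  - exact: cmeas_param.
  - apply: aeW => x; rewrite -cintZr//.
    apply: (cinteg_le (g := fun s => M * normc (a s))).
    + exact: cmeasM.
    + by apply: measurable_funM; [exact: measurable_cst|exact: mnormc].
    + by move=> s; rewrite normcM' mulrC ler_wpM2r ?normc_ge0.
    have := IaM (measurable_cst M%:E) (fun _ => ltac:(by rewrite lee_fin)) (fun _ => lexx _).
    by congr (_ < _)%E; apply: eq_integral => s _; rewrite /= -EFinM mulrC.
rewrite cfubini1// -cfubini2//; apply: cint_ext => s; rewrite -cintZ.
  by apply: cint_ext => x; rewrite /F /= mulrA.
exact: stft_cinteg.
Qed.

(** By [stft_param_integral] the transform passes under the integral sign; Tonelli then exchanges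
    the two integrations of the moduli. *)
Lemma S0n_param_integral : (S0n h <= \int[mV]_s ((normc (a s))%:E * S0n (H s)))%E.
Proof.
have mS : @cmeasurable _ (XX * V)%type R (fun p => stft phi (H p.2) p.1).
  apply: (cmeas_param mu (f := fun q : (XX * V) * borel X => H q.1.2 q.2 * (tfshift q.1.1 phi q.2)^*)).
  apply: cmeasM.
    apply: (cmeas_comp _ mH (h := fun q : (XX * V) * borel X => (q.1.2, q.2))).
    apply: measurable_fun_pair; last exact: measurable_snd.
    exact: (mcompT measurable_snd measurable_fst).
  apply: cmeas_conj; apply: cmeas_tfshift => //.
  exact: (mcompT measurable_fst measurable_fst).
have mn : mfunT (fun p : XX * V => (normc (a p.2 * stft phi (H p.2) p.1))%:E).
  by apply: menormc; exact: (cmeasM (@ma2 _ _) mS).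
have n0 (p : XX * V) : (0 <= (normc (a p.2 * stft phi (H p.2) p.1))%:E)%E by rewrite lee_fin normc_ge0.
apply: (@le_trans _ _ (\int[prodm mu nu]_z \int[mV]_s (normc (a s * stft phi (H s) z))%:E)%E).
  apply: ge0_le_int.
  - by apply: menormc; apply: cmeas_stft; exact: nice_param_integral.
  - exact: (mint1 mV mn n0).
  - by move=> z; rewrite lee_fin normc_ge0.
  - move=> z; rewrite stft_param_integral; apply: normc_cintegral_le => //.
      apply: cmeasM => //; exact: (cmeas_comp (measurable_pair1 z) mS).
    apply: mnormc; apply: cmeasM => //; exact: (cmeas_comp (measurable_pair1 z) mS).
rewrite (fubini_tonelli (m1 := prodm mu nu) (m2 := mV) _ mn n0).
apply: eqW; apply: eq_integral => s _.
under eq_integral do rewrite /= normcM' EFinM.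
rewrite ge0_intZ ?normc_ge0//; first by move=> z _; rewrite lee_fin normc_ge0.
by apply: menormc; exact: cmeas_stft.
Qed.

End Minkowski.

(** The S_0 distance of two shifts of [g], as a real number. *)
Definition Dist g v w : R := \int[prodm mu nu]_z normc (stft phi (fun x => tfshift v g x - tfshift w g x) z).

Lemma nwin_lty g : nwin g -> (S0n g < +oo)%E.
Proof. by move=> [ng lg]; exact: locally_dominated_lty. Qed.
Lemma nwinB f g : nwin f -> nwin g -> nwin (fun x => f x - g x).
Proof.
move=> nf /(nwinZ (-1)) ng; have := nwinD nf ng; congr nwin; apply/funext => x; by rewrite mulN1r.
Qed.
Lemma DistE g v w : nwin g -> S0n (fun x => tfshift v g x - tfshift w g x) = (Dist g v w)%:E.
Proof.
move=> ng; rewrite /Dist /Rintegral fineK// ge0_fin_numE.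
  by apply: nwin_lty; apply: nwinB; exact: nwin_tfshift.
exact: int_normc_ge0.
Qed.
(** Dominated convergence: for [v] near [w], the local majorant of [g] translated by [w] bounds the
    transforms of both shifts. *)
Lemma Dist_continuous g w : nwin g -> {for w, continuous (Dist g ^~ w)}.
Proof.
move=> ngw; have [ng [G [U [mG IG nU UG]]]] := ngw.
have G0 z : 0 <= G z by apply: le_trans (UG z 0 (nbhs_singleton nU)); exact: normc_ge0.
have tXX := tgroup_prod tX tX'.
have mg : bcmeas R X g by case: ng => -[].
have sB v z : stft phi (fun x => tfshift v g x - tfshift w g x) z = stft phi (tfshift v g) z - stft phi (tfshift w g) z.
  by rewrite stftB//; exact: nice_tfshift.
apply: (@Rintegral_continuous R _ (csb_prod cX cX') _ _ (prodm mu nu)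
  (fun v z => normc (stft phi (fun x => tfshift v g x - tfshift w g x) z)) w [set v | U (w - v)]
  (fun z => G (z - w) + G (z - w))).
- have : continuous (fun v : X * X' => w - v).
    by apply: tgroup_subf => // v; [exact: cvg_cst|exact: cvg_id].
  by move=> /(_ w); apply; rewrite subrr.
- move=> v; apply: mnormc; apply: cmeas_stft; apply: niceB => //; exact: nice_tfshift.
- by apply: measurable_funD; apply: (mcompT mG); exact: (mshf2 hX hX' (- w)).
- have mGw : mfunT (fun z : XX => (G (z - w))%:E).
    by apply/mEFinP; apply: (mcompT mG); exact: (mshf2 hX hX' (- w)).
  under eq_integral do rewrite EFinD.
  rewrite ge0_integralD//; try by move=> z _; rewrite lee_fin.
  by rewrite (int_shift2 hX hX' (- w) (f := fun z => (G z)%:E)) ; [by rewrite lte_add_pinfty|exact/mEFinP|by move=> z; rewrite lee_fin].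
- move=> v z Uv; rewrite ger0_norm ?normc_ge0// sB; apply: le_trans (normcB_le _ _) _.
  rewrite (normc_stft_tfshift v z ng) (normc_stft_tfshift w z ng); apply: lerD.
    by have := UG (z - w) (w - v) Uv; rewrite addrA subrK.
  by have := UG (z - w) 0 (nbhs_singleton nU); rewrite addr0.
- move=> z; apply: ccont_normc.
  rewrite (_ : (fun v => _) = (fun v => pairing v.2 v.1 * (pairing z.2 v.1)^* * stft phi g (z - v) - stft phi (tfshift w g) z)); last first.
    by apply/funext => v; rewrite sB stft_tfshift//; exact: stft_cinteg.
  apply: ccontD; last exact: cvg_cst.
  apply: ccontM.
    apply: ccontM.
      apply: (@continuous_comp _ _ _ (fun v : X * X' => (v.2, v.1)) (fun z : X' * X => pairing z.1 z.2 : R[i]^o)); last exact: tf_cont.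
      by apply: cvg_pair; [exact: cvg_snd|exact: cvg_fst].
    apply: ccont_conj; apply: (@continuous_comp _ _ _ fst (fun x => pairing z.2 x : R[i]^o)); first exact: cvg_fst.
    exact: continuous_pairing_r.
  apply: (@continuous_comp _ _ _ (fun v : X * X' => z - v) (stft phi g : X * X' -> R[i]^o)); last exact: stft_continuous.
  by apply: tgroup_subf => // v; [exact: cvg_cst|exact: cvg_id].
Qed.

(** * Functionals on S_0 and integrals of time-frequency shifts *)

Section DualBound.
Variables (u : (X -> R[i]) -> R[i]) (g : X -> R[i]) (a : X * X' -> R[i]).
Hypotheses (Su : S0_dual u) (ng : nwin g) (Ia : cinteg (prodm mu nu) a).
Let nig : nice g. Proof. by case: ng. Qed.
Let mg : bcmeas R X g. Proof. by case: nig => -[]. Qed.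

Lemma S0_dual0 : u (fun=> 0) = 0.
Proof.
have S0z := nwin_S0 nwin0; have := Su.1 1 _ _ S0z S0z.
rewrite (_ : (fun x => _) = (fun=> 0)); last by apply/funext => x; rewrite mulr0 addr0.
by rewrite conjC1 mul1r => /eqP; rewrite -subr_eq0 opprD addrA addrN sub0r oppr_eq0 => /eqP.
Qed.
Lemma S0_dualZ c f : S0 f -> u (fun x => c * f x) = c^* * u f.
Proof.
move=> Sf; have := Su.1 c _ _ Sf (nwin_S0 nwin0); rewrite S0_dual0 addr0 => <-.
by congr u; apply/funext => x; rewrite addr0.
Qed.
Lemma S0_dualB f h : S0 f -> S0 h -> u (fun x => f x - h x) = u f - u h.
Proof.
move=> Sf Sh; have := Su.1 (-1) _ _ Sh Sf; have -> : (-1)^* = -1 :> R[i] by apply: complexP; rewrite ?Re_conj ?Im_conj ?ReN ?ImN /= ?oppr0.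
rewrite mulN1r [RHS]addrC => <-.
by congr u; apply/funext => x; rewrite mulN1r addrC.
Qed.
Lemma S0_dual_sum n (c : 'I_n -> R[i]) (F : 'I_n -> X -> R[i]) : (forall k, nwin (F k)) ->
  u (fun x => \sum_(k < n) c k * F k x) = \sum_(k < n) (c k)^* * u (F k).
Proof.
elim: n c F => [|n IH] c F nF.
  by rewrite [RHS]big_ord0 -[RHS]S0_dual0; congr u; apply/funext => x; rewrite big_ord0.
rewrite big_ord_recr /= -IH// addrC -Su.1; [|exact: nwin_S0|].
  by congr u; apply/funext => x; rewrite big_ord_recr addrC.
by apply: nwin_S0; apply: nwin_sum => k; exact: nwinZ.
Qed.
Lemma S0_dual_bound : exists C : R, 0 <= C /\ forall f (r : R), S0 f -> (S0n f <= r%:E)%E -> normc (u f) <= C * r.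
Proof.
have [C HC] := Su.2; exists (Num.max C 0); split; first by rewrite le_max lexx orbT.
move=> f r Sf fr; have := HC f Sf; rewrite S0_normE -lee_fin => /le_trans; apply.
have f0 : (0 <= S0n f)%E by exact: int_normc_ge0.
apply: (@le_trans _ _ ((Num.max C 0)%:E * S0n f)%E).
  by rewrite lee_wpmul2r// lee_fin le_max lexx.
by rewrite EFinM lee_wpmul2l// lee_fin le_max lexx orbT.
Qed.

(** A functional on S_0 is Lipschitz for the S_0 norm, in which the shifts of a window depend
    continuously on the point. *)
Lemma dual_stft_continuous : continuous (dual_stft g u : X * X' -> R[i]^o).
Proof.
have [C [C0 HC]] := S0_dual_bound; move=> w U /nbhs_ballP[e /= e0 eU].
have [{}e0 eE] : 0 < complex.Re e /\ e = (complex.Re e)%:C.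
  by move: e0; case: (e) => p q; rewrite ltcE /= => /andP[/eqP -> ?].
have e1 : 0 < complex.Re e / (C + 1) by rewrite divr_gt0// ltr_wpDl.
have := @Dist_continuous g w ng; have D0 : Dist g w w = 0.
  rewrite /Dist (_ : (fun z => _) = (fun=> 0)); first by rewrite Rintegral_cst// mul0r.
  apply/funext => z; rewrite (_ : (fun x => _) = (fun x => 0 * g x)); first by rewrite stftZ// mul0r normc0.
  by apply/funext => x; rewrite subrr mul0r.
move=> /cvgrPdist_lt /(_ _ e1); apply: filterS => v; rewrite D0 sub0r normrN.
have Dv0 : 0 <= Dist g v w by apply: Rintegral_ge0 => z _; exact: normc_ge0.
rewrite ger0_norm// ltr_pdivlMr; last by rewrite ltr_wpDl.
move=> Dv; apply: eU; rewrite /ball /= normr_normc eE ltcR normcB_sym /dual_stft -S0_dualB; try by apply: nwin_S0; exact: nwin_tfshift.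
apply: le_lt_trans Dv; apply: (@le_trans _ _ (C * Dist g v w)).
  apply: HC; last by rewrite DistE.
  by apply: nwin_S0; apply: nwinB; exact: nwin_tfshift.
by rewrite mulrC ler_wpM2l// lerDl.
Qed.

Lemma nice_bound : exists M : R, [/\ 0 <= M, forall x, normc (g x) <= M & forall v, (\int[mu]_x (normc (tfshift v g x))%:E <= M%:E)%E].
Proof.
have [[mg' Ig] [c gc]] := nig.
have If : (\int[mu]_x (normc (g x))%:E)%E \is a fin_num.
  by rewrite ge0_fin_numE//; apply: integral_ge0 => x _; rewrite lee_fin normc_ge0.
exists (Num.max c (fine (\int[mu]_x (normc (g x))%:E)%E)); split.
- by rewrite le_max (le_trans (normc_ge0 (g 0)))//.
- by move=> x; rewrite le_max gc.
- move=> v; under eq_integral do rewrite normc_tfshift//.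
  rewrite (int_shift hX (- v.1) (f := fun x => (normc (g x))%:E)); [|exact: menormc|by move=> x; rewrite lee_fin normc_ge0].
  by rewrite -{1}(fineK If) lee_fin le_max lexx orbT.
Qed.

Lemma cmeas_tfshift_prod : @cmeasurable _ (XX * borel X)%type R (fun p => tfshift p.1 g p.2).
Proof. by apply: cmeas_tfshift. Qed.

Lemma nice_synth : nice (synth a g).
Proof.
have [M [M0 gM gI]] := nice_bound.
apply: (@nice_param_integral _ _ (prodm mu nu) a (fun v => tfshift v g) M) => //.
- exact: cmeas_tfshift_prod.
- by move=> v x; rewrite normc_tfshift.
Qed.
Lemma S0_synth : S0 (synth a g).
Proof.
have [M [M0 gM gI]] := nice_bound; apply: nice_S0; first exact: nice_synth.
apply: le_lt_trans (@S0n_param_integral _ _ (prodm mu nu) a (fun v => tfshift v g) M Ia cmeas_tfshift_prod M0 _ gI) _.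
  by move=> v x; rewrite normc_tfshift.
under eq_integral do rewrite S0n_tfshift//.
rewrite ge0_integralZr//.
- apply: lte_mul_pinfty.
  + exact: int_normc_ge0.
  + by rewrite ge0_fin_numE; [case: Ia|apply: integral_ge0 => v _; rewrite lee_fin normc_ge0].
  + exact: nwin_lty.
- by apply: menormc; case: Ia.
- by move=> v _; rewrite lee_fin normc_ge0.
- exact: int_normc_ge0.
Qed.


(** * Riemann sums for a superposition of shifts *)

Section Partition.
Variables (e : R) (c : nat -> X * X').
Hypothesis e0 : 0 < e.
Hypothesis cover : forall v, exists n, Dist g v (c n) < e.

Let W n : set (X * X') := [set v | Dist g v (c n) < e].
Let E K : set (X * X') := \bigcup_(n < K) W n.
Let B n : set (X * X') := W n `\` E n.
(** A step function: [y n] on the n-th ball deprived of the earlier ones, and 0 outside the first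
    [K] balls. *)
Let step K (y : nat -> R[i]) v : R[i] := \sum_(n < K) (\1_(B n) v)%:C * y n.

Let mDist w : mfunT (Dist g ^~ w : XX -> R).
Proof.
apply: (measurable_Rparam (prodm mu nu) (f := fun p : XX * XX =>
  normc (stft phi (fun x => tfshift p.1 g x - tfshift w g x) p.2))).
apply: mnormc; apply: (cmeas_param mu (f := fun q : (XX * XX) * borel X =>
  (tfshift q.1.1 g q.2 - tfshift w g q.2) * (tfshift q.1.2 phi q.2)^*)).
have m1 : mfunT (fun q : (XX * XX) * borel X => q.1.1).
  exact: (mcompT measurable_fst measurable_fst).
have m2 : mfunT (fun q : (XX * XX) * borel X => q.1.2).
  exact: (mcompT measurable_snd measurable_fst).
apply: cmeasM; last by apply: cmeas_conj; apply: cmeas_tfshift.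
apply: cmeasB; first by apply: cmeas_tfshift.
by apply: (cmeas_comp measurable_snd); exact: cmeas_tfshift1.
Qed.
Let mW n : measurable (W n : set XX).
Proof.
have := mDist (c n) measurableT (measurable_itv `]-oo, e[); rewrite setTI; congr measurable.
Qed.
Let mE K : measurable (E K : set XX).
Proof. by apply: bigcup_measurable => n _. Qed.
Let mB n : measurable (B n : set XX).
Proof. exact: measurableD. Qed.

Let stepE K v : (exists2 n, W n v & forall q, step K q v = q n) \/ (~ E K v /\ forall q, step K q v = 0).
Proof.
elim: K => [|K [[n Wn IH]|[nE IH]]].
- by right; split => [[n]|y]; rewrite // /step big_ord0.
- have [EK|nEK] := pselect (E K v).
    left; exists n => // y; rewrite /step big_ord_recr /= indicE memNset ?mul0r ?addr0; first exact: IH.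
    by move=> [].
  have s0 : forall q, step K q v = 0.
    move=> y; rewrite /step big1// => i _; rewrite indicE memNset ?mul0r// => -[Wi _]; apply: nEK.
    by exists i => //=.
  have [WK|nWK] := pselect (W K v).
    by left; exists K => // y; rewrite /step big_ord_recr /= -/(step K y v) s0 add0r indicE mem_set ?mul1r.
  right; split => [[m /=]|y].
    by rewrite ltnS leq_eqVlt => /orP[/eqP -> //|mK Wm]; apply: nEK; exists m.
  by rewrite /step big_ord_recr /= -/(step K y v) s0 add0r indicE memNset; [rewrite mul0r|case].
- have [WK|nWK] := pselect (W K v).
    by left; exists K => // y; rewrite /step big_ord_recr /= -/(step K y v) IH add0r indicE mem_set ?mul1r.
  right; split => [[m /=]|y].
    by rewrite ltnS leq_eqVlt => /orP[/eqP -> //|mK Wm]; apply: nE; exists m.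
  by rewrite /step big_ord_recr /= -/(step K y v) IH add0r indicE memNset; [rewrite mul0r|case].
Qed.
Let cmstep d' (S : measurableType d') K (F : nat -> S -> R[i]) : (forall n, cmeasurable (F n)) ->
  @cmeasurable _ (XX * S)%type R (fun p => step K (fun n => F n p.2) p.1).
Proof.
move=> mF; apply: cmeas_sum => n; apply: cmeasM.
  exact: (cmeas_comp measurable_fst (cmeas_indic _ (mB n))).
exact: (cmeas_comp measurable_snd).
Qed.

Let al n : R[i] := cintegral (prodm mu nu) (fun v => a v * (\1_(B n) v)%:C).
Let Ial n : cinteg (prodm mu nu) (fun v => a v * (\1_(B n) v)%:C).
Proof.
apply: (cintegMr Ia (M := 1)) => [|v]; first exact: (cmeas_indic _ (mB n)).
by rewrite normc_real indicE; case: (_ \in _); rewrite ?normr1 ?normr0.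
Qed.
Let sumal K (y : nat -> R[i]) : \sum_(n < K) al n * y n = cintegral (prodm mu nu) (fun v => a v * step K y v).
Proof.
rewrite (_ : (fun v => a v * step K y v) = fun v => \sum_(n < K) y n * (a v * (\1_(B n) v)%:C)).
  rewrite cint_sum => [|n]; last exact: (cintegZ (y n) (Ial n)).
  by apply: eq_bigr => n _; rewrite (cintZ (y n) (Ial n)) mulrC.
apply/funext => v; rewrite /step mulr_sumr; apply: eq_bigr => n _; ring.
Qed.

Let norma : (\int[prodm mu nu]_v (normc (a v))%:E)%E \is a fin_num.
Proof. by rewrite ge0_fin_numE; [case: Ia|apply: integral_ge0 => v _; rewrite lee_fin normc_ge0]. Qed.
Let mna : mfunT (fun v : XX => normc (a v)).
Proof. by apply: mnormc; case: Ia. Qed.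
Let mtail K : mfunT (fun v : XX => (normc (a v) * \1_(~` E K) v)%:E).
Proof.
by apply/mEFinP; apply: measurable_funM => //; apply: measurable_indic; exact: measurableC.
Qed.
Let tail K : R := fine (\int[prodm mu nu]_v (normc (a v) * \1_(~` E K) v)%:E).
Let tailE K : (\int[prodm mu nu]_v (normc (a v) * \1_(~` E K) v)%:E)%E = (tail K)%:E.
Proof.
rewrite /tail fineK// ge0_fin_numE; last by apply: integral_ge0 => v _; rewrite lee_fin mulr_ge0// normc_ge0.
case: Ia => _; apply: le_lt_trans; apply: ge0_le_int => //.
- exact/mEFinP.
- by move=> v; rewrite lee_fin mulr_ge0// normc_ge0.
- by move=> v; rewrite lee_fin indicE ler_piMr ?normc_ge0//; case: (_ \in _).
Qed.
Let tail_cvg : tail @ \oo --> (0 : R).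
Proof.
have h := @dominated_cvg _ _ _ (prodm mu nu) setT measurableT (fun K v => (normc (a v) * \1_(~` E K) v)%:E)
  (fun=> 0%E) (fun v => (normc (a v))%:E).
have {}h : (\int[prodm mu nu]_v (normc (a v) * \1_(~` E K) v)%:E)%E @[K --> \oo] --> (\int[prodm mu nu]_(v in setT) 0)%E.
  apply: h => //.
  - move=> v _; apply: cvg_near_cst; have [n Wn] := cover v; exists n.+1 => // K /= nK.
    by rewrite indicE memNset ?mulr0//=; apply; exists n.
  - apply/integrableP; split; first exact/mEFinP.
    under eq_integral do rewrite gee0_abs ?lee_fin ?normc_ge0//.
    by case: Ia.
  - by move=> K v _; rewrite gee0_abs lee_fin ?mulr_ge0 ?normc_ge0// indicE ler_piMr ?normc_ge0//; case: (_ \in _).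
by move: h; rewrite integral0 => /fine_cvg.
Qed.

Let T K x : R[i] := \sum_(n < K) al n * tfshift (c n) g x.
Let H K v x : R[i] := tfshift v g x - step K (fun n => tfshift (c n) g x) v.
Let nwT K : nwin (T K).
Proof. by apply: nwin_sum => n; apply: nwinZ; exact: nwin_tfshift. Qed.
Let cint_mult (G : X * X' -> R[i]) (M : R) : @cmeasurable _ XX R G -> (forall v, normc (G v) <= M) ->
  cinteg (prodm mu nu) (fun v => a v * G v).
Proof.
exact: cintegMr.
Qed.
Let subE K x : synth a g x - T K x = cintegral (prodm mu nu) (fun v => a v * H K v x).
Proof.
have [M [M0 gM gI]] := nice_bound.
rewrite /T (sumal K (fun n => tfshift (c n) g x)) /synth -cintB.
- by apply: cint_ext => v; rewrite mulrBr.
- apply: (cint_mult (M := M)); last by move=> v; rewrite normc_tfshift.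
  exact: (cmeas_comp (measurable_pair2 (x : borel X)) cmeas_tfshift_prod).
- apply: (cint_mult (M := M)).
    have h := @cmstep _ (borel X) K (fun n => tfshift (c n) g) (fun n => cmeas_tfshift1 hP _ mg).
    exact: (cmeas_comp (measurable_pair2 (x : borel X)) h).
  move=> v; have [[n _ ->]|[_ ->]] := stepE K v; last by rewrite normc0.
  by rewrite normc_tfshift.
Qed.
Let HS K v : (S0n (H K v) <= (e + fine (S0n g) * \1_(~` E K) v)%:E)%E.
Proof.
have Nf : S0n g \is a fin_num.
  by rewrite ge0_fin_numE; [exact: nwin_lty|apply: integral_ge0 => z _; rewrite lee_fin normc_ge0].
have N0 : 0 <= fine (S0n g) by apply: fine_ge0; apply: integral_ge0 => z _; rewrite lee_fin normc_ge0.
have [[n Wn st]|[nE st]] := stepE K v.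
  rewrite (_ : H K v = fun x => tfshift v g x - tfshift (c n) g x); last by apply/funext => x; rewrite /H st.
  rewrite DistE// lee_fin (le_trans (ltW Wn))// lerDl mulr_ge0//.
rewrite (_ : H K v = tfshift v g); last by apply/funext => x; rewrite /H st subr0.
by rewrite S0n_tfshift// -{1}(fineK Nf) lee_fin indicE mem_set// mulr1 lerDr ltW.
Qed.

(** On a finite sum of shifts [u] is antilinear. One error [C * e] comes from replacing the shift at
    [v] by that at the centre of its ball, the other from the S_0 distance between the superposition
    and the finite sum; [d] pays for the mass of [a] outside the first balls. *)
Lemma dual_synth_approx C : 0 <= C -> (forall f (r : R), S0 f -> (S0n f <= r%:E)%E -> normc (u f) <= C * r) ->
  forall d : R, 0 < d ->
  ((normc (u (synth a g)))%:E <= \int[prodm mu nu]_v (normc (a v) * (normc (u (tfshift v g)) + C * e + C * e))%:E + d%:E)%E.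
Proof.
move=> C0 HC d d0; have [M [M0 gM gI]] := nice_bound.
set N := fine (S0n g).
have N0 : 0 <= N by apply: fine_ge0; apply: integral_ge0 => z _; rewrite lee_fin normc_ge0.
have CN1 : 0 < C * N + 1 by rewrite ltr_wpDl// mulr_ge0.
(* The tail of [a] is the one error that the mesh [e] does not control. *)
have [K tK] : exists K, C * N * tail K <= d.
  have /cvgrPdist_lt/(_ _ (divr_gt0 d0 CN1)) [K _ HK] := tail_cvg; exists K.
  have := HK K (leqnn K); rewrite sub0r normrN.
  have t0 : 0 <= tail K by rewrite /tail fine_ge0//; apply: integral_ge0 => v _; rewrite lee_fin mulr_ge0// normc_ge0.
  rewrite ger0_norm// ltr_pdivlMr// => /ltW; apply: le_trans.
  by rewrite mulrC ler_wpM2l// lerDl.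
have ST : S0 (T K) by exact: nwin_S0.
have SD : S0 (fun x => synth a g x - T K x).
  have := nwin_S0 (nwT K) => _; split.
    by apply: nice_L2; apply: niceB; [exact: nice_synth|case: (nwT K)].
  apply/in_L1P; split.
    by apply: cmeas_stft; apply: niceB; [exact: nice_synth|case: (nwT K)].
  have h1 : cinteg (prodm mu nu) (stft phi (synth a g)) by apply/in_L1P; case: S0_synth.
  have h2 : cinteg (prodm mu nu) (stft phi (T K)) by apply/in_L1P; case: ST.
  have [_] := cintegB h1 h2; congr (_ < _)%E; apply: eq_integral => z _.
  by rewrite stftB//; [exact: nice_synth|case: (nwT K)].
set A := fine (\int[prodm mu nu]_v (normc (a v))%:E).
have IA : (\int[prodm mu nu]_v (normc (a v))%:E = A%:E)%E by rewrite /A fineK.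
have mu1 : mfunT (fun v : XX => normc (u (tfshift v g))).
  apply: mnormc; apply: (continuous_cmeas_prod cX cX'); exact: dual_stft_continuous.
have b2 : normc (u (fun x => synth a g x - T K x)) <= C * (e * A + N * tail K).
  apply: HC => //.
  rewrite (_ : (fun x => synth a g x - T K x) = (fun x => cintegral (prodm mu nu) (fun v => a v * H K v x))); last first.
    by apply/funext => x; exact: subE.
  have h := @cmstep _ (borel X) K (fun n => tfshift (c n) g) (fun n => cmeas_tfshift1 hP _ mg).
  have mH : @cmeasurable _ (XX * borel X)%type R (fun p => H K p.1 p.2).
    by apply: cmeasB => //; exact: cmeas_tfshift_prod.
  have stM v x : normc (step K (fun n => tfshift (c n) g x) v) <= M.
    have [[n _ ->]|[_ ->]] := stepE K v; last by rewrite normc0.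
    by rewrite normc_tfshift.
  apply: le_trans (@S0n_param_integral _ _ (prodm mu nu) a (H K) (M + M) Ia mH _ _ _) _.
  - by rewrite addr_ge0.
  - move=> v x; apply: le_trans (normcB_le _ _) _; apply: lerD => //; by rewrite normc_tfshift.
  - move=> v; have [[n _ st]|[_ st]] := stepE K v.
      apply: (@le_trans _ _ (\int[mu]_x ((normc (tfshift v g x))%:E + (normc (tfshift (c n) g x))%:E))%E).
        apply: ge0_le_int.
        + apply: menormc; exact: (cmeas_comp (measurable_pair1 v) mH).
        + by apply: emeasurable_funD; apply: menormc; exact: cmeas_tfshift1.
        + by move=> x; rewrite lee_fin normc_ge0.
        + by move=> x; rewrite /H st lee_fin normcB_le.
      rewrite ge0_integralD//; try (by move=> x _; rewrite lee_fin normc_ge0); try (by apply: menormc; exact: cmeas_tfshift1).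
      by rewrite EFinD; apply: leeD.
    under eq_integral do rewrite /H st subr0.
    by apply: le_trans (gI v) _; rewrite lee_fin lerDl.
  apply: (@le_trans _ _ (\int[prodm mu nu]_v (e%:E * (normc (a v))%:E + N%:E * (normc (a v) * \1_(~` E K) v)%:E))%E).
    apply: ge0_le_int.
    - apply: emeasurable_funM; first exact/mEFinP.
      apply: (mint1 (prodm mu nu) (f := fun p : XX * XX => (normc (stft phi (H K p.1) p.2))%:E)); last first.
        by move=> p; rewrite lee_fin normc_ge0.
      apply: menormc.
      apply: (cmeas_param mu (f := fun q : (XX * XX) * borel X => H K q.1.1 q.2 * (tfshift q.1.2 phi q.2)^*)).
      apply: cmeasM.
        apply: (cmeas_comp _ mH (h := fun q : (XX * XX) * borel X => (q.1.1, q.2))).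
        apply: measurable_fun_pair; last exact: measurable_snd.
        exact: (mcompT measurable_fst measurable_fst).
      apply: cmeas_conj; apply: cmeas_tfshift => //.
      exact: (mcompT measurable_snd measurable_fst).
    - apply: emeasurable_funD; apply: emeasurable_funM => //; try exact: measurable_cst; exact/mEFinP.
    - by move=> v; rewrite mule_ge0 ?lee_fin ?normc_ge0//; apply: integral_ge0 => z _; rewrite lee_fin normc_ge0.
    - move=> v; apply: (@le_trans _ _ ((normc (a v))%:E * (e + N * \1_(~` E K) v)%:E)%E).
        by rewrite lee_wpmul2l ?lee_fin ?normc_ge0//; exact: HS.
      by rewrite -!EFinM -EFinD lee_fin le_eqVlt; apply/orP; left; apply/eqP; ring.
  rewrite ge0_integralD//; last 4 first.
  - by move=> v _; rewrite mule_ge0// lee_fin ?normc_ge0// ltW.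
  - by apply: emeasurable_funM; [exact: measurable_cst|exact/mEFinP].
  - by move=> v _; rewrite mule_ge0// lee_fin// mulr_ge0// normc_ge0.
  - by apply: emeasurable_funM; [exact: measurable_cst|].
  rewrite !ge0_intZ//; try (by move=> v _; rewrite lee_fin ?mulr_ge0 ?normc_ge0); try exact/mEFinP; try exact: ltW.
  by rewrite IA tailE -!EFinM -EFinD.
have b1 : ((normc (u (T K)))%:E <= \int[prodm mu nu]_v (normc (a v) * (normc (u (tfshift v g)) + C * e))%:E)%E.
  rewrite S0_dual_sum; last by move=> n; exact: nwin_tfshift.
  rewrite (_ : \sum_(n < K) _ = (\sum_(n < K) al n * (u (tfshift (c n) g))^*)^*); last first.
    by rewrite rmorph_sum; apply: eq_bigr => n _ /=; rewrite rmorphM /= conjCK.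
  rewrite normc_conj (sumal K (fun n => (u (tfshift (c n) g))^*)).
  apply: normc_cintegral_le.
  - apply: cmeasM; first by case: Ia.
    by apply: cmeas_sum => n; apply: cmeasM; [exact: (cmeas_indic _ (mB n))|exact: cmeas_cst].
  - by apply: measurable_funM => //; apply: measurable_funD => //; exact: measurable_cst.
  - move=> v; rewrite normcM' ler_wpM2l ?normc_ge0//.
    have [[n Wn ->]|[_ ->]] := stepE K v; last by rewrite normc0 addr_ge0 ?normc_ge0 ?mulr_ge0 ?(ltW e0).
    rewrite normc_conj -[X in normc X](subrK (u (tfshift v g))) addrC.
    apply: le_trans (normcD_le _ _) _; rewrite lerD2l normcB_sym -S0_dualB; try by apply: nwin_S0; exact: nwin_tfshift.
    apply: le_trans (HC _ (Dist g v (c n)) _ _) _.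
    + by apply: nwin_S0; apply: nwinB; exact: nwin_tfshift.
    + by rewrite (DistE v (c n) ng); exact: lexx.
    + by rewrite ler_wpM2l// ltW.
have -> : u (synth a g) = u (T K) + u (fun x => synth a g x - T K x).
  by have SS : S0 (synth a g) := S0_synth; rewrite (S0_dualB SS ST) addrC subrK.
apply: (@le_trans _ _ ((normc (u (T K)))%:E + (normc (u (fun x => (synth a g x - T K x)%R)))%:E)%E).
  by rewrite -EFinD lee_fin normcD_le.
apply: le_trans (leeD b1 (_ : _ <= (C * (e * A + N * tail K))%:E)%E) _; first by rewrite lee_fin.
apply: (@le_trans _ _ (\int[prodm mu nu]_v (normc (a v) * (normc (u (tfshift v g)) + C * e))%:E + ((C * e * A)%:E + d%:E))%E).
  apply: leeD => //; rewrite -EFinD lee_fin mulrDr mulrA lerD2l mulrA//.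
rewrite addeA; apply: leeD => //.
have -> : (C * e * A)%:E = (\int[prodm mu nu]_v (C * e * normc (a v))%:E)%E.
  under eq_integral do rewrite EFinM.
  rewrite ge0_intZ ?mulr_ge0 ?(ltW e0)//; [by rewrite IA EFinM|by move=> v _; rewrite lee_fin normc_ge0|exact/mEFinP].
rewrite -ge0_integralD//; last 4 first.
- by move=> v _; rewrite lee_fin mulr_ge0 ?addr_ge0 ?normc_ge0 ?mulr_ge0 ?(ltW e0).
- by apply/mEFinP; apply: measurable_funM => //; apply: measurable_funD => //; exact: measurable_cst.
- by move=> v _; rewrite lee_fin !mulr_ge0 ?normc_ge0 ?(ltW e0).
- by apply/mEFinP; apply: measurable_funM => //; exact: measurable_cst.
apply: eqW; apply: eq_integral => v _; rewrite -EFinD; congr (_%:E); ring.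
Qed.
End Partition.

(** [u] is moved under the integral by Riemann sums of mesh [e] tending to 0. Continuity of the
    shifts in the norm of S_0 and the Lindelof property provide the countably many balls. *)
Lemma dual_synth_le :
  ((normc (u (synth a g)))%:E <= \int[prodm mu nu]_v (normc (a v) * normc (u (tfshift v g)))%:E)%E.
Proof.
have [C [C0 HC]] := S0_dual_bound.
set A := fine (\int[prodm mu nu]_v (normc (a v))%:E)%E.
have A0 : 0 <= A by apply: fine_ge0; apply: integral_ge0 => v _; rewrite lee_fin normc_ge0.
have IA : (\int[prodm mu nu]_v (normc (a v))%:E = A%:E)%E.
  by rewrite /A fineK// ge0_fin_numE; [case: Ia|apply: integral_ge0 => v _; rewrite lee_fin normc_ge0].
have mna : mfunT (fun v : XX => normc (a v)) by apply: mnormc; case: Ia.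
have mu1 : mfunT (fun v : XX => normc (u (tfshift v g))).
  by apply: mnormc; apply: (continuous_cmeas_prod cX cX'); exact: dual_stft_continuous.
apply/lee_addgt0Pr => d d0.
(* The two errors [C * e] integrate to [2 * C * e * A], here at most d / 2; the other half of [d] is
   spent on the tail. *)
pose e := d / 2 / (2 * C * A + 1).
have CA : 0 < 2 * C * A + 1 by rewrite ltr_wpDl// !mulr_ge0.
have e0 : 0 < e by rewrite !divr_gt0.
have [c cover] : exists c : nat -> X * X', forall v, exists n, Dist g v (c n) < e.
  have D0 w : Dist g w w = 0.
    rewrite /Dist (_ : (fun z => _) = (fun=> 0)); first by rewrite Rintegral_cst// mul0r.
    apply/funext => z; rewrite (_ : (fun x => _) = (fun x => 0 * g x)); first by rewrite stftZ// mul0r normc0.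
    by apply/funext => x; rewrite subrr mul0r.
  apply: (@csb_lindelof _ 0 (fun w => [set v | Dist g v w < e]) (csb_prod cX cX')) => w.
  have /cvgrPdist_lt/(_ _ e0) := @Dist_continuous g w ng.
  apply: filterS => v; rewrite D0 sub0r normrN => /=; apply: le_lt_trans; exact: ler_norm.
apply: le_trans (dual_synth_approx e0 cover C0 HC (divr_gt0 d0 (ltr0Sn _ 1))) _.
have Ce : 0 <= C * e by rewrite mulr_ge0// ltW.
rewrite (_ : (\int[prodm mu nu]_v _)%E = (\int[prodm mu nu]_v (normc (a v) * normc (u (tfshift v g)))%:E + (2 * C * e * A)%:E)%E); last first.
  have -> : (2 * C * e * A)%:E = (\int[prodm mu nu]_v (2 * C * e * normc (a v))%:E)%E.
    under eq_integral do rewrite EFinM.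
    rewrite ge0_intZ; [by rewrite IA EFinM|by []|by move=> v _; rewrite lee_fin normc_ge0|exact/mEFinP|by rewrite -mulrA mulr_ge0].
  rewrite -ge0_integralD//; last 4 first.
  - by move=> v _; rewrite lee_fin mulr_ge0 ?normc_ge0.
  - by apply/mEFinP; exact: measurable_funM.
  - by move=> v _; rewrite lee_fin mulr_ge0 ?normc_ge0// -mulrA mulr_ge0.
  - by apply/mEFinP; apply: measurable_funM => //; exact: measurable_cst.
  apply: eq_integral => v _; rewrite -EFinD; congr (_%:E); ring.
rewrite -addeA; apply: leeD => //; rewrite -EFinD lee_fin.
have : 2 * C * e * A <= d / 2.
  rewrite (_ : _ * A = d / 2 * (2 * C * A / (2 * C * A + 1))); last by rewrite /e; field; rewrite gt_eqF.
  by rewrite -[leRHS]mulr1 ler_wpM2l ?divr_ge0 ?(ltW d0)// ler_pdivrMr// mul1r lerDl.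
by move=> h; rewrite [leRHS]splitr lerD2r.
Qed.

End DualBound.
End Synthesis.

Lemma ccont_nbhs (R : realType) (T : topologicalType) (f : T -> R[i]) (t : T) (e : R) :
  {for t, continuous (f : T -> R[i]^o)} -> 0 < e -> nbhs t [set s | normc (f t - f s) < e].
Proof.
move=> cf e0; have /cvgrPdist_lt/(_ e%:C) h := cf.
move: h; rewrite ltcR => /(_ e0); apply: filterS => s.
by rewrite normr_normc ltcR.
Qed.

(** Otherwise the sets that contain the points of [C] left uncovered by finitely many [W y] would
    form a proper filter, and a cluster point [p] of it would contradict its own neighbourhood
    [W p]. *)
Lemma compact_fcover (T : topologicalType) (C : set T) (W : T -> set T) : compact C ->
  (forall x, C x -> nbhs x (W x)) -> exists s : seq T, forall x, C x -> exists2 y, y \in s & W y x.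
Proof.
move=> cC nW; apply: contrapT => nos.
pose F : set_system T := fun S => exists s : seq T, forall x, C x -> (forall y, y \in s -> ~ W y x) -> S x.
have FF : ProperFilter F.
  split.
    move=> [s sP]; apply: nos; exists s => x Cx; apply: contrapT => h; apply: (sP x Cx) => y ys Wyx.
    by apply: h; exists y.
  split.
  - by exists nil.
  - move=> A B [s sA] [t tB]; exists (s ++ t) => x Cx h; split.
      by apply: sA => // y ys; apply: h; rewrite mem_cat ys.
    by apply: tB => // y yt; apply: h; rewrite mem_cat yt orbT.
  - by move=> A B AB [s sA]; exists s => x Cx h; apply: AB; exact: sA.
have FC : F C by exists nil.
have [p [Cp clp]] := cC F FF FC.
have Fp : F (~` W p) by exists [:: p] => x Cx; apply; rewrite inE.
by have [x []] := clp _ _ Fp (nW p Cp).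
Qed.

(** * Topology of the dual group: neighbourhoods, continuity of the pairing, countable base *)

Section DualTopology.
Variables (R : realType) (G : topologicalZmodType).
Local Notation D := (dual R G).

Lemma ltcP_pos (e : R[i]) : 0 < e -> 0 < complex.Re e /\ e = (complex.Re e)%:C.
Proof. by case: e => a b; rewrite ltcE /= => /andP[/eqP -> ?]. Qed.

(** The converse of [dual_nbhs]: the sets of functions uniformly close to [xi0] on a compact set
    generate a filter that converges to [xi0] in the compact-open topology. *)
Lemma dual_nbhs_ex (xi0 : D) (U : set D) : nbhs xi0 U -> exists (C : set G) (e : R),
  [/\ compact C, 0 < e & forall xi : D, (forall x, C x -> normc (xi0 x - xi x) < e) -> U xi].
Proof.
pose F : set_system (G -> R[i]) := fun W => exists (C : set G) (e : R),
  [/\ compact C, 0 < e & forall f : G -> R[i], (forall x, C x -> normc (xi0 x - f x) < e) -> W f].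
have FF : Filter F.
  split.
  - by exists set0, 1; split => //; exact: compact0.
  - move=> V W [C [e [cC e0 CV]]] [C' [e' [cC' e0' CW]]]; exists (C `|` C'), (Num.min e e'); split.
    + exact: compactU.
    + by rewrite lt_min e0.
    + move=> f h; split; [apply: CV|apply: CW] => x Cx.
        by have := h x (or_introl Cx); rewrite lt_min => /andP[].
      by have := h x (or_intror Cx); rewrite lt_min => /andP[].
  - by move=> V W VW [C [e [cC e0 CV]]]; exists C, e; split => // f h; apply: VW; exact: CV.
have [cxi _ _] := characterP xi0.
have co : {compact-open, F --> (xi0 : G -> R[i]^o)}.
  apply: (@compact_open_fam_compactP G R[i]^o xi0 _ cxi FF).2.
  apply: (@fam_cvgP G R[i]^o compact _ _ FF).2 => K cK P /uniform_nbhs[E []].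
  rewrite -entourage_ballE => -[e /= e0 eE] EP.
  have [e1 eE'] := ltcP_pos e0.
  exists K, (complex.Re e); split => // f h; apply: EP => x Kx; apply: eE => /=.
  by rewrite /ball /= normr_normc eE' ltcR; exact: h.
rewrite nbhsE => -[B [[A oA AB] Bxi] BU].
have : F A.
  by apply: co; apply: open_nbhs_nbhs; split => //; move: Bxi; rewrite -AB.
move=> [C [e [cC e0 CA]]]; exists C, e; split => // xi h.
by apply: BU; rewrite -AB; exact: CA.
Qed.

Lemma dual_nbhs (chi : D) (K : set G) (e : R) : compact K -> 0 < e ->
  nbhs chi [set psi : D | forall x, K x -> normc (chi x - psi x) < e].
Proof.
move=> cK e0; have := @dual_nbhsP R G chi K e%:C cK; rewrite ltcR => /(_ e0).
by apply: filterS => psi h x Kx; rewrite -ltcR -normr_normc; exact: h.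
Qed.

Lemma normc_ch (chi : D) x : normc (chi x) = 1.
Proof. by have [_ _ /(_ x)] := characterP chi; rewrite normr_normc => -[]. Qed.
Lemma characterD (chi : D) x y : chi (x + y) = chi x * chi y.
Proof. by have [] := characterP chi. Qed.
Lemma character_cont (chi : D) : continuous (chi : G -> R[i]^o).
Proof. by have [] := characterP chi. Qed.
Lemma character0 (chi : D) : chi 0 = 1.
Proof. by apply: (mulfI (character_neq0 chi 0)); rewrite -characterD addr0 mulr1. Qed.

Hypothesis lG : locally_compact [set: G].

Lemma lc_compact_nbhs (x : G) : exists C : set G, compact C /\ nbhs x C.
Proof.
have [C nC [cC _]] := lG (x := x) I; exists C; split => //.
by move: nC; rewrite /within /=; apply: filterS => y; exact.
Qed.

(** Closeness of characters is uniform on a compact neighbourhood of [x0], which local compactness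
    provides. *)
Lemma dual_pairing_continuous : continuous (fun z : D * G => z.1 z.2 : R[i]^o).
Proof.
move=> [xi0 x0] U /nbhs_ballP[e0 /= /ltcP_pos[]]; set e := complex.Re e0 => e0' -> eU.
have [C [cC nC]] := lc_compact_nbhs x0.
have e2 : 0 < e / 2 by rewrite divr_gt0.
have n1 := dual_nbhs xi0 cC e2.
have n2 : nbhs x0 [set x | normc (xi0 x0 - xi0 x) < e / 2].
  by apply: ccont_nbhs e2; exact: character_cont.
exists ([set psi : D | forall x, C x -> normc (xi0 x - psi x) < e / 2], C `&` [set x | normc (xi0 x0 - xi0 x) < e / 2]).
  by split => //=; apply: filterI.
move=> [xi x] /= [h1 [Cx h2]]; apply: eU; rewrite /ball /= normr_normc ltcR.
have -> : xi0 x0 - xi x = (xi0 x0 - xi0 x) + (xi0 x - xi x) by ring.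
by apply: le_lt_trans (normcD_le _ _) _; rewrite [ltRHS]splitr ltrD// h1.
Qed.

Hypothesis cG : csb G.

Lemma complex_rat_approx (z : R[i]) (e : R) : 0 < e -> exists q : rat * rat, normc (z - (ratr q.1 +i* ratr q.2)) < e.
Proof.
move=> e0; have e2 : 0 < e / 2 by rewrite divr_gt0.
have H (a : R) : exists q : rat, `|a - ratr q| < e / 2.
  have /rat_in_itvoo[q] : a - e / 2 < a + e / 2 by rewrite ltrBlDr -addrA ltrDl addr_gt0.
  rewrite in_itv /= => /andP[h1 h2]; exists q; rewrite distrC ltr_distl h1 h2 //.
have [a ha] := H (complex.Re z); have [b hb] := H (complex.Im z).
exists (a, b) => /=; apply: le_lt_trans (normc_le_ReIm _) _.
by rewrite ReD ImD ReN ImN /= [ltRHS]splitr ltrD.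
Qed.

(** A basic set is coded by a precision 1 / (m + 1) and a finite list of basic open sets of [G],
    each with a rational complex value to be approximated on it; interiors are taken to make the
    coded sets open. *)
Lemma csb_dual : csb D.
Proof.
have [B [oB bB]] := cG.
pose q2c (q : rat * rat) : R[i] := ratr q.1 +i* ratr q.2.
pose S (m : nat) (s : seq (nat * (rat * rat))) : set D :=
  [set xi : D | forall t, t \in s -> forall x, B t.1 x -> normc (xi x - q2c t.2) < m.+1%:R^-1].
pose W n : set D := if @unpickle (nat * seq (nat * (rat * rat)))%type n is Some (m, s) then interior (S m s) else set0.
exists W; split=> [n|xi0 U /dual_nbhs_ex[C [e [cC e0 CU]]]].
  by rewrite /W; case: unpickle => [[m s]|]; [exact: open_interior|exact: open0].
have [m hm] : exists m, 2 * m.+1%:R^-1 < e.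
  have [m _ /(_ m (leqnn m)) h] := near_infty_natSinv_lt (PosNum (divr_gt0 e0 (ltr0n R 2))).
  exists m; rewrite mulrC -ltr_pdivlMr//.
set d := m.+1%:R^-1 : R.
have d0 : 0 < d by rewrite invr_gt0.
have d2 : 0 < d / 2 by rewrite divr_gt0.
(* Each basic set is chosen inside a compact set, so that closeness on it holds throughout a
   neighbourhood of [xi0]. *)
have loc (x : G) : exists nqK : (nat * (rat * rat)) * set G,
   [/\ B nqK.1.1 x, compact nqK.2, B nqK.1.1 `<=` nqK.2 & forall y, B nqK.1.1 y -> normc (xi0 y - q2c nqK.1.2) < d / 2].
  have [q hq] := complex_rat_approx (xi0 x) (divr_gt0 d2 (ltr0n R 2)).
  have [K [cK nK]] := lc_compact_nbhs x.
  have n2 : nbhs x [set y | normc (xi0 x - xi0 y) < d / 2 / 2].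
    by apply: ccont_nbhs; [exact: character_cont|exact: divr_gt0].
  have [n [Bnx BnK]] := bB _ _ (filterI nK n2).
  exists ((n, q), K); split => //= y By; first by have [] := BnK y By.
  have -> : xi0 y - q2c q = (xi0 y - xi0 x) + (xi0 x - q2c q) by ring.
  have [_ /= h] := BnK y By; apply: le_lt_trans (normcD_le _ _) _.
  by rewrite normcB_sym [ltRHS]splitr ltrD.
have {loc}[t tP] := choice loc.
have [F FC] : exists F : seq G, forall x, C x -> exists2 y, y \in F & B (t y).1.1 x.
  apply: (compact_fcover cC) => x _; apply: open_nbhs_nbhs; split => //.
  by have [] := tP x.
pose s := [seq (t x).1 | x <- F].
exists (pickle (m, s)); rewrite /W pickleK; split.
  have nU : nbhs xi0 [set xi : D | forall x, (\big[setU/set0]_(y <- F) (t y).2) x -> normc (xi0 x - xi x) < d / 2].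
    apply: dual_nbhs => //; elim/big_ind: _ => [|A A' cA cA'|y _]; first exact: compact0.
      exact: compactU.
    by have [] := tP y.
  apply: filterS nU => xi h _ /mapP[y yF ->] x Bx.
  have [_ _ BK hB] := tP y.
  have -> : xi x - q2c (t y).1.2 = (xi x - xi0 x) + (xi0 x - q2c (t y).1.2) by ring.
  apply: le_lt_trans (normcD_le _ _) _.
  rewrite [ltRHS]splitr ltrD//; last exact: hB.
  rewrite normcB_sym; apply: h; rewrite -bigcup_seq; exists y => //; exact: BK.
move=> xi Sxi; apply: CU => x Cx.
have [y yF Byx] := FC x Cx.
have h1 := interior_subset Sxi _ (map_f (fun x => (t x).1) yF) x Byx.
have [_ _ _ /(_ x Byx) h2] := tP y.
have -> : xi0 x - xi x = (xi0 x - q2c (t y).1.2) + (q2c (t y).1.2 - xi x) by ring.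
apply: le_lt_trans (normcD_le _ _) _; apply: le_lt_trans hm.
rewrite mulrDl mul1r lerD// ?(normcB_sym (q2c _)) ?(ltW h1)//.
by apply/ltW/(lt_le_trans h2); rewrite -/d ler_pdivrMr// ler_peMr ?ltW// ltr1n.
Qed.

End DualTopology.

(** * Invariant measures on products; the time-frequency structures of the group and of its phase
    space *)

Section ProductGroup.
Variables (R : realType) (X Y : preTopologicalZmodType).
Variables (mu : sfm R X)
  (nu : sfm R Y)
  (rho : sfm R (X * Y)%type).
Hypotheses (hX : hgroup mu) (hY : hgroup nu) (rhoE : is_product_measure mu nu rho).

Lemma hgroup_prod : hgroup rho.
Proof.
split.
- exact: tgroup_prod (hg_top hX) (hg_top hY).
- exact: csb_prod (hg_csb hX) (hg_csb hY).
- move=> w E mE.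
  have mE' : measurable (E : set (borel X * borel Y)).
    have := mborel_of_prod (hg_csb hX) (hg_csb hY) measurableT mE.
    by rewrite setTI.
  have tXY := tgroup_prod (hg_top hX) (hg_top hY).
  have sE : [set (w + y : X * Y) | y in E] = [set z : X * Y | E (z - w)].
    apply/seteqP; split=> [_ [y Ey <-]|z Ez] /=; first by rewrite addrAC subrr add0r.
    by exists (z - w) => //; rewrite addrC subrK.
  have mS : measurable ([set z : X * Y | E (z - w)] : set (borel X * borel Y)).
    have := mshf2 hX hY (- w) measurableT mE'.
    by rewrite setTI.
  rewrite sE (is_product_measureE rhoE mS) (is_product_measureE rhoE mE').
  have mI : mfunT (fun z : borel X * borel Y => (\1_E z : R)%:E).
    by apply/mEFinP; exact: measurable_indic.
  have h := int_shift2 hX hY (- w) mI (fun z => _).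
  have {}h : (\int[prodm mu nu]_z (\1_[set z : X * Y | E (z - w)] z : R)%:E = \int[prodm mu nu]_z (\1_E z : R)%:E)%E.
    rewrite -h; last by move=> z; rewrite lee_fin indicE.
    by apply: eq_integral => z _; congr EFin; rewrite !indicE; congr (_%:R); congr nat_of_bool; apply/idP/idP; rewrite !inE.
  move: h; rewrite !integral_indic// !setIT.
  exact.
- move=> U oU [[x y] Uxy].
  have [[V W] /= [nV nW] VWU] : nbhs (x, y) U by exact: open_nbhs_nbhs.
  have mB := @open_mborel (X * Y)%type.
  apply: (@lt_le_trans _ _ (rho (interior V `*` interior W))).
    rewrite (rhoE (open_mborel (@open_interior _ V)) (open_mborel (@open_interior _ W))).
    apply: mule_gt0.
      by apply: (hg_pos hX); [exact: open_interior|exists x].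
    by apply: (hg_pos hY); [exact: open_interior|exists y].
  apply: le_measure; rewrite ?inE.
  + by apply: mB; apply: open_setX; exact: open_interior.
  + exact: mB.
  + by move=> [a b] [/= /interior_subset Va /interior_subset Wb]; apply: VWU.
Qed.
End ProductGroup.

Section Spaces.
Variables (R : realType) (G : topologicalZmodType).
Hypotheses (G_lca : is_lca G) (G_sc : @second_countable G).
Variables (mu : sfm R G)
  (nu : sfm R (dual R G))
  (mu2 : sfm R (G * dual R G)%type)
  (nu2 : sfm R (dual R G * G)%type).
Hypotheses (mu_haar : is_haar mu) (nu_haar : is_haar nu)
  (mu2_prod : is_product_measure mu nu mu2) (nu2_prod : is_product_measure nu mu nu2).
Variable s : lca_structure R G.

Lemma tgroupT (X : topologicalZmodType) : tgroup X.
Proof. by move=> z; exact: sub_continuous. Qed.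

Lemma hgroup_G : hgroup mu.
Proof. by have [h1 h2 h3] := mu_haar; split => //; [exact: tgroupT|exact: csb_second_countable]. Qed.

Lemma hgroup_D : hgroup nu.
Proof.
have [h1 h2 h3] := nu_haar; split => //; first exact: tgroupT.
by apply: csb_dual; [exact: G_lca.2|exact: csb_second_countable].
Qed.

Lemma tf_group_G : tf_group (group_tf s mu nu).
Proof.
split.
- exact: hgroup_G.
- exact: hgroup_D.
- exact: dual_pairing_continuous G_lca.2.
- by move=> xi x y; exact: characterD.
- by [].
- by move=> xi x; exact: normc_ch.
Qed.

Lemma tf_group_phase : tf_group (phase_tf s mu2 nu2).
Proof.
split.
- exact: hgroup_prod hgroup_G hgroup_D mu2_prod.
- exact: hgroup_prod hgroup_D hgroup_G nu2_prod.
- move=> z; apply: (@ccontM R _ (fun z : (dual R G * G) * (G * dual R G) => z.1.1 z.2.1) (fun z => z.2.2 z.1.2)).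
    apply: (@continuous_comp _ _ _ (fun z : (dual R G * G) * (G * dual R G) => (z.1.1, z.2.1)) (fun z => z.1 z.2 : R[i]^o)); last exact: dual_pairing_continuous G_lca.2 _.
    apply: cpair => t.
      by apply: continuous_comp; [exact: cvg_fst|exact: cvg_fst].
    by apply: (@continuous_comp _ _ _ snd fst); [exact: cvg_snd|exact: cvg_fst].
  apply: (@continuous_comp _ _ _ (fun z : (dual R G * G) * (G * dual R G) => (z.2.2, z.1.2)) (fun z => z.1 z.2 : R[i]^o)); last exact: dual_pairing_continuous G_lca.2 _.
  apply: cpair => t.
    by apply: continuous_comp; [exact: cvg_snd|exact: cvg_snd].
  by apply: continuous_comp; [exact: cvg_fst|exact: cvg_snd].
- by move=> w x y /=; rewrite characterD mulrACA.
- by move=> w w' x /=; rewrite characterD mulrACA.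
- by move=> w x /=; rewrite normcM' !normc_ch mulr1.
Qed.

End Spaces.

(** * The inner product of R^n and elementary estimates *)

Section Dot.
Variables (R : realType) (n : nat).
Implicit Types u v w : 'rV[R]_n.
Lemma dotC u v : dot u v = dot v u.
Proof. by apply: eq_bigr => k _; rewrite mulrC. Qed.
Lemma dotDl u v w : dot (u + v) w = dot u w + dot v w.
Proof. by rewrite -big_split; apply: eq_bigr => k _; rewrite mxE mulrDl. Qed.
Lemma dotDr u v w : dot w (u + v) = dot w u + dot w v.
Proof. by rewrite dotC dotDl !(dotC _ w). Qed.
Lemma dotZl a u v : dot (a *: u) v = a * dot u v.
Proof. by rewrite mulr_sumr; apply: eq_bigr => k _; rewrite mxE mulrA. Qed.
Lemma dotZr a u v : dot u (a *: v) = a * dot u v.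
Proof. by rewrite dotC dotZl dotC. Qed.
Lemma dotNl u v : dot (- u) v = - dot u v.
Proof. by rewrite -scaleN1r dotZl mulN1r. Qed.
Lemma dotNr u v : dot u (- v) = - dot u v.
Proof. by rewrite dotC dotNl dotC. Qed.
Lemma dot_ge0 u : 0 <= dot u u.
Proof. by apply: sumr_ge0 => k _; exact: sqr_ge0. Qed.
Lemma dot_le_sqr k u : u 0 k ^+ 2 <= dot u u.
Proof. by rewrite /dot (bigD1 k)//= -expr2 lerDl sumr_ge0// => j _; exact: sqr_ge0. Qed.
Lemma dot0l u : dot 0 u = 0.
Proof. by rewrite -(scale0r u) dotZl mul0r. Qed.
Lemma continuous_dot (T : topologicalType) (f g : T -> 'rV[R]_n) : continuous f -> continuous g ->
  continuous (fun t => dot (f t) (g t)).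
Proof.
move=> cf cg; rewrite /dot; elim: (index_enum _) => [|k l IH] t.
  by under [X in continuous_at _ X]eq_fun do rewrite big_nil; exact: cvg_cst.
under [X in continuous_at _ X]eq_fun do rewrite big_cons.
apply: cvgD; last exact: IH.
apply: cvgM; apply: (continuous_comp _ (@coord_continuous R 1 n 0 k _)).
  exact: cf.
exact: cg.
Qed.

Lemma continuous_dist (T : topologicalType) (f : T -> 'rV[R]_n) (w : 'rV[R]_n) : continuous f ->
  continuous (fun t => dot (f t - w) (f t - w)).
Proof.
move=> cf; have cw : continuous (fun _ : T => w) by exact: cst_continuous.
have -> : (fun t => dot (f t - w) (f t - w)) = (fun t => dot (f t) (f t) + (dot w w - 2 * dot (f t) w)).
  by apply/funext => v; rewrite !(dotDl, dotDr, dotNl, dotNr) (dotC w); ring.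
move=> t; apply: cvgD; first exact: (continuous_dot cf cf).
apply: cvgB; first exact: cvg_cst.
by apply: cvgM; [exact: cvg_cst|exact: (continuous_dot cf cw)].
Qed.

Lemma compact_dot_ball (r : R) : 0 <= r -> compact [set v : 'rV[R]_n | dot v v <= r ^+ 2].
Proof.
move=> r0; have cB := @rV_compact R n (fun=> `[- r, r]%classic) (fun=> @segment_compact R _ _).
apply: (subclosed_compact _ cB) => [|v /= h i].
  have cid : continuous (@id 'rV[R]_n) by move=> v; exact: cvg_id.
  have cd := continuous_dot cid cid.
  have -> : [set v : 'rV[R]_n | dot v v <= r ^+ 2] = (fun v => dot v v) @^-1` [set t | t <= r ^+ 2] by [].
  by apply: (continuous_closedP _).1 => //; exact: closed_le.
have := le_trans (dot_le_sqr i v) h.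
by rewrite -real_normK ?num_real// ler_pXn2r ?nnegrE// ler_norml in_itv.
Qed.
End Dot.

Lemma measure_seq_union d (T : measurableType d) (R : realType) (m : {measure set T -> \bar R}) (I : Type) (s : seq I)
  (E : I -> set T) (A : set T) (M : R) : (forall i, measurable (E i)) -> measurable A -> (forall i, (m (E i) <= M%:E)%E) ->
  A `<=` \big[setU/set0]_(i <- s) E i -> (m A <= (size s)%:R%:E * M%:E)%E.
Proof.
move=> mE mA EM AE.
have mU : measurable (\big[setU/set0]_(i <- s) E i) by apply: bigsetU_measurable => i _; exact: mE.
apply: (@le_trans _ _ (m (\big[setU/set0]_(i <- s) E i))); first by apply: le_measure; rewrite ?inE.
elim: s {AE mU} => [|i s IH]; first by rewrite big_nil measure0 mul0e.
have mU : measurable (\big[setU/set0]_(i <- s) E i) by apply: bigsetU_measurable => j _; exact: mE.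
rewrite big_cons; apply: (le_trans (measureU2 _ (mE i) mU)).
rewrite /= -natr1 EFinD -EFinM mulrDl mul1r EFinD EFinM addeC.
exact: leeD.
Qed.

Lemma geometric_series_bound (R : realType) (C : R) (n : nat) : 0 <= C -> \sum_(0 <= k < n) C * (2^-1) ^+ k <= 2 * C.
Proof.
move=> C0; have -> : \sum_(0 <= k < n) C * (2^-1) ^+ k = 2 * C - 2 * C * (2^-1) ^+ n.
  elim: n => [|n IH]; first by rewrite big_geq// expr0 mulr1 subrr.
  by rewrite big_nat_recr//= IH exprS; field.
by rewrite gerBl !mulr_ge0// exprn_ge0// invr_ge0.
Qed.

(** From exp x >= x^k / k! with k = N + 1, and N / 4^k <= 1/2. It shows that Gaussian decay at
    radius 2^n beats a covering number N^n. *)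
Lemma expR_pow_bound (R : realType) (A : R) (N : nat) : 0 < A -> exists C : R, 0 <= C /\
  forall n, expR (- (A * 4 ^+ n)) * N%:R ^+ n <= C * (2^-1) ^+ n.
Proof.
move=> A0; pose k := N.+1; exists (k`!%:R / A ^+ k); split.
  by rewrite divr_ge0 ?exprn_ge0 ?ltW//.
move=> n; have x0 : 0 < A * 4 ^+ n by rewrite mulr_gt0 ?exprn_gt0.
have h := @expR_ge1Dxn _ _ N (ltW x0); rewrite -/k in h.
have f0 : 0 < k`!%:R :> R by rewrite ltr0n fact_gt0.
have h1 : expR (- (A * 4 ^+ n)) <= k`!%:R / (A * 4 ^+ n) ^+ k.
  rewrite expRN -(invrK (_ / _)) lef_pV2 ?posrE ?expR_gt0 ?invr_gt0 ?divr_gt0 ?exprn_gt0// invf_div.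
  by apply: le_trans h; rewrite lerDr.
apply: (@le_trans _ _ (k`!%:R / (A * 4 ^+ n) ^+ k * N%:R ^+ n)); first by rewrite ler_wpM2r ?exprn_ge0.
have -> : k`!%:R / (A * 4 ^+ n) ^+ k * N%:R ^+ n = k`!%:R / A ^+ k * (N%:R / 4 ^+ k) ^+ n.
  rewrite exprMn [in RHS]expr_div_n -exprM mulnC exprM; field.
  by rewrite !expf_neq0 ?gt_eqF.
apply: ler_wpM2l; first by rewrite divr_ge0 ?exprn_ge0 ?ltW.
apply: lerXn2r; rewrite ?nnegrE ?divr_ge0 ?exprn_ge0//.
rewrite ler_pdivrMr ?exprn_gt0// mulrC ler_pdivlMr// -natrX -natrM ler_nat.
rewrite (@leq_trans (2 ^ N * 2))// ?leq_mul2r ?orbT ?(ltnW (ltn_expl _ _))//.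
by rewrite -expnSr -(expnM 2 2) leq_exp2l// mul2n -addnn leq_addr.
Qed.

Lemma conjRC (R : realType) (a : R) : (a%:C)^* = a%:C.
Proof. by apply: complexP; rewrite ?Re_conj ?Im_conj /= ?oppr0. Qed.

Lemma RCM (R : realType) (a b : R) : (a * b)%:C = a%:C * b%:C.
Proof. by apply: complexP; rewrite ?ReM ?ImM /= ?mulr0 ?mul0r ?subr0 ?addr0. Qed.

(** * Derivatives of the integrands in the Fourier integral of a Gaussian *)

Section RealDerivatives.
Variable R : realType.
Implicit Types A B C D E t : R.
Lemma der_cos A B t : is_derive t (1 : R) (fun s : R => A * cos (B * s)) (- (A * B * sin (B * t))).
Proof.
have d1 : is_derive t (1 : R) (fun s : R => B * s) B by apply: is_derive_eq; rewrite /GRing.scale /= mulr1 ?mulr0 ?addr0.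
have d2 := is_derive1_comp (is_derive_cos (B * t)) d1.
have d3 := @is_deriveM R R (cst A) (cos \o *%R B) t 1 0 _ _ d2.
have {}d3 := d3 (is_derive_cst _ _ _).
apply: (is_derive_eq d3); rewrite /GRing.scale /= /cst; ring.
Qed.
Lemma der_exp_sin E A B C D t : is_derive t (1 : R) (fun s : R => E * (expR (A * s - B * s ^+ 2) * sin (C - D * s)))
  (E * (expR (A * t - B * t ^+ 2) * ((A - 2 * B * t) * sin (C - D * t) - D * cos (C - D * t)))).
Proof.
have d1 : is_derive t (1 : R) (fun s : R => A * s - B * s ^+ 2) (A - 2 * B * t).
  by apply: is_derive_eq; rewrite /GRing.scale /=; ring.
have d2 : is_derive t (1 : R) (fun s : R => C - D * s) (- D).
  by apply: is_derive_eq; rewrite /GRing.scale /=; ring.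
have e1 := is_derive1_comp (is_derive_expR _) d1.
have e2 := is_derive1_comp (is_derive_sin _) d2.
have d3 := is_deriveM e1 e2.
have d4 := @is_deriveM R R (cst E) _ t 1 0 _ _ d3.
have {}d4 := d4 (is_derive_cst _ _ _).
apply: (is_derive_eq d4); rewrite /GRing.scale /= /cst; ring.
Qed.
End RealDerivatives.

(** * Gaussians on a group with an additive coordinate *)

Section GaussSystem.
Variables (R : realType) (X : preTopologicalZmodType) (mu : sfm R X).
Variable d : nat.

(** A Gaussian needs an additive coordinate [r] into R^d with an additive section [lin], and an open
    subgroup [K] containing the image of that section; [gs_fin] relates them to the measure. Both
    the group and its dual are instances. *)
Record gauss_sys (r : X -> 'rV[R]_d) (lin : 'rV[R]_d -> X) (K : set X) : Prop := GaussSys {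
  gs_cont : continuous r;
  gs_rD : forall x y, r (x + y) = r x + r y;
  gs_linD : forall u v, lin (u + v) = lin u + lin v;
  gs_rlin : forall v, r (lin v) = v;
  gs_K0 : K 0;
  gs_KB : forall x y, K x -> K y -> K (x - y);
  gs_Klin : forall v, K (lin v);
  gs_open : open K;
  gs_fin : exists e : R, 0 < e /\ (mu [set x | K x /\ (dot (r x) (r x) < e)%R] < +oo)%E }.

Hypothesis hX : hgroup mu.
Variables (r : X -> 'rV[R]_d) (lin : 'rV[R]_d -> X) (K : set X).
Hypothesis gs : gauss_sys r lin K.
Implicit Types (x y : X) (v : 'rV[R]_d) (a : R).

Definition gE a x : R := expR (- (a * dot (r x) (r x))) * \1_K x.

Lemma gs_r0 : r 0 = 0.
Proof. by apply: (addrI (r 0)); rewrite -(gs_rD gs) !addr0. Qed.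
Lemma gs_rN x : r (- x) = - r x.
Proof. by apply: (addrI (r x)); rewrite -(gs_rD gs) !subrr gs_r0. Qed.
Lemma gs_rB x y : r (x - y) = r x - r y.
Proof. by rewrite (gs_rD gs) gs_rN. Qed.
Lemma gs_KN x : K x -> K (- x).
Proof. by move=> Kx; rewrite -sub0r; apply: (gs_KB gs) => //; exact: gs_K0 gs. Qed.
Lemma gs_KD x y : K x -> K y -> K (x + y).
Proof. by move=> Kx Ky; rewrite -(opprK y); apply: (gs_KB gs) => //; exact: gs_KN. Qed.
Lemma gs_KDr x y : K y -> K (x + y) <-> K x.
Proof.
move=> Ky; split=> [h|Kx]; last exact: gs_KD.
by rewrite -(addrK y x); exact: (gs_KB gs).
Qed.
Lemma indic_KDr x y : K y -> \1_K (x + y) = \1_K x :> R.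
Proof.
move=> Ky; rewrite !indicE; congr (nat_of_bool _)%:R; apply/idP/idP; rewrite !inE => h; exact/(gs_KDr _ Ky).
Qed.
Lemma gE_ge0 a x : 0 <= gE a x.
Proof. by rewrite mulr_ge0 ?expR_ge0. Qed.
Lemma gE_le1 a x : 0 <= a -> gE a x <= 1.
Proof.
move=> a0; rewrite -[leRHS]mulr1 ler_pM ?expR_ge0//.
by rewrite -[leRHS]expR0 ler_expR oppr_le0 mulr_ge0 ?dot_ge0.
Qed.
Lemma gEK a x : K x -> gE a x = expR (- (a * dot (r x) (r x))).
Proof. by move=> Kx; rewrite /gE indicE mem_set ?mulr1. Qed.
Lemma gE_nK a x : ~ K x -> gE a x = 0.
Proof. by move=> Kx; rewrite /gE indicE memNset ?mulr0. Qed.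
Lemma gE0 a : gE a 0 = 1.
Proof. by rewrite gEK; [rewrite gs_r0 dot0l mulr0 oppr0 expR0|exact: gs_K0 gs]. Qed.
Lemma gEN a x : gE a (- x) = gE a x.
Proof.
have [Kx|nKx] := pselect (K x); first by rewrite !gEK ?gs_rN ?dotNl ?dotNr ?opprK//; exact: gs_KN.
by rewrite !gE_nK// => /gs_KN; rewrite opprK.
Qed.

(** In the coordinate, |t|^2 + |t - x|^2 = |x|^2 / 2 + 2 |t - x / 2|^2. The point
    [lin (2^-1 *: r x)] serves as midpoint: it always lies in [K], although [x] itself need not be
    divisible by 2. *)
Lemma gE_prod a x t : gE a t * gE a (t - x) = gE (a / 2) x * gE (2 * a) (t - lin (2^-1 *: r x)).
Proof.
have [Kt|nKt] := pselect (K t); last first.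
  rewrite gE_nK// mul0r; have [Kx|nKx] := pselect (K x); last by rewrite gE_nK// mul0r.
  rewrite (gE_nK _ (x := t - _)) ?mulr0// => h; apply: nKt.
  by rewrite -(subrK (lin (2^-1 *: r x)) t); apply: gs_KD => //; exact: gs_Klin gs _.
have [Kx|nKx] := pselect (K x); last first.
  rewrite (gE_nK _ nKx) mul0r (gE_nK _ (x := t - x)) ?mulr0// => h; apply: nKx.
  by rewrite -(subKr t x); exact: (gs_KB gs).
rewrite !gEK//; [|by apply: (gs_KB gs) => //; exact: gs_Klin gs _|exact: (gs_KB gs)].
rewrite -!expRD; congr expR; rewrite !gs_rB (gs_rlin gs).
rewrite !(dotDl, dotDr, dotNl, dotNr, dotZl, dotZr) (dotC (r x) (r t)); by field.
Qed.

(** From |u + v|^2 <= 2 |u|^2 + 2 |v|^2, hence the half of the parameter. *)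
Lemma gE_add_le a x y : 0 <= a -> gE a x * gE a y <= gE (a / 2) (x + y).
Proof.
move=> a0; have [Kx|nKx] := pselect (K x); last by rewrite (gE_nK _ nKx) mul0r gE_ge0.
have [Ky|nKy] := pselect (K y); last by rewrite (gE_nK _ nKy) mulr0 gE_ge0.
rewrite !gEK//; last exact: gs_KD.
rewrite -expRD ler_expR (gs_rD gs) -subr_ge0.
have := mulr_ge0 a0 (dot_ge0 (r x - r y)).
rewrite !(dotDl, dotDr, dotNl, dotNr) (dotC (r y) (r x)) => h.
suff -> : - (a / 2 * (dot (r x) (r x) + dot (r x) (r y) + (dot (r x) (r y) + dot (r y) (r y)))) -
  (- (a * dot (r x) (r x)) - a * dot (r y) (r y)) = a * (dot (r x) (r x) - dot (r x) (r y) - (dot (r x) (r y) - dot (r y) (r y))) / 2.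
  by rewrite divr_ge0//; apply: (le_trans h); apply: eqW; ring.
by field.
Qed.

Lemma gE_shift_le a x y : 0 <= a -> K y -> dot (r y) (r y) <= 1 -> gE a x <= expR a * gE (a / 2) (x + y).
Proof.
move=> a0 Ky y1; have := @gE_add_le a x y a0; rewrite (gEK _ Ky).
rewrite -ler_pdivlMr ?expR_gt0// => h; apply: (le_trans h); rewrite mulrC ler_wpM2r ?gE_ge0//.
by rewrite -expRN opprK ler_expR -[leRHS]mulr1 ler_wpM2l.
Qed.


(** An open subgroup is closed, since its complement is a union of cosets. The indicator of [K] is
    therefore continuous. *)
Lemma gs_closed : closed K.
Proof.
rewrite -[K]setCK; apply: open_closedC; rewrite openE => x nKx.
have h : nbhs x [set y | K (y - x)].
  by apply: (nbhs_shift (hg_top hX)); apply: open_nbhs_nbhs; split; [exact: gs_open gs|exact: gs_K0 gs].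
apply: filterS h => y /= Kyx Ky; apply: nKx; rewrite -(subKr y x); exact: (gs_KB gs).
Qed.

Lemma continuous_indicK : continuous (\1_K : X -> R).
Proof.
move=> x U /nbhs_singleton Ux; have [Kx|nKx] := pselect (K x).
  have h : nbhs x K by apply: open_nbhs_nbhs; split => //; exact: gs_open gs.
  by apply: filterS h => y Ky /=; move: Ux; rewrite !indicE (mem_set Kx) (mem_set Ky).
have h : nbhs x (~` K) by apply: open_nbhs_nbhs; split => //; rewrite openC; exact: gs_closed.
by apply: filterS h => y Ky /=; move: Ux; rewrite !indicE (memNset nKx) (memNset Ky).
Qed.

Lemma continuous_gE a : continuous (gE a).
Proof.
move=> x; apply: (@continuousM R X (fun x => expR (- (a * dot (r x) (r x)))) (\1_K)); last exact: continuous_indicK.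
apply: (@continuous_comp _ _ _ (fun x => - (a * dot (r x) (r x))) expR); last exact: continuous_expR.
apply: continuousN; apply: continuousM; first exact: cvg_cst.
exact: (continuous_dot (gs_cont gs) (gs_cont gs)).
Qed.

Lemma measurable_gE a : mfunT (gE a : borel X -> R).
Proof. by apply: ccont_mR; exact: continuous_gE. Qed.

(** Doubling the radius multiplies the measure of [D n] by at most the size of a fixed covering of a
    ball of R^d, so these measures grow geometrically in n, while the Gaussian decays like exp (- a
    e 4^n). *)
Lemma gE_integrable a : 0 < a -> (\int[mu]_x (gE a x)%:E < +oo)%E.
Proof.
move=> a0; have [e [e0 finD]] := gs_fin gs.
pose D n : set X := [set x | K x /\ dot (r x) (r x) < e * 4 ^+ n].
have oD n : open (D n).
  have -> : D n = K `&` (fun x => dot (r x) (r x)) @^-1` [set t | t < e * 4 ^+ n] by [].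
  apply: openI; first exact: gs_open gs.
  by apply: (continuousP _).1 => //; exact: continuous_dot (gs_cont gs) (gs_cont gs).
have mD n : measurable (D n : set (borel X)) by exact: open_mborel.
(* [dot] is a squared length: balls of radius sqrt e cover the ball of radius 2 sqrt e. By
   homogeneity this single covering serves all scales. *)
have [s sP] : exists s : seq 'rV[R]_d, forall v, dot v v <= (2 * Num.sqrt e) ^+ 2 -> exists2 w, w \in s & dot (v - w) (v - w) < e.
  apply: (compact_fcover (W := fun w v => dot (v - w) (v - w) < e) (@compact_dot_ball R d (2 * Num.sqrt e) _)) => [|w _].
    by rewrite mulr_ge0 ?sqrtr_ge0.
  have c : continuous (fun v : 'rV[R]_d => dot (v - w) (v - w)).
    have cid : continuous (@id 'rV[R]_d) by move=> v; exact: cvg_id.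
    exact: (continuous_dist cid).
  have := c w; rewrite /continuous_at subrr dot0l => /(_ [set t | t < e]); apply.
  by apply: lt_nbhsl.
have [M0 M0P] : exists M0 : R, 0 <= M0 /\ (mu (D 0%N) <= M0%:E)%E.
  have D0 : D 0%N = [set x | K x /\ dot (r x) (r x) < e] by rewrite /D expr0 mulr1.
  exists (fine (mu (D 0%N))); rewrite fine_ge0// fineK ?lexx//.
  by rewrite ge0_fin_numE// D0.
have DS n : (mu (D n) <= ((size s)%:R ^+ n * M0)%:E)%E.
  elim: n => [|n IH]; first by rewrite expr0 mul1r; case: M0P.
  pose T w : set X := [set (lin (2 ^+ n *: w) + y : X) | y in D n].
  have mT w : measurable (T w : set (borel X)).
    have -> : T w = [set y : X | D n (y - lin (2 ^+ n *: w))].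
      apply/seteqP; split=> [_ [y Dy <-]|y Dy] /=; first by rewrite addrAC subrr add0r.
      by exists (y - lin (2 ^+ n *: w)) => //; rewrite addrC subrK.
    by apply: open_mborel; apply: open_shift => //; exact: hg_top hX.
  have Tle w : (mu (T w) <= ((size s)%:R ^+ n * M0)%:E)%E by rewrite (hg_inv hX).
  have := measure_seq_union (s := s) mT (mD n.+1) Tle.
  rewrite exprS -mulrA -EFinM; apply => x [Kx rx].
  have p0 : 0 < 2 ^+ n :> R by rewrite exprn_gt0.
  have p4 : 4 ^+ n = 2 ^+ n * 2 ^+ n :> R by rewrite -exprMn; congr (_ ^+ _); ring.
  have [|w ws hw] := sP ((2 ^+ n)^-1 *: r x).
    have -> : dot ((2 ^+ n)^-1 *: r x) ((2 ^+ n)^-1 *: r x) = dot (r x) (r x) / 4 ^+ n.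
      by rewrite dotZl dotZr p4; field; rewrite gt_eqF.
    rewrite ler_pdivrMr ?exprn_gt0// exprMn sqr_sqrtr ?ltW//; apply: (lt_le_trans rx).
    by apply: eqW; rewrite exprS; ring.
  rewrite -bigcup_seq; exists w => //=.
  exists (x - lin (2 ^+ n *: w)); last by rewrite addrC subrK.
  split; first by apply: (gs_KB gs) => //; exact: gs_Klin gs _.
  rewrite gs_rB (gs_rlin gs).
  have -> : r x - 2 ^+ n *: w = 2 ^+ n *: ((2 ^+ n)^-1 *: r x - w).
    by rewrite scalerBr scalerA divff ?scale1r// gt_eqF.
  by rewrite dotZl dotZr mulrA -p4 mulrC ltr_pM2r ?exprn_gt0.
have [C [C0 hC]] := expR_pow_bound (size s) (mulr_gt0 a0 e0).
(* [b n] bounds the Gaussian outside [D (n - 1)], where the squared radius is at least e 4^(n - 1);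
   for n = 0 the bound is 1. *)
pose b n : R := if n is n'.+1 then expR (- (a * e * 4 ^+ n')) else 1.
have b0 n : 0 <= b n by case: n => [|n] /=; rewrite ?expR_ge0.
pose B : R := M0 + 2 * (C * (size s)%:R * M0).
have gb x : ((gE a x)%:E <= \sum_(0 <= n <oo) (b n * \1_(D n) x)%:E)%E.
  have [Kx|nKx] := pselect (K x); last first.
    by rewrite gE_nK// nneseries_ge0// => n _ _; rewrite lee_fin mulr_ge0.
  have ex : exists n, dot (r x) (r x) < e * 4 ^+ n.
    exists (Num.bound (dot (r x) (r x) / e)).
    rewrite mulrC -ltr_pdivrMr//; apply: (lt_le_trans (archi_boundP (divr_ge0 (dot_ge0 _) (ltW e0)))).
    by rewrite -natrX ler_nat ltnW// ltn_expl.
  have [n nP nmin] := ex_minnP ex.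
  have h : ((b n)%:E <= \sum_(0 <= n <oo) (b n * \1_(D n) x)%:E)%E.
    have h := nneseries_lim_ge (u_ := fun n => (b n * \1_(D n) x)%:E) (P := xpredT) (m := 0) n.+1.
    apply: (le_trans _ (h _)); last by move=> k _ _; rewrite lee_fin mulr_ge0.
    rewrite big_nat_recr//= indicE mem_set ?mulr1// leeDr// sume_ge0// => k _.
    by rewrite lee_fin mulr_ge0.
  apply: le_trans h; rewrite lee_fin gEK//; case: n nP nmin => [|n] nP nmin /=.
    by rewrite -expR0 ler_expR oppr_le0 mulr_ge0 ?dot_ge0 ?ltW.
  rewrite ler_expR lerN2 -mulrA ler_wpM2l ?(ltW a0)// leNgt; apply/negP => h.
  by have := nmin n h; rewrite ltnn.
apply: (@le_lt_trans _ _ B%:E); last exact: ltry.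
have mb n : mfunT (fun x : borel X => (b n * \1_(D n) x)%:E).
  by apply/mEFinP; apply: measurable_funM => //; exact: measurable_indic.
apply: (@le_trans _ _ (\int[mu]_x \sum_(0 <= n <oo) (b n * \1_(D n) x)%:E)%E).
  apply: ge0_le_integral => //.
  - by move=> x _; rewrite lee_fin gE_ge0.
  - by apply/mEFinP; exact: measurable_gE.
  - have h0 k (x : borel X) : setT x -> xpredT k -> (0 <= (b k * \1_(D k) x)%:E)%E by rewrite lee_fin mulr_ge0.
    exact: (ge0_emeasurable_sum h0 (fun k _ => mb k)).
rewrite integral_nneseries//; last by move=> n x _; rewrite lee_fin mulr_ge0.
apply: lime_le; first by apply: is_cvg_nneseries => n _ _; apply: integral_ge0 => x _; rewrite lee_fin mulr_ge0.
apply: nearW => n; have term k : (\int[mu]_x (b k * \1_(D k) x)%:E <= (b k * ((size s)%:R ^+ k * M0))%:E)%E.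
  under eq_integral do rewrite EFinM.
  have mI : mfunT (fun x : borel X => (\1_(D k) x : R)%:E).
    by apply/mEFinP; exact: measurable_indic.
  rewrite ge0_integralZl//; last by rewrite lee_fin.
  rewrite integral_indic// setIT EFinM.
  by apply: lee_wpmul2l; [rewrite lee_fin; exact: b0|exact: DS].
apply: (le_trans (lee_sum _ (fun k _ => term k))); rewrite sumEFin lee_fin.
case: n => [|n]; first by rewrite big_geq// addr_ge0 ?mulr_ge0//; case: M0P.
rewrite big_nat_recl//= mul1r expr0 mul1r lerD2l.
apply: (le_trans _ (geometric_series_bound n _)); last by rewrite !mulr_ge0//; case: M0P.
apply: ler_sum => k _; rewrite exprS.
have -> : expR (- (a * e * 4 ^+ k)) * ((size s)%:R * (size s)%:R ^+ k * M0) = (expR (- (a * e * 4 ^+ k)) * (size s)%:R ^+ k) * ((size s)%:R * M0) by ring.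
have -> : C * (size s)%:R * M0 * 2^-1 ^+ k = (C * 2^-1 ^+ k) * ((size s)%:R * M0) by ring.
by apply: ler_wpM2r (hC k); rewrite mulr_ge0//; case: M0P.
Qed.

(** * The Fourier transform of a Gaussian *)

Section GaussFourier.
Variables (a : R) (v : 'rV[R]_d).
Hypothesis a0 : 0 < a.
Let y x := dot v (r x).
Let n := dot v v.
Let b := 2 * a.
Let n0 : 0 <= n. Proof. exact: dot_ge0. Qed.
Let b0 : 0 < b. Proof. by rewrite mulr_gt0. Qed.

Lemma cont_y : continuous y.
Proof.
have cv : continuous (fun _ : X => v) by exact: cst_continuous.
exact: (continuous_dot cv (gs_cont gs)).
Qed.


(** Completing the square at 4 v or - 4 v, according to the sign of [y x]: half of the Gaussian
    absorbs the exponential. *)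
Lemma exp_y_bound x : expR (2 * (b * `|y x|)) * gE a x <= expR (8 * a * n) * gE (a / 2) x.
Proof.
have [Kx|nKx] := pselect (K x); last by rewrite !(gE_nK _ nKx) !mulr0.
rewrite !gEK// -!expRD ler_expR.
have H (e : R) : e = 1 \/ e = -1 -> 2 * (b * (e * y x)) - a * dot (r x) (r x) <= 8 * a * n - a / 2 * dot (r x) (r x).
  move=> eE; have ee : e * e = 1 by case: eE => ->; rewrite ?mulr1 ?mulrNN ?mulr1.
  rewrite -subr_ge0; have := mulr_ge0 (ltW a0) (dot_ge0 (r x - (4 * e) *: v)).
  rewrite !(dotDl, dotDr, dotNl, dotNr, dotZl, dotZr) (dotC (r x) v) -/(y x) -/n => h.
  have -> : 8 * a * n - a / 2 * dot (r x) (r x) - (2 * (b * (e * y x)) - a * dot (r x) (r x)) =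
    (a * (dot (r x) (r x) + - (4 * e * y x) + (- (4 * e * y x) + - - (4 * e * (4 * e * n))))) / 2 + 8 * a * n * (1 - e * e).
    by rewrite /b; field.
  rewrite ee subrr mulr0 addr0 divr_ge0//; apply: (le_trans h).
  by apply: eqW; ring.
have [y0|y0] := leP 0 (y x).
  by rewrite ger0_norm//; have := H 1 (or_introl erefl); rewrite mul1r.
by rewrite ltr0_norm//; have := H (-1) (or_intror erefl); rewrite mulN1r.
Qed.

Lemma poly_exp_y_bound x (C : R) : 0 <= C -> gE a x * (expR (b * `|y x|) * (b * `|y x| + C)) <= (1 + C) * expR (8 * a * n) * gE (a / 2) x.
Proof.
move=> C0; rewrite -mulrA; apply: (le_trans _ (ler_wpM2l _ (exp_y_bound x))); last by rewrite addr_ge0.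
have -> : 2 * (b * `|y x|) = b * `|y x| + b * `|y x| by ring.
rewrite expRD mulrC.
have -> : (1 + C) * (expR (b * `|y x|) * expR (b * `|y x|) * gE a x) = (expR (b * `|y x|) * (expR (b * `|y x|) * (1 + C))) * gE a x by ring.
rewrite ler_wpM2r ?gE_ge0// ler_wpM2l ?expR_ge0//.
have t0 : 0 <= b * `|y x| by apply: mulr_ge0 => //; exact: ltW.
have h := expR_ge1Dx (b * `|y x|).
rewrite mulrDr mulr1 lerD//; first by apply: le_trans h; rewrite lerDr.
by rewrite ler_peMl//; apply: le_trans h; rewrite lerDl.
Qed.

Lemma gE_lin_shift x (t : R) : gE a (x - lin (t *: v)) = gE a x * expR (b * t * y x - a * t ^+ 2 * n).
Proof.
have [Kx|nKx] := pselect (K x); last first.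
  rewrite (gE_nK _ nKx) mul0r gE_nK// => h; apply: nKx.
  by rewrite -(subrK (lin (t *: v)) x); apply: gs_KD => //; exact: gs_Klin gs _.
rewrite !gEK//; last by apply: (gs_KB gs) => //; exact: gs_Klin gs _.
rewrite -expRD; congr expR; rewrite gs_rB (gs_rlin gs).
by rewrite !(dotDl, dotDr, dotNl, dotNr, dotZl, dotZr) (dotC (r x) v) -/(y x) -/n /b; ring.
Qed.

Lemma gauss_integrable (e M : R) (h : borel X -> R) : 0 < e -> mfunT h -> (forall x, `|h x| <= M * gE e x) ->
  mu.-integrable setT (EFin \o h).
Proof.
move=> e0 mh hM; apply/integrableP; split; first exact/mEFinP.
apply: (@le_lt_trans _ _ (\int[mu]_x (`|M|%:E * (gE e x)%:E))%E).
  apply: ge0_le_integral => //.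
  - by apply: mcompT => //; exact/mEFinP.
  - by apply: measurable_funeM; apply/mEFinP; exact: measurable_gE.
  - move=> x _ /=; rewrite lee_fin; apply: (le_trans (hM x)).
    by rewrite ler_wpM2r ?gE_ge0// ler_norm.
rewrite ge0_integralZl//.
- by rewrite lte_mul_pinfty// gE_integrable.
- by apply/mEFinP; exact: measurable_gE.
- by move=> x _; rewrite lee_fin gE_ge0.
Qed.

Let f (s : R) (x : borel X) := gE a x * cos (b * y x * s).
Let J s := \int[mu]_x f s x.
(** The function [gE a x * sin (b * s * y x)] translated by [lin (t *: v)], with the translate
    expanded through [gE_lin_shift]. *)
Let g (s t : R) (x : borel X) := gE a x * (expR (b * y x * t - a * n * t ^+ 2) * sin (b * s * y x - b * s * n * t)).

Lemma is_derive_of_cvg (h : R -> R) (s l : R) : (e^-1 *: (h (e + s) - h s)) @[e --> 0^'] --> l -> is_derive s (1 : R) h l.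
Proof.
move=> hl; have hl' : (e^-1 *: (h (e *: (1 : R) + s) - h s)) @[e --> 0^'] --> l.
  by under eq_fun do rewrite /GRing.scale /= mulr1; exact: hl.
apply: DeriveDef; first by apply/cvg_ex; exists l.
by rewrite /derive; apply: cvg_lim => //; exact: hl'.
Qed.

Lemma measurable_gEy (h : R -> R) : continuous h -> mfunT (fun x : borel X => gE a x * h (y x)).
Proof.
move=> ch; apply: measurable_funM; first exact: measurable_gE.
apply: ccont_mR => x; apply: continuous_comp; [exact: cont_y|exact: ch].
Qed.

Lemma ysin_le x t : `|b * y x * sin t| <= b * `|y x|.
Proof.
rewrite normrM; apply: (@le_trans _ _ (`|b * y x|)); first by rewrite ler_piMr// ler_norml sin_geN1 sin_le1.
by rewrite normrM gtr0_norm.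
Qed.

Lemma J_derive s : is_derive s (1 : R) J (\int[mu]_x (- (gE a x * (b * y x) * sin (b * y x * s)))).
Proof.
apply: is_derive_of_cvg.
have pE t x : partial1of2 f t x = - (gE a x * (b * y x) * sin (b * y x * t)).
  by rewrite /partial1of2 /f derive1E; have [_ ->] := der_cos (gE a x) (b * y x) t.
have -> : \int[mu]_x (- (gE a x * (b * y x) * sin (b * y x * s))) = \int[mu]_x partial1of2 f s x.
  by apply: eq_Rintegral => x _; rewrite pE.
have y1 (x : X) : b * `|y x| <= expR (2 * (b * `|y x|)).
  have t0 : 0 <= b * `|y x| by apply: mulr_ge0 => //; exact: ltW.
  have := expR_ge1Dx (2 * (b * `|y x|)); apply: le_trans; lra.
apply: (@cvg_differentiation_under_integral R _ (borel X) mu f setT measurableT s (s - 1) (s + 1) _ _ _ (fun x => gE a x * (b * `|y x|))).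
- by rewrite /= in_itv /= ltrBlDr ltrDl ltr01.
- move=> t _; apply: (gauss_integrable (e := a) (M := 1)) => // [|x].
    apply: (measurable_gEy (h := fun u => cos (b * u * t))) => u.
    apply: (@continuous_comp _ _ _ (fun u => b * u * t) cos); last exact: continuous_cos.
    by apply: cvgM; [apply: cvgM; [exact: cvg_cst|exact: cvg_id]|exact: cvg_cst].
  by rewrite mul1r normrM ger0_norm ?gE_ge0// ler_piMr ?gE_ge0// ler_norml cos_geN1 cos_le1.
- by move=> t x _ _; have [] := der_cos (gE a x) (b * y x) t.
- by move=> x; apply: mulr_ge0; [exact: gE_ge0|apply: mulr_ge0 => //; exact: ltW].
- apply: (gauss_integrable (e := a / 2) (M := expR (8 * a * n))) => [|| x].
  + by rewrite divr_gt0.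
  + apply: (measurable_gEy (h := fun u => b * `|u|)) => u.
    by apply: cvgM; [exact: cvg_cst|exact: norm_continuous].
  + rewrite ger0_norm; last by apply: mulr_ge0; [exact: gE_ge0|apply: mulr_ge0 => //; exact: ltW].
    apply: (le_trans _ (exp_y_bound x)); rewrite mulrC; apply: ler_wpM2r => //; exact: gE_ge0.
- move=> t x _ _; rewrite pE normrN -mulrA normrM (ger0_norm (gE_ge0 a x)) ler_wpM2l ?gE_ge0//.
  exact: ysin_le.
Qed.

(** A substitute for integration by parts: by invariance of the measure the integral of [g s t] does
    not depend on t, and the identity is its derivative at t = 0. *)
Lemma ibp_identity s : \int[mu]_x (gE a x * (b * y x * sin (b * y x * s) - b * s * n * cos (b * y x * s))) = 0.
Proof.
pose h (t : R) := \int[mu]_x g s t x.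
have hE t : h t = h 0.
  have mg0 : mfunT (g s 0).
    apply: (measurable_gEy (h := fun u => expR (b * u * 0 - a * n * 0 ^+ 2) * sin (b * s * u - b * s * n * 0))) => u.
    apply: cvgM.
      apply: (@continuous_comp _ _ _ (fun u => b * u * 0 - a * n * 0 ^+ 2) expR); last exact: continuous_expR.
      by apply: cvgB; [apply: cvgM; [apply: cvgM; [exact: cvg_cst|exact: cvg_id]|exact: cvg_cst]|exact: cvg_cst].
    apply: (@continuous_comp _ _ _ (fun u => b * s * u - b * s * n * 0) sin); last exact: continuous_sin.
    by apply: cvgB; [apply: cvgM; [exact: cvg_cst|exact: cvg_id]|exact: cvg_cst].
  have := Rintegral_mp (mshf hX (- lin (t *: v))) (shift_mp hX (- lin (t *: v))) mg0.
  rewrite -/(h 0) => <-; apply: eq_Rintegral => x _.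
  have yE : y (x - lin (t *: v)) = y x - t * n by rewrite /y gs_rB (gs_rlin gs) dotDr dotNr dotZr.
  rewrite /g gE_lin_shift yE mulr0 expr0n /= mulr0 subrr expR0 mul1r mulr0 subr0 -mulrA.
  have -> : b * (y x * t) - a * n * t ^+ 2 = b * t * y x - a * t ^+ 2 * n by ring.
  have -> : b * s * (y x - t * n) = b * s * y x - b * s * n * t by ring.
  by rewrite mulrA.
have pE t x : partial1of2 (g s) t x = gE a x * (expR (b * y x * t - a * n * t ^+ 2) *
   ((b * y x - 2 * (a * n) * t) * sin (b * s * y x - b * s * n * t) - b * s * n * cos (b * s * y x - b * s * n * t))).
  by rewrite /partial1of2 /g derive1E; have [_ ->] := der_exp_sin (gE a x) (b * y x) (a * n) (b * s * y x) (b * s * n) t.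
have -> : \int[mu]_x (gE a x * (b * y x * sin (b * y x * s) - b * s * n * cos (b * y x * s))) = \int[mu]_x partial1of2 (g s) 0 x.
  apply: eq_Rintegral => x _; rewrite pE !mulr0 expr0n /= mulr0 !subr0 expR0 mul1r.
  by rewrite (_ : b * s * y x = b * y x * s)//; ring.
pose C := b * n + `|b * s * n|; pose M := (1 + C) * expR (8 * a * n).
have C0 : 0 <= C by rewrite addr_ge0// mulr_ge0// ltW.
have expb t x : `|t| <= 1 -> expR (b * y x * t - a * n * t ^+ 2) <= expR (b * `|y x|).
  move=> t1; rewrite ler_expR; apply: (@le_trans _ _ (b * y x * t)).
    by rewrite gerBl mulr_ge0 ?sqr_ge0// mulr_ge0// ltW.
  apply: (le_trans (ler_norm _)); rewrite normrM [`|b * y x|]normrM (gtr0_norm b0) ler_piMr//.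
  by apply: mulr_ge0 => //; exact: ltW.
have t1 (t : R) : `]0 - 1, 0 + 1[%classic t -> `|t| <= 1.
  by rewrite /= in_itv /= sub0r add0r => /andP[h1 h2]; rewrite ler_norml !ltW.
have bd t x : `|t| <= 1 -> `|g s t x| <= M * gE (a / 2) x /\ `|partial1of2 (g s) t x| <= M * gE (a / 2) x.
  move=> tl; have PB := poly_exp_y_bound x C0.
  have y0 : 0 <= b * `|y x| by apply: mulr_ge0 => //; exact: ltW.
  split.
    rewrite /g normrM (ger0_norm (gE_ge0 a x)) normrM (ger0_norm (expR_ge0 _)).
    apply: (@le_trans _ _ (expR (2 * (b * `|y x|)) * gE a x)).
      rewrite mulrC ler_wpM2r ?gE_ge0//; apply: (@le_trans _ _ (expR (b * `|y x|) * 1)).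
        by apply: ler_pM; rewrite ?expR_ge0// ?expb// ler_norml sin_geN1 sin_le1.
      by rewrite mulr1 ler_expR ler_peMl// ler1n.
    apply: (le_trans (exp_y_bound x)); apply: ler_wpM2r; first exact: gE_ge0.
    by rewrite ler_peMl ?expR_ge0// lerDl.
  apply: (le_trans _ PB); rewrite pE normrM (ger0_norm (gE_ge0 a x)) ler_wpM2l ?gE_ge0//.
  rewrite normrM (ger0_norm (expR_ge0 _)); apply: ler_pM; rewrite ?expR_ge0//; first exact: expb.
  apply: (le_trans (ler_normB _ _)); rewrite /C addrA; apply: lerD; last first.
    by rewrite normrM ler_piMr// ler_norml cos_geN1 cos_le1.
  rewrite normrM; apply: (@le_trans _ _ (`|b * y x - 2 * (a * n) * t|)).
    by rewrite ler_piMr// ler_norml sin_geN1 sin_le1.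
  apply: (le_trans (ler_normB _ _)); rewrite normrM (ger0_norm (ltW b0)) lerD2l.
  have bn0 : 0 <= 2 * (a * n) by rewrite !mulr_ge0// ltW.
  by rewrite normrM (ger0_norm bn0) /b -(mulrA 2) ler_piMr.
have dM : mu.-integrable setT (EFin \o (fun x : borel X => M * gE (a / 2) x)).
  apply: (gauss_integrable (e := a / 2) (M := M)) => [||x].
  - by rewrite divr_gt0.
  - by apply: measurable_funM => //; exact: measurable_gE.
  - by rewrite ger0_norm// mulr_ge0 ?gE_ge0// mulr_ge0 ?expR_ge0// addr_ge0.
have dd := @cvg_differentiation_under_integral R _ (borel X) mu (g s) setT measurableT 0 (0 - 1) (0 + 1) _ _ _ (fun x => M * gE (a / 2) x) _ dM.
have {}dd : e^-1 *: (h (e + 0) - h 0) @[e --> 0^'] --> \int[mu]_x partial1of2 (g s) 0 x.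
  apply: dd.
  - by rewrite /= in_itv /= sub0r add0r ltrN10 ltr01.
  - move=> t /t1 tl; apply: (gauss_integrable (e := a / 2) (M := M)) => [||x]; last by have [] := bd t x tl.
      by rewrite divr_gt0.
    apply: (measurable_gEy (h := fun u => expR (b * u * t - a * n * t ^+ 2) * sin (b * s * u - b * s * n * t))) => u.
    apply: cvgM.
      apply: (@continuous_comp _ _ _ (fun u => b * u * t - a * n * t ^+ 2) expR); last exact: continuous_expR.
      by apply: cvgB; [apply: cvgM; [apply: cvgM; [exact: cvg_cst|exact: cvg_id]|exact: cvg_cst]|exact: cvg_cst].
    apply: (@continuous_comp _ _ _ (fun u => b * s * u - b * s * n * t) sin); last exact: continuous_sin.
    by apply: cvgB; [apply: cvgM; [exact: cvg_cst|exact: cvg_id]|exact: cvg_cst].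
  - by move=> t x _ _; have [] := der_exp_sin (gE a x) (b * y x) (a * n) (b * s * y x) (b * s * n) t.
  - by move=> x; rewrite mulr_ge0 ?gE_ge0// mulr_ge0 ?expR_ge0// addr_ge0.
  - by move=> t x /t1 tl _; have [] := bd t x tl.
have d0 : e^-1 *: (h (e + 0) - h 0) @[e --> 0^'] --> (0 : R).
  by under eq_fun do rewrite hE subrr scaler0; exact: cvg_cst.
exact: (cvg_unique _ dd d0).
Qed.

Lemma J_ode s : is_derive s (1 : R) J (- (b * n * s * J s)).
Proof.
apply: (is_derive_eq (J_derive s)).
have iS : mu.-integrable setT (EFin \o (fun x : borel X => gE a x * (b * y x * sin (b * y x * s)))).
  apply: (gauss_integrable (e := a / 2) (M := expR (8 * a * n))) => [||x].
  - by rewrite divr_gt0.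
  - apply: (measurable_gEy (h := fun u => b * u * sin (b * u * s))) => u.
    apply: cvgM; first by apply: cvgM; [exact: cvg_cst|exact: cvg_id].
    apply: (@continuous_comp _ _ _ (fun u => b * u * s) sin); last exact: continuous_sin.
    by apply: cvgM; [apply: cvgM; [exact: cvg_cst|exact: cvg_id]|exact: cvg_cst].
  - apply: (le_trans _ (exp_y_bound x)); rewrite normrM (ger0_norm (gE_ge0 a x)) mulrC ler_wpM2r ?gE_ge0//.
    have t0 : 0 <= b * `|y x| by apply: mulr_ge0 => //; exact: ltW.
    apply: (le_trans (ysin_le _ _)).
    have := expR_ge1Dx (2 * (b * `|y x|)); apply: le_trans; lra.
have iC : mu.-integrable setT (EFin \o (fun x : borel X => gE a x * cos (b * y x * s))).
  apply: (gauss_integrable (e := a) (M := 1)) => // [|x].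
    apply: (measurable_gEy (h := fun u => cos (b * u * s))) => u.
    apply: (@continuous_comp _ _ _ (fun u => b * u * s) cos); last exact: continuous_cos.
    by apply: cvgM; [apply: cvgM; [exact: cvg_cst|exact: cvg_id]|exact: cvg_cst].
  by rewrite mul1r normrM ger0_norm ?gE_ge0// ler_piMr ?gE_ge0// ler_norml cos_geN1 cos_le1.
have := ibp_identity s.
have -> : (fun x => gE a x * (b * y x * sin (b * y x * s) - b * s * n * cos (b * y x * s))) =
   (fun x => gE a x * (b * y x * sin (b * y x * s)) - b * s * n * (gE a x * cos (b * y x * s))).
  by apply/funext => x; ring.
rewrite RintegralB//; last first.
  by have := integrableZl measurableT (b * s * n) iC.
rewrite RintegralZl// => /eqP; rewrite subr_eq0 => /eqP IE.
have -> : (fun x => - (gE a x * (b * y x) * sin (b * y x * s))) = (fun x => -1 * (gE a x * (b * y x * sin (b * y x * s)))).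
  by apply/funext => x; ring.
by rewrite RintegralZl// IE /J /f; ring.
Qed.

(** By [J_ode], [J] times the inverse Gaussian has derivative 0, hence equals its value at 0. *)
Lemma J_formula s : J s = \int[mu]_x gE a x * expR (- (a * n * s ^+ 2)).
Proof.
pose h (t : R) := J t * expR (a * n * t ^+ 2).
have hd t : is_derive t (1 : R) h 0.
  have d1 : is_derive t (1 : R) (fun t : R => a * n * t ^+ 2) (2 * (a * n) * t).
    by apply: is_derive_eq; rewrite /GRing.scale /=; ring.
  have d2 := is_derive1_comp (is_derive_expR _) d1.
  have d3 := is_deriveM (J_ode t) d2.
  apply: (is_derive_eq d3); rewrite /GRing.scale /= /b; ring.
have := is_derive_0_is_cst s 0 hd.
rewrite /h expr0n /= mulr0 expR0 mulr1 => hs.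
have -> : \int[mu]_x gE a x = J 0.
  by apply: eq_Rintegral => x _; rewrite /f mulr0 cos0 mulr1.
by rewrite -hs -mulrA -expRD subrr expR0 mulr1.
Qed.

Variable chi : X -> R[i].
Hypotheses (chi_cont : continuous (chi : X -> R[i]^o)) (chiD : forall x t, chi (x + t) = chi x * chi t)
  (chi1 : forall x, normc (chi x) = 1).

Lemma cinteg_gE : @cinteg _ (borel X) R mu (fun x => (gE a x)%:C).
Proof.
split; first by apply: cmeas_real; exact: measurable_gE.
under eq_integral do rewrite normc_real (ger0_norm (gE_ge0 a _)).
exact: gE_integrable.
Qed.

Lemma cinteg_gE_chi : @cinteg _ (borel X) R mu (fun x => (gE a x)%:C * (chi x)^*).
Proof.
split.
  apply: cmeasM; first by apply: cmeas_real; exact: measurable_gE.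
  by apply: cmeas_conj; exact: continuous_cmeasurable.
under eq_integral do rewrite normcM' normc_conj chi1 mulr1 normc_real (ger0_norm (gE_ge0 a _)).
exact: gE_integrable.
Qed.

(** Translation by [k] leaves the Gaussian unchanged and multiplies the integral by the conjugate of
    [chi k], which differs from 1. *)
Lemma gauss_fourier0 k : K k -> r k = 0 -> chi k != 1 -> cintegral mu (fun x : borel X => (gE a x)%:C * (chi x)^*) = 0.
Proof.
move=> Kk rk ck; set I := cintegral _ _.
have : I = (chi k)^* * I.
  rewrite -cintZ; last exact: cinteg_gE_chi.
  rewrite /I -(cint_shift hX k); last by have [] := cinteg_gE_chi.
  apply: cint_ext => x; have -> : gE a (x + k) = gE a x by rewrite /gE (gs_rD gs) rk addr0 indic_KDr.
  by rewrite chiD rmorphM /=; ring.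
move=> /eqP; rewrite -subr_eq0 -{1}(mul1r I) -mulrBl mulf_eq0 => /orP[|/eqP //].
rewrite subr_eq0 => /eqP h; move: ck; rewrite -(conjCK (chi k)) -h rmorph1 eqxx //.
Qed.

Hypothesis chiE : forall x, K x -> chi x = cis (2 * pi * dot v (r x)).

(** The cosine part is [J] at s = pi / a; the sine part is odd and vanishes by reflection. *)
Lemma gauss_fourier1 : cintegral mu (fun x : borel X => (gE a x)%:C * (chi x)^*) =
  (\int[mu]_x gE a x * expR (- (pi ^+ 2 / a * n)))%:C.
Proof.
have fE x : (gE a x)%:C * (chi x)^* = gE a x * cos (b * y x * (pi / a)) -i* (gE a x * sin (b * y x * (pi / a))).
  have [Kx|nKx] := pselect (K x); last by rewrite (gE_nK _ nKx) !mul0r oppr0.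
  have -> : b * y x * (pi / a) = 2 * pi * dot v (r x) by rewrite /b /y; field; rewrite gt_eqF.
  rewrite chiE//; apply: complexP; rewrite ?ReM ?ImM ?Re_conj ?Im_conj /=; ring.
rewrite (funext fE : (fun x : borel X => _) = _).
have mS : mfunT (fun x : borel X => gE a x * sin (b * y x * (pi / a))).
  apply: (measurable_gEy (h := fun u => sin (b * u * (pi / a)))) => u.
  apply: (@continuous_comp _ _ _ (fun u => b * u * (pi / a)) sin); last exact: continuous_sin.
  by apply: cvgM; [apply: cvgM; [exact: cvg_cst|exact: cvg_id]|exact: cvg_cst].
have iS : mu.-integrable setT (EFin \o (fun x : borel X => gE a x * sin (b * y x * (pi / a)))).
  apply: (gauss_integrable (e := a) (M := 1)) => // x.
  by rewrite mul1r normrM ger0_norm ?gE_ge0// ler_piMr ?gE_ge0// ler_norml sin_geN1 sin_le1.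
have S0 : \int[mu]_x (gE a x * sin (b * y x * (pi / a))) = 0.
  have h := Rintegral_mp (measurable_opp hX) (opp_mp hX) mS.
  have : \int[mu]_x (gE a x * sin (b * y x * (pi / a))) = - \int[mu]_x (gE a x * sin (b * y x * (pi / a))).
    rewrite -{1}h -mulN1r -RintegralZl//; apply: eq_Rintegral => x _.
    have -> : y (- x) = - y x by rewrite /y gs_rN dotNr.
    by rewrite gEN mulrN mulNr sinN mulrN mulN1r.
  lra.
apply: complexP => /=.
  rewrite -[LHS]/(J (pi / a)) J_formula; congr (_ * expR (- _)).
  by field; rewrite gt_eqF.
under eq_Rintegral do rewrite -mulN1r.
by rewrite RintegralZl// S0 mulr0.
Qed.
End GaussFourier.

(** By [gE_prod] the product of the two Gaussians is a single Gaussian about the midpoint; centring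
    it contributes a unimodular factor. *)
Lemma gauss_window_stft (a : R) (chi : X -> R[i]) (x : X) : 0 < a -> continuous (chi : X -> R[i]^o) ->
  (forall x t, chi (x + t) = chi x * chi t) -> (forall x, normc (chi x) = 1) ->
  normc (cintegral mu (fun t : borel X => (gE a t)%:C * (chi t * (gE a (t - x)%R)%:C)^*)) =
  gE (a / 2) x * normc (cintegral mu (fun t : borel X => (gE (2 * a) t)%:C * (chi t)^*)).
Proof.
move=> a0 cc cD c1; have a20 : 0 < 2 * a by rewrite mulr_gt0.
pose z := lin (2^-1 *: r x).
have ic := cinteg_gE_chi a20 cc c1.
have -> : (fun t : borel X => (gE a t)%:C * (chi t * (gE a (t - x)%R)%:C)^*) =
  (fun t => ((gE (a / 2) x)%:C * (chi z)^*) * ((gE (2 * a) (t - z))%:C * (chi (t - z))^*)); last first.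
  rewrite cintZ; last exact: (cinteg_shift hX (- z) ic).
  rewrite (cint_shift hX (- z) (f := fun t => (gE (2 * a) t)%:C * (chi t)^*)); last by have [] := ic.
  by rewrite !normcM' normc_conj c1 mulr1 normc_real (ger0_norm (gE_ge0 _ _)).
apply/funext => t; rewrite conjcM conjRC.
have -> : (gE a t)%:C * ((chi t)^* * (gE a (t - x))%:C) = (gE a t * gE a (t - x))%:C * (chi t)^*.
  by rewrite RCM; ring.
have -> : chi t = chi (t - z) * chi z by rewrite -cD subrK.
by rewrite gE_prod RCM -/z conjcM; ring.
Qed.
End GaussSystem.

(** * Characters of R^n and subgroups of the circle *)

Section Cis.
Variable R : realType.
Implicit Types s t : R.
Lemma cisD s t : cis (s + t) = cis s * cis t.
Proof. by apply: complexP; rewrite ?ReM ?ImM /= ?cosD ?sinD//; ring. Qed.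
Lemma cis0 : cis 0 = 1 :> R[i].
Proof. by rewrite /cis cos0 sin0. Qed.
Lemma normc_cis t : normc (cis t) = 1.
Proof. by rewrite /= cos2Dsin2 sqrtr1. Qed.
Lemma continuous_cis : continuous (@cis R : R -> R[i]^o).
Proof. by move=> t; apply: continuousC; [exact: continuous_cos|exact: continuous_sin]. Qed.
Lemma cis_pi : cis pi = -1 :> R[i].
Proof. by apply: complexP; rewrite /= ?cospi ?sinpi ?ReN ?ImN ?oppr0. Qed.

Lemma sqr_eq_pos (u w : R[i]) : u * u = w * w -> 0 < complex.Re u -> 0 < complex.Re w -> u = w.
Proof.
move=> h u0 w0; have : (u - w) * (u + w) = 0 by rewrite mulrDr !mulrBl h; ring.
move=> /eqP; rewrite mulf_eq0 => /orP[|]; first by rewrite subr_eq0 => /eqP.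
move=> /eqP/(congr1 (@complex.Re R)); rewrite ReD => /eqP; rewrite /= gt_eqF//.
by rewrite addr_gt0.
Qed.

Lemma unit_cis (z : R[i]) : normc z = 1 -> 0 < complex.Re z -> exists2 b : R, - (pi / 2) <= b <= pi / 2 & z = cis b.
Proof.
case: z => x y /= h x0; have {}h : x ^+ 2 + y ^+ 2 = 1.
  by rewrite -(sqr_sqrtr (a := x ^+ 2 + y ^+ 2)) ?h ?expr1n// addr_ge0 ?sqr_ge0.
have y1 : -1 <= y <= 1.
  by rewrite -ler_norml -(ler_pXn2r (n := 2))// ?nnegrE// real_normK ?num_real// expr1n -h lerDr sqr_ge0.
exists (asin y); first by rewrite asin_geNpi2// asin_lepi2.
rewrite /cis cos_asin// asinK ?in_itv//=; congr (_ +i* _).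
by rewrite -h addrK sqrtr_sqr gtr0_norm.
Qed.

(** [g] is 1 at the multiples of each d / 2^n. A value other than 1 at [t] would recur within one
    such step of 0, against continuity there. *)
Lemma trivial_character_half (g : R -> R[i]) (d : R) : continuous (g : R -> R[i]^o) -> (forall s t, g (s + t) = g s * g t) ->
  0 < d -> (forall n, g (d / 2 ^+ n) = 1) -> forall t, g t = 1.
Proof.
move=> cg gD d0 gd.
have g0 : g 0 = 1.
  have /eqP := gD 0 (d / 2 ^+ 0); rewrite add0r gd mulr1 => /eqP //.
have gn (e : R) n : g e = 1 -> g (n%:R * e) = 1.
  move=> e1; elim: n => [|n IH]; first by rewrite mul0r.
  by rewrite -natr1 mulrDl mul1r gD IH e1 mulr1.
have pos t : 0 <= t -> g t = 1.
  move=> t0; apply: contrapT => nt.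
  have e0 : 0 < normc (g 0 - g t).
    rewrite lt_neqAle normc_ge0 andbT eq_sym; apply/negP => /eqP; rewrite g0 => h.
    by apply: nt; apply/eqP; rewrite eq_sym -subr_eq0 -normc_eq0 h.
  have /nbhs_ballP[e /= e1 eP] := ccont_nbhs (cg 0) e0.
  have [n hn] : exists n, d / 2 ^+ n < e.
    exists (Num.bound (d / e)); rewrite ltr_pdivrMr ?exprn_gt0// mulrC -ltr_pdivrMr//.
    apply: (lt_le_trans (archi_boundP (ltW (divr_gt0 d0 e1)))).
    by rewrite -natrX ler_nat ltnW// ltn_expl.
  set st := d / 2 ^+ n in hn; have st0 : 0 < st by rewrite divr_gt0 ?exprn_gt0.
  pose k := Num.truncn (t / st); have /andP[k1 k2] := truncn_itv (divr_ge0 t0 (ltW st0)).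
  have tE : t = (t - k%:R * st) + k%:R * st by ring.
  have gt : g t = g (t - k%:R * st) by rewrite {1}tE gD (gn _ k (gd n)) mulr1.
  suff inb : ball 0 e (t - k%:R * st) by have := eP _ inb; rewrite /= -gt ltxx.
  rewrite /ball /= sub0r normrN ger0_norm; last by rewrite subr_ge0 -ler_pdivlMr.
  apply: (le_lt_trans _ hn).
  by move: k2; rewrite ltr_pdivrMr// -natr1 mulrDl mul1r -ltrBlDl => /ltW.
move=> t; have [t0|t0] := leP 0 t; first exact: pos.
have := gD t (- t); rewrite subrr g0 (pos (- t)) ?mulr1 ?oppr_ge0 ?ltW//.
Qed.

(** On [0, d] the values of [h] have positive real part, so the value at d / 2^(n + 1) is determined
    by its square. This makes [h] agree with a [cis] at all d / 2^n, and [trivial_character_half]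
    applies to the quotient. *)
Lemma real_character (h : R -> R[i]) : continuous (h : R -> R[i]^o) -> (forall s t, h (s + t) = h s * h t) ->
  (forall t, normc (h t) = 1) -> exists b : R, forall t, h t = cis (b * t).
Proof.
move=> ch hD h1.
have h00 : h 0 = 1.
  have n0 : h 0 != 0 by rewrite -normc_eq0 h1 oner_eq0.
  by apply: (mulfI n0); rewrite -hD addr0 mulr1.
have /nbhs_ballP[d' /= d'0 dP] := ccont_nbhs (ch 0) (ltr01 : (0 : R) < 1).
pose d := d' / 2; have d0 : 0 < d by rewrite divr_gt0.
have pos t : 0 <= t <= d -> 0 < complex.Re (h t).
  move=> /andP[t0 td]; have := dP t; rewrite /= h00 => H.
  have {}H : normc (1 - h t) < 1.
    apply: H; rewrite /ball /= sub0r normrN ger0_norm//; apply: (le_lt_trans td).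
    by rewrite ltr_pdivrMr// ltr_pMr// ltr1n.
  have := le_lt_trans (Re_le_normc _) H; rewrite ReD ReN /= ltr_norml => /andP[_].
  by rewrite ltrBlDr -ltrBlDl subrr.
have [|b /andP[b1 b2] hb] := unit_cis (h1 d); first by apply: pos; rewrite lexx ltW.
have p0 : 0 < (pi : R) by exact: pi_gt0.
have dn n : 0 <= d / 2 ^+ n <= d.
  have q0 : 0 < 2 ^+ n :> R by rewrite exprn_gt0.
  rewrite (divr_ge0 (ltW d0) (ltW q0)) ler_pdivrMr// ler_peMr ?(ltW d0)//.
  by rewrite -natrX ler1n expn_gt0.
have hn n : h (d / 2 ^+ n) = cis (b / 2 ^+ n).
  elim: n => [|n IH]; first by rewrite expr0 !divr1.
  apply: sqr_eq_pos.
  - have half (x : R) : x / 2 ^+ n.+1 + x / 2 ^+ n.+1 = x / 2 ^+ n.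
      by rewrite exprS; field; rewrite expf_neq0.
    by rewrite -hD -cisD !half.
  - exact: pos.
  - rewrite /=; apply: cos_gt0_pihalf.
    have q0 : 0 < 2 ^+ n.+1 :> R by rewrite exprn_gt0.
    have q1 : 2 <= 2 ^+ n.+1 :> R by rewrite exprS ler_peMr// -natrX ler1n expn_gt0.
    rewrite ltr_pdivlMr// ltr_pdivrMr//; apply/andP; split.
      apply: (lt_le_trans _ b1); rewrite mulNr ltrN2 -[ltLHS]mulr1 ltr_pM2l ?divr_gt0//.
      by apply: lt_le_trans q1; rewrite ltr1n.
    apply: (le_lt_trans b2); rewrite -[ltLHS]mulr1 ltr_pM2l ?divr_gt0//.
    by apply: lt_le_trans q1; rewrite ltr1n.
exists (b / d) => t.
pose g s := h s * cis (- (b / d * s)).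
have g1 : g t = 1.
  apply: (trivial_character_half (d := d) _ _ d0).
  - move=> s; apply: (@ccontM R _ h (fun s => cis (- (b / d * s)))); first exact: ch.
    apply: (@continuous_comp _ _ _ (fun s => - (b / d * s)) (@cis R : R -> R[i]^o)); last exact: continuous_cis.
    by apply: cvgN; apply: cvgM; [exact: cvg_cst|exact: cvg_id].
  - by move=> s u; rewrite /g hD mulrDr opprD cisD; ring.
  - move=> n; rewrite /g hn -cisD (_ : _ + _ = 0) ?cis0//; field.
    by rewrite expf_neq0// gt_eqF.
have := congr1 (fun z => z * cis (b / d * t)) g1; rewrite /g -mulrA -cisD addNr cis0 mulr1 mul1r //.
Qed.

(** By |1 - u|^2 + |1 + u|^2 = 4, squaring a unimodular u with |1 - u| < 1 at least triples |1 -
    u|^2; repeated squaring would leave the disc unless z = 1. *)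
Lemma no_small_subgroup (z : R[i]) : normc z = 1 -> (forall n, normc (1 - z ^+ n) < 1) -> z = 1.
Proof.
move=> z1 zn; apply: contrapT => nz.
pose e n := normc (1 - z ^+ (2 ^ n)) ^+ 2.
have step n : 3 * e n <= e n.+1.
  rewrite /e expnSr exprM; set u := z ^+ (2 ^ n).
  have u1 : normc u = 1.
    rewrite /u; elim: (2 ^ n)%N => [|k IH]; first by rewrite expr0 normc1.
    by rewrite exprS normcM' z1 IH mulr1.
  have -> : 1 - u ^+ 2 = (1 - u) * (1 + u) by ring.
  rewrite normcM' exprMn mulrC ler_wpM2l ?sqr_ge0//.
  have pE : normc (1 - u) ^+ 2 + normc (1 + u) ^+ 2 = 4.
    move: u1; case: (u) => a b /= h.
    have {}h : a ^+ 2 + b ^+ 2 = 1.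
      by rewrite -(sqr_sqrtr (a := a ^+ 2 + b ^+ 2)) ?h ?expr1n// addr_ge0 ?sqr_ge0.
    rewrite !sqr_sqrtr ?addr_ge0 ?sqr_ge0// sub0r add0r.
    have -> : (1 - a) ^+ 2 + (- b) ^+ 2 + ((1 + a) ^+ 2 + b ^+ 2) = 2 + 2 * (a ^+ 2 + b ^+ 2) by ring.
    by rewrite h; ring.
  have : normc (1 - u) ^+ 2 <= 1 by rewrite expr_le1 ?normc_ge0// ltW// /u zn.
  by move: pE; lra.
have e0 : 0 < e 0%N.
  rewrite /e expn0 expr1 exprn_gt0// lt_neqAle normc_ge0 andbT eq_sym normc_eq0.
  by rewrite subr_eq0 eq_sym; apply/eqP.
have en n : 3 ^+ n * e 0%N <= e n.
  elim: n => [|n IH]; first by rewrite expr0 mul1r.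
  by rewrite exprS -mulrA; apply: (le_trans _ (step n)); rewrite ler_wpM2l.
have := en (Num.bound (e 0%N)^-1); apply/negP; rewrite -ltNge.
apply: (@lt_le_trans _ _ 1); first by rewrite /e expr_lt1 ?normc_ge0.
rewrite -ler_pdivrMr// div1r; apply: (le_trans (ltW (archi_boundP _))); first by rewrite invr_ge0 ltW.
by rewrite -natrX ler_nat ltnW// ltn_expl.
Qed.

Variable n : nat.
Lemma rV_character (h : 'rV[R]_n -> R[i]) : continuous (h : 'rV[R]_n -> R[i]^o) -> (forall u v, h (u + v) = h u * h v) ->
  (forall v, normc (h v) = 1) -> exists w : 'rV[R]_n, forall v, h v = cis (2 * pi * dot w v).
Proof.
move=> ch hD h1.
have h00 : h 0 = 1.
  have n0 : h 0 != 0 by rewrite -normc_eq0 h1 oner_eq0.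
  by apply: (mulfI n0); rewrite -hD addr0 mulr1.
have /choice[b bP] (k : 'I_n) : exists b : R, forall t, h (t *: delta_mx 0 k) = cis (b * t).
  apply: real_character => [t|s t|t]; last exact: h1.
    apply: (@continuous_comp _ _ _ (fun t : R => t *: delta_mx 0 k : 'rV[R]_n) (h : _ -> R[i]^o)); last exact: ch.
    exact: scalel_continuous.
  by rewrite scalerDl hD.
exists (\row_k (b k / (2 * pi))) => v.
have p0 : (pi : R) != 0 by rewrite gt_eqF// pi_gt0.
have -> : 2 * pi * dot (\row_k (b k / (2 * pi))) v = \sum_k (b k * v 0 k).
  by rewrite mulr_sumr; apply: eq_bigr => k _; rewrite mxE mulrA [2 * pi * _]mulrC divfK// mulf_neq0// pnatr_eq0.
rewrite {1}(row_sum_delta v).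
elim/big_ind2 : _ => [|x1 x2 y1 y2 e1 e2|k _]; first by rewrite h00 cis0.
  by rewrite hD cisD e1 e2.
exact: bP.
Qed.

Lemma cis_dot_inj (w w' : 'rV[R]_n) : (forall v, cis (2 * pi * dot w v) = cis (2 * pi * dot w' v)) -> w = w'.
Proof.
move=> h; apply/rowP => k; apply: contrapT => nk.
pose D := w 0 k - w' 0 k; have D0 : D != 0 by rewrite subr_eq0; apply/eqP.
(* With this [v] the two phases differ by exactly pi. *)
pose v : 'rV[R]_n := (2 * D)^-1 *: delta_mx 0 k.
have dv (u : 'rV[R]_n) : dot u v = u 0 k / (2 * D).
  rewrite /dot (bigD1 k)//= big1 ?addr0 => [|j jk]; rewrite !mxE ?eqxx ?mulr1//.
  by rewrite (negbTE jk) !mulr0.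
have := h v; rewrite !dv => e1.
have : cis (2 * pi * (w 0 k / (2 * D)) - 2 * pi * (w' 0 k / (2 * D))) = 1.
  by rewrite cisD e1 -cisD subrr cis0.
have -> : 2 * pi * (w 0 k / (2 * D)) - 2 * pi * (w' 0 k / (2 * D)) = pi.
  have -> : 2 * pi * (w 0 k / (2 * D)) - 2 * pi * (w' 0 k / (2 * D)) = pi * (D / D).
    by rewrite /D; field.
  by rewrite divff ?mulr1.
rewrite cis_pi => /(congr1 (@complex.Re R)); rewrite ReN /=; lra.
Qed.
End Cis.

(** * Gaussian coordinates on the group and on its dual, from the structure theorem *)

Section Structure.
Variables (R : realType) (G : topologicalZmodType) (G_lca : is_lca G) (s : lca_structure R G).
Local Notation D := (dual R G).
Local Notation d := (rdim s).
Local Notation V := 'rV[R]_d.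
Local Notation G0 := (core s).
Local Notation crd := (Defs.coord s).
Local Notation coordi := (Defs.coord_inv (l := s)).

Lemma coord0 : crd 0 = 0.
Proof. by apply: (addrI (crd 0)); rewrite -coordD !addr0. Qed.
Lemma coordiD u v : coordi (u + v) = coordi u + coordi v.
Proof. by apply: (can_inj (coordK s)); rewrite coordD !coord_invK. Qed.
Lemma coordi0 : coordi 0 = 0.
Proof. by rewrite -coord0 coordK. Qed.

Definition iV (v : V) : G := coordi (v, 0).
Definition iC (k : G0) : G := coordi (0, k).
Definition rG (x : G) : V := (crd x).1.
Definition KG : set G := [set x | cpt (crd x).2].

Lemma continuous_iV : continuous iV.
Proof.
move=> v; apply: (@continuous_comp _ _ _ (fun v : V => (v, 0 : G0)) (coordi)); last exact: coord_inv_continuous.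
by apply: (cpair (f := fun v : V => v) (g := fun _ : V => 0 : G0)); [move=> t; exact: cvg_id|exact: cst_continuous].
Qed.
Lemma continuous_iC : continuous iC.
Proof.
move=> v; apply: (@continuous_comp _ _ _ (fun v : G0 => (0 : V, v)) (coordi)); last exact: coord_inv_continuous.
by apply: (cpair (f := fun v : G0 => 0 : V) (g := fun v : G0 => v)) => t; [exact: cvg_cst|exact: cvg_id].
Qed.
Lemma iVD u v : iV (u + v) = iV u + iV v.
Proof.
rewrite -coordiD; congr (coordi _); change ((u + v, 0) = (u + v, (0 : G0) + 0)).
by rewrite addr0.
Qed.
Lemma iCD u v : iC (u + v) = iC u + iC v.
Proof.
rewrite -coordiD; congr (coordi _); change ((0, u + v) = ((0 : V) + 0, u + v)).
by rewrite addr0.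
Qed.
Lemma coord_split x : x = iV (crd x).1 + iC (crd x).2.
Proof.
rewrite -coordiD -[LHS](coordK s); congr coordi; case: (crd x) => a b.
by congr (_, _); rewrite ?addr0 ?add0r.
Qed.
Lemma coord_iV v : crd (iV v) = (v, 0). Proof. by rewrite coord_invK. Qed.
Lemma coord_iC v : crd (iC v) = (0, v). Proof. by rewrite coord_invK. Qed.

Lemma continuous_rG : continuous rG.
Proof. by move=> x; apply: (@continuous_comp _ _ _ (crd) fst); [exact: Defs.coord_continuous|exact: cvg_fst]. Qed.

Lemma gauss_sys_G (mu : sfm R G) : is_haar mu -> gauss_sys mu rG iV KG.
Proof.
move=> [_ mu_fin _].
have oK : open KG.
  apply: (continuousP _).1; last exact: cpt_open.
  by move=> x; apply: (@continuous_comp _ _ _ (crd) snd); [exact: Defs.coord_continuous|exact: cvg_snd].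
split => //.
- exact: continuous_rG.
- by move=> x y; rewrite /rG coordD.
- exact: iVD.
- by move=> v; rewrite /rG coord_iV.
- by rewrite /KG /= coord0; exact: cpt0.
- move=> x y Kx Ky; rewrite /KG /=.
  have -> : (crd (x - y)).2 = (crd x).2 - (crd y).2.
    have h := coordD s (x - y) y; rewrite subrK in h.
    by rewrite h /= addrK.
  exact: cptB.
- by move=> v; rewrite /KG /= coord_iV; exact: cpt0.
- exists 1; split => //.
  pose C : set G := [set coordi z | z in [set v : V | dot v v <= 1 ^+ 2] `*` @cpt _ _ s].
  have cC : compact C.
    apply: continuous_compact; first by apply: continuous_subspaceT; exact: coord_inv_continuous.
    by apply: compact_setX; [exact: compact_dot_ball|exact: cpt_compact].
  apply: (le_lt_trans _ (mu_fin C cC)); apply: le_measure; rewrite ?inE.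
  + have -> : [set x | KG x /\ (dot (rG x) (rG x) < 1)%R] = KG `&` (fun x => dot (rG x) (rG x)) @^-1` [set t | t < 1] by [].
    apply: open_mborel; apply: openI => //; apply: (continuousP _).1 => //.
    exact: continuous_dot continuous_rG continuous_rG.
  + rewrite -[C]setCK; apply: measurableC; apply: open_mborel; rewrite openC.
    by apply: compact_closed => //; exact: G_lca.1.
  + move=> x [Kx rx]; exists (crd x); last exact: coordK.
    by split => //=; rewrite expr1n ltW.
Qed.

Lemma is_character_iV (xi : D) : exists w : V, forall v, xi (iV v) = cis (2 * pi * dot w v).
Proof.
apply: rV_character => [v|u v|v]; last exact: normc_ch.
  by apply: (@continuous_comp _ _ _ iV (xi : G -> R[i]^o)); [exact: continuous_iV|exact: character_cont].
by rewrite iVD characterD.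
Qed.

Lemma is_character_iC (xi : D) : is_character (fun k => xi (iC k)).
Proof.
split => [k|x y|x].
- by apply: (@continuous_comp _ _ _ iC (xi : G -> R[i]^o)); [exact: continuous_iC|exact: character_cont].
- by rewrite iCD characterD.
- by rewrite normr_normc normc_ch.
Qed.

(** The restrictions of [xi] to the two factors form a pair with the defining property, so the pair
    returned by [get] has it too. *)
Lemma dual_coordE (xi : D) x : xi x = cis (2 * pi * dot (dual_coord s xi).1 (crd x).1) * (dual_coord s xi).2 (crd x).2.
Proof.
have [w hw] := is_character_iV xi.
have : [set w : V * dual R G0 | forall x : G, xi x =
      cis (2 * pi * dot w.1 (crd x).1) * w.2 (crd x).2] (w, Dual (is_character_iC xi)).
  by move=> y /=; rewrite -hw -characterD -coord_split.
by move=> /getI; exact.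
Qed.

Lemma dual_coord_uniq (xi : D) w (chi : dual R G0) :
  (forall x, xi x = cis (2 * pi * dot w (crd x).1) * chi (crd x).2) -> dual_coord s xi = (w, chi).
Proof.
move=> h; rewrite [LHS]surjective_pairing; congr (_, _).
  apply: cis_dot_inj => v; have := h (iV v); rewrite dual_coordE coord_iV /= !character0 !mulr1 //.
apply: dual_eq => k; have := h (iC k); rewrite dual_coordE coord_iC /=.
have d0 (u : V) : dot u 0 = 0 by rewrite dotC dot0l.
by rewrite !d0 !mulr0 cis0 !mul1r.
Qed.

Definition rD (xi : D) : V := (dual_coord s xi).1.
Definition KD : set D := [set xi | annihilator (dual_coord s xi).2].
Lemma is_character_lin (w : V) : is_character (fun x : G => cis (2 * pi * dot w (crd x).1)).
Proof.
split => [x|x y|x].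
- apply: (@continuous_comp _ _ _ (fun x => 2 * pi * dot w (rG x)) (@cis R : R -> R[i]^o)); last exact: continuous_cis.
  apply: cvgM; first exact: cvg_cst.
  have cw : continuous (fun _ : G => w) by exact: cst_continuous.
  exact: (continuous_dot cw continuous_rG).
- by rewrite coordD /= dotDr mulrDr cisD.
- by rewrite normr_normc normc_cis.
Qed.
Definition linD (w : V) : D := Dual (is_character_lin w).

Lemma dual_coordD (xi eta : D) : dual_coord s (xi + eta) = (rD xi + rD eta, (dual_coord s xi).2 + (dual_coord s eta).2).
Proof.
apply: dual_coord_uniq => x; rewrite dotDl mulrDr cisD.
change ((xi + eta) x) with (xi x * eta x); rewrite !dual_coordE /=; ring.
Qed.
Lemma rD_add xi eta : rD (xi + eta) = rD xi + rD eta.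
Proof. by rewrite {1}/rD dual_coordD. Qed.
Lemma dual_coord_lin w : dual_coord s (linD w) = (w, 0).
Proof. by apply: dual_coord_uniq => x /=; rewrite mulr1. Qed.

Lemma KDE xi : KD xi <-> forall k, @cpt _ _ s k -> xi (iC k) = 1.
Proof.
have E k : xi (iC k) = (dual_coord s xi).2 k.
  by rewrite dual_coordE coord_iC /= dotC dot0l mulr0 cis0 mul1r.
by split=> h k ck; have := h k ck; rewrite E.
Qed.

Lemma KD_char xi x : KD xi -> KG x -> xi x = cis (2 * pi * dot (rD xi) (rG x)).
Proof. by move=> Kxi Kx; rewrite dual_coordE Kxi ?mulr1. Qed.

(** If a coordinate of [xi] differed from that of [xi0] by at least [e'], a vector of the unit ball
    along this axis would produce a phase difference of exactly 2 pi e', against closeness on the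
    compact image of the ball. *)
Lemma rD_continuous : continuous rD.
Proof.
move=> xi0 U /nbhs_ballP[e /= e0 eU].
(* The bound 1/2 keeps 2 pi e' in the interval from 0 to pi, where the cosine is strictly
   monotone. *)
pose e' := Num.min e 2^-1; have e'0 : 0 < e' by rewrite lt_min e0 invr_gt0 ltr0n.
pose B : set G := iV @` [set v : V | dot v v <= 1 ^+ 2].
have cB : compact B.
  apply: continuous_compact; first by apply: continuous_subspaceT; exact: continuous_iV.
  exact: compact_dot_ball.
have r0 : 0 < normc (1 - cis (2 * pi * e')).
  rewrite lt_neqAle normc_ge0 andbT eq_sym normc_eq0 subr_eq0.
  apply/negP => /eqP/(congr1 (@complex.Re R)) /= h.
  have p0 := pi_gt0 R; have x0 : 0 < 2 * pi * e' by rewrite !mulr_gt0.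
  have xp : 2 * pi * e' <= pi.
    have : e' <= 2^-1 by rewrite ge_min lexx orbT.
    rewrite -(ler_pM2l (x := 2 * pi)) ?mulr_gt0// => /le_trans; apply.
    by apply: eqW; field.
  have := @ltr_cos R 0 (2 * pi * e'); rewrite !in_itv /= lexx ltW// xp ltW// => /(_ erefl erefl).
  by rewrite cos0 -h ltxx x0.
have := dual_nbhs xi0 cB r0.
apply: filterS => xi h; apply: eU; split => // i j; rewrite (ord1 i) /ball /= ltNge; apply/negP => ge.
set Dl := rD xi0 0 j - rD xi 0 j in ge.
have De : e' <= `|Dl| by apply: le_trans ge; rewrite ge_min lexx.
have D0 : Dl != 0 by rewrite -normr_gt0; exact: lt_le_trans De.
pose v : V := (e' / Dl) *: delta_mx 0 j.
have dv (u : V) : dot u v = u 0 j * (e' / Dl).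
  rewrite /dot (bigD1 j)//= big1 ?addr0 => [|k kj]; rewrite !mxE ?eqxx ?mulr1//.
  by rewrite (negbTE kj) !mulr0.
have vB : B (iV v).
  have vj : v 0 j = e' / Dl by rewrite /v !mxE !eqxx mulr1.
  exists v => //=; rewrite dv vj expr1n -expr2 -real_normK ?num_real//.
  rewrite expr_le1// normrM normfV (gtr0_norm e'0) ler_pdivrMr ?mul1r//.
  exact: lt_le_trans De.
have xiE (eta : D) : eta (iV v) = cis (2 * pi * dot (rD eta) v).
  by rewrite dual_coordE coord_iV /= character0 mulr1.
have := h _ vB; rewrite normcB_sym !xiE !dv.
have -> : 2 * pi * (rD xi0 0 j * (e' / Dl)) = 2 * pi * (rD xi 0 j * (e' / Dl)) + 2 * pi * e'.
  have -> : rD xi0 0 j = Dl + rD xi 0 j by rewrite /Dl subrK.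
  by field.
rewrite cisD -[X in X - _]mulr1 -mulrBr normcM' normc_cis mul1r.
by rewrite ltxx.
Qed.

Lemma dual_hausdorff : hausdorff_space D.
Proof.
move=> xi eta cl; apply: dual_eq => x; apply/eqP; rewrite -subr_eq0 -normc_eq0; apply/negPn/negP => n0.
have e0 : 0 < normc (xi x - eta x) / 2 by rewrite divr_gt0// lt_neqAle eq_sym n0 normc_ge0.
have [z [/= /(_ x erefl) h1 /(_ x erefl) h2]] := cl _ _ (dual_nbhs xi (@compact_set1 _ x) e0) (dual_nbhs eta (@compact_set1 _ x) e0).
have := normcD_le (xi x - z x) (z x - eta x).
have -> : xi x - z x + (z x - eta x) = xi x - eta x by ring.
by rewrite leNgt [ltRHS]splitr ltrD// normcB_sym.
Qed.

Lemma KD0 : KD 0.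
Proof. by apply/KDE. Qed.
Lemma KDB xi eta : KD xi -> KD eta -> KD (xi - eta).
Proof.
move=> /KDE h1 /KDE h2; apply/KDE => k ck.
by change (xi (iC k) * (eta (iC k))^-1 = 1); rewrite h1// h2// invr1 mulr1.
Qed.

Lemma KDD xi eta : KD xi -> KD eta -> KD (xi + eta).
Proof.
move=> h1 h2; rewrite -(opprK eta); apply: KDB => //; rewrite -sub0r; apply: KDB => //; exact: KD0.
Qed.

(** A character within distance 1 of the trivial one on the compact subgroup takes it to a subgroup
    of the circle close to 1, which is trivial by [no_small_subgroup]. *)
Lemma KD_nbhs0 : nbhs (0 : D) KD.
Proof.
have cB : compact (iC @` @cpt _ _ s).
  apply: continuous_compact; first by apply: continuous_subspaceT; exact: continuous_iC.
  exact: cpt_compact.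
apply: filterS (dual_nbhs 0 cB ltr01) => xi h; apply/KDE => k ck.
apply: no_small_subgroup => [|n]; first exact: normc_ch.
have cn : @cpt _ _ s (k *+ n).
  elim: n => [|n IH]; first exact: cpt0.
  rewrite mulrS -(opprK (k *+ n)); apply: cptB => //.
  by rewrite -sub0r; apply: cptB => //; exact: cpt0.
have -> : xi (iC k) ^+ n = xi (iC (k *+ n)).
  elim: n {cn} => [|n IH]; first by rewrite expr0 mulr0n /iC coordi0 character0.
  by rewrite exprS mulrS iCD characterD IH.
by apply: h; exists (k *+ n).
Qed.

Lemma KD_open : open KD.
Proof.
rewrite openE => xi Kxi.
have h := nbhs_shift (@tgroupT D) xi KD_nbhs0.
by apply: filterS h => eta /= h; rewrite -(subrK xi eta); exact: KDD.
Qed.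

Lemma unit_disc_cover (e : R) : 0 < e -> exists qs : seq R[i], forall z : R[i], normc z <= 1 -> exists2 q, q \in qs & normc (z - q) < e.
Proof.
move=> e0; have e2 : 0 < e / 2 by rewrite divr_gt0.
have [l lP] : exists l : seq R, forall x, `[-1, 1]%classic x -> exists2 y, y \in l & `|x - y| < e / 2.
  apply: (compact_fcover (W := fun y x : R => `|x - y| < e / 2) (@segment_compact R (-1) 1)) => x _.
  apply/nbhs_ballP; exists (e / 2) => //= y; by rewrite /ball /= distrC.
exists [seq a +i* b | a <- l, b <- l] => z z1.
have [a al ha] : exists2 y, y \in l & `|complex.Re z - y| < e / 2.
  by apply: lP; rewrite /= in_itv /= -ler_norml; exact: le_trans (Re_le_normc z) z1.
have [b bl hb] : exists2 y, y \in l & `|complex.Im z - y| < e / 2.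
  by apply: lP; rewrite /= in_itv /= -ler_norml; exact: le_trans (Im_le_normc z) z1.
exists (a +i* b); first by apply/allpairsP; exists (a, b).
apply: le_lt_trans (normc_le_ReIm _) _.
by rewrite ReD ImD ReN ImN /= [ltRHS]splitr ltrD.
Qed.

(** Values at finitely many points form a totally bounded set; the representatives are taken in [S]
    itself. *)
Lemma dual_pigeonhole (c : seq G) (S : set D) (e : R) : 0 < e ->
  exists F : seq D, forall xi, S xi -> exists eta, [/\ eta \in F, S eta & forall x, x \in c -> normc (xi x - eta x) < e].
Proof.
move=> e0; have e2 : 0 < e / 2 by rewrite divr_gt0.
have [qs qsP] := unit_disc_cover e2.
elim: c S => [|x c IH] S.
  have [[xi Sxi]|nS] := pselect (S !=set0).
    by exists [:: xi] => eta _; exists xi; rewrite inE eqxx.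
  by exists nil => xi Sxi; case: nS; exists xi.
have /choice[F FP] (q : R[i]) := IH (S `&` [set xi | normc (xi x - q) < e / 2]).
exists (flatten [seq F q | q <- qs]) => xi Sxi.
have [|q qqs hq] := qsP (xi x); first by rewrite normc_ch.
have [eta [etaF [Seta h] etac]] := FP q xi (conj Sxi hq).
exists eta; split => //; first by apply/flattenP; exists (F q) => //; apply: map_f.
move=> y; rewrite inE => /orP[/eqP ->|]; last exact: etac.
have -> : xi x - eta x = (xi x - q) + (q - eta x) by ring.
apply: le_lt_trans (normcD_le _ _) _; rewrite [ltRHS]splitr ltrD//.
by rewrite normcB_sym.
Qed.

Variable nu : sfm R D.
Hypotheses (hD : hgroup nu) (nu_fin : forall C : set D, compact C -> (nu C < +oo)%E)
  (lcD : exists C : set D, compact C /\ nbhs (0 : D) C).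

Lemma dot_bound (w u : V) (T : R) : 0 < T -> 2 * `|dot w u| <= T * dot w w + dot u u / T.
Proof.
move=> T0; have H (e : R) : e = 1 \/ e = -1 -> 2 * (e * dot w u) <= T * dot w w + dot u u / T.
  move=> eE; have ee : e * e = 1 by case: eE => ->; rewrite ?mulr1 ?mulrNN ?mulr1.
  have h := dot_ge0 (T *: w - e *: u).
  rewrite -subr_ge0 -(pmulr_rge0 _ T0); apply: (le_trans h); rewrite le_eqVlt; apply/orP; left; apply/eqP.
  rewrite !(dotDl, dotDr, dotNl, dotNr, dotZl, dotZr) (dotC u w).
  have -> : T * (T * dot w w + dot u u / T - 2 * (e * dot w u)) = T ^+ 2 * dot w w + dot u u * 1 - 2 * T * e * dot w u.
    by field; rewrite gt_eqF.
  have -> : dot u u * 1 = e * e * dot u u by rewrite ee mul1r mulr1.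
  by ring.
have [y0|y0] := leP 0 (dot w u).
  by rewrite ger0_norm//; have := H 1 (or_introl erefl); rewrite mul1r.
by rewrite ltr0_norm//; have := H (-1) (or_intror erefl); rewrite mulN1r.
Qed.

(** A compact neighbourhood [Q] of 0 contains all characters close to 1 on some compact [C]. On [C],
    a character of [KD] with small real coordinate is determined up to a small error by its values
    at finitely many coset representatives; by [dual_pigeonhole] finitely many translates of [Q]
    suffice. *)
Lemma dual_ball_finite : exists e : R, 0 < e /\ (nu [set xi | KD xi /\ (dot (rD xi) (rD xi) < e)%R] < +oo)%E.
Proof.
have [Q [cQ nQ]] := lcD.
have [C [e [cC e0 CQ]]] := dual_nbhs_ex nQ.
have e4 : 0 < e / 4 by rewrite divr_gt0.
have /nbhs_ballP[eta eta0 etaP] := ccont_nbhs (@continuous_cis R 0) e4.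
rewrite /= in eta0.
have [M M0 CM] : exists2 M : R, 0 <= M & forall x, C x -> dot (rG x) (rG x) <= M.
  have [l lP] : exists l : seq G, forall x, C x -> exists2 y, y \in l & dot (rG x) (rG x) < dot (rG y) (rG y) + 1.
    apply: (compact_fcover (W := fun y x => dot (rG x) (rG x) < dot (rG y) (rG y) + 1) cC) => x _.
    have cd := continuous_dot continuous_rG continuous_rG.
    by apply: (cd x [set t | t < dot (rG x) (rG x) + 1]); apply: lt_nbhsl; rewrite ltrDl.
  exists (\sum_(y <- l) (dot (rG y) (rG y) + 1)).
    by apply: sumr_ge0 => y _; rewrite addr_ge0 ?dot_ge0.
  move=> x /lP[y yl h]; apply: (le_trans (ltW h)).
  by rewrite (big_rem y)//= lerDl sumr_ge0// => z _; rewrite addr_ge0 ?dot_ge0.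
have p0 := pi_gt0 R.
have aux1 (P U c : R) : 0 < P -> 0 < U -> U * (c / (2 * P * U)) = c / (2 * P).
  by move=> P0 U0; field; rewrite !gt_eqF.
have aux2 (P : R) : 0 < P -> eta / (2 * P) * (2 * P * M / eta + 1) = M + eta / (2 * P).
  by move=> P0; field; rewrite !gt_eqF.
have aux3 (P c : R) : 0 < P -> P * (c / (2 * P) + c / (2 * P)) = c.
  by move=> P0; field; rewrite gt_eqF.
(* [T] balances the two terms of [dot_bound]: with [ep] below, each contributes at most eta / 2 to
   the phase. *)
pose T := 2 * pi * M / eta + 1.
have T0 : 0 < T.
  rewrite /T ltr_wpDl//; apply: divr_ge0; last exact: ltW.
  by apply: mulr_ge0 => //; apply: mulr_ge0 => //; exact: ltW.
pose ep := eta / (2 * pi * T).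
have ep0 : 0 < ep by rewrite divr_gt0// !mulr_gt0.
have cis_close (w : V) x : C x -> dot w w < ep -> normc (1 - cis (2 * pi * dot w (rG x))) < e / 4.
  move=> Cx wep; rewrite -cis0; apply: etaP; rewrite /ball /= sub0r normrN.
  rewrite -mulrA mulrCA normrM (gtr0_norm p0) normrM (gtr0_norm (ltr0n _ 2)).
  apply: (@le_lt_trans _ _ (pi * (T * dot w w + dot (rG x) (rG x) / T))).
    by rewrite ler_pM2l// dot_bound.
  have h1 : T * dot w w < eta / (2 * pi).
    apply: (@lt_le_trans _ _ (T * ep)); first by rewrite ltr_pM2l.
    by rewrite /ep aux1 ?lexx.
  have h2 : dot (rG x) (rG x) / T <= eta / (2 * pi).
    rewrite ler_pdivrMr// /T; apply: (le_trans (CM x Cx)).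
    have -> : eta / (2 * pi) * (2 * pi * M / eta + 1) = M + eta / (2 * pi) by exact: aux2.
    by rewrite lerDl divr_ge0 ?mulr_ge0 ?ltW.
  apply: (@lt_le_trans _ _ (pi * (eta / (2 * pi) + eta / (2 * pi)))).
    by rewrite ltr_pM2l// ltr_leD.
  by rewrite aux3 ?lexx.
have oK : open KG.
  apply: (continuousP _).1; last exact: cpt_open.
  by move=> x; apply: (@continuous_comp _ _ _ (crd) snd); [exact: Defs.coord_continuous|exact: cvg_snd].
have KG0 : KG 0 by rewrite /KG /= coord0; exact: cpt0.
have [l lP] : exists l : seq G, forall x, C x -> exists2 y, y \in l & KG (x - y).
  apply: (compact_fcover (W := fun y x => KG (x - y)) cC) => x _.
  by apply: (nbhs_shift (@tgroupT G)); apply: open_nbhs_nbhs.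
exists ep; split => //.
pose S := [set xi : D | KD xi /\ dot (rD xi) (rD xi) < ep].
have [F FP] := dual_pigeonhole [seq iC (crd y).2 | y <- l] S e4.
have mQ : measurable (Q : set (borel D)).
  rewrite -[Q]setCK; apply: measurableC; apply: open_mborel; rewrite openC.
  by apply: compact_closed => //; exact: dual_hausdorff.
have mT (eta' : D) : measurable ([set (eta' + y : D) | y in Q] : set (borel D)).
  have -> : [set (eta' + y : D) | y in Q] = [set y : D | Q (y - eta')].
    apply/seteqP; split=> [_ [y Dy <-]|y Dy] /=; first by rewrite addrAC subrr add0r.
    by exists (y - eta') => //; rewrite addrC subrK.
  by have := mshf hD (- eta') measurableT mQ; rewrite setTI.
have mS : measurable (S : set (borel D)).
  have -> : S = KD `&` (fun x => dot (rD x) (rD x)) @^-1` [set t | t < ep] by [].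
  apply: open_mborel; apply: openI; first exact: KD_open.
  by apply: (continuousP _).1 => //; exact: continuous_dot rD_continuous rD_continuous.
have QE : nu Q = (fine (nu Q))%:E by rewrite fineK// ge0_fin_numE// nu_fin.
have bd (eta' : D) : (nu [set (eta' + y)%R | y in Q] <= (fine (nu Q))%:E)%E.
  by rewrite (hg_inv hD)// -QE.
apply: (@le_lt_trans _ _ ((size F)%:R%:E * (fine (nu Q))%:E)%E); last by rewrite -EFinM ltry.
apply: (measure_seq_union mT mS bd) => xi Sxi.
have [eta' [etaF [Keta eeta] hF]] := FP xi Sxi.
have [Kxi exi] := Sxi.
rewrite -bigcup_seq; exists eta' => //=.
exists (xi - eta'); last by rewrite addrC subrK.
apply: CQ => x Cx; change (normc (1 - xi x * (eta' x)^-1) < e).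
have -> : 1 - xi x * (eta' x)^-1 = (eta' x - xi x) * (eta' x)^-1.
  by rewrite mulrBl divff// character_neq0.
have -> : normc ((eta' x - xi x) / eta' x) = normc (xi x - eta' x).
  have := normcM' ((eta' x - xi x) / eta' x) (eta' x).
  by rewrite divfK ?character_neq0// normc_ch mulr1 normcB_sym.
have [y yl Kxy] := lP x Cx.
have E (z : D) : KD z -> z x = cis (2 * pi * dot (rD z) (rG x)) * z (iC (crd y).2).
  move=> Kz; rewrite dual_coordE; congr (_ * _); rewrite dual_coordE coord_iC /= dotC dot0l mulr0 cis0 mul1r.
  have cD := Defs.coordD s (x - y) y; rewrite subrK in cD.
  by rewrite cD /= characterD (Kz _ Kxy) mul1r.
rewrite (E xi Kxi) (E eta' Keta); set z := xi _; set z' := eta' _.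
set a := cis _; set b := cis _.
have zz : normc (z - z') < e / 4 by apply: hF; apply: map_f.
have -> : a * z - b * z' = (a - 1) * z + (z - z') + (1 - b) * z' by ring.
have n1 : normc ((a - 1) * z) < e / 4 by rewrite normcM' normc_ch mulr1 normcB_sym; exact: cis_close.
have n2 : normc ((1 - b) * z') < e / 4 by rewrite normcM' normc_ch mulr1; exact: cis_close.
apply: (le_lt_trans (normcD_le _ _)).
have h3 := normcD_le ((a - 1) * z) (z - z').
move: n1 n2 zz h3; lra.
Qed.

Lemma gauss_sys_D : gauss_sys nu rD linD KD.
Proof.
split.
- exact: rD_continuous.
- exact: rD_add.
- move=> u v; apply: dual_eq => x.
  by change (cis (2 * pi * dot (u + v) (crd x).1) = cis (2 * pi * dot u (crd x).1) * cis (2 * pi * dot v (crd x).1)); rewrite dotDl mulrDr cisD.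
- by move=> w; rewrite /rD dual_coord_lin.
- exact: KD0.
- exact: KDB.
- by move=> w; rewrite /KD /= dual_coord_lin.
- exact: KD_open.
- exact: dual_ball_finite.
Qed.
End Structure.

(** * Integrals of tensor products *)

Section ProductFunctions.
Context d1 d2 (T1 : measurableType d1) (T2 : measurableType d2) (R : realType).
Variables (m1 : {sigma_finite_measure set T1 -> \bar R}) (m2 : {sigma_finite_measure set T2 -> \bar R}).

Lemma measurable_mul_prod (f : T1 -> R) (g : T2 -> R) : mfunT f -> mfunT g ->
  mfunT (fun z : T1 * T2 => f z.1 * g z.2).
Proof.
move=> mf mg; apply: measurable_funM.
  exact: (mcompT mf measurable_fst).
exact: (mcompT mg measurable_snd).
Qed.

Lemma prodm_mulE (f : T1 -> R) (g : T2 -> R) : mfunT f -> mfunT g ->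
  (forall x, 0 <= f x) -> (forall y, 0 <= g y) ->
  (\int[prodm m1 m2]_z (f z.1 * g z.2)%:E = (\int[m1]_x (f x)%:E) * (\int[m2]_y (g y)%:E))%E.
Proof.
move=> mf mg f0 g0.
have mfg : mfunT (fun z : T1 * T2 => (f z.1 * g z.2)%:E).
  by apply/mEFinP; exact: measurable_mul_prod.
have fg0 (z : T1 * T2) : (0 <= (f z.1 * g z.2)%:E)%E by rewrite lee_fin mulr_ge0.
rewrite (prodm_tonelli1 m1 m2 mfg fg0) /=.
have G0 : (0 <= \int[m2]_y (g y)%:E)%E by apply: integral_ge0 => y _; rewrite lee_fin.
rewrite -(ge0_integralZr m1 measurableT _ _ G0).
- apply: eq_integral => x _; under eq_integral do rewrite EFinM.
  rewrite ge0_integralZl//; first exact/mEFinP.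
    by move=> y _; rewrite lee_fin.
  by rewrite lee_fin.
- exact/mEFinP.
- by move=> x _; rewrite lee_fin.
Qed.

Lemma prodm_mul_lty (f : T1 -> R) (g : T2 -> R) : mfunT f -> mfunT g ->
  (forall x, 0 <= f x) -> (forall y, 0 <= g y) -> (\int[m1]_x (f x)%:E < +oo)%E -> (\int[m2]_y (g y)%:E < +oo)%E ->
  (\int[prodm m1 m2]_z (f z.1 * g z.2)%:E < +oo)%E.
Proof.
move=> mf mg f0 g0 If Ig; rewrite prodm_mulE// lte_mul_pinfty//.
  by apply: integral_ge0 => y _; rewrite lee_fin.
by rewrite ge0_fin_numE//; apply: integral_ge0 => y _; rewrite lee_fin.
Qed.

Lemma cinteg_mul_prod (f : T1 -> R[i]) (g : T2 -> R[i]) : cinteg m1 f -> cinteg m2 g ->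
  cinteg (m1 \x m2)%E (fun z => f z.1 * g z.2).
Proof.
move=> [mf If] [mg Ig]; split.
  by apply: cmeasM; [exact: (cmeas_comp measurable_fst mf)|exact: (cmeas_comp measurable_snd mg)].
under eq_integral do rewrite normcM'.
exact: (prodm_mul_lty (mnormc mf) (mnormc mg) (fun x => normc_ge0 _) (fun x => normc_ge0 _) If Ig).
Qed.

Lemma cint_mul_prod (f : T1 -> R[i]) (g : T2 -> R[i]) : cinteg m1 f -> cinteg m2 g ->
  cintegral (m1 \x m2)%E (fun z => f z.1 * g z.2) = cintegral m1 f * cintegral m2 g.
Proof.
move=> If Ig; rewrite -cfubini1; last exact: cinteg_mul_prod.
rewrite -cintZr//; apply: cint_ext => x /=.
by rewrite cintZ.
Qed.
End ProductFunctions.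

(** * Gaussians on the group, its dual and the phase space *)

Section Spaces.
Variables (R : realType) (G : topologicalZmodType).
Hypotheses (G_lca : is_lca G) (G_sc : @second_countable G).
Variables (mu : sfm R G)
  (nu : sfm R (dual R G))
  (mu2 : sfm R (G * dual R G)%type)
  (nu2 : sfm R (dual R G * G)%type).
Hypotheses (mu_haar : is_haar mu) (nu_haar : is_haar nu)
  (mu2_prod : is_product_measure mu nu mu2) (nu2_prod : is_product_measure nu mu nu2).
Variable s : lca_structure R G.
Hypothesis inversion : fourier_inversion (group_tf s mu nu).
Hypothesis lcD : exists C : set (dual R G), compact C /\ nbhs (0 : dual R G) C.
Local Notation D := (dual R G).
Implicit Types (x y : G) (xi eta : D) (a b : R).

Let hG : hgroup mu := hgroup_G G_sc mu_haar.
Let hD : hgroup nu := hgroup_D G_lca G_sc nu_haar.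
Let cG := hg_csb hG.
Let cD := hg_csb hD.
Let gsG := gauss_sys_G G_lca s mu_haar.
Let nu_fin : forall C : set D, compact C -> (nu C < +oo)%E. Proof. by case: nu_haar. Qed.
Let gsD := gauss_sys_D s hD nu_fin lcD.

Definition EG a x : R := gE (rG s) (KG s) a x.
Definition ED a xi : R := gE (rD s) (KD s) a xi.
(** Kept as a symbol, since the normalization of [mu] is arbitrary. *)
Definition cEG a : R := \int[mu]_x EG a x.

Lemma EG_ge0 a x : 0 <= EG a x. Proof. exact: gE_ge0. Qed.
Lemma ED_ge0 a xi : 0 <= ED a xi. Proof. exact: gE_ge0. Qed.
Lemma continuous_EG a : continuous (EG a). Proof. exact: (continuous_gE hG gsG). Qed.
Lemma continuous_ED a : continuous (ED a). Proof. exact: (continuous_gE hD gsD). Qed.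
Lemma measurable_EG a : mfunT (EG a : borel G -> R).
Proof. by apply: ccont_mR; exact: continuous_EG. Qed.
Lemma measurable_ED a : mfunT (ED a : borel D -> R).
Proof. by apply: ccont_mR; exact: continuous_ED. Qed.
Lemma EG_lty a : 0 < a -> (\int[mu]_x (EG a x)%:E < +oo)%E. Proof. exact: (gE_integrable hG gsG). Qed.
Lemma ED_lty a : 0 < a -> (\int[nu]_xi (ED a xi)%:E < +oo)%E. Proof. exact: (gE_integrable hD gsD). Qed.
Lemma EG_scale_lty a (C : R) : 0 < a -> 0 <= C -> (\int[mu]_x (C * EG a x)%:E < +oo)%E.
Proof.
move=> a0 C0; under eq_integral do rewrite EFinM.
rewrite ge0_integralZl//.
- by rewrite lte_mul_pinfty// EG_lty.
- by apply/mEFinP; exact: measurable_EG.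
- by move=> x _; rewrite lee_fin EG_ge0.
Qed.
Lemma EG_int a : 0 < a -> @cinteg _ (borel G) R mu (fun x => (EG a x)%:C).
Proof. exact: (cinteg_gE hG gsG). Qed.
Lemma ED_int a : 0 < a -> @cinteg _ (borel D) R nu (fun xi => (ED a xi)%:C).
Proof. exact: (cinteg_gE hD gsD). Qed.
Lemma ccont_real (T : topologicalType) (f : T -> R) : continuous f -> continuous (fun t => (f t)%:C : R[i]^o).
Proof. by move=> cf t; apply: continuousC; [exact: cf|exact: cvg_cst]. Qed.

Lemma cEG_gt0 a : 0 < a -> 0 < cEG a.
Proof.
move=> a0; rewrite /cEG /Rintegral fine_gt0// EG_lty// andbT.
have h : nbhs (0 : G) [set x | 2^-1 < EG a x].
  apply: (@continuous_EG a 0 [set t | 2^-1 < t]); rewrite /EG (gE0 gsG).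
  by apply: lt_nbhsr; rewrite invf_lt1// ltr1n.
set U := [set x : G | 2^-1 < EG a x] in h.
have oU : open U.
  have -> : U = EG a @^-1` [set t | 2^-1 < t] by [].
  by apply: (continuousP _).1 => //; exact: continuous_EG.
have mU : measurable (U : set (borel G)) by exact: open_mborel.
have U0 : (0 < mu U)%E by apply: (hg_pos hG) => //; exists 0; exact: nbhs_singleton h.
apply: (@lt_le_trans _ _ (2^-1%:E * mu U)%E); first by rewrite mule_gt0// lte_fin invr_gt0.
have -> : mu U = (\int[mu]_x (\1_U x : R)%:E)%E by rewrite integral_indic// setIT.
rewrite -ge0_integralZl//.
- apply: ge0_le_int.
  + apply/mEFinP; apply: measurable_funM => //; exact: measurable_indic.
  + by apply/mEFinP; exact: measurable_EG.
  + by move=> x; rewrite mule_ge0// lee_fin// invr_ge0.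
  + move=> x; rewrite lee_fin indicE; have [xU|xU] := boolP (x \in U).
      by rewrite mulr1 ltW//; move: xU; rewrite inE.
    by rewrite mulr0 EG_ge0.
- by apply/mEFinP; exact: measurable_indic.
Qed.

Let p0 : 0 < (pi : R). Proof. exact: pi_gt0. Qed.

Let pi_half : (pi : R) ^+ 2 / (2 * pi) = pi / 2.
Proof. by have H (P : R) : 0 < P -> P ^+ 2 / (2 * P) = P / 2; [move=> P0; field; rewrite gt_eqF|exact: H]. Qed.

(** A character outside [KD] is nontrivial on the compact subgroup and the integral vanishes; for
    one in [KD] the character is an exponential of the coordinate wherever the Gaussian is
    nonzero. *)
Lemma EG_fourier a xi : 0 < a ->
  cintegral mu (fun x : borel G => (EG a x)%:C * (xi x)^*) = (cEG a * ED (pi ^+ 2 / a) xi)%:C.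
Proof.
move=> a0; have [Kxi|nKxi] := pselect (KD s xi).
  rewrite (gauss_fourier1 hG gsG a0 (v := rD s xi) (chi := xi)).
  - by rewrite /ED gEK.
  - by move=> x Kx; exact: KD_char.
rewrite /ED gE_nK// mulr0.
have [k [ck nk]] : exists k, @cpt _ _ s k /\ xi (iC k) != 1.
  apply: contrapT => h; apply: nKxi; apply/KDE => k ck; apply: contrapT => nk; apply: h.
  by exists k; split => //; apply/eqP.
apply: (gauss_fourier0 hG gsG a0 (chi := xi) _ _ _ _ _ nk).
- exact: character_cont.
- exact: characterD.
- exact: normc_ch.
- by rewrite /KG /= coord_iC.
- by rewrite /rG coord_iC.
Qed.

Lemma pairing_cmeas_D x : bcmeas R D (fun xi => xi x).
Proof.
apply: continuous_cmeasurable => xi.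
apply: (@continuous_comp _ _ _ (fun xi : D => (xi, x)) (fun z : D * G => z.1 z.2 : R[i]^o)).
  by apply: (cpair (f := fun xi : D => xi) (g := fun _ : D => x)); [move=> eta; exact: cvg_id|exact: cst_continuous].
exact: dual_pairing_continuous G_lca.2 _.
Qed.

(** Read off from the inversion formula for the Gaussian of parameter pi^2 / b on the group, whose
    Fourier transform is a multiple of [ED b]. This also yields the constant that belongs to the
    dual measure. *)
Lemma ED_fourier b x : 0 < b ->
  cintegral nu (fun xi : borel D => (ED b xi)%:C * xi x) = (EG (pi ^+ 2 / b) x / cEG (pi ^+ 2 / b))%:C.
Proof.
move=> b0; set a := pi ^+ 2 / b.
have a0 : 0 < a by rewrite divr_gt0// exprn_gt0.
have ab : pi ^+ 2 / a = b by rewrite /a invf_div mulrCA divff ?mulr1// expf_neq0// gt_eqF.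
have fE : fourier (P := group_tf s mu nu) (fun x => (EG a x)%:C) = fun xi => (cEG a * ED b xi)%:C.
  by apply/funext => xi; rewrite /fourier EG_fourier// ab.
have := inversion (f := fun x => (EG a x)%:C) (ccont_real (continuous_EG (a := a))).
move=> /(_ ((in_L1P mu _).2 (EG_int a0))).
have iD : @cinteg _ (borel D) R nu (fun xi => (cEG a * ED b xi)%:C).
  have := cintegZ (cEG a)%:C (ED_int b0).
  by under eq_fun do rewrite -RCM.
rewrite fE => /(_ ((in_L1P nu _).2 iD) x) xE.
have c0 := cEG_gt0 a0.
have Ib : @cinteg _ (borel D) R nu (fun xi => (ED b xi)%:C * xi x).
  split; first by apply: cmeasM; [by have [] := ED_int b0|exact: pairing_cmeas_D].
  under eq_integral do rewrite normcM' normc_ch mulr1.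
  by have [] := ED_int b0.
have IE : (EG a x)%:C = (cEG a)%:C * cintegral nu (fun xi : borel D => (ED b xi)%:C * xi x).
  rewrite xE -cintZ//; apply: cint_ext => xi; rewrite RCM /= mulrA //.
have n0 : (cEG a)%:C != 0 by apply/negP => /eqP[/eqP]; rewrite gt_eqF.
apply: (mulfI n0); rewrite -IE -RCM; congr (_%:C); field.
by rewrite gt_eqF.
Qed.

Lemma ED_fourier_conj b x : 0 < b ->
  cintegral nu (fun xi : borel D => (ED b xi)%:C * (xi x)^*) = (EG (pi ^+ 2 / b) x / cEG (pi ^+ 2 / b))%:C.
Proof.
move=> b0; rewrite -[RHS]conjRC -ED_fourier// -cint_conj.
  by apply: cint_ext => xi; rewrite conjcM conjRC.
split; first by apply: cmeasM; [by have [] := ED_int b0|exact: pairing_cmeas_D].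
under eq_integral do rewrite normcM' normc_ch mulr1.
by have [] := ED_int b0.
Qed.

Local Notation P1 := (group_tf s mu nu).
Local Notation P2 := (phase_tf s mu2 nu2).

Lemma gaussE x : gauss (t := P1) x = (EG pi x)%:C.
Proof. by rewrite /gauss /= /gaussian mulNr. Qed.

Lemma phase_gaussE z : gauss (t := P2) z = (EG pi z.1 * ED pi z.2)%:C.
Proof.
rewrite /gauss /= /gaussian; congr (_%:C); rewrite /EG /ED /gE.
have -> : dot (phase_coord s z).1 (phase_coord s z).1 = dot (rG s z.1) (rG s z.1) + dot (rD s z.2) (rD s z.2).
  rewrite /dot big_split_ord /=; congr (_ + _); apply: eq_bigr => k _.
    by rewrite !row_mxEl.
  by rewrite !row_mxEr.
rewrite mulrDr expRD !mulNr.
have -> : \1_(@cpt _ _ s `*` @annihilator _ _ s) (phase_coord s z).2 = \1_(KG s) z.1 * \1_(KD s) z.2 :> R.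
  rewrite !indicE -natrM mulnb; congr (nat_of_bool _)%:R.
  by apply/idP/andP; rewrite !inE.
by ring.
Qed.

Lemma stft_gauss x xi : normc (stft (gauss (t := P1)) (gauss (t := P1)) ((x, xi) : time P1 * freq P1)) =
  EG (pi / 2) x * (cEG (2 * pi) * ED (pi / 2) xi).
Proof.
rewrite /stft /L2_inner.
have -> : (fun t : borel G => gauss (t := P1) t * (tfshift (P := P1) (x, xi) (gauss (t := P1)) t)^*) =
  (fun t : borel G => (EG pi t)%:C * (xi t * (EG pi (t - x)%R)%:C)^*).
  by apply/funext => t; rewrite /tfshift !gaussE.
have h := gauss_window_stft hG gsG x p0 (character_cont (chi := xi)) (characterD xi) (normc_ch xi).
rewrite [LHS]h; congr (_ * _).
have -> : cintegral mu (fun t : borel G => (gE (rG s) (KG s) (2 * pi) t)%:C * (xi t)^*) = (cEG (2 * pi) * ED (pi / 2) xi)%:C.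
  by rewrite EG_fourier ?mulr_gt0// pi_half.
by rewrite normc_real ger0_norm// mulr_ge0 ?ED_ge0// ltW// cEG_gt0// mulr_gt0.
Qed.

Lemma continuous_eval x : continuous (fun xi : D => xi x : R[i]^o).
Proof.
move=> xi; apply: (@continuous_comp _ _ _ (fun xi : D => (xi, x)) (fun z : D * G => z.1 z.2 : R[i]^o)).
  by apply: (cpair (f := fun xi : D => xi) (g := fun _ : D => x)); [move=> eta; exact: cvg_id|exact: cst_continuous].
exact: dual_pairing_continuous G_lca.2 _.
Qed.

Lemma dual_stft_gauss xi y :
  normc (cintegral nu (fun t : borel D => (ED pi t)%:C * (t y * (ED pi (t - xi)%R)%:C)^*)) =
  ED (pi / 2) xi * (EG (pi / 2) y / cEG (pi / 2)).
Proof.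
have h := gauss_window_stft hD gsD xi p0 (chi := fun t : D => t y) (@continuous_eval y) (fun _ _ => erefl) (fun t => normc_ch t y).
rewrite [LHS]h; congr (_ * _).
have pp : 0 < (pi : R) / 2 by rewrite divr_gt0.
have -> : cintegral nu (fun t : borel D => (gE (rD s) (KD s) (2 * pi) t)%:C * (t y)^*) = (EG (pi / 2) y / cEG (pi / 2))%:C.
  have pp2 : 0 < 2 * (pi : R) by rewrite mulr_gt0.
  by rewrite -pi_half -(ED_fourier_conj y pp2).
by rewrite normc_real ger0_norm// divr_ge0 ?EG_ge0// ltW// cEG_gt0.
Qed.

Lemma window_integrable_G x eta : @cinteg _ (borel G) R mu (fun t => (EG pi t)%:C * (eta t * (EG pi (t - x)%R)%:C)^*).
Proof.
have [m1 _] := EG_int p0.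
have m2 : bcmeas R G (fun t => (EG pi (t - x))%:C) by exact: (cmeas_comp (mshf hG (- x)) m1).
apply: (cintegMr (EG_int p0) (M := 1)) => [|t].
  apply: cmeas_conj; apply: cmeasM => //; by apply: continuous_cmeasurable; exact: character_cont.
by rewrite normc_conj normcM' normc_ch mul1r normc_real ger0_norm ?EG_ge0// gE_le1// ltW.
Qed.

Lemma window_integrable_D xi y : @cinteg _ (borel D) R nu (fun t => (ED pi t)%:C * (t y * (ED pi (t - xi)%R)%:C)^*).
Proof.
have [m1 _] := ED_int p0.
have m2 : bcmeas R D (fun t => (ED pi (t - xi))%:C) by exact: (cmeas_comp (mshf hD (- xi)) m1).
apply: (cintegMr (ED_int p0) (M := 1)) => [|t].
  apply: cmeas_conj; apply: cmeasM => //; exact: pairing_cmeas_D.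
by rewrite normc_conj normcM' normc_ch mul1r normc_real ger0_norm ?ED_ge0// gE_le1// ltW.
Qed.

(** The phase-space Gaussian is a tensor product, so its transform factors into one over the group
    and one over the dual. *)
Lemma stft_phase_gauss (z : time P2) (w : freq P2) : normc (stft (gauss (t := P2)) (gauss (t := P2)) ((z, w) : time P2 * freq P2)) =
  (EG (pi / 2) z.1 * (cEG (2 * pi) * ED (pi / 2) w.1)) * (ED (pi / 2) z.2 * (EG (pi / 2) w.2 / cEG (pi / 2))).
Proof.
case: z w => x xi [eta y].
change (normc (stft (gauss (t := P2)) (gauss (t := P2)) (((x, xi), (eta, y)) : time P2 * freq P2)) =
  (EG (pi / 2) x * (cEG (2 * pi) * ED (pi / 2) eta)) * (ED (pi / 2) xi * (EG (pi / 2) y / cEG (pi / 2)))).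
rewrite -stft_gauss -dual_stft_gauss -normcM'; congr (normc _).
rewrite /stft /L2_inner.
have -> : (fun t : borel G => gauss (t := P1) t * (tfshift (P := P1) (x, eta) (gauss (t := P1)) t)^*) =
  (fun t : borel G => (EG pi t)%:C * (eta t * (EG pi (t - x)%R)%:C)^*).
  by apply/funext => t; rewrite /tfshift !gaussE.
rewrite -cint_mul_prod; [|exact: window_integrable_G|exact: window_integrable_D].
rewrite -(cint_product mu2_prod); last first.
  by have [] := cinteg_mul_prod (window_integrable_G x eta) (window_integrable_D xi y).
apply: cint_ext => -[t tau]; rewrite /tfshift !phase_gaussE /= !RCM !conjcM !conjRC; ring.
Qed.

Lemma gauss_ball_G : nbhs (0 : G) [set x | KG s x /\ dot (rG s x) (rG s x) <= 1].
Proof.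
apply: filterI; first by apply: open_nbhs_nbhs; split; [exact: gs_open gsG|exact: gs_K0 gsG].
have c := continuous_dot (gs_cont gsG) (gs_cont gsG).
have h : nbhs (0 : R) [set t | t < 1] by apply: lt_nbhsl.
have := c 0 [set t | t < 1]; rewrite (gs_r0 gsG) dot0l => /(_ h) hn.
by apply: (filterS (P := [set x | dot (rG s x) (rG s x) < 1]) _ hn) => x /= /ltW.
Qed.
Lemma gauss_ball_D : nbhs (0 : D) [set x | KD s x /\ dot (rD s x) (rD s x) <= 1].
Proof.
apply: filterI; first by apply: open_nbhs_nbhs; split; [exact: gs_open gsD|exact: gs_K0 gsD].
have c := continuous_dot (gs_cont gsD) (gs_cont gsD).
have h : nbhs (0 : R) [set t | t < 1] by apply: lt_nbhsl.
have := c 0 [set t | t < 1]; rewrite (gs_r0 gsD) dot0l => /(_ h) hn.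
by apply: (filterS (P := [set x | dot (rD s x) (rD s x) < 1]) _ hn) => x /= /ltW.
Qed.

Lemma EG_shift_le a x h : 0 <= a -> KG s h -> dot (rG s h) (rG s h) <= 1 -> EG a (x + h) <= expR a * EG (a / 2) x.
Proof.
move=> a0 Kh rh; have := gE_shift_le gsG (x + h) (y := - h) a0 (gs_KN gsG Kh).
by rewrite (gs_rN gsG) dotNl dotNr opprK addrK; exact.
Qed.
Lemma ED_shift_le a xi h : 0 <= a -> KD s h -> dot (rD s h) (rD s h) <= 1 -> ED a (xi + h) <= expR a * ED (a / 2) xi.
Proof.
move=> a0 Kh rh; have := gE_shift_le gsD (xi + h) (y := - h) a0 (gs_KN gsD Kh).
by rewrite (gs_rN gsD) dotNl dotNr opprK addrK; exact.
Qed.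

Lemma EG_le1 a x : 0 <= a -> EG a x <= 1. Proof. exact: gE_le1. Qed.
Lemma ED_le1 a xi : 0 <= a -> ED a xi <= 1. Proof. exact: gE_le1. Qed.

(** The transform of the Gaussian is again a Gaussian, and a displacement in the unit balls only
    widens it and costs a constant: this is the local domination. *)
Lemma tf_gauss_G : tf_gauss P1.
Proof.
have gE : gauss (t := P1) = fun x => (EG pi x)%:C by apply/funext => x; rewrite gaussE.
have pp : 0 < (pi : R) / 2 by rewrite divr_gt0.
split.
- rewrite gE; split; first exact: EG_int.
  by exists 1 => x; rewrite normc_real ger0_norm ?EG_ge0// EG_le1// ltW.
- by rewrite gE; apply: ccont_real; exact: continuous_EG.
(* One factor exp (pi / 2) for the displacement in each of the two variables. *)
- pose C := expR (pi / 2) * expR (pi / 2) * cEG (2 * pi).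
  have C0 : 0 <= C by rewrite !mulr_ge0 ?expR_ge0// ltW// cEG_gt0// mulr_gt0.
  exists (fun z : G * D => C * EG (pi / 2 / 2) z.1 * ED (pi / 2 / 2) z.2).
  exists ([set x | KG s x /\ dot (rG s x) (rG s x) <= 1] `*` [set x | KD s x /\ dot (rD s x) (rD s x) <= 1]).
  have m1 : mfunT (fun x : borel G => C * EG (pi / 2 / 2) x).
    by apply: measurable_funM => //; exact: measurable_EG.
  have m2 : mfunT (ED (pi / 2 / 2) : borel D -> R) by exact: measurable_ED.
  split.
  + exact: (measurable_mul_prod m1 m2).
  + have f0 x : 0 <= C * EG (pi / 2 / 2) x by rewrite mulr_ge0 ?EG_ge0.
    have p4 : 0 < (pi : R) / 2 / 2 by rewrite divr_gt0.
    have h := @prodm_mul_lty _ _ _ _ _ mu nu _ _ m1 m2 f0 (fun _ => ED_ge0 _ _) (EG_scale_lty p4 C0) (ED_lty p4).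
    exact: h.
  + exists ([set x | KG s x /\ dot (rG s x) (rG s x) <= 1], [set x | KD s x /\ dot (rD s x) (rD s x) <= 1]) => //.
    by split; [exact: gauss_ball_G|exact: gauss_ball_D].
  + move=> [x xi] [h k] [[Kh rh] [Kk rk]].
    change (normc (stft (gauss (t := P1)) (gauss (t := P1)) ((x + h, xi + k) : time P1 * freq P1)) <=
      C * EG (pi / 2 / 2) x * ED (pi / 2 / 2) xi).
    rewrite stft_gauss /C.
    have l1 := EG_shift_le x (ltW pp) Kh rh; have l2 := ED_shift_le xi (ltW pp) Kk rk.
    have c0 : 0 <= cEG (2 * pi) by rewrite ltW// cEG_gt0// mulr_gt0.
    apply: (le_trans (ler_pM (EG_ge0 _ _) (mulr_ge0 c0 (ED_ge0 _ _)) l1 (ler_wpM2l c0 l2))).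
    by apply: eqW; ring.
Qed.

Lemma gauss_GD_lty a b (C : R) : 0 < a -> 0 < b -> 0 <= C -> (\int[mu2]_z (C * EG a z.1 * ED b z.2)%:E < +oo)%E.
Proof.
move=> a0 b0 C0.
have m1 : mfunT (fun x : borel G => C * EG a x) by apply: measurable_funM => //; exact: measurable_EG.
have m2 : mfunT (ED b : borel D -> R) by exact: measurable_ED.
have f0 x : 0 <= C * EG a x by rewrite mulr_ge0 ?EG_ge0.
have mp : mfunT (fun z : borel G * borel D => (C * EG a z.1 * ED b z.2)%:E).
  by apply/mEFinP; exact: (measurable_mul_prod m1 m2).
rewrite (ge0_integral_product mu2_prod mp); last by move=> z; rewrite lee_fin mulr_ge0 ?ED_ge0.
have h := @prodm_mul_lty _ _ _ _ _ mu nu _ _ m1 m2 f0 (fun _ => ED_ge0 _ _) (EG_scale_lty a0 C0) (ED_lty b0).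
exact: h.
Qed.

Lemma gauss_DG_lty a b (C : R) : 0 < a -> 0 < b -> 0 <= C -> (\int[nu2]_z (ED b z.1 * (C * EG a z.2))%:E < +oo)%E.
Proof.
move=> a0 b0 C0.
have m1 : mfunT (fun x : borel G => C * EG a x) by apply: measurable_funM => //; exact: measurable_EG.
have m2 : mfunT (ED b : borel D -> R) by exact: measurable_ED.
have f0 x : 0 <= C * EG a x by rewrite mulr_ge0 ?EG_ge0.
have mp : mfunT (fun z : borel D * borel G => (ED b z.1 * (C * EG a z.2))%:E).
  by apply/mEFinP; exact: (measurable_mul_prod m2 m1).
rewrite (ge0_integral_product nu2_prod mp); last by move=> z; rewrite lee_fin mulr_ge0 ?ED_ge0.
have h := @prodm_mul_lty _ _ _ _ _ nu mu _ _ m2 m1 (fun _ => ED_ge0 _ _) f0 (ED_lty b0) (EG_scale_lty a0 C0).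
exact: h.
Qed.

Lemma continuous_GD a b (C : R) : continuous (fun z : G * D => C * EG a z.1 * ED b z.2).
Proof.
move=> z; apply: cvgM; first apply: cvgM; first exact: cvg_cst.
  by apply: (@continuous_comp _ _ _ (fst : G * D -> G) (EG a)); [exact: cvg_fst|exact: continuous_EG].
by apply: (@continuous_comp _ _ _ (snd : G * D -> D) (ED b)); [exact: cvg_snd|exact: continuous_ED].
Qed.
Lemma continuous_DG a b (C : R) : continuous (fun z : D * G => ED b z.1 * (C * EG a z.2)).
Proof.
move=> z; apply: cvgM.
  by apply: (@continuous_comp _ _ _ (fst : D * G -> D) (ED b)); [exact: cvg_fst|exact: continuous_ED].
apply: cvgM; first exact: cvg_cst.
by apply: (@continuous_comp _ _ _ (snd : D * G -> G) (EG a)); [exact: cvg_snd|exact: continuous_EG].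
Qed.

Lemma tf_gauss_phase : tf_gauss P2.
Proof.
have gE : gauss (t := P2) = fun z : G * D => (1 * EG pi z.1 * ED pi z.2)%:C.
  by apply/funext => z; rewrite phase_gaussE mul1r.
have pp : 0 < (pi : R) / 2 by rewrite divr_gt0.
have p4 : 0 < (pi : R) / 2 / 2 by rewrite divr_gt0.
have g01 z : 0 <= 1 * EG pi z.1 * ED pi z.2 <= 1.
  rewrite mul1r; apply/andP; split; first exact: mulr_ge0 (EG_ge0 _ _) (ED_ge0 _ _).
  rewrite -[leRHS]mulr1.
  exact: ler_pM (EG_ge0 _ _) (ED_ge0 _ _) (EG_le1 _ (ltW p0)) (ED_le1 _ (ltW p0)).
split.
- rewrite gE; split.
    split.
      apply: cmeas_real; apply: ccont_mR; exact: continuous_GD.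
    have := gauss_GD_lty p0 p0 ler01; congr (_ < _)%E; apply: eq_integral => z _.
    by have /andP[h _] := g01 z; rewrite normc_real ger0_norm.
  by exists 1 => z; have /andP[h1 h2] := g01 z; rewrite normc_real ger0_norm.
- by rewrite gE; apply: ccont_real; exact: continuous_GD.
- have c0 : 0 <= cEG (2 * pi) by rewrite ltW// cEG_gt0// mulr_gt0.
  have c1 : 0 <= (cEG (pi / 2))^-1 by rewrite invr_ge0 ltW// cEG_gt0.
  pose C := expR (pi / 2) * expR (pi / 2) * cEG (2 * pi) * expR (pi / 2) * expR (pi / 2) * (cEG (pi / 2))^-1.
  have C0 : 0 <= C by rewrite !mulr_ge0 ?expR_ge0.
  pose UG := [set x | KG s x /\ dot (rG s x) (rG s x) <= 1].
  pose UD := [set x | KD s x /\ dot (rD s x) (rD s x) <= 1].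
  pose f (z : borel (G * D)%type) := C * EG (pi / 2 / 2) z.1 * ED (pi / 2 / 2) z.2.
  pose g (z : borel (D * G)%type) := ED (pi / 2 / 2) z.1 * (1 * EG (pi / 2 / 2) z.2).
  have m1 : mfunT f by apply: ccont_mR; exact: continuous_GD.
  have m2 : mfunT g by apply: ccont_mR; exact: continuous_DG.
  exists (fun z => f z.1 * g z.2); exists ((UG `*` UD) `*` (UD `*` UG)); split.
  + exact: (measurable_mul_prod m1 m2).
  + have f0 z : 0 <= f z by apply: mulr_ge0; [apply: mulr_ge0 => //; exact: EG_ge0|exact: ED_ge0].
    have g0 z : 0 <= g z by apply: mulr_ge0; [exact: ED_ge0|apply: mulr_ge0 => //; exact: EG_ge0].
    have h := @prodm_mul_lty _ _ _ _ _ mu2 nu2 _ _ m1 m2 f0 g0 (gauss_GD_lty p4 p4 C0) (gauss_DG_lty p4 p4 ler01).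
    exact: h.
  + exists (UG `*` UD, UD `*` UG) => //; split.
      by exists (UG, UD) => //; split; [exact: gauss_ball_G|exact: gauss_ball_D].
    by exists (UD, UG) => //; split; [exact: gauss_ball_D|exact: gauss_ball_G].
  + move=> [[x xi] [eta y]] [[h k] [k' h']] [[[Kh rh] [Kk rk]] [[Kk' rk'] [Kh' rh']]].
    apply: (le_trans (eq_ind_r (fun u => u <= _) (lexx _) (stft_phase_gauss ((x, xi) + (h, k)) ((eta, y) + (k', h'))))).
    change (EG (pi / 2) (x + h) * (cEG (2 * pi) * ED (pi / 2) (eta + k')) *
      (ED (pi / 2) (xi + k) * (EG (pi / 2) (y + h') / cEG (pi / 2))) <= f (x, xi) * g (eta, y)).
    have l1 := EG_shift_le x (ltW pp) Kh rh; have l2 := ED_shift_le xi (ltW pp) Kk rk.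
    have l3 := ED_shift_le eta (ltW pp) Kk' rk'; have l4 := EG_shift_le y (ltW pp) Kh' rh'.
    have a1 := ler_pM (EG_ge0 _ _) (mulr_ge0 c0 (ED_ge0 _ _)) l1 (ler_wpM2l c0 l3).
    have a2 := ler_pM (ED_ge0 _ _) (mulr_ge0 (EG_ge0 _ _) c1) l2 (ler_wpM2r c1 l4).
    apply: (le_trans (ler_pM _ _ a1 a2)).
    * by rewrite !mulr_ge0 ?EG_ge0 ?ED_ge0.
    * by rewrite !mulr_ge0 ?EG_ge0 ?ED_ge0.
    * by apply: eqW; rewrite /f /g /C /=; ring.
Qed.
End Spaces.

Import HBSimple HBNNSimple.

(** * Square integrable functions and the Cauchy-Schwarz inequality *)

Section SquareIntegrable.
Context d (T : measurableType d) (R : realType) (m : {measure set T -> \bar R}).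
Implicit Types f g : T -> R[i].

(** The squared L^2 norm with an integer power; [in_L2P] relates it to [in_L]. *)
Definition sqn f : \bar R := (\int[m]_x (normc (f x) ^+ 2)%:E)%E.

Lemma sqn_ge0 f : (0 <= sqn f)%E.
Proof. by apply: integral_ge0 => x _; rewrite lee_fin sqr_ge0. Qed.

Lemma in_L2P f : in_L m 2%:E f <-> cmeasurable f /\ (sqn f < +oo)%E.
Proof.
have E : (\int[m]_x (`|(normc (f x))%:E| `^ 2) = sqn f)%E.
  apply: eq_integral => x _; rewrite gee0_abs ?lee_fin ?normc_ge0// poweR_EFin.
  by rewrite (powR_mulrn 2 (normc_ge0 _)).
rewrite /in_L /cLnorm; split=> -[mf h]; split => //.
  rewrite -E -powR_Lnorm//; exact: poweR_lty.
by apply: (@lty_poweRy _ _ 2) => //; rewrite powR_Lnorm// E.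
Qed.

Lemma msqn f : cmeasurable f -> mfunT (fun x => (normc (f x) ^+ 2)%:E).
Proof. by move=> mf; apply/mEFinP; apply: measurable_funX; exact: mnormc. Qed.

Lemma sqn_le f g : cmeasurable f -> cmeasurable g -> (forall x, normc (f x) <= normc (g x)) -> (sqn f <= sqn g)%E.
Proof.
move=> mf mg fg; apply: ge0_le_int; [exact: msqn|exact: msqn|by move=> x; rewrite lee_fin sqr_ge0|move=> x].
by rewrite lee_fin lerXn2r ?nnegrE ?normc_ge0.
Qed.

Lemma sqnD f g : cmeasurable f -> cmeasurable g -> (sqn (fun x => (f x + g x)%R) <= 2%:E * sqn f + 2%:E * sqn g)%E.
Proof.
move=> mf mg; have m1 := msqn mf; have m2 := msqn mg.
have h1 x : setT x -> (0 <= (normc (f x) ^+ 2)%:E)%E by rewrite lee_fin sqr_ge0.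
have h2 x : setT x -> (0 <= (normc (g x) ^+ 2)%:E)%E by rewrite lee_fin sqr_ge0.
rewrite /sqn -!ge0_integralZl// -ge0_integralD//.
- apply: ge0_le_int.
  + by apply: msqn; exact: cmeasD.
  + by apply: emeasurable_funD; exact: measurable_funeM.
  + by move=> x; rewrite lee_fin sqr_ge0.
  + move=> x; rewrite -!EFinM -EFinD lee_fin.
    apply: (@le_trans _ _ ((normc (f x) + normc (g x)) ^+ 2)).
      by rewrite lerXn2r ?nnegrE ?normc_ge0 ?addr_ge0 ?normc_ge0// normcD_le.
    rewrite -subr_ge0 (_ : _ - _ = (normc (f x) - normc (g x)) ^+ 2) ?sqr_ge0//; ring.
- by move=> x _; rewrite mule_ge0// lee_fin sqr_ge0.
- exact: measurable_funeM.
- by move=> x _; rewrite mule_ge0// lee_fin sqr_ge0.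
- exact: measurable_funeM.
Qed.

Lemma sqnZ (c : R[i]) f : cmeasurable f -> sqn (fun x => c * f x) = ((normc c ^+ 2)%:E * sqn f)%E.
Proof.
move=> mf; rewrite /sqn -ge0_integralZl//.
- by apply: eq_integral => x _; rewrite normcM' exprMn EFinM.
- exact: msqn.
- by move=> x _; rewrite lee_fin sqr_ge0.
- by rewrite lee_fin sqr_ge0.
Qed.

Lemma sqn_mul_conj f g : cmeasurable f -> cmeasurable g -> (sqn f < +oo)%E -> (sqn g < +oo)%E ->
  cinteg m (fun x => f x * (g x)^*).
Proof.
move=> mf mg sf sg; have m1 := msqn mf; have m2 := msqn mg.
apply: (@cinteg_le _ _ _ m _ (fun x => normc (f x) ^+ 2 + normc (g x) ^+ 2)).
- by apply: cmeasM => //; exact: cmeas_conj.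
- by apply: measurable_funD; apply: measurable_funX; exact: mnormc.
- move=> x; rewrite normcM' normc_conj.
  have := sqr_ge0 (normc (f x) - normc (g x)); have := normc_ge0 (f x); have := normc_ge0 (g x).
  nra.
- under eq_integral do rewrite EFinD.
  rewrite ge0_integralD//; first exact: lte_add_pinfty.
  + by move=> x _; rewrite lee_fin sqr_ge0.
  + by move=> x _; rewrite lee_fin sqr_ge0.
Qed.

Lemma sqn_fin f : (sqn f < +oo)%E -> sqn f = (fine (sqn f))%:E.
Proof. by move=> h; rewrite fineK// ge0_fin_numE ?sqn_ge0. Qed.

(** The inequality 2 u v <= t u^2 + v^2 / t is integrated, and t is then chosen optimally. *)
Lemma cauchy_schwarz f g : cmeasurable f -> cmeasurable g -> (sqn f < +oo)%E -> (sqn g < +oo)%E ->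
  normc (L2_inner m f g) ^+ 2 <= fine (sqn f) * fine (sqn g).
Proof.
move=> mf mg sf sg; have Ifg := sqn_mul_conj mf mg sf sg.
set I := L2_inner m f g; set a := fine (sqn f); set b := fine (sqn g).
have a0 : 0 <= a by rewrite fine_ge0 ?sqn_ge0.
have b0 : 0 <= b by rewrite fine_ge0 ?sqn_ge0.
have H (t : R) : 0 < t -> 2 * normc I <= t * a + t^-1 * b.
  move=> t0; rewrite -lee_fin EFinM.
  apply: (@le_trans _ _ (2%:E * \int[m]_x (normc (f x * (g x)^*))%:E)%E).
    by apply: lee_wpmul2l; rewrite ?lee_fin//; exact: normc_cintegral.
  have m1 := msqn mf; have m2 := msqn mg.
  have h1 x : setT x -> (0 <= (normc (f x) ^+ 2)%:E)%E by rewrite lee_fin sqr_ge0.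
  have h2 x : setT x -> (0 <= (normc (g x) ^+ 2)%:E)%E by rewrite lee_fin sqr_ge0.
  have -> : (t * a + t^-1 * b)%:E = (t%:E * sqn f + t^-1%:E * sqn g)%E by rewrite (sqn_fin sf) (sqn_fin sg).
  rewrite /sqn.
  have ti0 : 0 <= t^-1 by rewrite invr_ge0 ltW.
  rewrite -(ge0_integralZl m measurableT m1 h1) ?lee_fin ?(ltW t0)//.
  rewrite -(ge0_integralZl m measurableT m2 h2) ?lee_fin//.
  rewrite -ge0_integralZl//; last 2 first.
  - by apply/mEFinP; apply: mnormc; case: Ifg.
  - by move=> x _; rewrite lee_fin normc_ge0.
  rewrite -ge0_integralD//.
  - apply: ge0_le_int.
    + by apply: measurable_funeM; apply/mEFinP; apply: mnormc; case: Ifg.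
    + by apply: emeasurable_funD; exact: measurable_funeM.
    + by move=> x; rewrite mule_ge0// lee_fin normc_ge0.
    + move=> x; rewrite -!EFinM -EFinD lee_fin normcM' normc_conj.
      set u := normc (f x); set v := normc (g x).
      rewrite -subr_ge0 (_ : _ - _ = t^-1 * (t * u - v) ^+ 2); first by apply: mulr_ge0 => //; exact: sqr_ge0.
      by field; rewrite gt_eqF.
  - by move=> x _; rewrite mule_ge0 ?lee_fin ?sqr_ge0// ltW.
  - exact: measurable_funeM.
  - by move=> x _; rewrite mule_ge0 ?lee_fin ?sqr_ge0.
  - exact: measurable_funeM.
have n0 := normc_ge0 I.
have [->|I0] := eqVneq (normc I) 0; first by rewrite expr0n mulr_ge0.
have {}I0 : 0 < normc I by rewrite lt_neqAle eq_sym I0.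
(* For a = 0 no t is optimal; t = (b + 1) / |I| gives a contradiction with I nonzero. *)
have [a_0|a1] := leP a 0.
  have aE : a = 0 by apply/eqP; rewrite eq_le a_0.
  have b1 : 0 < b + 1 by rewrite ltr_wpDl.
  have := H ((b + 1) / normc I) (divr_gt0 b1 I0).
  rewrite aE mulr0 add0r invf_div mulrAC ler_pdivlMr// => h.
  have : normc I * (2 * (b + 1)) <= normc I * b by rewrite mulrA [normc I * 2]mulrC.
  rewrite ler_pM2l//; lra.
have := H (normc I / a) (divr_gt0 I0 a1).
rewrite divfK ?gt_eqF// invf_div => h.
have {}h : normc I <= a / normc I * b by move: h; lra.
by rewrite expr2 -ler_pdivlMr//; apply: (le_trans h); rewrite mulrAC.
Qed.

End SquareIntegrable.

Lemma RCB (R : realType) (a b : R) : (a - b)%:C = a%:C - b%:C.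
Proof. by apply: complexP; rewrite ?ReD ?ImD ?ReN ?ImN /= ?subrr. Qed.

Lemma RC_sum (R : realType) n (F : 'I_n -> R) : (\sum_(i < n) F i)%:C = \sum_(i < n) (F i)%:C.
Proof.
elim: n F => [|n IH] F; first by rewrite !big_ord0.
by rewrite !big_ord_recr /= -IH; apply: complexP; rewrite /= ?addr0.
Qed.

(** * Continuity of translations in L^2 *)

Section TranslationContinuity.
Variables (R : realType) (X : preTopologicalZmodType) (mu : sfm R X).
Hypothesis hX : hgroup mu.
Implicit Types (f g : X -> R[i]) (x h : X).
Local Notation cmeas f := (bcmeas R X f).

Definition tcont f := cmeas f /\ forall e : R, 0 < e -> nbhs (0 : X) [set h | (sqn mu (fun x => (f (x + h) - f x)%R) <= e%:E)%E].

Lemma cmeas_shift f h : cmeas f -> cmeas (fun x => f (x + h)).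
Proof. by move=> mf; exact: (cmeas_comp (mshf hX h) mf). Qed.

Lemma sqn_shift f h : cmeas f -> sqn mu (fun x => f (x + h)) = sqn mu f.
Proof.
move=> mf; apply: (int_shift hX h (f := fun x => (normc (f x) ^+ 2)%:E)).
  exact: msqn.
by move=> x; rewrite lee_fin sqr_ge0.
Qed.

Lemma tcontD f g : tcont f -> tcont g -> tcont (fun x => f x + g x).
Proof.
move=> [mf cf] [mg cg]; split; first exact: cmeasD.
move=> e e0; have e4 : 0 < e / 4 by rewrite divr_gt0.
apply: filterS2 (cf _ e4) (cg _ e4) => h h1 h2 /=.
have -> : (fun x => f (x + h) + g (x + h) - (f x + g x)) = (fun x => (f (x + h) - f x) + (g (x + h) - g x)).
  by apply/funext => x; ring.
apply: (le_trans (sqnD mu _ _)).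
- by apply: cmeasB => //; exact: cmeas_shift.
- by apply: cmeasB => //; exact: cmeas_shift.
have -> : e%:E = (2%:E * (e / 4)%:E + 2%:E * (e / 4)%:E)%E by rewrite -!EFinM -!EFinD; congr EFin; field.
by apply: leeD; apply: lee_wpmul2l => //; rewrite lee_fin.
Qed.

Lemma tcontZ c f : tcont f -> tcont (fun x => c * f x).
Proof.
move=> [mf cf]; split; first by apply: cmeasM => //; exact: cmeas_cst.
move=> e e0; have c0 : 0 < normc c ^+ 2 + 1 by rewrite ltr_wpDl ?sqr_ge0.
apply: filterS (cf _ (divr_gt0 e0 c0)) => h hh /=.
have -> : (fun x => c * f (x + h) - c * f x) = (fun x => c * (f (x + h) - f x)).
  by apply/funext => x; ring.
rewrite /= sqnZ; last by apply: cmeasB => //; exact: cmeas_shift.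
apply: (@le_trans _ _ ((normc c ^+ 2 + 1)%:E * (e / (normc c ^+ 2 + 1))%:E)%E).
  apply: lee_pmul => //; rewrite ?lee_fin ?sqr_ge0 ?sqn_ge0 ?lerDl//.
by rewrite -EFinM lee_fin mulrC divfK// gt_eqF.
Qed.

Lemma tcont0 : tcont (fun=> 0).
Proof.
split; first exact: cmeas_cst.
move=> e e0; apply: nearW => h /=; rewrite /sqn.
under eq_integral do rewrite subr0 normc0 expr0n.
by rewrite integral0 lee_fin ltW.
Qed.

Lemma tcont_sum n (F : 'I_n -> X -> R[i]) : (forall k, tcont (F k)) -> tcont (fun x => \sum_(k < n) F k x).
Proof.
elim: n F => [|n IH] F mF; first by under eq_fun do rewrite big_ord0; exact: tcont0.
by under eq_fun do rewrite big_ord_recr; apply: tcontD => //; exact: IH.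
Qed.

Lemma tcont_lim f : cmeas f -> (forall e : R, 0 < e -> exists2 g, tcont g & (sqn mu (fun x => (f x - g x)%R) <= e%:E)%E) -> tcont f.
Proof.
move=> mf H; split => // e e0; have e8 : 0 < e / 16 by rewrite divr_gt0.
have [g [mg cg] fg] := H _ e8.
have mfg : cmeas (fun x => f x - g x) by exact: cmeasB.
apply: filterS (cg _ e8) => h hh /=.
have -> : (fun x => f (x + h) - f x) = (fun x => ((f (x + h) - g (x + h)) + (-1) * (f x - g x)) + (g (x + h) - g x)).
  by apply/funext => x; ring.
have m1 := cmeas_shift h mfg.
have m2 : cmeas (fun x => -1 * (f x - g x)) by apply: cmeasM => //; exact: cmeas_cst.
have m3 : cmeas (fun x => g (x + h) - g x) by apply: cmeasB => //; exact: cmeas_shift.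
apply: (le_trans (sqnD mu (cmeasD m1 m2) m3)).
have h1 := sqnD mu m1 m2.
rewrite (sqn_shift h mfg) (sqnZ mu _ mfg) in h1.
have n1 : normc (-1 : R[i]) ^+ 2 = 1 by rewrite normcN' normc1 expr1n.
rewrite n1 mul1e in h1.
have h2 : (2%:E * sqn mu (fun x => (f x - g x)%R) + 2%:E * sqn mu (fun x => (f x - g x)%R) <= (e / 4)%:E)%E.
  have -> : (e / 4)%:E = (2%:E * (e / 16)%:E + 2%:E * (e / 16)%:E)%E by rewrite -!EFinM -!EFinD; congr EFin; field.
  by apply: leeD; apply: lee_wpmul2l => //; rewrite lee_fin.
have -> : e%:E = (2%:E * (e / 4)%:E + 2%:E * (e / 4)%:E)%E by rewrite -!EFinM -!EFinD; congr EFin; field.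
apply: leeD; apply: lee_wpmul2l; rewrite ?lee_fin//; first exact: le_trans h1 h2.
by apply: (le_trans hh); rewrite lee_fin; lra.
Qed.

(** [q h] is the measure of the points of [U] that [h] moves out of [U]. Around each point of [U]
    this integrand vanishes for small [h], so [q] tends to 0 by dominated convergence; the squared
    norm of the difference is [q h + q (- h)]. *)
Lemma tcont_open (U : set X) : open U -> (mu U < +oo)%E -> tcont (fun x => (\1_U x)%:C).
Proof.
move=> oU finU; have mU := open_mborel oU.
have mI h : mfunT (fun x : borel X => \1_U (x + h) : R).
  have m0 : mfunT (\1_U : borel X -> R) by exact: measurable_indic.
  exact: (mcompT m0 (mshf hX h)).
have mI0 : mfunT (\1_U : borel X -> R) by exact: measurable_indic.
have i01 (x : X) : \1_U x = 0 :> R \/ \1_U x = 1 :> R by rewrite indicE; case: (x \in U); [right|left].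
split; first exact: cmeas_real.
pose q h := \int[mu]_x (\1_U x * (1 - \1_U (x + h)) : R).
have q01 h x : 0 <= (\1_U x * (1 - \1_U (x + h)) : R) <= \1_U x.
  by case: (i01 x) => ->; case: (i01 (x + h)) => ->; rewrite ?mul0r ?mul1r ?subr0 ?subrr ?lexx ?ler01.
have iU : (\int[mu]_x (\1_U x : R)%:E < +oo)%E by rewrite integral_indic// setIT.
have mq h : mfunT (fun x : borel X => \1_U x * (1 - \1_U (x + h)) : R).
  by apply: measurable_funM => //; apply: measurable_funB => //; exact: measurable_cst.
have qE h : (\int[mu]_x (\1_U x * (1 - \1_U (x + h)%R) : R)%:E)%E = (q h)%:E.
  rewrite /q /Rintegral fineK// ge0_fin_numE; last by apply: integral_ge0 => x _; rewrite lee_fin; have /andP[] := q01 h x.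
  apply: le_lt_trans iU; apply: ge0_le_int; [exact/mEFinP|exact/mEFinP| |] => x; rewrite lee_fin; by have /andP[] := q01 h x.
have cq : {for (0 : X), continuous q}.
  have RC := @Rintegral_continuous R X (hg_csb hX) _ (borel X) mu (fun h (x : borel X) => \1_U x * (1 - \1_U (x + h)) : R) 0 setT (\1_U : borel X -> R).
  apply: (RC filterT mq mI0 iU).
  - by move=> h x _; have /andP[a b] := q01 h x; rewrite ger0_norm.
  - move=> x; have [xU|xU] := boolP (x \in U); last first.
      rewrite (_ : (fun h => \1_U x * (1 - \1_U (x + h))) = fun=> 0); first exact: cst_continuous.
      by apply/funext => h; rewrite [\1_U x]indicE (negbTE xU) mul0r.
    rewrite inE in xU.
    have nU : nbhs (0 : X) [set h | U (x + h)].
      have cs : continuous (fun h : X => x + h).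
        by apply: (tgroup_addf (hg_top hX)); [exact: cst_continuous|move=> z; exact: cvg_id].
      by apply: cs; rewrite addr0; exact: open_nbhs_nbhs.
    move=> W /nbhs_singleton; rewrite addr0 indicE mem_set// subrr mulr0 => W0.
    by apply: filterS nU => h /= Uh; rewrite !indicE !mem_set// subrr mulr0.
have q0 : q 0 = 0.
  rewrite /q; under eq_Rintegral do rewrite addr0.
  rewrite (_ : (fun x => \1_U x * (1 - \1_U x)) = fun=> 0) ?/Rintegral ?integral0//.
  by apply/funext => x; case: (i01 x) => ->; rewrite ?mul0r ?subrr ?mulr0.
move=> e e0; have e2 : 0 < e / 2 by rewrite divr_gt0.
have n1 : nbhs (0 : X) [set h | q h < e / 2].
  by apply: (cq [set t | t < e / 2]); rewrite q0; apply: lt_nbhsl.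
have n2 : nbhs (0 : X) [set h | q (- h) < e / 2].
  have cN : continuous (fun h : X => - h) by apply: (tgroup_oppf (hg_top hX)) => z; exact: cvg_id.
  by apply: (cN 0 [set h | q h < e / 2]); rewrite oppr0.
apply: filterS2 n1 n2 => h h1 h2 /=.
have sE : sqn mu (fun x => (\1_U (x + h))%:C - (\1_U x)%:C) = ((q h)%:E + (q (- h))%:E)%E.
  rewrite -!qE.
  have -> : (\int[mu]_x (\1_U x * (1 - \1_U (x + - h)%R) : R)%:E = \int[mu]_x (\1_U (x + h)%R * (1 - \1_U x) : R)%:E)%E.
    rewrite -(int_shift hX h (f := fun x => (\1_U x * (1 - \1_U (x + - h)%R) : R)%:E)).
    - by apply: eq_integral => x _; rewrite addrK.
    - by apply/mEFinP; exact: mq.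
    - by move=> x; rewrite lee_fin; have /andP[] := q01 (- h) x.
  rewrite -ge0_integralD//.
  - apply: eq_integral => x _; rewrite -EFinD; congr EFin.
    rewrite -RCB normc_real real_normK ?num_real//.
    by case: (i01 x) => ->; case: (i01 (x + h)) => ->; ring.
  - by apply/mEFinP; exact: mq.
  - by apply/mEFinP; apply: measurable_funM => //; apply: measurable_funB => //; exact: measurable_cst.
by rewrite sE -EFinD lee_fin ltW// [ltRHS]splitr ltrD.
Qed.

Lemma tcontB f g : tcont f -> tcont g -> tcont (fun x => f x - g x).
Proof.
move=> tf tg; have := tcontD tf (tcontZ (-1) tg).
by under eq_fun do rewrite mulN1r.
Qed.

Lemma indicDE (A B : set X) x : B `<=` A -> \1_(A `\` B) x = \1_A x - \1_B x :> R.
Proof.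
move=> BA; rewrite !indicE; have [xB|xB] := pselect (B x).
  by rewrite (mem_set xB) (mem_set (BA _ xB)) memNset ?subrr// => -[].
have [xA|xA] := pselect (A x); first by rewrite (mem_set xA) (memNset xB) mem_set ?subr0.
by rewrite (memNset xA) (memNset xB) memNset ?subr0// => -[].
Qed.

Lemma sqn_indicB (A B : set X) : measurable (A : set (borel X)) -> measurable (B : set (borel X)) -> B `<=` A ->
  sqn mu (fun x => (\1_A x)%:C - (\1_B x)%:C) = mu (A `\` B).
Proof.
move=> mA mB BA; have mD : measurable (A `\` B : set (borel X)) by exact: measurableD.
have -> : mu (A `\` B) = (\int[mu]_x (\1_(A `\` B) x : R)%:E)%E by rewrite integral_indic// setIT.
apply: eq_integral => x _; rewrite -RCB -indicDE// normc_real ger0_norm// indicE.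
by case: (x \in _); rewrite ?expr0n ?expr1n.
Qed.

(** The sets with this property form a lambda-system that contains the open sets; intersecting with
    [W] keeps all measures finite. *)
Lemma tcont_measurable (W E : set X) : open W -> (mu W < +oo)%E -> measurable (E : set (borel X)) -> tcont (fun x => (\1_(E `&` W) x)%:C).
Proof.
move=> oW finW; have mW := open_mborel oW.
have fin (A : set X) : measurable (A : set (borel X)) -> (mu (A `&` W) < +oo)%E.
  by move=> mA; apply: le_lt_trans finW; apply: le_measure; rewrite ?inE//; exact: measurableI.
pose H : set (set X) := [set A | measurable (A : set (borel X)) /\ tcont (fun x => (\1_(A `&` W) x)%:C)].
have sub : <<s [set: X], @open X >> `<=` H.
  apply: lambda_system_subset => //.
  - by move=> A B oA oB; exact: openI.
  - split; first by [].
    + by split; [exact: measurableT|rewrite setTI; exact: tcont_open].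
    + move=> A B BA [mA tA] [mB tB]; split; first exact: measurableD.
      have -> : (fun x => (\1_((A `\` B) `&` W) x)%:C) = (fun x => (\1_(A `&` W) x)%:C - (\1_(B `&` W) x)%:C : R[i]).
        apply/funext => x; rewrite -RCB -indicDE; last by apply: setSI.
        congr (\1_ _ _)%:C; apply/seteqP; split=> z; first by move=> [[Az nBz] Wz]; split => // -[].
        by move=> [[Az Wz] nB]; split => //; split => // Bz; apply: nB.
      exact: tcontB tA tB.
    + move=> F ndF HF; have mF n : measurable (F n : set (borel X)) by have [] := HF n.
      have mU : measurable (\bigcup_n F n : set (borel X)) by exact: bigcupT_measurable.
      split => //; apply: tcont_lim.
        by apply: cmeas_indic; exact: measurableI.
      move=> e e0.
      have mUW : measurable (\bigcup_n (F n `&` W) : set (borel X)) by apply: bigcupT_measurable => n; exact: measurableI.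
      have UE : \bigcup_n (F n `&` W) = (\bigcup_n F n) `&` W by rewrite setI_bigcupl.
      have nd : nondecreasing_seq (fun n => F n `&` W).
        by move=> a b ab; apply/subsetPset; apply: setSI; apply/subsetPset; exact: ndF.
      have fU : mu (\bigcup_n (F n `&` W)) = (fine (mu (\bigcup_n (F n `&` W))))%:E.
        by rewrite fineK// ge0_fin_numE// UE fin.
      have cv0 := @nondecreasing_cvg_mu _ (borel X) R mu (fun n => F n `&` W) (fun n => measurableI _ _ (mF n) mW) mUW nd.
      have cv := eq_ind _ (fun l => (mu \o (fun n => F n `&` W)) n @[n --> \oo] --> l) cv0 _ fU.
      have /fine_cvgP[_ /cvgrPdist_le/(_ e e0)[n _ /(_ n (leqnn n)) hn]] := cv.
      have fn : mu (F n `&` W) = (fine (mu (F n `&` W)))%:E by rewrite fineK// ge0_fin_numE// fin.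
      exists (fun x => (\1_(F n `&` W) x)%:C); first by have [] := HF n.
      have FU : F n `&` W `<=` \bigcup_n F n `&` W by apply: setSI; exact: bigcup_sup.
      rewrite sqn_indicB//; [|exact: measurableI|exact: measurableI].
      rewrite measureD//; [|exact: measurableI|exact: measurableI|exact: fin].
      rewrite (setIidr FU); apply: (@le_trans _ _ ((fine (mu (\bigcup_n (F n `&` W))))%:E - (fine (mu (F n `&` W)))%:E)%E).
        apply: leeB; [apply: eqW; exact: (etrans (congr1 mu (esym UE)) fU)|].
        by apply: eqW; exact: esym fn.
      by rewrite -EFinB lee_fin (le_trans (ler_norm _)).
  - move=> A oA; split; first exact: open_mborel.
    by apply: tcont_open; [exact: openI|apply: fin; exact: open_mborel].
by move=> mE; have [] := sub E mE.
Qed.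

Hypothesis fO : exists U : set X, [/\ open U, U 0 & (mu U < +oo)%E].

(** Countably many translates of one open set of finite measure cover the group, by the Lindelof
    property. *)
Lemma open_exhaustion : exists W : nat -> set X, [/\ forall n, open (W n), forall n, (mu (W n) < +oo)%E,
  forall n k, (n <= k)%N -> W n `<=` W k & forall x, exists n, W n x].
Proof.
have [U0 [oU0 U00 finU0]] := fO.
have oS (c : X) : open [set y | U0 (y - c)] by apply: open_shift => //; exact: hg_top hX.
have [c cP] := csb_lindelof 0 (W := fun c => [set y | U0 (y - c)]) (hg_csb hX)
  (fun c => open_nbhs_nbhs (conj (oS c) (eq_ind_r U0 U00 (subrr c)))).
pose W n := \bigcup_(k in [set k | (k <= n)%N]) [set y | U0 (y - c k)].
exists W; split=> [n|n|n k nk x [i /= li Ux]|x].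
- by apply: bigcup_open => k _.
- have -> : W n = \big[setU/set0]_(k < n.+1) [set y | U0 (y - c k)].
    by rewrite /W -(bigcup_mkord n.+1 (fun k => [set y | U0 (y - c k)])).
  elim: (n.+1) => [|k IH]; first by rewrite big_ord0 measure0.
  rewrite big_ord_recr /=; apply: (le_lt_trans (measureU2 _ _ _)).
  + by apply: bigsetU_measurable => i _; exact: open_mborel.
  + exact: open_mborel.
  + apply: lte_add_pinfty => //.
    exact: (eq_ind_r (fun u => (u < +oo)%E) finU0 (measure_shift_set hX (c k) oU0).2).
- by exists i => //=; exact: leq_trans nk.
- by have [n hn] := cP x; exists n; exists n => /=.
Qed.

(** Approximation in L^2 by simple functions cut off to the exhausting open sets. *)
Lemma tcont_ge0 (g : X -> R) : mfunT (g : borel X -> R) -> (forall x, 0 <= g x) ->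
  (\int[mu]_x (g x ^+ 2)%:E < +oo)%E -> tcont (fun x => (g x)%:C).
Proof.
move=> mg g0 ig; have [W [oW finW ndW covW]] := open_exhaustion.
have mge : mfunT (EFin \o (g : borel X -> R)) by exact/mEFinP.
pose s n : {nnsfun borel X >-> R} := nnsfun_approx measurableT mge n.
pose t n (x : borel X) : R := s n x * \1_(W n) x.
have mW n : measurable (W n : set (borel X)) by exact: open_mborel.
have cs x : s n x @[n --> \oo] --> g x.
  have ge0 (y : borel X) : setT y -> (0 <= (EFin \o (g : borel X -> R)) y)%E by rewrite lee_fin.
  exact: (fine_cvg (cvg_nnsfun_approx measurableT mge ge0 (I : setT x))).
have sg n x : s n x <= g x.
  have nd : nondecreasing_seq (fun n => s n x).
    by move=> a b ab; have /lefP := nd_nnsfun_approx measurableT mge ab; exact.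
  rewrite -(cvg_lim (@Rhausdorff R) (cs x)); apply: nondecreasing_cvgn_le => //.
  by apply/cvg_ex; exists (g x); exact: cs.
have s0 n x : 0 <= s n x by [].
have i01 n x : 0 <= (\1_(W n) x : R) <= 1 by rewrite indicE; case: (x \in W n); rewrite ?lexx ?ler01.
have tg n x : 0 <= t n x <= g x.
  have /andP[i0 i1] := i01 n x; rewrite mulr_ge0//=; apply: le_trans (sg n x).
  by rewrite ler_piMr.
have mt n : mfunT (t n).
  apply: measurable_funM; last exact: measurable_indic.
  exact: measurable_funPT.
have tc n : tcont (fun x => (t n x)%:C).
  have [N [c [E [mE sE]]]] : exists N (c : nat -> R) (E : nat -> set X),
      (forall i, measurable (E i : set (borel X))) /\ forall x, s n x = \sum_(i < N) c i * \1_(E i) x.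
    pose c i := nth 0 (finmap.enum_fset (fset_set (range (s n)))) i.
    have FE := fimfunEord (s n).
    exists (size (finmap.enum_fset (fset_set (range (s n))))), c, (fun i => s n @^-1` [set c i]); split; last exact: FE.
    by move=> i; rewrite -[X in measurable X]setTI; apply: measurable_funPT.
  have -> : (fun x => (t n x)%:C) = (fun x => \sum_(i < N) (c i)%:C * (\1_(E i `&` W n) x)%:C : R[i]).
    apply/funext => x; rewrite /t sE mulr_suml.
    rewrite RC_sum; apply: eq_bigr => i _; rewrite indicI /= -RCM; congr (_%:C).
    by rewrite mulrA.
  by apply: tcont_sum => i; apply: tcontZ; apply: tcont_measurable.
apply: tcont_lim; first exact: cmeas_real.
move=> e e0.
have cvt x : t n x @[n --> \oo] --> g x.
  have [k Wk] := covW x.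
  have ev : \forall n \near \oo, s n x = t n x.
    exists k => // n /= kn; rewrite /t indicE mem_set ?mulr1//; exact: ndW Wk.
  by apply: cvg_trans (cs x); apply: near_eq_cvg.
have [n hn] : exists n, (sqn mu (fun x => ((g x)%:C - (t n x)%:C)%R) <= e%:E)%E.
  have nE (k : nat) x : normc ((g x)%:C - (t k x)%:C) ^+ 2 = (g x - t k x) ^+ 2.
    by rewrite -RCB normc_real real_normK ?num_real.
  have mf k : mfunT (fun x : borel X => ((g x - t k x) ^+ 2)%:E).
    by apply/mEFinP; apply: measurable_funX; exact: measurable_funB.
  have ig' : mu.-integrable setT (fun x : borel X => (g x ^+ 2)%:E).
    apply/integrableP; split; first by apply/mEFinP; exact: measurable_funX.
    by under eq_integral do rewrite gee0_abs ?lee_fin ?sqr_ge0//.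
  have DC : (\int[mu]_x ((g x - t n x) ^+ 2)%:E)%E @[n --> \oo] --> (\int[mu]_x (0 : \bar R))%E.
    apply: (@dominated_cvg _ (borel X) _ mu setT measurableT (fun n x => ((g x - t n x) ^+ 2)%:E) (fun=> 0%E) (fun x => (g x ^+ 2)%:E)) => //.
    - move=> x _; apply/fine_cvgP; split; first exact: nearW.
      have -> : (0 : R) = (g x - g x) ^+ 2 by rewrite subrr expr0n.
      have h1 : (g x - t n x) @[n --> \oo] --> g x - g x by apply: cvgB; [exact: cvg_cst|exact: cvt].
      exact: (cvgM h1 h1).
    - move=> k x _; rewrite gee0_abs ?lee_fin ?sqr_ge0// lerXn2r ?nnegrE//.
        by rewrite subr_ge0; have /andP[] := tg k x.
      by rewrite lerBlDr lerDl; have /andP[] := tg k x.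
  rewrite integral0 in DC; have /fine_cvgP[fn /cvgrPdist_le/(_ e e0) hn] := DC.
  have [k _ /(_ k (leqnn k)) [f1 f2]] := filterI fn hn.
  exists k; rewrite /sqn; under eq_integral do rewrite nE.
  rewrite -(fineK f1) lee_fin; apply: (le_trans _ f2).
  by rewrite sub0r normrN ler_norm.
by exists (fun x => (t n x)%:C).
Qed.

Lemma tcont_L2 f : cmeas f -> (sqn mu f < +oo)%E -> tcont f.
Proof.
move=> mf sf; have [mR mI] := mf.
have H (u : X -> R) : mfunT (u : borel X -> R) -> (forall x, `|u x| <= normc (f x)) -> tcont (fun x => (u x)%:C).
  move=> mu0 ub.
  have part (v : X -> R) : mfunT (v : borel X -> R) -> (forall x, 0 <= v x) -> (forall x, v x <= normc (f x)) -> tcont (fun x => (v x)%:C).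
    move=> mv v0 vf; apply: tcont_ge0 => //; apply: le_lt_trans sf; apply: ge0_le_int.
    - by apply/mEFinP; exact: measurable_funX.
    - exact: msqn.
    - by move=> x; rewrite lee_fin sqr_ge0.
    - by move=> x; rewrite lee_fin lerXn2r ?nnegrE ?normc_ge0.
  have -> : (fun x => (u x)%:C) = (fun x => (Num.max (u x) 0)%:C - (Num.max (- u x) 0)%:C).
    apply/funext => x; rewrite -RCB; congr (_%:C).
    have [h|h] := leP 0 (u x).
      by rewrite max_r ?oppr_le0// subr0.
    by rewrite max_l ?oppr_ge0 ?ltW// sub0r opprK.
  apply: tcontB; apply: part.
  - by apply: measurable_maxr => //; exact: measurable_cst.
  - by move=> x; rewrite le_max lexx orbT.
  - move=> x; rewrite ge_max normc_ge0 andbT; exact: le_trans (ler_norm _) (ub x).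
  - by apply: measurable_maxr; [exact: mcompT|exact: measurable_cst].
  - by move=> x; rewrite le_max lexx orbT.
  - move=> x; rewrite ge_max normc_ge0 andbT; apply: le_trans (ub x); rewrite -normrN; exact: ler_norm.
have -> : f = (fun x => (complex.Re (f x))%:C + 'i%C * (complex.Im (f x))%:C).
  by apply/funext => x; apply: complexP; rewrite ?ReD ?ImD ?ReM ?ImM /=; ring.
apply: tcontD; first by apply: H => // x; exact: Re_le_normc.
by apply: tcontZ; apply: H => // x; exact: Im_le_normc.
Qed.
End TranslationContinuity.

(** * Cutoffs to sets of finite measure *)

Section SquareExhaustion.
Context d (T : measurableType d) (R : realType) (m : {sigma_finite_measure set T -> \bar R}).

Lemma finite_exhaustion : exists D : nat -> set T, [/\ forall n, measurable (D n), forall n, (m (D n) < +oo)%E,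
  nondecreasing_seq D & forall x, exists n, D n x].
Proof.
have [F [UF ndF mF]] := (@sigma_finiteP _ _ _ setT m).1 (sigma_finiteT m).
exists F; split => //; [by move=> n; have [] := mF n|by move=> n; have [] := mF n|move=> x].
have : (\bigcup_i F i) x by rewrite -UF.
by move=> [n _ Fx]; exists n.
Qed.

Definition cutoff (A : set T) (f : T -> R[i]) (x : T) : R[i] := (\1_A x)%:C * f x.

Lemma cmeas_cutoff A f : measurable A -> cmeasurable f -> cmeasurable (cutoff A f).
Proof. by move=> mA mf; apply: cmeasM => //; exact: cmeas_indic. Qed.

Lemma normc_cutoff A f x : normc (cutoff A f x) = \1_A x * normc (f x).
Proof. by rewrite /cutoff normcM' normc_real ger0_norm// indicE. Qed.

Lemma normc_cutoff_le A f x : normc (cutoff A f x) <= normc (f x).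
Proof. by rewrite normc_cutoff indicE; case: (x \in A); rewrite ?mul1r ?mul0r ?normc_ge0. Qed.

Lemma cinteg_cutoff A f c : measurable A -> (m A < +oo)%E -> cmeasurable f -> (forall x, normc (f x) <= c) ->
  cinteg m (cutoff A f).
Proof.
move=> mA fA mf fc; apply: (@cinteg_le _ T R m _ (fun x => c * \1_A x : R)).
- exact: cmeas_cutoff.
- by apply: measurable_funM; [exact: measurable_cst|exact: measurable_indic].
- by move=> x; rewrite normc_cutoff mulrC ler_wpM2r// indicE.
- have c0 (x : T) : 0 <= c by apply: le_trans (normc_ge0 _) (fc x).
  under eq_integral do rewrite EFinM.
  have [[x _]|/forallNP E] := pselect (exists x : T, True).
    rewrite ge0_intZ//.
    - by rewrite integral_indic// setIT lte_mul_pinfty// lee_fin (c0 x).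
    - by apply/mEFinP; exact: measurable_indic.
    - exact: c0 x.
  rewrite (_ : setT = set0) ?integral_set0//.
  by apply/seteqP; split => x // _; case: (E x).
Qed.

Variable D : nat -> set T.
Hypotheses (mD : forall n, measurable (D n)) (ndD : nondecreasing_seq D) (UD : forall x, exists n, D n x).

(** Monotone convergence along the cutoffs. It lets a uniform bound on the cutoffs establish square
    integrability. *)
Lemma sqn_cutoff_sup f (r : \bar R) : cmeasurable f -> (forall n, (sqn m (cutoff (D n) f) <= r)%E) -> (sqn m f <= r)%E.
Proof.
move=> mf H; pose s n x := (normc (cutoff (D n) f x) ^+ 2)%:E.
have ms n : mfunT (s n) by apply: msqn; exact: cmeas_cutoff.
have cs x : s n x @[n --> \oo] --> (normc (f x) ^+ 2)%:E.
  have [k Dk] := UD x; apply: cvg_near_cst; exists k => // n /= kn.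
  rewrite /s normc_cutoff indicE mem_set ?mul1r//; have /subsetPset := ndD kn; exact.
have := @cvg_monotone_convergence _ T R m setT measurableT s ms _ _.
have -> : sqn m f = (\int[m]_x (limn (s^~ x)))%E.
  by apply: eq_integral => x _; apply/esym/cvg_lim => //; exact: cs.
move=> cv; have s0 n x : setT x -> (0 <= s n x)%E by rewrite lee_fin sqr_ge0.
have nds x : setT x -> nondecreasing_seq (s^~ x).
  move=> _ a b ab; rewrite lee_fin lerXn2r ?nnegrE ?normc_ge0// !normc_cutoff ler_wpM2r ?normc_ge0// !indicE.
  have /subsetPset DD := ndD ab; have [xa|xa] := boolP (x \in D a); last by rewrite ler0n.
  by rewrite (mem_set (DD _ (set_mem xa))).
move: (cv s0 nds) => {}cv.
rewrite -(cvg_lim _ cv)//; apply: lime_le; first by apply/cvg_ex; exists (\int[m]_x limn (s^~ x))%E; exact: cv.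
by apply: nearW => n; exact: H.
Qed.

Lemma sqn_cutoff_cvg f (e : R) : cmeasurable f -> (sqn m f < +oo)%E -> 0 < e ->
  exists n, (sqn m (fun x => (cutoff (D n) f x - f x)%R) <= e%:E)%E.
Proof.
move=> mf sf e0.
have DC : (\int[m]_x (normc (cutoff (D n) f x - f x)%R ^+ 2)%:E)%E @[n --> \oo] --> (\int[m]_x (0 : \bar R))%E.
  apply: (@dominated_cvg _ T _ m setT measurableT (fun n x => (normc (cutoff (D n) f x - f x) ^+ 2)%:E) (fun=> 0%E) (fun x => (normc (f x) ^+ 2)%:E)) => //.
  - by move=> n; apply: msqn; apply: cmeasB => //; exact: cmeas_cutoff.
  - move=> x _; have [k Dk] := UD x; apply: cvg_near_cst; exists k => // n /= kn.
    have /subsetPset DD := ndD kn.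
    by rewrite /cutoff indicE mem_set ?mul1r ?subrr ?normc0 ?expr0n//; exact: DD.
  - apply/integrableP; split; first exact: msqn.
    by under eq_integral do rewrite gee0_abs ?lee_fin ?sqr_ge0//.
  - move=> n x _; rewrite gee0_abs ?lee_fin ?sqr_ge0// lerXn2r ?nnegrE ?normc_ge0//.
    rewrite /cutoff indicE; case: (x \in _); first by rewrite mul1r subrr normc0 normc_ge0.
    by rewrite mul0r sub0r normcN'.
rewrite integral0 in DC; have /fine_cvgP[fn /cvgrPdist_le/(_ e e0) hn] := DC.
have [k _ /(_ k (leqnn k)) [f1 f2]] := filterI fn hn.
exists k; rewrite /sqn -(fineK f1) lee_fin; apply: (le_trans _ f2).
by rewrite sub0r normrN ler_norm.
Qed.
End SquareExhaustion.

Lemma ccont_normcP (R : realType) (T : topologicalType) (f : T -> R[i]) (t : T) :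
  (forall e : R, 0 < e -> nbhs t [set s | normc (f s - f t) < e]) -> {for t, continuous (f : T -> R[i]^o)}.
Proof.
move=> H U /nbhs_ballP[e /= /ltcP_pos[e0 eE] eU].
by apply: filterS (H _ e0) => s /= hs; apply: eU; rewrite /ball /= normr_normc eE ltcR normcB_sym.
Qed.

(** * Bessel's inequality, Moyal's formula and reconstruction in L^2 *)

Section Moyal.
Variables (R : realType) (P : tf_space R).
Hypotheses (hP : tf_group P) (gP : tf_gauss P).
Local Notation X := (time P).
Local Notation X' := (freq P).
Local Notation XX := (borel X * borel X')%type.
Local Notation mu := (haar P).
Local Notation nu := (dual_haar P).
Local Notation mn := (prodm mu nu).
Local Notation phi := (gauss (t := P)).
Local Notation V := (stft phi).
Implicit Types (f h k l : X -> R[i]) (v w z : X * X') (x y : X) (xi : X').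
Local Notation cmeas f := (bcmeas R X f).
Local Notation cmeas2 F := (@cmeasurable _ XX R F).

Definition L2 f := cmeas f /\ (sqn mu f < +oo)%E.

Let hX := tf_time hP. Let hX' := tf_freq hP.
Let nphi := tg_nice gP.
Let mphi : cmeas phi. Proof. by case: nphi => -[]. Qed.

Lemma nice_sqn f : nice f -> L2 f.
Proof. by move=> nf; apply/in_L2P; exact: nice_L2. Qed.

Lemma sqn_tfshift z f : cmeas f -> sqn mu (tfshift z f) = sqn mu f.
Proof.
move=> mf; rewrite -[RHS](sqn_shift hX (- z.1) mf).
by apply: eq_integral => y _; rewrite normc_tfshift.
Qed.

Lemma L2_tfshift z f : L2 f -> L2 (tfshift z f).
Proof. by move=> [mf sf]; split; [exact: cmeas_tfshift1|rewrite sqn_tfshift]. Qed.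

Lemma L2D f h : L2 f -> L2 h -> L2 (fun x => f x + h x).
Proof.
move=> [mf sf] [mh sh]; split; first exact: cmeasD.
by apply: le_lt_trans (sqnD mu mf mh) _; rewrite lte_add_pinfty// lte_mul_pinfty.
Qed.

Lemma L2Z c f : L2 f -> L2 (fun x => c * f x).
Proof.
move=> [mf sf]; split; first by apply: cmeasM => //; exact: cmeas_cst.
by rewrite sqnZ// lte_mul_pinfty// lee_fin sqr_ge0.
Qed.

Lemma L2B f h : L2 f -> L2 h -> L2 (fun x => f x - h x).
Proof. by move=> Lf Lh; have := L2D Lf (L2Z (-1) Lh); under eq_fun do rewrite mulN1r. Qed.

Lemma L2_mul_conj f h : L2 f -> L2 h -> cinteg mu (fun x => f x * (h x)^*).
Proof. by move=> [mf sf] [mh sh]; exact: sqn_mul_conj. Qed.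

Lemma L2_phi z : L2 (tfshift z phi).
Proof. by apply: L2_tfshift; exact: nice_sqn. Qed.

Lemma L2_inner_conj f h : L2 f -> L2 h -> L2_inner mu h f = (L2_inner mu f h)^*.
Proof.
move=> Lf Lh; rewrite /L2_inner -cint_conj; last exact: L2_mul_conj.
by apply: cint_ext => x; rewrite conjcM conjE conjE conjcK mulrC.
Qed.

Lemma L2_inner_norm f : L2 f -> L2_inner mu f f = (fine (sqn mu f))%:C.
Proof.
move=> Lf; rewrite /L2_inner.
have -> : (fun x => f x * (f x)^*) = (fun x => (normc (f x) ^+ 2)%:C) by apply/funext => x; rewrite mulc_conj.
rewrite /cintegral /=; apply: complexP => //=.
by rewrite /Rintegral integral0.
Qed.

Lemma stft_L2_sqr f z : L2 f -> normc (V f z) ^+ 2 <= fine (sqn mu f) * fine (sqn mu phi).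
Proof.
move=> [mf sf]; have [mp sp] := L2_phi z.
by apply: (le_trans (cauchy_schwarz mf mp sf sp)); rewrite sqn_tfshift.
Qed.

Lemma stft_L2_bound f : L2 f -> exists M : R, forall z, normc (V f z) <= M.
Proof.
move=> Lf; exists (1 + fine (sqn mu f) * fine (sqn mu phi)) => z.
have := stft_L2_sqr z Lf; have := normc_ge0 (V f z); nra.
Qed.

Lemma cmeas_stft_L2 f : L2 f -> cmeas2 (V f).
Proof.
move=> [mf _].
pose F (p : XX * borel X) := f p.2 * (tfshift p.1 phi p.2)^*.
apply: (@cmeas_param _ _ XX (borel X) R mu F).
apply: cmeasM; first exact: (cmeas_comp (@measurable_snd _ _ _ _) mf).
apply: cmeas_conj.
exact: (cmeas_tfshift hP (@measurable_fst _ _ _ _) (@measurable_snd _ _ _ _) mphi).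
Qed.

(** Fubini; [f] being only square integrable, 2 u v <= u^2 + v^2 bounds the inner integrals of the
    moduli uniformly in [v] by [M]. *)
Lemma synth_inner a f : cinteg mn a -> L2 f ->
  L2_inner mu (synth a phi) f = cintegral mn (fun v => a v * (V f v)^*).
Proof.
move=> Ia Lf; have [mf sf] := Lf; have ma : cmeas2 a by case: Ia.
pose F (p : XX * borel X) := a p.1 * (tfshift p.1 phi p.2 * (f p.2)^*).
have mT : cmeasurable (fun p : XX * borel X => tfshift p.1 phi p.2).
  exact: (cmeas_tfshift hP (@measurable_fst _ _ _ _) (@measurable_snd _ _ _ _) mphi).
have mF : cmeasurable F.
  apply: cmeasM; first exact: (cmeas_comp (@measurable_fst _ _ _ _) ma).
  apply: cmeasM => //; apply: cmeas_conj; exact: (cmeas_comp (@measurable_snd _ _ _ _) mf).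
pose M := fine (sqn mu phi) + fine (sqn mu f).
have sp : (sqn mu phi < +oo)%E by have [] := nice_sqn nphi.
have bd v : (\int[mu]_y (normc (tfshift v phi y * (f y)^*))%:E <= M%:E)%E.
  have [mp sp'] := L2_phi v.
  rewrite /M EFinD -(sqn_fin sp) -(sqn_fin sf) -(sqn_tfshift v mphi) -ge0_integralD//.
  - apply: ge0_le_int.
    + by apply: menormc; apply: cmeasM => //; exact: cmeas_conj.
    + by apply: emeasurable_funD; exact: msqn.
    + by move=> y; rewrite lee_fin normc_ge0.
    + move=> y; rewrite -EFinD lee_fin normcM' normc_conj.
      have := sqr_ge0 (normc (tfshift v phi y) - normc (f y)); have := normc_ge0 (tfshift v phi y); have := normc_ge0 (f y); nra.
  - by move=> y _; rewrite lee_fin sqr_ge0.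
  - exact: msqn.
  - by move=> y _; rewrite lee_fin sqr_ge0.
  - exact: msqn.
have IF : cinteg (mn \x mu)%E F.
  split => //.
  have -> : (\int[(mn \x mu)%E]_p (normc (F p))%:E = \int[mn]_v \int[mu]_y (normc (F (v, y)))%:E)%E.
    have h := @prodm_tonelli1 _ _ _ _ R mn mu (fun p => (normc (F p))%:E) _ _.
    by apply: h; [exact: menormc|move=> p; rewrite lee_fin normc_ge0].
  have [_ ia] := Ia.
  apply: (@le_lt_trans _ _ (\int[mn]_v ((normc (a v))%:E * M%:E))%E).
  - apply: ge0_le_int.
    + have h := @mint1 _ _ _ _ R mu (fun p => (normc (F p))%:E).
      by apply: h; [exact: menormc|move=> p; rewrite lee_fin normc_ge0].
    + by apply: emeasurable_funM; [exact: menormc|exact: measurable_cst].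
    + by move=> v; apply: integral_ge0 => y _; rewrite lee_fin normc_ge0.
    + move=> v; rewrite /F /=; under eq_integral do rewrite normcM' EFinM.
      rewrite ge0_intZ ?normc_ge0//; [|by move=> y _; rewrite lee_fin normc_ge0|].
        by apply: lee_wpmul2l; rewrite ?lee_fin ?normc_ge0.
      have [mp _] := L2_phi v.
      by apply: menormc; apply: cmeasM => //; exact: cmeas_conj.
  - under eq_integral do rewrite muleC.
    have M0 : 0 <= M by rewrite addr_ge0// fine_ge0 ?sqn_ge0.
    rewrite ge0_intZ//; [|by move=> y _; rewrite lee_fin normc_ge0|exact: menormc].
    by rewrite lte_mul_pinfty.
rewrite /L2_inner.
transitivity (cintegral mu (fun y => cintegral mn (fun v => F (v, y)))).
  apply: cint_ext => y; rewrite /synth -cintZr.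
    by apply: cint_ext => v; rewrite /F /= mulrA.
  have [Mg [_ Mg1 _]] := nice_bound hP (nwin_gauss gP).
  apply: (cintegMr Ia (M := Mg)) => [|v]; last by rewrite normc_tfshift.
  by apply: (cmeas_tfshift hP _ _ mphi); [exact: measurable_id|exact: measurable_cst].
have -> : cintegral mu (fun y => cintegral mn (fun v => F (v, y))) = cintegral mn (fun v => cintegral mu (fun y => F (v, y))).
  have e1 := @cfubini2 _ _ _ _ R mn mu F IF; have e2 := @cfubini1 _ _ _ _ R mn mu F IF.
  exact: (etrans e1 (esym e2)).
apply: cint_ext => v; rewrite /F /= cintZ; last exact: (L2_mul_conj (L2_phi v) Lf).
by congr (_ * _); exact: (L2_inner_conj Lf (L2_phi v)).
Qed.

Let nwp := nwin_gauss gP.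
Let ip : (S0n phi < +oo)%E := nwin_lty hP gP nwp.

Lemma stft_sym z w : normc (V (tfshift w phi) z) = normc (V (tfshift z phi) w).
Proof.
have E : V (tfshift z phi) w = (V (tfshift w phi) z)^* := L2_inner_conj (L2_phi w) (L2_phi z).
by rewrite E normc_conj.
Qed.

(** Schur's test: the Gram kernel of the shifts of the Gaussian has integral [S0n phi] in either
    variable, and |a z| |a w| <= |a z|^2 + |a w|^2. *)
Lemma sqn_synth_le a : cinteg mn a -> (sqn mn a < +oo)%E ->
  (sqn mu (synth a phi) <= 2%:E * (S0n phi * sqn mn a))%E.
Proof.
move=> Ia sa; have ma : cmeas2 a by case: Ia.
have Ls := nice_sqn (nice_synth hP nwp Ia).
have [Mg [Mg0 Mg1 Mg2]] := nice_bound hP nwp.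
pose K (p : XX * XX) := normc (V (tfshift p.2 phi) p.1).
have mK : mfunT K.
  apply: mnormc.
  pose F (q : (XX * XX) * borel X) := tfshift q.1.2 phi q.2 * (tfshift q.1.1 phi q.2)^*.
  apply: (@cmeas_param _ _ (XX * XX)%type (borel X) R mu F).
  apply: cmeasM; last apply: cmeas_conj.
    apply: (cmeas_tfshift hP _ _ mphi); last exact: measurable_snd.
    exact: (mcompT (@measurable_snd _ _ _ _) (@measurable_fst _ _ _ _)).
  apply: (cmeas_tfshift hP _ _ mphi); last exact: measurable_snd.
  exact: (mcompT (@measurable_fst _ _ _ _) (@measurable_fst _ _ _ _)).
have mKe : mfunT (fun p => (K p)%:E) by exact/mEFinP.
have K0 p : (0 <= (K p)%:E)%E by rewrite lee_fin normc_ge0.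
have IK1 z : (\int[mn]_w (K (z, w))%:E = S0n phi)%E.
  rewrite -(S0n_tfshift hP gP z nphi); apply: eq_integral => w _.
  by congr EFin; exact: stft_sym.
have IK2 w : (\int[mn]_z (K (z, w))%:E = S0n phi)%E by rewrite -(S0n_tfshift hP gP w nphi).
pose F1 p := ((normc (a p.1) ^+ 2) * K p)%:E; pose F2 p := ((normc (a p.2) ^+ 2) * K p)%:E.
have ms := msqn ma.
have ma1 (i : XX * XX -> XX) : mfunT i ->
    mfunT (fun p => ((normc (a (i p)) ^+ 2) * K p)%:E).
  move=> mi; apply/mEFinP; apply: measurable_funM => //.
  by apply/mEFinP; exact: (mcompT ms mi).
have mF1 : mfunT F1 by apply: ma1; exact: measurable_fst.
have mF2 : mfunT F2 by apply: ma1; exact: measurable_snd.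
have F10 p : (0 <= F1 p)%E by rewrite lee_fin mulr_ge0 ?sqr_ge0// normc_ge0.
have F20 p : (0 <= F2 p)%E by rewrite lee_fin mulr_ge0 ?sqr_ge0// normc_ge0.
have IS : (\int[mn]_z ((normc (a z) ^+ 2)%:E * S0n phi) = S0n phi * sqn mn a)%E.
  under eq_integral do rewrite muleC.
  apply: ge0_integralZl => //; first by move=> z _; rewrite lee_fin sqr_ge0.
  exact: int_normc_ge0.
have mnorm (i : XX * XX -> XX) : mfunT i ->
    mfunT (fun p => normc (a (i p))).
  by move=> mi; exact: (mcompT (mnormc ma) mi).
pose F0 p := (normc (a p.1) * (normc (a p.2) * K p))%:E.
have mF0 : mfunT F0.
  apply/mEFinP; apply: measurable_funM; first by apply: mnorm; exact: measurable_fst.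
  by apply: measurable_funM => //; apply: mnorm; exact: measurable_snd.
have F00 p : (0 <= F0 p)%E by rewrite lee_fin mulr_ge0 ?normc_ge0// mulr_ge0 ?normc_ge0.
have ms' : cmeas2 (V (synth a phi)) by apply: cmeas_stft_L2.
have Iav : cinteg mn (fun v => a v * (V (synth a phi) v)^*).
  have [M HM] := stft_L2_bound Ls.
  by apply: (cintegMr Ia (M := M)) => [|v]; [exact: cmeas_conj|rewrite normc_conj].
have [_ sL] := Ls.
rewrite (sqn_fin sL) -[fine _]ger0_norm ?fine_ge0 ?sqn_ge0// -normc_real -(L2_inner_norm Ls) (synth_inner Ia Ls).
apply: (le_trans (normc_cintegral Iav)).
apply: (@le_trans _ _ (\int[mn]_z \int[mn]_w F0 (z, w))%E).
  apply: ge0_le_int.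
  - by apply: menormc; case: Iav.
  - exact: (@mint1 _ _ _ _ R mn F0).
  - by move=> z; rewrite lee_fin normc_ge0.
  - move=> z; rewrite normcM' normc_conj EFinM.
    rewrite (_ : \int[mn]_w F0 (z, w) = (normc (a z))%:E * \int[mn]_w (normc (a w * V (tfshift w phi) z))%:E)%E; last first.
      rewrite -ge0_intZ ?normc_ge0//.
      - by apply: eq_integral => w _; rewrite /F0 /K /= normcM' -EFinM.
      - by move=> w _; rewrite lee_fin normc_ge0.
      - apply/mEFinP; under eq_fun do rewrite normcM'.
        apply: measurable_funM; first exact: mnormc.
        exact: (mcompT mK (@measurable_pair1 _ _ XX XX z)).
    apply: lee_wpmul2l; first by rewrite lee_fin normc_ge0.
    rewrite (stft_param_integral hP gP (a := a) (H := fun v => tfshift v phi) Ia _ Mg0 _ Mg2); last 2 first.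
    - exact: (cmeas_tfshift_prod hP nwp).
    - by move=> v x; rewrite normc_tfshift.
    apply: normc_cintegral; have [_ ia] := Ia.
    have M0 : 0 <= fine (sqn mu phi) by rewrite fine_ge0 ?sqn_ge0.
    have mKz : cmeas2 (fun w => V (tfshift w phi) z).
      pose F (q : XX * borel X) := tfshift q.1 phi q.2 * (tfshift z phi q.2)^*.
      apply: (@cmeas_param _ _ XX (borel X) R mu F).
      apply: cmeasM; last apply: cmeas_conj.
        by apply: (cmeas_tfshift hP _ _ mphi); [exact: measurable_fst|exact: measurable_snd].
      by apply: (cmeas_tfshift hP _ _ mphi); [exact: measurable_cst|exact: measurable_snd].
    apply: (cintegMr Ia (M := fine (sqn mu phi))) => // v.
    have := stft_L2_sqr z (L2_phi v); rewrite sqn_tfshift// -expr2 ler_pXn2r ?nnegrE ?normc_ge0//.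
have [h1 h2] : (\int[mn]_z \int[mn]_w F1 (z, w) = S0n phi * sqn mn a)%E /\ (\int[mn]_z \int[mn]_w F2 (z, w) = S0n phi * sqn mn a)%E.
  split.
  - rewrite -IS; apply: eq_integral => z _; rewrite /F1 /=.
    under eq_integral do rewrite EFinM.
    rewrite -(IK1 z); apply: ge0_intZ.
    + exact: measurableT.
    + by move=> w _; exact: K0.
    + exact: (mcompT mKe (@measurable_pair1 _ _ XX XX z)).
    + exact: sqr_ge0.
  - rewrite -(@prodm_tonelli1 _ _ _ _ R mn mn F2 mF2 F20) (@prodm_tonelli2 _ _ _ _ R mn mn F2 mF2 F20).
    rewrite -IS; apply: eq_integral => w _; rewrite /F2 /=.
    under eq_integral do rewrite EFinM.
    rewrite -(IK2 w); apply: ge0_intZ.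
    + exact: measurableT.
    + by move=> z _; exact: K0.
    + exact: (mcompT mKe (@measurable_pair2 _ _ XX XX w)).
    + exact: sqr_ge0.
have -> : (2%:E * (S0n phi * sqn mn a) = \int[mn]_z \int[mn]_w F1 (z, w) + \int[mn]_z \int[mn]_w F2 (z, w))%E.
  rewrite h1 h2 (_ : 2%:E = 1%:E + 1%:E)%E// ge0_muleDl ?mul1e//.
rewrite -ge0_integralD//; last 4 first.
- by move=> z _; exact: integral_ge0.
- exact: (@mint1 _ _ _ _ R mn F1).
- by move=> z _; exact: integral_ge0.
- exact: (@mint1 _ _ _ _ R mn F2).
have mp1 z (F : XX * XX -> \bar R) : mfunT F -> mfunT (fun w : XX => F (z, w)).
  by move=> mF; exact: (mcompT mF (@measurable_pair1 _ _ XX XX z)).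
apply: ge0_le_int.
- exact: (@mint1 _ _ _ _ R mn F0).
- by apply: emeasurable_funD; [exact: (@mint1 _ _ _ _ R mn F1)|exact: (@mint1 _ _ _ _ R mn F2)].
- by move=> z; exact: integral_ge0.
- move=> z; rewrite -(@ge0_integralD _ _ R mn setT measurableT (fun w => F1 (z, w)) (fun w => F2 (z, w)) (fun w _ => F10 (z, w)) (mp1 z F1 mF1) (fun w _ => F20 (z, w)) (mp1 z F2 mF2)).
  apply: ge0_le_int.
  + exact: (mp1 z F0 mF0).
  + exact: (emeasurable_funD (mp1 z F1 mF1) (mp1 z F2 mF2)).
  + by move=> w.
  + move=> w; rewrite /F0 /F1 /F2 /= -EFinD lee_fin mulrA -mulrDl ler_wpM2r ?normc_ge0//.
    have := sqr_ge0 (normc (a z) - normc (a w)); have := normc_ge0 (a z); have := normc_ge0 (a w); nra.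
Qed.

Lemma cint_realE dT (T : measurableType dT) (m : {measure set T -> \bar R}) (q : T -> R) :
  cintegral m (fun t => (q t)%:C) = (fine (\int[m]_t (q t)%:E))%:C.
Proof. by rewrite /cintegral /=; apply: complexP => //=; rewrite /Rintegral integral0. Qed.

(** The dual of [sqn_synth_le]: for [a] the transform cut off to a set of finite measure, |a|^2
    integrates to the inner product of [synth a phi] with [f]. The cutoff makes this quantity
    finite, so that one factor of it cancels in Cauchy-Schwarz. *)
Lemma bessel f : L2 f -> (sqn mn (V f) <= 2%:E * S0n phi * sqn mu f)%E.
Proof.
move=> Lf; have [mf sf] := Lf; have mV := cmeas_stft_L2 Lf.
have [D [mD fD ndD UD]] := @finite_exhaustion _ _ R mn.
apply: (sqn_cutoff_sup mD ndD UD mV) => n.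
have [M HM] := stft_L2_bound Lf.
pose a := cutoff (D n) (V f).
have Ia : cinteg mn a := @cinteg_cutoff _ _ R mn _ _ _ (mD n) (fD n) mV HM.
have ma : cmeas2 a by case: Ia.
have sa : (sqn mn a < +oo)%E.
  have [_ ia] := Ia; have M0 : 0 <= M by apply: le_trans (HM 0); exact: normc_ge0.
  apply: (@le_lt_trans _ _ (\int[mn]_v (M * normc (a v))%:E)%E).
    apply: ge0_le_int.
    - exact: msqn.
    - by apply/mEFinP; apply: measurable_funM; [exact: measurable_cst|exact: mnormc].
    - by move=> v; rewrite lee_fin sqr_ge0.
    - move=> v; rewrite lee_fin expr2 ler_wpM2r ?normc_ge0//; exact: le_trans (normc_cutoff_le _ _ _) (HM v).
  under eq_integral do rewrite EFinM.
  rewrite ge0_intZ//; [|by move=> t _; rewrite lee_fin normc_ge0|exact: menormc].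
  by rewrite lte_mul_pinfty.
have [mS sS] := nice_sqn (nice_synth hP nwp Ia).
have E : L2_inner mu (synth a phi) f = (fine (sqn mn a))%:C.
  rewrite (synth_inner Ia Lf) -(cint_realE mn (fun v => normc (a v) ^+ 2)).
  apply: cint_ext => v; rewrite -mulc_conj /a /cutoff conjcM conjRC indicE.
  by case: (v \in D n); rewrite ?mul0r// !mul1r.
have := cauchy_schwarz mS mf sS sf; rewrite E normc_real.
have sle := sqn_synth_le Ia sa.
rewrite -/a; move: sle sS sa ip sf; set J := sqn mn a; set B := S0n phi; set S := sqn mu f; set Y := sqn mu _ => sle sS sa ip' sf h.
have J0 : (0 <= J)%E := sqn_ge0 mn a. have S0' : (0 <= S)%E := sqn_ge0 mu f. have Y0 : (0 <= Y)%E := sqn_ge0 mu _.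
have B0 : (0 <= B)%E by exact: int_normc_ge0.
have eJ : J = (fine J)%:E by rewrite fineK// ge0_fin_numE.
have eB : B = (fine B)%:E by rewrite fineK// ge0_fin_numE.
have eS : S = (fine S)%:E by rewrite fineK// ge0_fin_numE.
have eY : Y = (fine Y)%:E by rewrite fineK// ge0_fin_numE.
have j0 : 0 <= fine J by rewrite fine_ge0. have s0 : 0 <= fine S by rewrite fine_ge0.
have b0 : 0 <= fine B by rewrite fine_ge0. have y0 : 0 <= fine Y by rewrite fine_ge0.
move: sle; rewrite eJ eB eS eY -!EFinM !lee_fin => sle.
rewrite ger0_norm// in h.
have [->|jn] := eqVneq (fine J) 0; first by rewrite !mulr_ge0.
have jp : 0 < fine J by rewrite lt_neqAle eq_sym jn.
rewrite -(ler_pM2l jp) -expr2; apply: (le_trans h).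
rewrite (_ : fine J * (2 * fine B * fine S) = 2 * (fine B * fine J) * fine S); last by ring.
by rewrite ler_wpM2r.
Qed.

Lemma stft_sqn_lty f : L2 f -> (sqn mn (V f) < +oo)%E.
Proof.
move=> Lf; have [mf sf] := Lf; apply: le_lt_trans (bessel Lf) _.
have B0 : (0 <= S0n phi)%E by exact: int_normc_ge0.
by apply: lte_mul_pinfty => //; [rewrite mule_ge0|rewrite ge0_fin_numE ?mule_ge0// lte_mul_pinfty].
Qed.

Hypothesis inv : fourier_inversion P.
Hypothesis fO : exists U : set X, [/\ open U, U 0 & (mu U < +oo)%E].

(** The convolution of [k] with the reflected conjugate of [l]; its value at 0 is their inner
    product. *)
Definition correlation k l (t : X) : R[i] := cintegral mu (fun s => k s * (l (s - t))^*).

Lemma L2_shift f t : L2 f -> L2 (fun s => f (s + t)).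
Proof. by move=> [mf sf]; split; [exact: (cmeas_shift hX)|rewrite (sqn_shift hX)]. Qed.

(** Cauchy-Schwarz and continuity of translations in L^2. Pointwise inversion is available for
    continuous functions. *)
Lemma correlation_continuous k l : L2 k -> L2 l -> continuous (correlation k l : X -> R[i]^o).
Proof.
move=> Lk Ll t0; have [ml sl] := Ll; have [mk sk] := Lk.
have [_ tl] := tcont_L2 hX fO ml sl.
have CE t : correlation k l t - correlation k l t0 = L2_inner mu k (fun s => l (s - t) - l (s - t0)).
  rewrite /correlation -cintB; last 2 first.
  - exact: (L2_mul_conj Lk (L2_shift (- t) Ll)).
  - exact: (L2_mul_conj Lk (L2_shift (- t0) Ll)).
  by apply: cint_ext => s; rewrite -mulrBr conjcD; congr (_ * (_ + _)); rewrite !conjE; case: (l _).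
have sE t : sqn mu (fun s => l (s - t) - l (s - t0)) = sqn mu (fun s => l (s + (t0 - t)) - l s).
  have mh : cmeas (fun s => l (s + (t0 - t)) - l s) by apply: cmeasB => //; exact: (cmeas_shift hX).
  rewrite -(sqn_shift hX (- t0) mh); apply: eq_integral => s _.
  by rewrite addrA addrNK.
apply: ccont_normcP => e e0.
pose S := fine (sqn mu k); have S0' : 0 <= S by rewrite fine_ge0 ?sqn_ge0.
pose d := e ^+ 2 / (2 * (S + 1)).
have S1 : 0 < 2 * (S + 1) by rewrite mulr_gt0// ltr_wpDl.
have d0 : 0 < d by rewrite divr_gt0 ?exprn_gt0.
have n1 : nbhs t0 [set t | (sqn mu (fun s => (l (s + (t0 - t)) - l s)%R) <= d%:E)%E].
  have cN : continuous (fun t : X => t0 - t).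
    by apply: (tgroup_subf (hg_top hX)); [exact: cst_continuous|move=> z; exact: cvg_id].
  by have := cN t0 [set h | (sqn mu (fun x => (l (x + h) - l x)%R) <= d%:E)%E]; apply; rewrite /= subrr; exact: tl.
apply: filterS n1 => t /= ht.
have [md sd] : L2 (fun s => l (s - t) - l (s - t0)) by apply: L2B; exact: L2_shift.
have := cauchy_schwarz mk md sk sd; rewrite -CE sE -/S => h.
rewrite sE in sd; have e1 := sqn_fin sd; rewrite e1 lee_fin in ht.
rewrite -(@ltr_pXn2r _ 2)// ?nnegrE ?normc_ge0//; last exact: ltW.
apply: (le_lt_trans h); apply: (le_lt_trans (ler_wpM2l S0' ht)).
rewrite /d mulrCA -[ltRHS]mulr1 ltr_pM2l ?exprn_gt0// ltr_pdivrMr// mul1r; lra.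
Qed.

(** Fourier inversion at 0 for the correlation, whose Fourier transform is the integrand on the
    left. Inversion asks for integrability on the dual side, which is therefore a hypothesis. *)
Lemma plancherel_local k l : L2 k -> L2 l -> cinteg mu k -> cinteg mu l ->
  cinteg nu (fun xi => fourier k xi * (fourier l xi)^*) ->
  cintegral nu (fun xi => fourier k xi * (fourier l xi)^*) = L2_inner mu k l.
Proof.
move=> Lk Ll Ik Il IF; have [mk _] := Lk; have [ml _] := Ll.
have [_ ik] := Ik; have [_ il] := Il.
pose F (p : borel X * borel X) := k p.2 * (l (p.2 - p.1))^*.
have msub : mfunT (fun p : borel X * borel X => (p.2 - p.1 : X) : borel X).
  by apply: (msubf (hg_top hX) (hg_csb hX)); [exact: measurable_snd|exact: measurable_fst].
have mF : cmeasurable F.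
  apply: cmeasM; first exact: (cmeas_comp (@measurable_snd _ _ _ _) mk).
  apply: cmeas_conj; exact: (cmeas_comp msub ml).
have nl (s : X) : (\int[mu]_t (normc (l (s - t)))%:E = \int[mu]_t (normc (l t))%:E)%E.
  rewrite -(ge0_integral_opp hX (k := fun t => (normc (l t))%:E)); last 2 first.
  - exact: menormc.
  - by move=> t; rewrite lee_fin normc_ge0.
  rewrite -(int_shift hX (- s) (f := fun t => (normc (l (- t)))%:E)).
  - by apply: eq_integral => t _; rewrite opprD opprK addrC.
  - apply: menormc; exact: (cmeas_comp (measurable_opp hX) ml).
  - by move=> t; rewrite lee_fin normc_ge0.
have IFp : cinteg (prodm mu mu) F.
  split => //.
  rewrite (@prodm_tonelli2 _ _ _ _ R mu mu (fun p => (normc (F p))%:E)); last 2 first.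
  - exact: menormc.
  - by move=> p; rewrite lee_fin normc_ge0.
  rewrite (_ : (fun s => _) = (fun s => (\int[mu]_t (normc (l t))%:E) * (normc (k s))%:E)%E).
    rewrite ge0_integralZl//; last 3 first.
    - exact: menormc.
    - by move=> s _; rewrite lee_fin normc_ge0.
    - exact: int_normc_ge0.
    apply: lte_mul_pinfty => //; first exact: int_normc_ge0.
    rewrite ge0_fin_numE//; exact: int_normc_ge0.
  apply/funext => s; rewrite -(nl s) /F /=.
  under eq_integral do rewrite normcM' normc_conj EFinM.
  rewrite ge0_intZ ?normc_ge0//; first by rewrite muleC.
  - by move=> t _; rewrite lee_fin normc_ge0.
  - apply: menormc.
    apply: (cmeas_comp _ ml); apply: (msubf (hg_top hX) (hg_csb hX)); [exact: measurable_cst|exact: measurable_id].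
have Iq : cinteg mu (correlation k l).
  exact: (@cinteg_param _ _ _ _ R mu mu F IFp).
have fq xi : fourier (correlation k l) xi = fourier k xi * (fourier l xi)^*.
  pose G (p : borel X * borel X) := F p * (pairing xi p.1)^*.
  have IG : cinteg (prodm mu mu) G.
    apply: (cintegMr IFp (M := 1)) => [|p]; last by rewrite (normc_pairing_conj hP).
    by apply: cmeas_conj; apply: (cmeas_pairingf hP); [exact: measurable_cst|exact: measurable_fst].
  have e1 := @cfubini1 _ _ _ _ R mu mu G IG; have e2 := @cfubini2 _ _ _ _ R mu mu G IG.
  transitivity (cintegral mu (fun t => cintegral mu (fun s => G (t, s)))).
    apply: cint_ext => t; rewrite /G /F /= cintZr//.
    exact: (L2_mul_conj Lk (L2_shift (- t) Ll)).
  rewrite (etrans e1 (esym e2)).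
  rewrite /fourier -cintZr; last first.
    apply: (@cintegMr _ (borel X) R mu k (fun s => (pairing xi s)^*) 1) => // [|t]; last by rewrite (normc_pairing_conj hP).
    by apply: cmeas_conj; apply: (cmeas_pairingf hP); [exact: measurable_cst|exact: measurable_id].
  apply: cint_ext => s.
  have Ilx : cinteg mu (fun t => l t * (pairing xi t)^*).
    apply: (@cintegMr _ (borel X) R mu l (fun s => (pairing xi s)^*) 1) => // [|t]; last by rewrite (normc_pairing_conj hP).
    by apply: cmeas_conj; apply: (cmeas_pairingf hP); [exact: measurable_cst|exact: measurable_id].
  rewrite -cint_conj//.
  pose h (t : X) := k s * (pairing xi s)^* * (l t * (pairing xi t)^*)^*.
  have mh : cmeas h.
    apply: cmeasM; first exact: cmeas_cst.
    by apply: cmeas_conj; case: Ilx.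
  rewrite -cintZ; last exact: cinteg_conj.
  transitivity (cintegral mu (fun t => h (s - t))).
    apply: cint_ext => t; rewrite /G /F /h /= (tf_pairDr hP) (pairingNr hP) !conjcM !conjE !conjcK.
    have := pairing_conjM hP xi s; rewrite conjE => E.
    by rewrite -[LHS]mul1r -E; ring.
  rewrite -(cint_opp hX mh) -(cint_shift hX (- s) (f := fun t => h (- t))).
    by apply: cint_ext => t; rewrite opprD opprK addrC.
  exact: (cmeas_comp (measurable_opp hX) mh).
have := inv (correlation_continuous Lk Ll).
rewrite !in_L1P (_ : fourier (correlation k l) = fun xi => fourier k xi * (fourier l xi)^*); last exact/funext.
move=> /(_ Iq IF 0) q0.
rewrite (_ : L2_inner mu k l = correlation k l 0); last first.
  by apply: cint_ext => s; rewrite subr0.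
rewrite q0; apply: cint_ext => xi.
by rewrite (pairing0r hP) mulr1.
Qed.

Let c0 := fine (sqn mu phi).

(** For fixed [x] the transform is the Fourier transform of [w x f]. By Bessel's inequality the
    product of the two transforms is integrable, hence integrable in the frequency for almost every
    [x], and there [plancherel_local] applies. The remaining integral of |phi (y - x)|^2 over [x]
    yields [c0]. *)
Lemma moyal f h : L2 f -> L2 h -> cintegral mn (fun z => V f z * (V h z)^*) = c0%:C * L2_inner mu f h.
Proof.
move=> Lf Lh; have [mf sf] := Lf; have [mh sh] := Lh.
have IV : cinteg mn (fun z => V f z * (V h z)^*).
  by apply: sqn_mul_conj; [exact: cmeas_stft_L2|exact: cmeas_stft_L2|exact: stft_sqn_lty|exact: stft_sqn_lty].
have [_ [bM bphi]] := nphi; have Lphi : L2 phi by exact: nice_sqn.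
pose w x (k : X -> R[i]) := fun y => k y * (phi (y - x))^*.
have Lp x : L2 (fun y => phi (y - x)) by exact: L2_shift.
have Iw x k : L2 k -> cinteg mu (w x k) by move=> Lk; exact: (L2_mul_conj Lk (Lp x)).
have Lw x k : L2 k -> L2 (w x k).
  move=> Lk; have [mk sk] := Lk; have mw : cmeas (w x k) by case: (Iw x k Lk).
  have [mb sb] := L2Z (bM%:C) Lk.
  split => //; apply: le_lt_trans sb; apply: sqn_le => // y.
  rewrite /w normcM' normc_conj mulrC normcM' normc_real ler_wpM2r ?normc_ge0//.
  exact: le_trans (bphi _) (ler_norm _).
have Vw k x xi : V k (x, xi) = fourier (w x k) xi.
  by apply: cint_ext => y; rewrite /w /tfshift /= conjcM; ring.
have inner x : cinteg nu (fun xi => V f (x, xi) * (V h (x, xi))^*) ->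
    cintegral nu (fun xi => V f (x, xi) * (V h (x, xi))^*) = L2_inner mu (w x f) (w x h).
  move=> Ix; rewrite -(plancherel_local (Lw x _ Lf) (Lw x _ Lh) (Iw x _ Lf) (Iw x _ Lh)).
    by apply: cint_ext => xi; rewrite !Vw.
  by move: Ix; under eq_fun do rewrite !Vw.
pose G (p : borel X * borel X) := f p.2 * (h p.2)^* * ((normc (phi (p.2 - p.1)) ^+ 2)%:C).
have msub : mfunT (fun p : borel X * borel X => (p.2 - p.1 : X) : borel X).
  by apply: (msubf (hg_top hX) (hg_csb hX)); [exact: measurable_snd|exact: measurable_fst].
have mphi2 : mfunT (fun y : borel X => normc (phi y) ^+ 2).
  by apply: measurable_funX; exact: mnormc.
have mG : cmeasurable G.
  apply: cmeasM; last by apply: cmeas_real; exact: (mcompT mphi2 msub).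
  apply: cmeasM; first exact: (cmeas_comp (@measurable_snd _ _ _ _) mf).
  apply: cmeas_conj; exact: (cmeas_comp (@measurable_snd _ _ _ _) mh).
have [_ sphi] := Lphi.
have c00 : 0 <= c0 by rewrite fine_ge0 ?sqn_ge0.
have np (y : X) : (\int[mu]_x ((normc (phi (y - x)) ^+ 2)%:E) = c0%:E)%E.
  rewrite -(sqn_fin sphi) /sqn.
  have mpe : mfunT (fun x : borel X => (normc (phi x) ^+ 2)%:E) by exact/mEFinP.
  rewrite -(ge0_integral_opp hX (k := fun t => (normc (phi t) ^+ 2)%:E))//; last by move=> t; rewrite lee_fin sqr_ge0.
  rewrite -(int_shift hX (- y) (f := fun t => (normc (phi (- t)) ^+ 2)%:E)).
  - by apply: eq_integral => t _; rewrite opprD opprK addrC.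
  - exact: (mcompT mpe (measurable_opp hX)).
  - by move=> t; rewrite lee_fin sqr_ge0.
have Ifh := L2_mul_conj Lf Lh; have [_ ifh] := Ifh.
have IG : cinteg (prodm mu mu) G.
  split => //; rewrite (@prodm_tonelli2 _ _ _ _ R mu mu (fun p => (normc (G p))%:E)); last 2 first.
  - exact: menormc.
  - by move=> p; rewrite lee_fin normc_ge0.
  rewrite (_ : (fun s => _) = (fun y => c0%:E * (normc (f y * (h y)^*))%:E)%E).
    rewrite ge0_intZ//; first by rewrite lte_mul_pinfty.
    - by move=> s _; rewrite lee_fin normc_ge0.
    - by apply: menormc; case: Ifh.
  apply/funext => y; rewrite -(np y) muleC -ge0_intZ ?normc_ge0//.
  - by apply: eq_integral => x _; rewrite /G /= normcM' normc_real (ger0_norm (sqr_ge0 _)) EFinM.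
  - by move=> x _; rewrite lee_fin sqr_ge0.
  - apply/mEFinP; apply: (mcompT mphi2).
    by apply: (msubf (hg_top hX) (hg_csb hX)); [exact: measurable_cst|exact: measurable_id].
have ww x : L2_inner mu (w x f) (w x h) = cintegral mu (fun y => G (x, y)).
  by apply: cint_ext => y; rewrite /G /w /= -mulc_conj !conjcM !conjE conjcK; ring.
rewrite -[LHS](@cfubini1 _ _ _ _ R mu nu (fun z => V f z * (V h z)^*) IV).
transitivity (cintegral mu (fun x => cintegral mu (fun y => G (x, y)))).
  apply: ae_eq_cintegral.
  - have [mV _] := IV; exact: (@cmeas_param _ _ (borel X) (borel X') R nu (fun z => V f z * (V h z)^*) mV).
  - exact: (@cmeas_param _ _ _ _ R mu G mG).
  - have mVe : mfunT (fun z : XX => (normc (V f z * (V h z)^*))%:E) by apply: menormc; case: IV.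
    have iV : (mu \x nu)%E.-integrable setT (fun z => (normc (V f z * (V h z)^*))%:E).
      apply/integrableP; split => //; case: IV => _ iv.
      by under eq_integral do rewrite gee0_abs ?lee_fin ?normc_ge0//.
    have := @ae_integrable1 _ _ _ _ R mu nu _ iV.
    apply: filterS => x /integrableP[mx ix].
    rewrite inner ?ww//; split.
      have [mV _] := IV; apply: (cmeas_comp _ mV).
      exact: (@measurable_pair1 _ _ (borel X) (borel X') x).
    apply: le_lt_trans ix; apply: eqW; apply: eq_integral => y _.
    by rewrite gee0_abs ?lee_fin ?normc_ge0.
have e1 := @cfubini1 _ _ _ _ R mu mu G IG; have e2 := @cfubini2 _ _ _ _ R mu mu G IG.
rewrite (etrans e1 (esym e2)) /L2_inner -cintZ//.
apply: cint_ext => y; rewrite /G /=.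
rewrite cintZ; last first.
  split.
    apply: cmeas_real; apply: (mcompT mphi2).
    by apply: (msubf (hg_top hX) (hg_csb hX)); [exact: measurable_cst|exact: measurable_id].
  under eq_integral do rewrite normc_real (ger0_norm (sqr_ge0 _)).
  by rewrite np ltry.
by rewrite (cint_realE mu (fun x => normc (phi (y - x)) ^+ 2)) np /= mulrC.
Qed.

Hypothesis c0_gt0 : 0 < c0.

(** The inversion formula that follows from Moyal's, with the transform cut off to [A] to make the
    coefficients integrable. *)
Definition reconstruct f (A : set (X * X')) x : R[i] := (c0^-1)%:C * synth (cutoff (T := XX) A (V f)) phi x.

Lemma S0_L2 f : S0 f -> L2 f.
Proof. by move=> [/in_L2P[]]. Qed.

(** By Moyal's formula the norm of [f] is a multiple of that of [V f], whose square is at most the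
    supremum of [V f] times its L^1 norm; the supremum is bounded by the norm of [f], one factor of
    which cancels. *)
Lemma sqn_le_S0n f : L2 f -> (sqn mu f <= (c0^-1)%:E * (S0n f * S0n f))%E.
Proof.
move=> Lf; have [mf sf] := Lf; have sf0 := sqn_ge0 mu f; have mV := cmeas_stft_L2 Lf.
have ci : (0 < (c0^-1)%:E)%E by rewrite lte_fin invr_gt0.
have [iV|] := ltP (S0n f) +oo%E; last first.
  by rewrite leye_eq => /eqP ->; rewrite mulyy gt0_muley// leey.
have S0' : (0 <= S0n f)%E by exact: int_normc_ge0.
set s := fine (sqn mu f); have s0 : 0 <= s by rewrite fine_ge0.
set N := fine (S0n f); have N0 : 0 <= N by rewrite fine_ge0.
have NE : S0n f = N%:E by rewrite fineK// ge0_fin_numE.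
have sE : sqn mu f = s%:E := sqn_fin sf.
have h1 : c0 * s <= Num.sqrt (s * c0) * N.
  rewrite -lee_fin; apply: (@le_trans _ _ (sqn mn (V f))).
    have sV := stft_sqn_lty Lf.
    have := moyal Lf Lf; rewrite (L2_inner_norm Lf) -RCM -/s => E.
    rewrite (sqn_fin sV) lee_fin.
    have : cintegral mn (fun z => V f z * (V f z)^*) = (fine (sqn mn (V f)))%:C.
      by rewrite -(cint_realE mn (fun v => normc (V f v) ^+ 2)); apply: cint_ext => v; rewrite mulc_conj.
    by rewrite E => -[->].
  rewrite EFinM -NE -ge0_intZ ?sqrtr_ge0//; last 2 first.
  - by move=> z _; rewrite lee_fin normc_ge0.
  - exact: menormc.
  apply: ge0_le_int.
  - exact: msqn.
  - by apply: measurable_funeM; exact: menormc.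
  - by move=> z; rewrite lee_fin sqr_ge0.
  - move=> z; rewrite -EFinM lee_fin expr2 ler_wpM2r ?normc_ge0//.
    by rewrite -[leLHS]ger0_norm ?normc_ge0// -sqrtr_sqr ler_wsqrtr// stft_L2_sqr.
rewrite sE NE -!EFinM lee_fin mulrC ler_pdivlMr// -expr2.
have sc0 : 0 <= s * c0 by rewrite mulr_ge0// ltW.
have [->|sn] := eqVneq s 0; first by rewrite mul0r sqr_ge0.
have sp : 0 < s * c0 by rewrite mulr_gt0// lt_neqAle eq_sym sn.
have h2 : Num.sqrt (s * c0) <= N.
  have r0 : 0 < Num.sqrt (s * c0) by rewrite sqrtr_gt0.
  by rewrite -(ler_pM2l r0) -expr2 sqr_sqrtr//; apply: le_trans h1; rewrite (mulrC c0).
by rewrite -(sqr_sqrtr sc0) lerXn2r ?nnegrE ?sqrtr_ge0.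
Qed.

Lemma normc_inner_le f h : L2 f -> L2 h ->
  normc (L2_inner mu f h) <= Num.sqrt (fine (sqn mu f)) * Num.sqrt (fine (sqn mu h)).
Proof.
move=> [mf sf] [mh sh]; have s1 : 0 <= fine (sqn mu f) by rewrite fine_ge0 ?sqn_ge0.
rewrite -sqrtrM// -[leLHS]ger0_norm ?normc_ge0// -sqrtr_sqr ler_wsqrtr//; exact: cauchy_schwarz.
Qed.

(** Moyal's formula turns the squared norm of the error [r] into the inner product of [V f - a] with
    [V r]. Bessel's inequality bounds [V r] by [r], and one norm of [r] cancels. *)
Lemma L2_reconstruct f (e : R) : L2 f -> 0 < e -> exists A : set (X * X'),
  [/\ cinteg mn (cutoff (T := XX) A (V f)),
      L2 (reconstruct f A) & (sqn mu (fun x => (f x - reconstruct f A x)%R) <= e%:E)%E].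
Proof.
move=> Lf e0; have mV := cmeas_stft_L2 Lf; have sV := stft_sqn_lty Lf.
have [D [mD fD ndD UD]] := @finite_exhaustion _ _ R mn.
have [M HM] := stft_L2_bound Lf.
pose b := 2 * fine (S0n phi); have b0 : 0 <= b.
  by rewrite mulr_ge0// fine_ge0//; apply: integral_ge0 => z _; rewrite lee_fin normc_ge0.
have bE : (2%:E * S0n phi)%E = b%:E.
  by rewrite EFinM fineK// ge0_fin_numE//; apply: integral_ge0 => z _; rewrite lee_fin normc_ge0.
(* This accuracy absorbs the constant [c0] of Moyal's formula and the Bessel constant [b]; b + 1
   avoids a division by 0. *)
have d0 : 0 < e * c0 ^+ 2 / (b + 1) by rewrite divr_gt0 ?mulr_gt0 ?exprn_gt0// ltr_wpDl.
have [n hn] := sqn_cutoff_cvg mD ndD UD mV sV d0.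
exists (D n); set a := cutoff _ _ in hn *.
have Ia : cinteg mn a := @cinteg_cutoff _ _ R mn _ _ _ (mD n) (fD n) mV HM.
have Lr : L2 (reconstruct f (D n)) by apply: L2Z; exact: (nice_sqn (nice_synth hP nwp Ia)).
split => //.
pose r x := f x - reconstruct f (D n) x.
have Lrr : L2 r by exact: L2B.
have mVr := cmeas_stft_L2 Lrr; have sVr := stft_sqn_lty Lrr.
have IVr : cinteg mn (fun z => V f z * (V r z)^*) by exact: (sqn_mul_conj mV mVr sV sVr).
have Iar : cinteg mn (fun z => a z * (V r z)^*).
  apply: (@cinteg_le _ _ R mn _ (fun z => normc (V f z * (V r z)^*))).
  - apply: cmeasM; [by case: Ia|exact: cmeas_conj].
  - by apply: mnormc; case: IVr.
  - move=> z; rewrite (normcM' (a z)) (normcM' (V f z)); apply: ler_wpM2r; first exact: normc_ge0.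
    exact: normc_cutoff_le.
  - by case: IVr.
have E : c0%:C * L2_inner mu r r = L2_inner mn (fun z => V f z - a z) (V r).
  have -> : L2_inner mu r r = L2_inner mu f r - L2_inner mu (reconstruct f (D n)) r.
    rewrite /L2_inner -cintB; [|exact: L2_mul_conj|exact: L2_mul_conj].
    by apply: cint_ext => x; rewrite -mulrBl.
  rewrite mulrBr -(moyal Lf Lrr).
  have -> : L2_inner mu (reconstruct f (D n)) r = (c0^-1)%:C * L2_inner mu (synth a phi) r.
    rewrite /L2_inner -cintZ; first by apply: cint_ext => x; rewrite /reconstruct mulrA.
    by apply: L2_mul_conj => //; exact: (nice_sqn (nice_synth hP nwp Ia)).
  rewrite mulrA -RCM divff ?gt_eqF// mul1r (synth_inner Ia Lrr) /L2_inner -cintB//.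
  by apply: cint_ext => z; rewrite -mulrBl.
have [mr sr] := Lrr; have sr0 : 0 <= fine (sqn mu r) by rewrite fine_ge0 ?sqn_ge0.
have ma : cmeas2 a by case: Ia.
have md : cmeas2 (fun z => V f z - a z) by exact: cmeasB.
have sdE : sqn mn (fun z => V f z - a z) = sqn mn (fun z => a z - V f z).
  by apply: eq_integral => z _; rewrite normcB_sym.
have sd : (sqn mn (fun z => (V f z - a z)%R) < +oo)%E by rewrite sdE; exact: le_lt_trans hn (ltry _).
have := cauchy_schwarz md mVr sd sVr.
rewrite -E (L2_inner_norm Lrr) -RCM normc_real ger0_norm ?mulr_ge0// ?(ltW c0_gt0)// => h.
rewrite -/r (sqn_fin sr) lee_fin.
have h1 : fine (sqn mn (fun z => V f z - a z)) <= e * c0 ^+ 2 / (b + 1).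
  by rewrite -lee_fin -(sqn_fin sd) sdE.
have h2 : fine (sqn mn (V r)) <= b * fine (sqn mu r).
  by rewrite -lee_fin -(sqn_fin sVr) EFinM -(sqn_fin sr) -bE; exact: bessel.
have [->|rn] := eqVneq (fine (sqn mu r)) 0; first exact: ltW.
have rp : 0 < fine (sqn mu r) by rewrite lt_neqAle eq_sym rn.
have k0 : 0 < c0 ^+ 2 * fine (sqn mu r) by rewrite mulr_gt0// exprn_gt0.
rewrite -(ler_pM2l k0).
have -> : c0 ^+ 2 * fine (sqn mu r) * fine (sqn mu r) = (c0 * fine (sqn mu r)) ^+ 2 by ring.
apply: (le_trans h); apply: (le_trans (ler_pM _ _ h1 h2)); rewrite ?fine_ge0 ?sqn_ge0//.
have b1 : 0 < b + 1 by rewrite ltr_wpDl.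
have -> : e * c0 ^+ 2 / (b + 1) * (b * fine (sqn mu r)) = (c0 ^+ 2 * fine (sqn mu r) * e) * (b / (b + 1)) by ring.
rewrite ler_piMr//; first by rewrite mulr_ge0// ltW.
by rewrite ler_pdivrMr// mul1r lerDl.
Qed.

Lemma bounded_S0_dual (u : (X -> R[i]) -> R[i]) (K : R) : 0 <= K ->
  (forall a k l, L2 k -> L2 l -> u (fun x => a * k x + l x) = a^* * u k + u l) ->
  (forall k, L2 k -> normc (u k) <= K * Num.sqrt (fine (sqn mu k))) -> S0_dual (P := P) u.
Proof.
move=> K0 ulin ub; split; first by move=> a k l /S0_L2 Lk /S0_L2 Ll; exact: ulin.
have ci0 : 0 <= c0^-1 by rewrite invr_ge0 ltW.
exists (K * Num.sqrt c0^-1) => k S0k; have Lk := S0_L2 S0k.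
have : (S0n k < +oo)%E by case: S0k => _ /in_L1P[].
rewrite S0_normE => iV; have S0' : (0 <= S0n k)%E by exact: int_normc_ge0.
have NE : S0n k = (fine (S0n k))%:E by rewrite fineK// ge0_fin_numE.
rewrite NE -EFinM lee_fin; apply: (le_trans (ub k Lk)).
rewrite -mulrA ler_wpM2l//.
have := sqn_le_S0n Lk; have [mk sk] := Lk; rewrite NE (sqn_fin sk) -!EFinM lee_fin => h.
rewrite -[fine (S0n k)]ger0_norm ?fine_ge0// -sqrtr_sqr -sqrtrM// ler_wsqrtr//.
Qed.

Lemma L2_functional_dual f : L2 f -> S0_dual (P := P) (L2_functional f).
Proof.
move=> Lf; apply: (@bounded_S0_dual _ (Num.sqrt (fine (sqn mu f)))); first exact: sqrtr_ge0.
  move=> a k l Lk Ll; rewrite /L2_functional /L2_inner.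
  have I1 := L2_mul_conj Lf Lk; have I2 := L2_mul_conj Lf Ll.
  rewrite -cintZ// -cintD//; last exact: cintegZ.
  by apply: cint_ext => x; rewrite conjcD conjcM mulrDr mulrCA.
by move=> k Lk; exact: normc_inner_le.
Qed.

Lemma cLnorm2 k : L2 k -> exists2 L : R, 0 <= L & cLnorm mu 2%:E k = L%:E /\ fine (sqn mu k) = L ^+ 2.
Proof.
move=> Lk; have [_ N] := (in_L2P mu k).2 Lk; have [_ sk] := Lk.
have N0 : (0 <= cLnorm mu 2%:E k)%E by exact: Lnorm_ge0.
exists (fine (cLnorm mu 2%:E k)); first exact: fine_ge0.
have NE : cLnorm mu 2%:E k = (fine (cLnorm mu 2%:E k))%:E by rewrite fineK// ge0_fin_numE.
split => //; apply: EFin_inj; rewrite -(sqn_fin sk).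
have E : (\int[mu]_x (`|(normc (k x))%:E| `^ 2) = sqn mu k)%E.
  apply: eq_integral => x _; rewrite gee0_abs ?lee_fin ?normc_ge0// poweR_EFin.
  by rewrite (powR_mulrn 2 (normc_ge0 _)).
rewrite -E -powR_Lnorm// -/(cLnorm mu 2%:E k) NE poweR_EFin.
by rewrite (powR_mulrn 2 (fine_ge0 N0)).
Qed.

(* The bound is first obtained for the functions synthesized from cut-off
   short-time Fourier transforms of [f], which converge to [f] in L^2. *)
Lemma L2_operator_bound A f h : bounded_L2_operator mu A -> L2 f -> L2 h ->
  continuous (fun v => L2_inner mu h (A (tfshift v phi)) : R[i]^o) /\
  ((normc (L2_inner mu (A f) h))%:E <= (c0^-1)%:E * \int[mn]_v (normc (V f v) * normc (L2_inner mu (A (tfshift v phi)) h))%:E)%E.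
Proof.
move=> [AL2 Alin [C HC]] Lf Lh.
have in2 k : L2 k -> in_L mu 2%:E k by move=> Lk; apply/in_L2P.
have LA k : L2 k -> L2 (A k) by move=> /in2/AL2/in_L2P.
(* With [A] in the second argument [u] is antilinear, as functionals on S_0 are. [A] is linear only
   up to null sets, which the inner product does not see. *)
pose u k := L2_inner mu h (A k).
have ulin a k l : L2 k -> L2 l -> u (fun x => a * k x + l x) = a^* * u k + u l.
  move=> Lk Ll; have Lkl : L2 (fun x => a * k x + l x) by apply: L2D => //; exact: L2Z.
  have I1 := L2_mul_conj Lh (LA _ Lk); have I2 := L2_mul_conj Lh (LA _ Ll); have I3 := L2_mul_conj Lh (LA _ Lkl).
  rewrite /u /L2_inner -cintZ// -cintD//; last exact: cintegZ.
  apply: ae_eq_cintegral.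
  - by case: I3.
  - by apply: cmeasD; [case: (cintegZ a^* I1)|case: I2].
  - have := Alin a k l (in2 _ Lk) (in2 _ Ll); apply: filterS => x /= ->.
    by rewrite conjcD conjcM mulrDr mulrCA.
have uE k : L2 k -> normc (L2_inner mu (A k) h) = normc (u k).
  by move=> Lk; rewrite (L2_inner_conj Lh (LA _ Lk)) normc_conj.
pose K := Num.sqrt (fine (sqn mu h)) * `|C|.
have K0 : 0 <= K by rewrite mulr_ge0 ?sqrtr_ge0.
have ub k : L2 k -> normc (u k) <= K * Num.sqrt (fine (sqn mu k)).
  move=> Lk; apply: (le_trans (normc_inner_le Lh (LA _ Lk))); rewrite -mulrA ler_wpM2l ?sqrtr_ge0//.
  have [N N0 [NE ->]] := cLnorm2 Lk; have [M M0 [ME ->]] := cLnorm2 (LA _ Lk).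
  rewrite !sqrtr_sqr (ger0_norm N0) (ger0_norm M0).
  have := HC k (in2 _ Lk); rewrite NE ME -EFinM lee_fin => /le_trans; apply.
  by rewrite ler_wpM2r// ler_norm.
have Su := bounded_S0_dual K0 ulin ub.
have cu := dual_stft_continuous hP gP Su nwp.
split; first exact: cu.
have mVf := cmeas_stft_L2 Lf.
have mdu : cmeas2 (fun v => u (tfshift v phi)).
  exact: (continuous_cmeas_prod (hg_csb hX) (hg_csb hX') cu).
have ci0 : 0 <= c0^-1 by rewrite invr_ge0 ltW.
rewrite uE//.
have -> : (\int[mn]_v (normc (V f v) * normc (L2_inner mu (A (tfshift v phi)) h))%:E = \int[mn]_v (normc (V f v) * normc (u (tfshift v phi)))%:E)%E.
  by apply: eq_integral => v _; rewrite uE//; exact: L2_phi.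
apply/lee_addgt0Pr => e e0.
have K1 : 0 < K + 1 by rewrite ltr_wpDl.
pose d := (e / (K + 1)) ^+ 2; have d0 : 0 < d by rewrite exprn_gt0// divr_gt0.
have [B [Ia Lr rd]] := L2_reconstruct Lf d0.
set a := cutoff _ _ in Ia.
pose r := reconstruct f B; have Lfr : L2 (fun x => f x - r x) by exact: L2B.
have uf : u f = u r + u (fun x => f x - r x).
  have e1 := ulin 1 r (fun x => f x - r x) Lr Lfr.
  have e2 : (fun x => 1 * r x + (f x - r x)) = f by apply/funext => x; ring.
  by rewrite e2 conjE conjc1 mul1r in e1.
have u1 : ((normc (u r))%:E <= (c0^-1)%:E * \int[mn]_v (normc (V f v) * normc (u (tfshift v phi)))%:E)%E.
  rewrite /r /reconstruct -/a (S0_dualZ hP gP Su _ (S0_synth hP gP nwp Ia)) normcM' normc_conj normc_real ger0_norm// EFinM.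
  apply: lee_wpmul2l; first by rewrite lee_fin.
  apply: (le_trans (dual_synth_le hP gP Su nwp Ia)).
  have mn1 (q : X * X' -> R[i]) : cmeas2 q -> mfunT (fun v : XX => (normc (q v) * normc (u (tfshift v phi)))%:E).
    by move=> mq; apply/mEFinP; apply: measurable_funM; exact: mnormc.
  apply: ge0_le_int.
  - by apply: (mn1 a); case: Ia.
  - exact: (mn1 (V f)).
  - by move=> v; rewrite lee_fin mulr_ge0 ?normc_ge0.
  - by move=> v; rewrite lee_fin ler_wpM2r ?normc_ge0// normc_cutoff_le.
have u2 : normc (u (fun x => f x - r x)) <= e.
  apply: (le_trans (ub _ Lfr)); have [_ sr] := Lfr.
  have hd : fine (sqn mu (fun x => f x - r x)) <= d by rewrite -lee_fin -(sqn_fin sr).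
  apply: (le_trans (ler_wpM2l K0 (ler_wsqrtr hd))).
  rewrite /d sqrtr_sqr ger0_norm; last by rewrite divr_ge0// ltW.
  by rewrite mulrCA ler_piMr ?(ltW e0)// ler_pdivrMr// mul1r lerDl.
apply: (@le_trans _ _ ((normc (u r))%:E + e%:E)%E).
  by rewrite -EFinD lee_fin uf; apply: (le_trans (normcD_le _ _)); rewrite lerD2l.
by rewrite leeD2r.
Qed.
End Moyal.

(** * Essential local suprema of continuous functions *)

Section LocalSup.
Variables (R : realType) (P : tf_space R).
Hypothesis hP : tf_group P.
Local Notation X := (time P).
Local Notation X' := (freq P).
Local Notation mu := (haar P).
Local Notation nu := (dual_haar P).
Local Notation mn := (mu \x nu)%E.
Variables (Q : set (X * X')) (F : X * X' -> R[i]).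
Hypothesis cF : continuous (F : X * X' -> R[i]^o).
Implicit Types y z : X * X'.
Let hX := tf_time hP. Let hX' := tf_freq hP.
Let cX := hg_csb hX. Let cX' := hg_csb hX'.
Let tZ := tgroup_prod (hg_top hX) (hg_top hX').

Lemma local_sup_le (r : R) z : 0 <= r -> (forall y, Q (y - z) -> normc (F y) <= r) -> (local_sup Q F z <= r%:E)%E.
Proof.
move=> r0 H; apply/ess_supP; apply: nearW => y /=; case: ifPn => [/set_mem/H|_]; by rewrite lee_fin.
Qed.

Lemma prodm_open_gt0 (U : set (X * X')) z : open U -> U z -> (0 < mn U)%E.
Proof.
case: z => z1 z2 oU Uz; have [[A B] [/= nA nB] AB] : nbhs (z1, z2) U by exact: open_nbhs_nbhs.
have [oA oB] : open A^° /\ open B^° by split; exact: open_interior.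
have mA := open_mborel oA; have mB := open_mborel oB.
have e : mn (A^° `*` B^°) = (mu A^° * nu B^°)%E by exact: (@prodmE _ _ (borel X) (borel X') R mu nu A^° B^° mA mB).
apply: (@lt_le_trans _ _ (mn (A^° `*` B^°))).
  apply: (eq_ind_r (fun r => (0 < r)%E) _ e); rewrite mule_gt0//.
    by apply: (hg_pos hX oA); exists z1.
  by apply: (hg_pos hX' oB); exists z2.
apply: le_measure; rewrite ?inE.
- exact: measurableX.
- exact: open_mprod.
- by move=> [a b] [/= Aa Bb]; apply: AB; split; exact: interior_subset.
Qed.

(** Nonempty open sets have positive measure, so an essential supremum of a continuous function
    dominates its values at interior points. *)
Lemma local_sup_ge y z : Q^° (y - z) -> ((normc (F y))%:E <= local_sup Q F z)%E.
Proof.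
move=> Qy; rewrite leNgt; apply/negP => lt.
have [r lr ry] : exists2 r : R, (local_sup Q F z <= r%:E)%E & r < normc (F y).
  move: lt; case: (local_sup Q F z) => [l| |] //; first by exists l.
  by exists (normc (F y) - 1); rewrite ?leNye// ltrBlDr ltrDl.
have /ess_supP[N [mN N0 sN]] := lr.
pose U := [set t : X * X' | Q^° (t - z)] `&` [set t | r < normc (F t)].
have oU : open U.
  apply: openI; first by apply: open_shift => //; exact: open_interior.
  have cn : continuous (fun t => normc (F t)) by move=> t; exact: (ccont_normc (@cF t)).
  by apply: ((continuousP _).1 cn [set t : R | r < t]).
have : (mn U <= mn N)%E.
  apply: le_measure; rewrite ?inE//; first exact: open_mprod.
  move=> t [/= Qt rt]; apply: sN => /=; rewrite mem_set; last exact: interior_subset.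
  by rewrite lee_fin leNgt rt.
by rewrite N0 leNgt (prodm_open_gt0 oU (z := y)).
Qed.

Hypothesis mQ : measurable (Q : set (borel X * borel X')).

(** The essential supremum exceeds r exactly when a section of a fixed measurable set has positive
    measure, and the measure of sections is a measurable function. *)
Lemma measurable_local_sup : mfunT (local_sup Q F : borel X * borel X' -> \bar R).
Proof.
pose Z : measurableType _ := (borel X * borel X')%type.
have mFn : mfunT (fun t : Z => normc (F t)).
  by apply: mnormc; exact: continuous_cmeas_prod.
have msub : mfunT (fun p : Z * Z => (p.2 - p.1 : X * X') : Z).
  apply: measurable_fun_pair.
    apply: (msubf (hg_top hX) cX).
      exact: (mcompT (@measurable_fst _ _ _ _) (@measurable_snd _ _ _ _)).
    exact: (mcompT (@measurable_fst _ _ _ _) (@measurable_fst _ _ _ _)).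
  apply: (msubf (hg_top hX') cX').
    exact: (mcompT (@measurable_snd _ _ _ _) (@measurable_snd _ _ _ _)).
  exact: (mcompT (@measurable_snd _ _ _ _) (@measurable_fst _ _ _ _)).
pose h (p : Z * Z) := (\1_Q (p.2 - p.1) * normc (F p.2))%:E : \bar R.
have mI : mfunT (\1_Q : Z -> R) by exact: measurable_indic.
have mh : mfunT h.
  apply/mEFinP; apply: measurable_funM; first exact: (mcompT mI msub).
  exact: (mcompT mFn (@measurable_snd _ _ _ _)).
apply: measurable_fun_gt => r.
pose A := [set p | r%:E < h p]%E.
have mA : measurable A by rewrite -[A]setTI; exact: emeasurable_fun_o_infty.
have mx := measurable_fun_xsection (prodm mu nu) mA.
have -> : [set z | (r%:E < local_sup Q F z)%E] = [set z | (0 < mn (xsection A z))%E].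
  apply/seteqP; split => z /=; rewrite !ltNge => H; apply: contraNN H => H.
  - apply/ess_supP; exists (xsection A z); split; first exact: measurable_xsection.
      by apply/eqP; rewrite eq_le H measure_ge0.
    move=> y /= Hy; rewrite /xsection /= inE /A /h /= ltNge; apply: contra_notN Hy.
    by rewrite indicE; case: ifP => _; rewrite ?mul1r ?mul0r.
  - move/ess_supP : H => [N [mN N0 sN]]; rewrite -N0; apply: le_measure; rewrite ?inE//; first exact: measurable_xsection.
    move=> y; rewrite /xsection /= inE /A /h /= ltNge => /negP Hy; apply: sN => /= Hy'; apply: Hy; move: Hy'.
    by rewrite indicE; case: ifP => _; rewrite ?mul1r ?mul0r.
rewrite -[X in measurable X]setTI; exact: emeasurable_fun_o_infty.
Qed.
End LocalSup.

(** * Mixed quasi-norms and finitely many translates *)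

Lemma seq_argmax (T : eqType) d (O : orderType d) (f : T -> O) (l : seq T) t0 : t0 \in l ->
  exists2 t, t \in l & forall u, u \in l -> (f u <= f t)%O.
Proof.
elim: l t0 => // a l IH t0 _; case: l IH => [|b l] IH; first by exists a; rewrite ?mem_head// => u; rewrite inE => /eqP ->.
have [t tl H] := IH b (mem_head _ _).
have [h|h] := leP (f t) (f a); [exists a; first exact: mem_head|exists t; first by rewrite in_cons tl orbT]; move=> u; rewrite in_cons => /orP[/eqP -> //|ul].
- by apply: le_trans h; exact: H.
- exact: ltW.
- exact: H.
Qed.

Lemma poweR_le (R : realType) (a b : \bar R) (r : R) : 0 < r -> (0 <= a)%E -> (a <= b)%E -> (a `^ r <= b `^ r)%E.
Proof.
move=> r0 a0 ab; apply: gt0_ler_poweR => //; first exact: ltW.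
  by rewrite in_itv /= a0 leey.
by rewrite in_itv /= (le_trans a0 ab) leey.
Qed.

(** The sum is at most [size l] times its largest term, which works for every exponent r > 0. *)
Lemma sum_poweR_le (R : realType) (T : eqType) (x : T -> \bar R) (l : seq T) (r : R) : 0 < r -> (forall t, 0 <= x t)%E ->
  ((\sum_(t <- l) x t) `^ r <= \sum_(t <- l) ((size l)%:R%:E * x t) `^ r)%E.
Proof.
move=> r0 x0; case: l => [|t0 l]; first by rewrite !big_nil poweR0r ?gt_eqF.
have [t tl H] := seq_argmax x (mem_head t0 l).
apply: (@le_trans _ _ (((size (t0 :: l))%:R%:E * x t) `^ r)%E).
  apply: poweR_le => //; first exact: sume_ge0.
  elim: (t0 :: l) H => [|a k IH] H; first by rewrite big_nil mule_ge0 ?lee_fin.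
  rewrite big_cons /= -natr1 EFinD ge0_muleDl ?lee_fin// mul1e addeC leeD//.
    by apply: IH => u uk; apply: H; rewrite in_cons uk orbT.
  by apply: H; exact: mem_head.
by rewrite (big_rem t)//= leeDl// sume_ge0// => u _; exact: poweR_ge0.
Qed.

Section MixedNorm.
Variables (R : realType) (Z B : preTopologicalZmodType).
Variables (m : sfm R Z) (n : sfm R B).
Hypotheses (hZ : hgroup m) (hB : hgroup n).
Variables (S : Z * B -> \bar R) (p g : R).
Hypotheses (mS : mfunT (S : borel Z * borel B -> \bar R)) (S0 : forall w, (0 <= S w)%E) (p0 : 0 < p) (g0 : 0 < g).

Lemma mixed_Lnorm_lty : (Lnorm n g%:E (fun b => Lnorm m p%:E (fun a => S (a, b))) < +oo)%E <->
  (\int[n]_b (\int[m]_a (S (a, b) `^ p)) `^ (g / p) < +oo)%E.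
Proof.
have E b : (`|Lnorm m p%:E (fun a => S (a, b))| `^ g = (\int[m]_a (S (a, b) `^ p)) `^ (g / p))%E.
  rewrite unlock gee0_abs ?poweR_ge0// -poweRrM mulrC; congr (_ `^ _)%E.
  by apply: eq_integral => a _; rewrite gee0_abs.
rewrite {1}unlock; under eq_integral do rewrite E.
by split=> [/lty_poweRy|] h; [apply: h; rewrite invr_eq0 gt_eqF|exact: poweR_lty].
Qed.

(** Translations preserve the mixed quasi-norm, and [sum_poweR_le] handles the sum over [l] for
    exponents above and below 1 alike. *)
Lemma mixed_translates (h : Z * B -> \bar R) (l : seq (Z * B)) : mfunT (h : borel Z * borel B -> \bar R) ->
  (forall w, (0 <= h w)%E) -> (forall w, exists2 t, t \in l & (h w <= S (w + t)%R)%E) ->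
  (\int[n]_b (\int[m]_a (S (a, b) `^ p)) `^ (g / p) < +oo)%E ->
  (\int[n]_b (\int[m]_a (h (a, b) `^ p)) `^ (g / p) < +oo)%E.
Proof.
move=> mh h0 hS I; have gp : 0 < g / p by rewrite divr_gt0.
have mpow (f : Z * B -> \bar R) : mfunT (f : borel Z * borel B -> \bar R) ->
    mfunT (fun w : borel Z * borel B => (f w `^ p)%E).
  by move=> mf; exact: (mcompT (measurable_poweR p) mf).
have sect (f : Z * B -> \bar R) (b : B) : mfunT (f : borel Z * borel B -> \bar R) -> mfunT (fun a : borel Z => f (a, b)).
  by move=> mf; exact: (mcompT mf (@measurable_pair2 _ _ (borel Z) (borel B) b)).
pose Phi (b : B) := (\int[m]_a (S (a, b) `^ p))%E.
have mPhi : mfunT (Phi : borel B -> \bar R).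
  by apply: (@mint2 _ _ (borel Z) (borel B) R m (fun w => S w `^ p)%E (mpow S mS)) => w; exact: poweR_ge0.
have Phi0 b : (0 <= Phi b)%E by apply: integral_ge0 => a _; exact: poweR_ge0.
have PhiS (t : Z * B) b : (\int[m]_a (S ((a, b) + t)%R `^ p) = Phi (b + t.2)%R)%E.
  exact: (int_shift hZ t.1 (f := fun a => (S (a, b + t.2)%R `^ p)%E) (sect _ _ (mpow S mS)) (fun a => poweR_ge0 _ _)).
have mSt (t : Z * B) : mfunT (fun w : borel Z * borel B => (S (w + t)%R `^ p)%E).
  exact: (mcompT (mpow S mS) (mshf2 hZ hB t)).
have le1 b : (\int[m]_a (h (a, b) `^ p) <= \sum_(t <- l) Phi (b + t.2)%R)%E.
  rewrite (eq_bigr (fun t : Z * B => \int[m]_a (S ((a, b) + t)%R `^ p))%E); last by move=> t _; rewrite PhiS.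
  rewrite -ge0_integral_sum//; [|by move=> t; exact: (sect _ b (mSt t))|by move=> t a _; exact: poweR_ge0].
  apply: ge0_le_int.
  - exact: (sect _ b (mpow h mh)).
  - by apply: emeasurable_sum => t; exact: (sect _ b (mSt t)).
  - by move=> a; exact: poweR_ge0.
  - move=> a; have [t tl le] := hS (a, b).
    rewrite (big_rem t)//=; apply: (le_trans (poweR_le p0 (h0 _) le)).
    by rewrite leeDl// sume_ge0// => u _; exact: poweR_ge0.
have mPt (t : Z * B) : mfunT (fun b : borel B => (((size l)%:R%:E * Phi (b + t.2)%R) `^ (g / p))%E).
  apply: (mcompT (measurable_poweR (g / p))); apply: measurable_funeM.
  exact: (mcompT mPhi (mshf hB t.2)).
apply: (@le_lt_trans _ _ (\int[n]_b \sum_(t <- l) ((size l)%:R%:E * Phi (b + t.2)%R) `^ (g / p))%E).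
  apply: ge0_le_int.
  - apply: (mcompT (measurable_poweR (g / p))).
    by apply: (@mint2 _ _ (borel Z) (borel B) R m (fun w => h w `^ p)%E (mpow h mh)) => w; exact: poweR_ge0.
  - by apply: emeasurable_sum => t; exact: mPt.
  - by move=> b; exact: poweR_ge0.
  - move=> b; have s := sum_poweR_le l gp (fun t : Z * B => Phi0 (b + t.2)).
    by apply: le_trans s; apply: poweR_le => //; apply: integral_ge0 => a _; exact: poweR_ge0.
rewrite ge0_integral_sum//; last by move=> t b _; exact: poweR_ge0.
apply: lte_sum_pinfty => t _.
have mf : mfunT (fun b : borel B => (Phi b `^ (g / p))%E) by exact: (mcompT (measurable_poweR (g / p)) mPhi).
have s0 : (0 <= (size l)%:R%:E :> \bar R)%E by rewrite lee_fin.
under eq_integral => b _ do rewrite poweRM ?Phi0 ?s0// poweR_EFin.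
rewrite ge0_intZ ?powR_ge0//; [|by move=> b _; exact: poweR_ge0|exact: (mcompT mf (mshf hB t.2))].
rewrite (int_shift hB t.2 (f := fun b => (Phi b `^ (g / p))%E) mf); last by move=> b; exact: poweR_ge0.
by rewrite lte_mul_pinfty ?lee_fin ?powR_ge0.
Qed.
End MixedNorm.

(** * Short-time Fourier transforms of functionals on S_0 *)

Section DualSTFT.
Variables (R : realType) (P : tf_space R).
Hypotheses (hP : tf_group P) (gP : tf_gauss P).

Lemma dual_stft_bounded u g : S0_dual u -> nwin g -> exists M : R, forall z, normc (dual_stft (P := P) g u z) <= M.
Proof.
move=> Su ng; have [C [C0 HC]] := S0_dual_bound Su; exists (C * fine (S0n g)) => z.
have Sz := nwin_S0 hP gP (nwin_tfshift hP gP z ng).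
apply: (HC _ _ Sz).
have [n _] := ng; rewrite (S0n_tfshift hP gP z n) fineK// ge0_fin_numE.
  by have := (nwin_S0 hP gP ng).2 => /in_L1P[].
exact: int_normc_ge0.
Qed.

(** The modulation norm takes an essential supremum over one fixed [Q]. Finitely many translates of
    its interior cover the compact [N], so the supremum over [N] and the displacement [v0] cost only
    finitely many translates. *)
Lemma msup_dual_stft_lty u g Q (p r : R) N v0 : nwin g -> unit_neighbourhood Q -> 0 < p -> 0 < r ->
  modulation g Q p%:E r%:E u -> compact N -> N !=set0 ->
  (\int[dual_haar P]_b (\int[haar P]_a (msup N (fun w : time P * freq P => normc (dual_stft g u (w + v0))) (a, b) `^ p)%:E) `^ (r / p) < +oo)%E.
Proof.
move=> ng [mQ _ nQ] p0 r0 [Su mS fS] kN Nn; have hX := tf_time hP; have hX' := tf_freq hP.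
have tZ := tgroup_prod (hg_top hX) (hg_top hX').
have cF := dual_stft_continuous hP gP Su ng; have [M HM] := dual_stft_bounded Su ng.
have Sge := local_sup_ge hP cF; set S := local_sup Q (dual_stft g u) in mS fS Sge.
have Q0 : Q^° 0 by exact: nbhs_singleton (nbhs_interior nQ).
have S0 w : (0 <= S w)%E by apply: le_trans (Sge Q w w _); rewrite ?lee_fin ?normc_ge0// subrr.
have [l lP] : exists l : seq (time P * freq P), forall k, N k -> exists2 c, c \in l & Q^° (k - c).
  apply: (compact_fcover (W := fun c => [set k | Q^° (k - c)])) kN _ => c _.
  exact: (nbhs_shift tZ c (nbhs_interior nQ)).
pose V w := normc (dual_stft g u (w + v0)).
have cV : continuous (V : time P * freq P -> R).
  move=> w; apply: (@ccont_normc R (time P * freq P)%type (fun w => dual_stft g u (w + v0)) w); apply: (@continuous_comp _ _ _ (fun w => w + v0) (dual_stft g u : _ -> R[i]^o)); last exact: cF.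
  exact: (tgroup_shift tZ).
have VM w : V w <= M by exact: HM.
have mV : mfunT (fun w : borel (time P) * borel (freq P) => (msup N V w)%:E).
  apply/mEFinP; apply: (measurable_msup (j := id : borel (time P) * borel (freq P) -> time P * freq P) _ tZ VM Nn cV) => U oU.
  exact: (open_mprod (hg_csb hX) (hg_csb hX')).
have fS' := (mixed_Lnorm_lty (haar P) (dual_haar P) _ S0 r0).1 fS.
have := @mixed_translates R _ _ _ _ hX hX' S p r mS p0 r0 (fun w => (msup N V w)%:E) [seq v0 + c | c <- l] mV.
move=> h; apply: h fS'.
  by move=> w; rewrite lee_fin; apply: (msup_ge0 VM Nn) => z; exact: normc_ge0.
move=> w; have [k0 Nk0] := Nn; have [c0 c0l _] := lP k0 Nk0.
have [t tl tm] := seq_argmax (fun c => S (w + (v0 + c))) c0l.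
exists (v0 + t); first exact: map_f.
have le k : N k -> ((V (w + k)%R)%:E <= S (w + (v0 + t))%R)%E.
  move=> Nk; have [c cl Qc] := lP k Nk; apply: le_trans (tm c cl); apply: Sge.
  have grp (U : zmodType) (x y z a : U) : x + y + z - (x + (z + a)) = y - a by rewrite [x + y]addrC -[y + x + z]addrA [x + (z + a)]addrA addrKA.
  by rewrite (grp (time P * freq P)%type).
move: (S0 (w + (v0 + t))) le; case: (S _) => [x _ le|_ _|//]; last by rewrite leey.
rewrite lee_fin; apply: (msup_le VM Nn) => k /le h; by rewrite -lee_fin.
Qed.
End DualSTFT.

Section DualShift.
Variables (R : realType) (P : tf_space R).
Hypotheses (hP : tf_group P) (gP : tf_gauss P).
Implicit Types (f : time P -> R[i]) (v : time P * freq P).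
Let mphi : @cmeasurable _ (borel (time P)) R (gauss (t := P)). Proof. by case: (tg_nice gP) => -[]. Qed.

Lemma S0_tfshift v f : S0 f -> S0 (tfshift v f) /\ S0n (tfshift v f) = S0n f.
Proof.
move=> Sf; have Lf := S0_L2 Sf; have [mf _] := Lf; have Lv := L2_tfshift hP v Lf.
have mV := cmeas_stft_L2 hP gP Lf.
have E z : normc (stft (gauss (t := P)) (tfshift v f) z) = normc (stft (gauss (t := P)) f (z - v)).
  rewrite stft_tfshift//; first by rewrite !normcM' normc_conj !(tf_norm hP) !mul1r.
  exact: (L2_mul_conj Lf (L2_phi hP gP (z - v))).
have NE : S0n (tfshift v f) = S0n f.
  rewrite /S0n; under eq_integral do rewrite E.
  rewrite (int_shift2 (tf_time hP) (tf_freq hP) (- v) (f := fun z => (normc (stft (gauss (t := P)) f z))%:E))//.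
    exact: menormc.
  by move=> z; rewrite lee_fin normc_ge0.
split; last exact: NE.
split; first exact: ((in_L2P _ _).2 Lv).
apply/in_L1P; split; first exact: (cmeas_stft_L2 hP gP Lv).
have [_ /in_L1P[_ I]] := Sf; exact: (eq_ind_r (fun r => (r < +oo)%E) I NE).
Qed.

Lemma S0_dual_tfshift v u : S0_dual u -> S0_dual (fun f => u (tfshift v f)).
Proof.
move=> [ul [C uC]]; split.
  move=> a f g Sf Sg; rewrite -ul; [|exact: (S0_tfshift v Sf).1|exact: (S0_tfshift v Sg).1].
  by congr u; rewrite tfshiftD tfshiftZ.
exists C => f Sf; have [Sv N] := S0_tfshift v Sf.
by apply: (le_trans (uC _ Sv)); rewrite !S0_normE N.
Qed.

Lemma S0Z c f : S0 f -> S0 (fun y => c * f y).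
Proof.
move=> Sf; have Lf := S0_L2 Sf; have [_ /in_L1P I] := Sf.
split; first exact: ((in_L2P _ _).2 (L2Z c Lf)).
rewrite (_ : stft (gauss (t := P)) (fun y => c * f y) = fun z => c * stft (gauss (t := P)) f z).
  by apply/in_L1P; exact: cintegZ.
apply/funext => z; rewrite -[RHS]cintZ; last exact: (L2_mul_conj Lf (L2_phi hP gP z)).
by apply: cint_ext => y; rewrite mulrA.
Qed.

Lemma normc_dual_tfshift u v w f : S0_dual u -> S0 f ->
  normc (u (tfshift v (tfshift w f))) = normc (u (tfshift (v + w) f)).
Proof.
move=> Su Sf; rewrite (tfshift_tfshift hP) (S0_dualZ hP gP Su); last exact: (S0_tfshift _ Sf).1.
by rewrite normcM' !normc_conj (tf_norm hP) mul1r.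
Qed.

Lemma tfshift_continuous v f : continuous (f : time P -> R[i]^o) -> continuous (tfshift v f : time P -> R[i]^o).
Proof.
move=> cf x; apply: (@ccontM R (time P) (fun y => pairing v.2 y) (fun y => f (y - v.1))).
  exact: (continuous_pairing_r hP).
have cs : continuous (fun y : time P => y - v.1).
  by apply: (tgroup_subf (hg_top (tf_time hP))); [move=> y; exact: cvg_id|exact: cst_continuous].
exact: (continuous_comp (cs x) (cf _)).
Qed.

Lemma S_C_continuous f : S_C f -> continuous (f : time P -> R[i]^o).
Proof.
move=> [n [c [z ->]]]; elim: n c z => [|n IH] c z x; first by under eq_fun do rewrite big_ord0; exact: cst_continuous.
under eq_fun do rewrite big_ord_recr.
apply: (@ccontD R (time P) (fun y => \sum_(k < n) c (widen_ord (leqnSn n) k) * tfshift (z (widen_ord (leqnSn n) k)) (gauss (t := P)) y)); first exact: IH.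
apply: (@ccontM R (time P) (fun=> c ord_max)); first exact: cst_continuous.
exact: (@tfshift_continuous (z ord_max) _ (tg_cont gP) x).
Qed.
End DualShift.

Lemma continuous_integral_gt0 (R : realType) (X : preTopologicalZmodType) (mu : sfm R X)
  (q : X -> R) (x : X) : hgroup mu -> continuous q -> (forall t, 0 <= q t) -> 0 < q x -> (0 < \int[mu]_t (q t)%:E)%E.
Proof.
move=> hX cq q0 qx; pose c := q x / 2; have c0 : 0 < c by rewrite divr_gt0.
have h : nbhs x [set t | c < q t].
  by apply: (cq x [set t | c < t]); apply: lt_nbhsr; rewrite ltr_pdivrMr// mulr_natr mulr2n ltrDl.
set U := [set t | c < q t] in h.
have oU : open U by apply: ((continuousP _).1 cq [set t : R | c < t]).
have mU : measurable (U : set (borel X)) by exact: open_mborel.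
have U0 : (0 < mu U)%E by apply: (hg_pos hX) => //; exists x; exact: nbhs_singleton h.
apply: (@lt_le_trans _ _ (c%:E * mu U)%E); first by rewrite mule_gt0.
have -> : mu U = (\int[mu]_t (\1_U t : R)%:E)%E by rewrite integral_indic// setIT.
rewrite -ge0_intZ ?(ltW c0)//; last by apply/mEFinP; exact: measurable_indic.
apply: ge0_le_int.
- by apply: measurable_funeM; apply/mEFinP; exact: measurable_indic.
- by apply/mEFinP; exact: ccont_mR.
- by move=> t; rewrite mule_ge0 ?lee_fin ?(ltW c0)// indicE.
- move=> t; rewrite -EFinM lee_fin indicE; have [tU|tU] := boolP (t \in U); rewrite ?mulr1 ?mulr0//.
  by move: tU; rewrite inE /U /= => /ltW.
Qed.

(** * The Rihaczek transform of the Gaussian as a window on phase space *)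

Section PhaseWindow.
Variables (R : realType) (G : topologicalZmodType).
Hypotheses (G_lca : is_lca G) (G_sc : @second_countable G).
Variables (mu : sfm R G)
  (nu : sfm R (dual R G))
  (mu2 : sfm R (G * dual R G)%type)
  (nu2 : sfm R (dual R G * G)%type).
Hypotheses (mu_haar : is_haar mu) (nu_haar : is_haar nu)
  (mu2_prod : is_product_measure mu nu mu2) (nu2_prod : is_product_measure nu mu nu2).
Variable s : lca_structure R G.
Hypothesis inversion : fourier_inversion (group_tf s mu nu).
Hypothesis lcD : exists C : set (dual R G), compact C /\ nbhs (0 : dual R G) C.
Local Notation D := (dual R G).
Local Notation bGD := (borel (G * D)%type).
Local Notation bDG := (borel (D * G)%type).
Local Notation intG := (@cinteg _ (borel G) R mu).
Local Notation intD := (@cinteg _ (borel D) R nu).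
Implicit Types (x y : G) (xi eta tau : D).

Let hG : hgroup mu := hgroup_G G_sc mu_haar.
Let hD : hgroup nu := hgroup_D G_lca G_sc nu_haar.
Let gsG := gauss_sys_G G_lca s mu_haar.
Let nu_fin : forall C : set D, compact C -> (nu C < +oo)%E. Proof. by case: nu_haar. Qed.
Let gsD := gauss_sys_D s hD nu_fin lcD.
Local Notation P1 := (group_tf s mu nu).
Local Notation P2 := (phase_tf s mu2 nu2).
Let hP1 : tf_group P1 := tf_group_G G_lca G_sc mu_haar nu_haar s.
Let hP2 : tf_group P2 := tf_group_phase G_lca G_sc mu_haar nu_haar mu2_prod nu2_prod s.
Let gP1 : tf_gauss P1 := tf_gauss_G G_lca G_sc mu_haar nu_haar s lcD.
Let gP2 : tf_gauss P2 := tf_gauss_phase G_lca G_sc mu_haar nu_haar mu2_prod nu2_prod inversion lcD.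
Local Notation tfs1 := (tfshift (P := P1)).
Local Notation tfs2 := (tfshift (P := P2)).
Local Notation EG := (EG s).
Local Notation ED := (ED s).
Local Notation cEG := (cEG mu s).
Local Notation phi := (gauss (t := P1)).
Let p0 : 0 < (pi : R). Proof. exact: pi_gt0. Qed.
Let p2 : 0 < 2 * (pi : R). Proof. by rewrite mulr_gt0. Qed.
Let ph : 0 < (pi : R) / 2. Proof. by rewrite divr_gt0. Qed.
Let pi_half : (pi : R) ^+ 2 / (2 * pi) = pi / 2.
Proof. by have H (P : R) : 0 < P -> P ^+ 2 / (2 * P) = P / 2; [move=> P0; field; rewrite gt_eqF|exact: H]. Qed.
Let pi_dbl : (pi : R) ^+ 2 / (pi / 2) = 2 * pi.
Proof. by have H (P : R) : 0 < P -> P ^+ 2 / (P / 2) = 2 * P; [move=> P0; field; rewrite gt_eqF|exact: H]. Qed.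
Let pi_one : (pi : R) ^+ 2 / pi = pi.
Proof. by have H (P : R) : 0 < P -> P ^+ 2 / P = P; [move=> P0; field; rewrite gt_eqF|exact: H]. Qed.
Let kappa := cEG pi.
Let k0 : 0 < kappa. Proof. exact: (cEG_gt0 G_lca G_sc mu_haar). Qed.
Let chconj xi x : xi x * (xi x)^* = 1. Proof. exact: (pairing_conjM hP1 xi x). Qed.
Let chD xi eta x : (xi + eta) x = xi x * eta x. Proof. by []. Qed.
Let chN xi x : (- xi) x = (xi x)^*. Proof. exact: (pairingNl hP1 xi x). Qed.
Let chDr xi x y : xi (x + y) = xi x * xi y. Proof. exact: (tf_pairDr hP1). Qed.
Let chNr xi x : xi (- x) = (xi x)^*. Proof. exact: (pairingNr hP1 xi x). Qed.
Let conjK (u : R[i]) : u^*^* = u. Proof. by rewrite !conjE conjcK. Qed.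

Let intEG a eta : 0 < a -> intG (fun x => (EG a x)%:C * (eta x)^*).
Proof.
move=> a0; apply: (cintegMr (EG_int G_lca G_sc mu_haar s a0) (M := 1)) => [|x]; last by rewrite normc_conj normc_ch.
by apply: cmeas_conj; apply: continuous_cmeasurable; exact: character_cont.
Qed.
Let intED a x : 0 < a -> intD (fun xi => (ED a xi)%:C * (xi x)^*).
Proof.
move=> a0; apply: (cintegMr (ED_int G_lca G_sc nu_haar s lcD a0) (M := 1)) => [|xi]; last by rewrite normc_conj normc_ch.
by apply: cmeas_conj; exact: (pairing_cmeas_D R G_lca).
Qed.

(** The midpoint that [gE_prod] introduces; [hD_] is its counterpart on the dual. *)
Let hG_ x : G := iV (2^-1 *: rG s x).
Let hD_ xi : D := linD (2^-1 *: rD s xi).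

Lemma fourier_gauss xi : fourier (P := P1) phi xi = (kappa * ED pi xi)%:C.
Proof.
rewrite /fourier -[X in ED X]pi_one -(EG_fourier G_lca G_sc mu_haar s xi p0).
by apply: cint_ext => x; rewrite gaussE.
Qed.

(** R(phi, phi), the window in which kernel values of the operator are transforms of the symbol. It
    is a Gaussian times a chirp, and in general does not lie in S_C. *)
Definition rgauss := rihaczek (P := P1) phi phi.

Lemma rgaussE z : rgauss z = (EG pi z.1 * (kappa * ED pi z.2))%:C * (z.2 z.1)^*.
Proof. by rewrite /rgauss /rihaczek gaussE fourier_gauss conjRC -RCM. Qed.

Lemma tfshift1E (v : G * D) f x : tfs1 v f x = v.2 x * f (x - v.1).
Proof. by []. Qed.

Lemma tfshift2E (a b : G) (al be tau : D) x f :
  tfs2 (((a, al), (be, b)) : (G * D) * (D * G)) f ((x, tau) : time P2) = be x * tau b * f (x - a, tau - al).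
Proof. by []. Qed.

Lemma fourier_tfshift (v : G * D) xi : fourier (P := P1) (tfs1 v phi) xi =
  v.2 v.1 * (xi v.1)^* * fourier (P := P1) phi (xi - v.2).
Proof.
have mphi : bcmeas R G phi by case: (tg_nice gP1) => -[].
have I1 : cinteg mu (fun x : borel G => phi x * ((xi - v.2) x)^*).
  by have := intEG (xi - v.2) p0; congr cinteg; apply/funext => x; rewrite gaussE.
rewrite /fourier -cintZ//.
rewrite -(cint_shift hG v.1 (f := fun x => tfs1 v phi x * (xi x)^*)).
  apply: cint_ext => x; rewrite tfshift1E addrK.
  change (v.2 (x + v.1) * phi x * (xi (x + v.1))^* = v.2 v.1 * (xi v.1)^* * (phi x * ((xi - v.2) x)^*)).
  by rewrite !chDr chD chN !conjcM conjK; ring.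
apply: cmeasM; first exact: (cmeas_tfshift1 hP1).
apply: cmeas_conj; apply: continuous_cmeasurable; exact: character_cont.
Qed.

(** Covariance of the Rihaczek transform. The phase-space shift on the right depends linearly on the
    two points. *)
Lemma rihaczek_tfshift (z v : G * D) : exists2 c : R[i], normc c = 1 &
  rihaczek (P := P1) (tfs1 z phi) (tfs1 v phi) =
  fun w => c * tfs2 ((z.1, v.2), (z.2 - v.2, v.1 - z.1)) rgauss w.
Proof.
exists ((v.2 v.1)^* * v.2 z.1); first by rewrite normcM' normc_conj !normc_ch mulr1.
apply/funext => -[x xi].
rewrite tfshift2E /rgauss /rihaczek fourier_tfshift tfshift1E.
change (z.2 x * phi (x - z.1) * (v.2 v.1 * (xi v.1)^* * fourier (P := P1) phi (xi - v.2))^* * (xi x)^* =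
  (v.2 v.1)^* * v.2 z.1 * ((z.2 - v.2) x * xi (v.1 - z.1) * (phi (x - z.1) * (fourier (P := P1) phi (xi - v.2))^* * ((xi - v.2) (x - z.1))^*))).
rewrite !chD !chN !chDr !chNr !conjcM !conjK.
set q := (fourier _ _)^*; set f := phi _.
have e1 := chconj v.2 x; have e2 := chconj xi z.1; set A := v.2 x in e1 *; set B := xi z.1 in e2 *; set C := v.2 z.1.
have e3 : C * C^* = 1 by exact: chconj.
(* The inserted factors are character values times their conjugates, hence 1. *)
transitivity ((A * A^*) * (B * B^*) * (C * C^*) * (z.2 x * f * ((v.2 v.1)^* * xi v.1 * q) * (xi x)^*)); last by ring.
by rewrite e1 e2 e3 !mul1r.
Qed.

Lemma continuous_rgauss : continuous (rgauss : G * D -> R[i]^o).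
Proof.
move=> z; rewrite (_ : rgauss = fun w : G * D => (kappa * EG pi w.1 * ED pi w.2)%:C * (w.2 w.1)^*); last first.
  by apply/funext => w; rewrite rgaussE; congr (_%:C * _); ring.
have c1 := ccont_real (fun w : G * D => @continuous_GD R G G_lca G_sc mu nu mu_haar nu_haar s lcD pi pi kappa w).
apply: (@ccontM R (G * D)%type (fun w : G * D => (kappa * EG pi w.1 * ED pi w.2)%:C) (fun w : G * D => (w.2 w.1)^*)); first exact: c1.
apply: (@ccont_conj R (G * D)%type (fun w : G * D => w.2 w.1)).
apply: (@continuous_comp _ _ _ (fun z : G * D => (z.2, z.1)) (fun z : D * G => z.1 z.2 : R[i]^o)).
  by apply: (cpair (f := fun z : G * D => z.2) (g := fun z : G * D => z.1)) => w; [exact: cvg_snd|exact: cvg_fst].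
exact: dual_pairing_continuous G_lca.2 _.
Qed.

Lemma normc_rgauss z : normc (rgauss z) = kappa * EG pi z.1 * ED pi z.2.
Proof.
rewrite rgaussE normcM' normc_conj normc_ch mulr1 normc_real ger0_norm; first by ring.
by rewrite mulr_ge0 ?EG_ge0// mulr_ge0 ?ED_ge0// ltW.
Qed.

Let hG2 : hgroup mu2 := tf_time hP2.
Let hD2 : hgroup nu2 := tf_freq hP2.

Lemma nice_rgauss : nice (P := P2) rgauss.
Proof.
split; last first.
  exists kappa => z; rewrite normc_rgauss.
  have h1 := EG_le1 s z.1 (ltW p0); have h2 := ED_le1 s z.2 (ltW p0).
  have h3 := EG_ge0 s pi z.1; have h4 := ED_ge0 s pi z.2; have h5 := ltW k0.
  rewrite -mulrA -[leRHS]mulr1; apply: ler_wpM2l => //; nra.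
split; first exact: (continuous_cmeasurable continuous_rgauss).
under eq_integral do rewrite normc_rgauss.
exact: (gauss_GD_lty G_lca G_sc mu_haar nu_haar mu2_prod s lcD p0 p0 (ltW k0)).
Qed.

Lemma EG_window x eta : intG (fun t => (EG pi t * EG pi (t - x))%:C * (eta t)^*) /\
  cintegral mu (fun t : borel G => (EG pi t * EG pi (t - x))%:C * (eta t)^*) =
  (EG (pi / 2) x * cEG (2 * pi) * ED (pi / 2) eta)%:C * (eta (hG_ x))^*.
Proof.
have I0 := window_integrable_G G_lca G_sc mu_haar s x eta.
have E : (fun t : borel G => (EG pi t * EG pi (t - x))%:C * (eta t)^*) =
    (fun t : borel G => (EG pi t)%:C * (eta t * (EG pi (t - x)%R)%:C)^*).
  by apply/funext => t; rewrite conjcM conjRC RCM; ring.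
split; first by rewrite E.
pose f (t : G) := (EG (pi / 2) x)%:C * (eta (hG_ x))^* * ((EG (2 * pi) t)%:C * (eta t)^*).
have Ig : intG (fun t => (EG (2 * pi) t)%:C * (eta t)^*).
  exact: intEG.
have If : intG f by exact: cintegZ.
transitivity (cintegral mu (fun t : borel G => f (t - hG_ x))).
  apply: cint_ext => t; rewrite /f [EG pi t * _](gE_prod gsG pi x t) RCM chDr chNr conjcM conjK.
  have e := chconj eta (hG_ x).
  transitivity ((eta (hG_ x) * (eta (hG_ x))^*) * ((EG (pi / 2) x)%:C * (EG (2 * pi) (t - hG_ x))%:C * (eta t)^*)).
    by rewrite e mul1r.
  by ring.
rewrite (cint_shift hG (- hG_ x) (f := f)); last by case: If.
by rewrite cintZ// (EG_fourier G_lca G_sc mu_haar s eta p2) pi_half !RCM; ring.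
Qed.

Lemma ED_window xi y : intD (fun t => (ED pi t * ED pi (t - xi))%:C * (t y)^*) /\
  cintegral nu (fun t : borel D => (ED pi t * ED pi (t - xi))%:C * (t y)^*) =
  (ED (pi / 2) xi * EG (pi / 2) y / cEG (pi / 2))%:C * (hD_ xi y)^*.
Proof.
have I0 := window_integrable_D G_lca G_sc nu_haar s lcD xi y.
have E : (fun t : borel D => (ED pi t * ED pi (t - xi))%:C * (t y)^*) =
    (fun t : borel D => (ED pi t)%:C * (t y * (ED pi (t - xi)%R)%:C)^*).
  by apply/funext => t; rewrite conjcM conjRC RCM; ring.
split; first by rewrite E.
pose f (t : D) := (ED (pi / 2) xi)%:C * (hD_ xi y)^* * ((ED (2 * pi) t)%:C * (t y)^*).
have Ig : intD (fun t => (ED (2 * pi) t)%:C * (t y)^*).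
  exact: intED.
have If : intD f by exact: cintegZ.
transitivity (cintegral nu (fun t : borel D => f (t - hD_ xi))).
  apply: cint_ext => t; rewrite /f [ED pi t * _](gE_prod gsD pi xi t) RCM chD chN conjcM conjK.
  have e := chconj (hD_ xi) y.
  transitivity ((hD_ xi y * (hD_ xi y)^*) * ((ED (pi / 2) xi)%:C * (ED (2 * pi) (t - hD_ xi))%:C * (t y)^*)).
    by rewrite e mul1r.
  by ring.
rewrite (cint_shift hD (- hD_ xi) (f := f)); last by case: If.
rewrite cintZ// (ED_fourier_conj G_lca G_sc mu_haar nu_haar inversion lcD y p2) pi_half.
by rewrite !RCM; ring.
Qed.

Definition rgauss_stft := stft (P := P2) rgauss rgauss.

Lemma cintegral2E (f : G -> R[i]) (g : D -> R[i]) : intG f -> intD g ->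
  cintegral mu2 (fun z : G * D => f z.1 * g z.2) = cintegral mu f * cintegral nu g.
Proof.
move=> If Ig; rewrite (cint_product mu2_prod (f := fun z : G * D => f z.1 * g z.2)).
  exact: cint_mul_prod.
by case: (cinteg_mul_prod If Ig).
Qed.

Lemma cintegral2E' (f : D -> R[i]) (g : G -> R[i]) : intD f -> intG g ->
  cintegral nu2 (fun z : D * G => f z.1 * g z.2) = cintegral nu f * cintegral mu g.
Proof.
move=> If Ig; rewrite (cint_product nu2_prod (f := fun z : D * G => f z.1 * g z.2)).
  exact: cint_mul_prod.
by case: (cinteg_mul_prod If Ig).
Qed.

(** The quadratic phases in [t] and [tau] cancel, so the product separates into a function of [t]
    times a function of [tau]. *)
Lemma rgauss_mul x xi (t : G) tau : rgauss (t, tau) * (rgauss (t - x, tau - xi))^* =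
  xi x * ((EG pi t * EG pi (t - x))%:C * (xi t)^*) * ((kappa ^+ 2)%:C * ((ED pi tau * ED pi (tau - xi))%:C * (tau x)^*)).
Proof.
rewrite !rgaussE /=.
change ((EG pi t * (kappa * ED pi tau))%:C * (tau t)^* * ((EG pi (t - x) * (kappa * ED pi (tau - xi)))%:C * ((tau - xi) (t - x))^*)^* =
  xi x * ((EG pi t * EG pi (t - x))%:C * (xi t)^*) * ((kappa ^+ 2)%:C * ((ED pi tau * ED pi (tau - xi))%:C * (tau x)^*))).
rewrite conjcM conjRC conjK chD chN !chDr !chNr !conjcM conjK expr2.
have e := chconj tau t.
move: (EG pi t) (EG pi (t - x)) (ED pi tau) (ED pi (tau - xi)) (kappa) => a a' b b' k.
transitivity ((tau t * (tau t)^*) * (xi x * ((a * a')%:C * (xi t)^*) * ((k * k)%:C * ((b * b')%:C * (tau x)^*)))).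
  by rewrite !RCM; ring.
by rewrite e mul1r.
Qed.

Lemma rgauss_stftE x xi eta y : rgauss_stft ((x, xi), (eta, y)) =
  xi x * ((EG (pi / 2) x * cEG (2 * pi) * ED (pi / 2) (xi + eta))%:C * ((xi + eta) (hG_ x))^*) *
  ((kappa ^+ 2)%:C * ((ED (pi / 2) xi * EG (pi / 2) (x + y) / cEG (pi / 2))%:C * (hD_ xi (x + y))^*)).
Proof.
have [I1 <-] := EG_window x (xi + eta); have [I2 <-] := ED_window xi (x + y).
rewrite -(cintZ _ I1) -(cintZ _ I2) -cintegral2E; [|exact: cintegZ|exact: cintegZ].
apply: cint_ext => -[t tau]; rewrite tfshift2E conjcM mulrCA rgauss_mul.
change ((eta t * tau y)^* * (xi x * ((EG pi t * EG pi (t - x))%:C * (xi t)^*) * ((kappa ^+ 2)%:C * ((ED pi tau * ED pi (tau - xi))%:C * (tau x)^*))) =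
 xi x * ((EG pi t * EG pi (t - x))%:C * ((xi + eta) t)^*) * ((kappa ^+ 2)%:C * ((ED pi tau * ED pi (tau - xi))%:C * (tau (x + y))^*))).
by rewrite chD chDr !conjcM; ring.
Qed.

Lemma normc_rgauss_stft x xi eta y : normc (rgauss_stft ((x, xi), (eta, y))) =
  kappa ^+ 2 * cEG (2 * pi) / cEG (pi / 2) * (EG (pi / 2) x * ED (pi / 2) (xi + eta) * ED (pi / 2) xi * EG (pi / 2) (x + y)).
Proof.
have c1 := ltW (cEG_gt0 G_lca G_sc mu_haar s p2); have c2 := ltW (cEG_gt0 G_lca G_sc mu_haar s ph).
have h1 := EG_ge0 s (pi / 2) x; have h2 := EG_ge0 s (pi / 2) (x + y); have h3 := ED_ge0 s (pi / 2) xi.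
have h4 := ED_ge0 s (pi / 2) (xi + eta).
rewrite rgauss_stftE !normcM' !normc_conj !normc_ch !normc_real mul1r !mulr1 (ger0_norm (sqr_ge0 _)).
rewrite (ger0_norm (mulr_ge0 (mulr_ge0 h1 c1) h4)) (ger0_norm (divr_ge0 (mulr_ge0 h3 h2) c2)).
by move: (EG _ _) (ED _ _) h1 h2 h3 h4 => *; ring.
Qed.

(** A regrouping of phases that exhibits the integrand as a function of [eta] times a function of
    [y]. *)
Lemma rgauss_stft_factor (x y t : G) (xi eta tau : D) (a b c a' b' d' k : R) :
  xi x * ((a * c * b)%:C * ((xi + eta) (hG_ x))^*) * (k%:C * ((b' * a' / d')%:C * (hD_ xi (x + y))^*)) * (eta t * tau y) =
  (a * c)%:C * (xi t)^* * (b%:C * (xi + eta) (t - hG_ x)) *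
  (xi x * k%:C * (b' / d')%:C * (tau x)^* * (a'%:C * ((hD_ xi - tau) (x + y))^*)).
Proof.
rewrite !chDr !chD !chN !chNr !conjcM !conjK !RCM.
have e1 := chconj xi t; have e2 := chconj tau x.
set q := (hD_ xi x)^*; set q' := (hD_ xi y)^*; set r := (xi (hG_ x))^*; set r' := (eta (hG_ x))^*.
transitivity ((xi t * (xi t)^*) * (tau x * (tau x)^*) * (xi x * (a%:C * c%:C * b%:C * (r * r')) * (k%:C * (b'%:C * a'%:C * (d'^-1)%:C * (q * q'))) * (eta t * tau y))).
  by rewrite e1 e2 !mul1r.
by ring.
Qed.

(* Gaussians on [G] and its dual are Fourier transforms of each other, so the
   two windowed transforms of [rgauss_stftE] can be inverted separately. *)
Lemma rgauss_stft_inversion (u z : G * D) :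
  cintegral nu2 (fun b : D * G => rgauss_stft (u, b) * (b.1 z.1 * z.2 b.2)) = rgauss z * (rgauss (z - u))^*.
Proof.
case: u z => [x xi] [t tau]; rewrite [RHS]rgauss_mul.
pose f (eta : D) := (EG (pi / 2) x * cEG (2 * pi))%:C * (xi t)^* * ((ED (pi / 2) (xi + eta))%:C * (xi + eta) (t - hG_ x)).
pose g (y : G) := xi x * (kappa ^+ 2)%:C * (ED (pi / 2) xi / cEG (pi / 2))%:C * (tau x)^* * ((EG (pi / 2) (x + y))%:C * ((hD_ xi - tau) (x + y))^*).
have If0 : intD (fun eta => (ED (pi / 2) eta)%:C * eta (t - hG_ x)).
  by have := intED (- (t - hG_ x)) ph; congr cinteg; apply/funext => eta; rewrite chNr conjK.
have Ig0 : intG (fun y => (EG (pi / 2) y)%:C * ((hD_ xi - tau) y)^*).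
  exact: intEG.
have [If fE] : intD f /\ cintegral nu f = (EG (pi / 2) x * EG (2 * pi) (t - hG_ x))%:C * (xi t)^*.
  have I1 := cinteg_shift hD xi If0.
  have Ef : f = fun eta => (EG (pi / 2) x * cEG (2 * pi))%:C * (xi t)^* * ((ED (pi / 2) (eta + xi))%:C * (eta + xi) (t - hG_ x)).
    by apply/funext => eta; rewrite /f addrC.
  split; first by rewrite Ef; exact: cintegZ.
  have mf0 : bcmeas R D (fun eta => (ED (pi / 2) eta)%:C * eta (t - hG_ x)) by case: If0.
  rewrite Ef cintZ// (cint_shift hD xi (f := fun eta => (ED (pi / 2) eta)%:C * eta (t - hG_ x)))//.
  rewrite (ED_fourier G_lca G_sc mu_haar nu_haar inversion lcD _ ph) pi_dbl.
  have := cEG_gt0 G_lca G_sc mu_haar s p2; rewrite mulrAC -RCM; move: (cEG _) => C C0; congr (_%:C * _).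
  by rewrite -mulrA [C * _]mulrC divfK// gt_eqF.
have [Ig gE] : intG g /\ cintegral mu g = xi x * (kappa ^+ 2)%:C * (ED (pi / 2) xi * ED (2 * pi) (tau - hD_ xi))%:C * (tau x)^*.
  have I1 := cinteg_shift hG x Ig0.
  have Eg : g = fun y => xi x * (kappa ^+ 2)%:C * (ED (pi / 2) xi / cEG (pi / 2))%:C * (tau x)^* * ((EG (pi / 2) (y + x))%:C * ((hD_ xi - tau) (y + x))^*).
    by apply/funext => y; rewrite /g (addrC x).
  split; first by rewrite Eg; exact: cintegZ.
  have mg0 : bcmeas R G (fun y => (EG (pi / 2) y)%:C * ((hD_ xi - tau) y)^*) by case: Ig0.
  rewrite Eg cintZ// (cint_shift hG x (f := fun y => (EG (pi / 2) y)%:C * ((hD_ xi - tau) y)^*))//.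
  rewrite (EG_fourier G_lca G_sc mu_haar s _ ph) pi_dbl -[hD_ xi - tau]opprB.
  have -> : ED (2 * pi) (- (tau - hD_ xi)) = ED (2 * pi) (tau - hD_ xi) by exact: (gEN gsD).
  rewrite -[LHS]mulrA [(tau x)^* * _]mulrC mulrA; congr (_ * _).
  have := cEG_gt0 G_lca G_sc mu_haar s ph; rewrite -[LHS]mulrA -RCM; move: (cEG _) => C C0; congr (_ * _%:C).
  by rewrite mulrA divfK// gt_eqF.
transitivity (cintegral nu2 (fun b : D * G => f b.1 * g b.2)).
  by apply: cint_ext => -[eta y]; rewrite rgauss_stftE; exact: rgauss_stft_factor.
rewrite cintegral2E'// fE gE [EG pi t * _](gE_prod gsG pi x t) [ED pi tau * _](gE_prod gsD pi xi tau).
set A := (EG (pi / 2) x * EG (2 * pi) (t - hG_ x))%:C; set B := (ED (pi / 2) xi * ED (2 * pi) (tau - hD_ xi))%:C.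
change (A * (xi t)^* * (xi x * (kappa ^+ 2)%:C * B * (tau x)^*) = xi x * (A * (xi t)^*) * ((kappa ^+ 2)%:C * (B * (tau x)^*))).
by move: (kappa ^+ 2)%:C => K; ring.
Qed.

(** If every inner product vanished, the transform of [g2] in the window [rgauss] would be 0. For a
    fixed window position it is a Fourier transform in the time variable, which inversion on [G]
    removes; at the time [x0] this makes [g2 (x0, _)] orthogonal to all shifts of the Gaussian of
    the dual, hence to itself. *)
Lemma inner_rgauss_neq0 g2 : S_C (P := P2) g2 -> (exists z, g2 z != 0) ->
  exists v : (G * D) * (D * G), L2_inner mu2 (tfs2 v g2) rgauss != 0.
Proof.
move=> Sg [[x0 xi0] gn0]; apply: contrapT => nE.
have [ng _] := S_C_nwin hP2 gP2 Sg.
have [[mg Ig] [M gM]] := ng.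
have [n [c [z gE2]]] := Sg.
have cg : continuous (g2 : G * D -> R[i]^o) by exact: (S_C_continuous hP2 gP2).
(* By covariance, a vanishing inner product with the shift of [g2] by [- w] is a zero of its
   transform at [w]. *)
have st0 (w : (G * D) * (D * G)) : stft (P := P2) rgauss g2 w = 0.
  apply/eqP; apply: contrapT => h; apply: nE; exists (- w); apply: contra_notN h => /eqP h.
  have := stft_tfshift hP2 (g := rgauss) (f := g2) (w := - w) (z := 0) mg.
  case: nice_rgauss => -[mr _] _ => /(_ mr (stft_cinteg hP2 _ ng nice_rgauss)).
  have -> : stft (P := P2) rgauss (tfs2 (- w) g2) 0 = 0 by rewrite /stft (tfshift0 hP2).
  rewrite sub0r opprK => /esym/eqP; rewrite -normc_eq0 (normcM' (_ * _)) (normcM' (pairing _ _)) normc_conj !(tf_norm hP2) !mul1r.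
  by rewrite normc_eq0.
pose H al eta y (p : G * D) := g2 p * (tfs2 (((x0, al), (eta, y)) : (G * D) * (D * G)) rgauss p)^*.
have HE al eta y x xi : H al eta y (x, xi) = g2 (x, xi) * (eta x * xi y * rgauss (x - x0, xi - al))^* by [].
have cH al eta y : continuous (H al eta y : G * D -> R[i]^o).
  move=> p; apply: (@ccontM R (G * D)%type g2); first exact: cg.
  apply: (@ccont_conj R (G * D)%type); exact: (@tfshift_continuous R P2 hP2 _ _ continuous_rgauss p).
have cHx al eta y x : continuous (fun xi : D => H al eta y (x, xi) : R[i]^o).
  move=> xi; apply: (@continuous_comp _ _ _ (fun xi : D => (x, xi) : G * D) (H al eta y : G * D -> R[i]^o)); last exact: cH.
  by apply: (cpair (f := fun _ : D => x) (g := fun xi : D => xi)); [exact: cst_continuous|move=> t; exact: cvg_id].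
have M0 : 0 <= M by apply: le_trans (gM 0); exact: normc_ge0.
pose B al (xi : D) := M * kappa * ED pi (xi - al).
have mB al : mfunT (B al : borel D -> R).
  apply: measurable_funM; first exact: measurable_cst.
  exact: (mcompT (measurable_ED G_lca G_sc nu_haar s lcD pi) (mshf hD (- al))).
have IB al : (\int[nu]_xi (B al xi)%:E < +oo)%E.
  have [_] := cintegZ (M * kappa)%:C (cinteg_shift hD (- al) (ED_int G_lca G_sc nu_haar s lcD p0)); congr (_ < _)%E; apply: eq_integral => xi _.
  by rewrite normcM' !normc_real !ger0_norm ?ED_ge0// mulr_ge0// ltW.
have HB al eta y x xi : normc (H al eta y (x, xi)) <= B al xi.
  rewrite HE normcM' normc_conj (normcM' (eta x * xi y)) (normcM' (eta x)) !normc_ch !mul1r normc_rgauss -mulrA.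
  have h1 := EG_le1 s (x - x0) (ltW p0); have h3 := EG_ge0 s pi (x - x0); have h4 := ED_ge0 s pi (xi - al); have h5 := ltW k0.
  change (normc (g2 (x, xi)) * (kappa * (EG pi (x - x0) * ED pi (xi - al))) <= M * kappa * ED pi (xi - al)).
  rewrite -[leRHS]mulrA; apply: ler_pM; [exact: normc_ge0|by apply: mulr_ge0 => //; exact: mulr_ge0|exact: gM|].
  by apply: ler_wpM2l => //; rewrite ler_piMl.
have IHx al eta y x : intD (fun xi => H al eta y (x, xi)).
  apply: (@cinteg_le _ (borel D) R nu _ (B al : borel D -> R) _ (mB al) (HB al eta y x) (IB al)).
  exact: continuous_cmeasurable.
have IH al eta y : cinteg (mu \x nu)%E (H al eta y).
  have [_ I] := stft_cinteg hP2 (((x0, al), (eta, y)) : (G * D) * (D * G)) ng nice_rgauss.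
  have mH : cmeasurable (H al eta y : borel G * borel D -> R[i]) by exact: (continuous_cmeas_prod (hg_csb hG) (hg_csb hD) (cH al eta y)).
  split => //; rewrite -(ge0_integral_product mu2_prod (f := fun p => (normc (H al eta y p))%:E)) => //.
  - exact: menormc.
  - by move=> p; rewrite lee_fin normc_ge0.
pose K al y x := cintegral nu (fun xi : borel D => H al 0 y (x, xi)).
(* [K al y] is continuous and integrable, and its Fourier transform is the vanishing transform of
   [g2]; inversion makes it 0 at every point. *)
have K0 al y x : K al y x = 0.
  have cK : continuous (K al y : G -> R[i]^o).
    move=> x'; apply: (@cint_continuous R G (hg_csb hG) _ (borel D) nu (fun x (xi : borel D) => H al 0 y (x, xi)) x' setT (B al : borel D -> R)) => //.
    - exact: filterT.
    - by move=> x''; case: (IHx al 0 y x'').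
    - move=> xi; apply: (@continuous_comp _ _ _ (fun x : G => (x, xi) : G * D) (H al 0 y : G * D -> R[i]^o)); last exact: cH.
      by apply: (cpair (f := fun x : G => x) (g := fun _ : G => (xi : D))); [move=> t; exact: cvg_id|exact: cst_continuous].
  have IK : intG (K al y) := @cinteg_param _ _ (borel G) (borel D) R mu nu _ (IH al 0 y).
  have fK : fourier (P := P1) (K al y) = fun=> 0.
    apply/funext => eta; rewrite -(st0 (((x0, al), (eta, y)) : (G * D) * (D * G))).
    transitivity (cintegral mu2 (H al eta y)); last by [].
    have mH : cmeasurable (H al eta y : borel G * borel D -> R[i]) by case: (IH al eta y).
    rewrite (cint_product mu2_prod mH) -(@cfubini1 _ _ (borel G) (borel D) R mu nu _ (IH al eta y)).
    apply: cint_ext => x'; rewrite -[_ * _](cintZr _ (IHx al 0 y x')); apply: cint_ext => xi.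
    rewrite !HE; move: (rgauss _) (g2 _) => r r'; rewrite !conjcM; change ((0 : D) x') with (1 : R[i]); rewrite [1^*]conjE conjc1 mul1r.
    by change (r' * ((xi y)^* * r^*) * (eta x')^* = r' * ((eta x')^* * (xi y)^* * r^*)); ring.
  have IK1 : in_L mu 1%:E (K al y) by apply/in_L1P.
  have If1 : in_L nu 1%:E (fourier (P := P1) (K al y)) by rewrite fK; apply/in_L1P; exact: cinteg0.
  rewrite (inversion cK IK1 If1) fK.
  by under eq_fun do rewrite mul0r; exact: cint0.
(* At the time [x0] the displacement in time is 0, so the chirp of [rgauss] is trivial. *)
have HmE al y xi : H al 0 y (x0, xi) = g2 (x0, xi) * ((xi y)^* * (kappa * ED pi (xi - al))%:C).
  have r0 : rgauss (x0 - x0, xi - al) = (kappa * ED pi (xi - al))%:C.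
    rewrite rgaussE; change ((EG pi (x0 - x0) * (kappa * ED pi (xi - al)))%:C * ((xi - al) (x0 - x0))^* = (kappa * ED pi (xi - al))%:C).
    have e0 : (xi - al) 0 = 1 := pairing0r hP1 (xi - al).
    by rewrite subrr e0 (_ : EG pi 0 = 1) ?mul1r ?conjE ?conjc1 ?mulr1//; exact: (gE0 gsG).
  rewrite HE r0; move: (g2 _) (kappa * _) => r' q; rewrite !conjcM conjRC; change ((0 : D) x0) with (1 : R[i]); rewrite [1^*]conjE conjc1.
  by rewrite mul1r.
pose q (xi : D) := normc (g2 (x0, xi)) ^+ 2.
pose a k := (c k)^* * ((z k).2.1 x0)^* * (EG pi (x0 - (z k).1.1) / kappa)%:C.
(* The conjugate of [g2 (x0, _)] is a combination of the functions against which it integrates to [0]. *)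
have qE xi : (q xi)%:C = \sum_(k < n) a k * H (z k).1.2 0 (z k).2.2 (x0, xi).
  have cs (E : 'I_n -> R[i]) : (\sum_(k < n) E k)^* = \sum_(k < n) (E k)^* by exact: rmorph_sum.
  rewrite /q -mulc_conj [in X in _ * X]gE2 cs mulr_sumr; apply: eq_bigr => k _.
  rewrite HmE /a (_ : tfshift (z k) _ (x0, xi) = (z k).2.1 x0 * xi (z k).2.2 * (EG pi (x0 - (z k).1.1) * ED pi (xi - (z k).1.2))%:C); last first.
    by rewrite /tfshift phase_gaussE.
  rewrite !conjcM conjRC; move: (EG _ _) (ED _ _) => e1 e2; rewrite !RCM.
  have e : (kappa^-1)%:C * kappa%:C = 1 by rewrite -RCM mulVf// gt_eqF.
  set d := (c k)^*; set b := (_ x0)^*; set d' := (xi _)^*; move: e1%:C e2%:C => {}e1 {}e2.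
  transitivity (((kappa^-1)%:C * kappa%:C) * (g2 (x0, xi) * (d * (b * d' * (e1 * e2))))); first by rewrite e mul1r.
  by ring.
have It k : intD (fun xi => a k * H (z k).1.2 0 (z k).2.2 (x0, xi)) by apply: cintegZ; exact: IHx.
have Iq : intD (fun xi => (q xi)%:C).
  by rewrite (_ : (fun xi => _) = fun xi => \sum_(k < n) a k * H (z k).1.2 0 (z k).2.2 (x0, xi)); [exact: cinteg_sum|apply/funext].
have q0 xi : 0 <= q xi by exact: sqr_ge0.
have cq : continuous q.
  move=> xi; have cgx : {for xi, continuous (fun xi : D => g2 (x0, xi) : R[i]^o)}.
    apply: (@continuous_comp _ _ _ (fun xi : D => (x0, xi) : G * D) (g2 : G * D -> R[i]^o)); last exact: cg.
    by apply: (cpair (f := fun _ : D => x0) (g := fun xi : D => xi)); [exact: cst_continuous|move=> t; exact: cvg_id].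
  have h := ccont_normc cgx; exact: (@continuousM R D _ _ xi h h).
have qp : 0 < q xi0 by rewrite exprn_gt0// lt_neqAle normc_ge0 eq_sym normc_eq0 gn0.
have qi := continuous_integral_gt0 hD cq q0 qp.
have Z : cintegral nu (fun xi : borel D => (q xi)%:C) = 0.
  under cint_ext do rewrite qE.
  by rewrite cint_sum// big1// => k _; rewrite (cintZ (a k) (IHx _ 0 _ x0)) -/(K (z k).1.2 (z k).2.2 x0) K0 mulr0.
move: Z Iq => + [_]; rewrite (cint_realE nu (q : borel D -> R)) => -[fz].
under eq_integral do rewrite normc_real ger0_norm//.
by move=> fq; have := fine_gt0 (introT andP (conj qi fq)); rewrite fz ltxx.
Qed.

(** For k = pi / 2 this is the modulus of [rgauss_stft] up to a constant. *)
Definition gprod (k : R) (w : (G * D) * (D * G)) : R :=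
  EG k w.1.1 * ED k (w.1.2 + w.2.1) * ED k w.1.2 * EG k (w.1.1 + w.2.2).

Lemma gprod_ge0 k w : 0 <= gprod k w.
Proof. by rewrite /gprod; do !apply: mulr_ge0; rewrite ?EG_ge0 ?ED_ge0. Qed.

Lemma continuous_gprod k : continuous (gprod k).
Proof.
have f1 (T1 T2 : topologicalType) : continuous (fst : T1 * T2 -> T1) by move=> z; exact: cvg_fst.
have f2 (T1 T2 : topologicalType) : continuous (snd : T1 * T2 -> T2) by move=> z; exact: cvg_snd.
have c11 : continuous (fun w : (G * D) * (D * G) => w.1.1) by move=> w; apply: continuous_comp; [exact: f1|exact: f1].
have c12 : continuous (fun w : (G * D) * (D * G) => w.1.2) by move=> w; apply: continuous_comp; [exact: f1|exact: f2].
have c21 : continuous (fun w : (G * D) * (D * G) => w.2.1) by move=> w; apply: continuous_comp; [exact: f2|exact: f1].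
have c22 : continuous (fun w : (G * D) * (D * G) => w.2.2) by move=> w; apply: continuous_comp; [exact: f2|exact: f2].
have cE := @continuous_EG R G G_lca G_sc mu mu_haar s k.
have cD' := @continuous_ED R G G_lca G_sc nu nu_haar s lcD k.
have s1 := tgroup_addf (hg_top hD) c12 c21; have s2 := tgroup_addf (hg_top hG) c11 c22.
move=> w; apply: cvgM; first apply: cvgM; first apply: cvgM.
- exact: (continuous_comp (c11 w) (cE _)).
- exact: (continuous_comp (s1 w) (cD' _)).
- exact: (continuous_comp (c12 w) (cD' _)).
- exact: (continuous_comp (s2 w) (cE _)).
Qed.

Lemma measurable_gprod k : mfunT (gprod k : bGD * bDG -> R).
Proof.
have c := ccont_real (@continuous_gprod k).
by case: (continuous_cmeas_prod (hg_csb hG2) (hg_csb hD2) c).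
Qed.

(** In the variable [b] the function is a translate by [(z.2, z.1)] of a fixed Gaussian. *)
Lemma gprod_slice k : 0 < k -> exists2 Q : R, 0 <= Q &
  forall z, (\int[nu2]_b (gprod k (z, b))%:E = (Q * EG k z.1 * ED k z.2)%:E)%E.
Proof.
move=> kp; pose q (b : D * G) := (ED k b.1 * (1 * EG k b.2))%:E.
have q0 b : (0 <= q b)%E by rewrite lee_fin mulr_ge0 ?ED_ge0// mul1r EG_ge0.
have mq : mfunT (q : bDG -> \bar R).
  apply/mEFinP; apply: (ccont_mR (f := fun b : D * G => ED k b.1 * (1 * EG k b.2))).
  exact: (@continuous_DG R G G_lca G_sc mu nu mu_haar nu_haar s lcD k k 1).
have iq : (\int[nu2]_b q b < +oo)%E := gauss_DG_lty G_lca G_sc mu_haar nu_haar nu2_prod s lcD kp kp ler01.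
have iq0 : (0 <= \int[nu2]_b q b)%E by apply: integral_ge0.
exists (fine (\int[nu2]_b q b)); first exact: fine_ge0.
move=> z; rewrite -mulrA mulrC EFinM fineK; last by rewrite ge0_fin_numE.
rewrite -(int_shift hD2 (z.2, z.1) mq q0) -ge0_intZ.
- by apply: eq_integral => b _; rewrite /q /gprod -EFinM; congr EFin; rewrite ![_ + b.1]addrC ![_ + b.2]addrC mul1r /=; ring.
- exact: measurableT.
- by move=> b _; exact: q0.
- exact: (mcompT mq (mshf hD2 (z.2, z.1))).
- by apply: mulr_ge0; [exact: EG_ge0|exact: ED_ge0].
Qed.

Lemma gprod_lty k : 0 < k -> (\int[prodm mu2 nu2]_w (gprod k w)%:E < +oo)%E.
Proof.
move=> kp; rewrite (@prodm_tonelli1 _ _ _ _ R mu2 nu2 (fun w => (gprod k w)%:E)); last 2 first.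
- by apply/mEFinP; exact: measurable_gprod.
- by move=> w; rewrite lee_fin gprod_ge0.
have [Q Q0 E] := gprod_slice kp; under eq_integral do rewrite E.
exact: (gauss_GD_lty G_lca G_sc mu_haar nu_haar mu2_prod s lcD kp kp Q0).
Qed.

Lemma EG_powR a t x : 0 < t -> EG a x `^ t = EG (t * a) x.
Proof.
move=> t0; change (gE (rG s) (KG s) a x `^ t = gE (rG s) (KG s) (t * a) x); rewrite /gE indicE; case: (x \in KG s); rewrite ?mulr1 ?mulr0 ?powR0 ?gt_eqF//.
by rewrite -expRM mulNr mulrC mulrA.
Qed.

Lemma ED_powR a t xi : 0 < t -> ED a xi `^ t = ED (t * a) xi.
Proof.
move=> t0; change (gE (rD s) (KD s) a xi `^ t = gE (rD s) (KD s) (t * a) xi); rewrite /gE indicE; case: (xi \in KD s); rewrite ?mulr1 ?mulr0 ?powR0 ?gt_eqF//.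
by rewrite -expRM mulNr mulrC mulrA.
Qed.

Lemma gprod_powR k t w : 0 < t -> gprod k w `^ t = gprod (t * k) w.
Proof.
move=> t0; have h1 := EG_ge0 s k w.1.1; have h2 := ED_ge0 s k (w.1.2 + w.2.1); have h3 := ED_ge0 s k w.1.2.
have h4 := EG_ge0 s k (w.1.1 + w.2.2).
rewrite /gprod (powRM t (mulr_ge0 (mulr_ge0 h1 h2) h3) h4) (powRM t (mulr_ge0 h1 h2) h3) (powRM t h1 h2).
by congr (_ * _ * _ * _); [exact: EG_powR|exact: ED_powR|exact: ED_powR|exact: EG_powR].
Qed.

Definition ballG : set G := [set h | KG s h /\ dot (rG s h) (rG s h) <= 1].
Definition ballD : set D := [set h | KD s h /\ dot (rD s h) (rD s h) <= 1].

Lemma ballG0 : ballG 0. Proof. have h := gauss_ball_G G_lca mu_haar s; exact: (nbhs_singleton h). Qed.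
Lemma ballD0 : ballD 0. Proof. have h := gauss_ball_D G_lca G_sc nu_haar s lcD; exact: (nbhs_singleton h). Qed.

Lemma EG_shift2 k x h h' : 0 <= k -> ballG h -> ballG h' -> EG k x <= expR k * expR (k / 2) * EG (k / 4) (x + (h + h')).
Proof.
move=> kp [K1 n1] [K2 n2]; have k2 : 0 <= k / 2 by rewrite divr_ge0.
apply: (le_trans (gE_shift_le gsG x kp K1 n1)); rewrite -mulrA ler_wpM2l ?expR_ge0//.
have := gE_shift_le gsG (x + h) k2 K2 n2; rewrite -addrA.
by have -> : k / 2 / 2 = k / 4 by field.
Qed.

Lemma ED_shift2 k xi h h' : 0 <= k -> ballD h -> ballD h' -> ED k xi <= expR k * expR (k / 2) * ED (k / 4) (xi + (h + h')).
Proof.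
move=> kp [K1 n1] [K2 n2]; have k2 : 0 <= k / 2 by rewrite divr_ge0.
apply: (le_trans (gE_shift_le gsD xi kp K1 n1)); rewrite -mulrA ler_wpM2l ?expR_ge0//.
have := gE_shift_le gsD (xi + h) k2 K2 n2; rewrite -addrA.
by have -> : k / 2 / 2 = k / 4 by field.
Qed.

(** An argument such as [w.1.2 + w.2.1] moves by a sum of two elements of the unit ball; two
    applications of [gE_shift_le] divide the parameter by 4. There is one constant for each of the
    four factors. *)
Lemma gprod_shift k w w0 : 0 <= k -> ballG w0.1.1 -> ballD w0.1.2 -> ballD w0.2.1 -> ballG w0.2.2 ->
  gprod k w <= (expR k * expR (k / 2)) ^+ 4 * gprod (k / 4) (w + w0).
Proof.
move=> kp b1 b2 b3 b4; set c := expR k * expR (k / 2).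
have e1 := EG_shift2 w.1.1 kp b1 ballG0; rewrite addr0 in e1.
have e2 := ED_shift2 (w.1.2 + w.2.1) kp b2 b3.
have e3 := ED_shift2 w.1.2 kp b2 ballD0; rewrite addr0 in e3.
have e4 := EG_shift2 (w.1.1 + w.2.2) kp b1 b4.
have -> : c ^+ 4 * gprod (k / 4) (w + w0) = c * EG (k / 4) (w.1.1 + w0.1.1) * (c * ED (k / 4) (w.1.2 + w.2.1 + (w0.1.2 + w0.2.1))) *
    (c * ED (k / 4) (w.1.2 + w0.1.2)) * (c * EG (k / 4) (w.1.1 + w.2.2 + (w0.1.1 + w0.2.2))).
  rewrite /gprod addrACA [w.1.1 + w.2.2 + _]addrACA; move: (c) => c'.
  change ((w + w0).1.1) with (w.1.1 + w0.1.1); change ((w + w0).1.2) with (w.1.2 + w0.1.2).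
  change ((w + w0).2.1) with (w.2.1 + w0.2.1); change ((w + w0).2.2) with (w.2.2 + w0.2.2).
  by move: (EG _ _) (EG _ _) (ED _ _) (ED _ _) => *; ring.
have h1 := EG_ge0 s k w.1.1; have h2 := ED_ge0 s k (w.1.2 + w.2.1); have h3 := ED_ge0 s k w.1.2.
have h4 := EG_ge0 s k (w.1.1 + w.2.2).
exact: (ler_pM (mulr_ge0 (mulr_ge0 h1 h2) h3) h4 (ler_pM (mulr_ge0 h1 h2) h3 (ler_pM h1 h2 e1 e2) e3) e4).
Qed.

Let cst : R := kappa ^+ 2 * cEG (2 * pi) / cEG (pi / 2).
Let cst_ge0 : 0 <= cst.
Proof.
have c1 := ltW (cEG_gt0 G_lca G_sc mu_haar s p2); have c2 := ltW (cEG_gt0 G_lca G_sc mu_haar s ph).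
exact: (divr_ge0 (mulr_ge0 (sqr_ge0 _) c1) c2).
Qed.

Lemma rgauss_stft_gprod w : normc (rgauss_stft w) = cst * gprod (pi / 2) w.
Proof. by case: w => -[x xi] [eta y]; exact: normc_rgauss_stft. Qed.

Lemma cinteg_rgauss_stft : cinteg (prodm mu2 nu2) rgauss_stft.
Proof.
split.
  apply: (continuous_cmeas_prod (hg_csb hG2) (hg_csb hD2)).
  exact: (stft_continuous hP2 nice_rgauss nice_rgauss continuous_rgauss).
under eq_integral do rewrite rgauss_stft_gprod EFinM.
rewrite ge0_intZ//.
- by rewrite lte_mul_pinfty//; exact: gprod_lty.
- by move=> w _; rewrite lee_fin gprod_ge0.
- by apply/mEFinP; exact: measurable_gprod.
Qed.

(* Integrating over the frequency variables first recovers
   [rgauss z * (rgauss (z - u))^*]; the remaining integral over [u] is an inner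
   product with the new window. *)
Lemma synth_rgauss g : nice (P := P2) g -> synth (P := P2) rgauss_stft g = fun z => L2_inner mu2 g rgauss * rgauss z.
Proof.
move=> ng; apply/funext => z; have [[mg _] [M gM]] := ng; have Ia := cinteg_rgauss_stft; have [ma ia] := Ia.
have IF : cinteg (mu2 \x nu2)%E (fun v => rgauss_stft v * tfs2 v g z).
  apply: (cintegMr Ia (M := M)) => [|v]; last by rewrite (normc_tfshift hP2).
  by apply: (cmeas_tfshift hP2 _ _ mg); [exact: measurable_id|exact: measurable_cst].
have e := @cfubini1 _ _ _ _ R mu2 nu2 _ IF.
rewrite /synth; apply: (etrans (esym e)).
transitivity (cintegral mu2 (fun u : bGD => rgauss z * (g (z - u) * (rgauss (z - u))^*))).
  apply: cint_ext => u.
  have Iu : @cinteg _ (bDG) R nu2 (fun b => rgauss_stft (u, b) * (b.1 z.1 * z.2 b.2)).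
    have mu1 : @cmeasurable _ (bDG) R (fun b => rgauss_stft (u, b)).
      exact: (cmeas_comp (@measurable_pair1 _ _ (bGD) (bDG) u) ma).
    have mp1 : @cmeasurable _ (bDG) R (fun b => b.1 z.1 * z.2 b.2).
      exact: (@continuous_cmeasurable R (D * G)%type (fun b : D * G => b.1 z.1 * z.2 b.2) (@continuous_pairing_l R P2 hP2 z)).
    apply: (@cinteg_le _ (bDG) R nu2 _ (fun b => normc (rgauss_stft (u, b)))).
    - exact: cmeasM.
    - exact: mnormc.
    - by move=> b; rewrite normcM' normcM' !normc_ch !mulr1.
    - under eq_integral do rewrite rgauss_stft_gprod EFinM.
      have [Q Q0 QE] := gprod_slice ph.
      rewrite ge0_intZ ?QE ?ltry//; first by move=> b _; rewrite lee_fin gprod_ge0.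
      apply/mEFinP.
      exact: (mcompT (measurable_gprod (pi / 2)) (@measurable_pair1 _ _ (bGD) (bDG) u)).
  transitivity (cintegral nu2 (fun b : D * G => rgauss_stft (u, b) * (b.1 z.1 * z.2 b.2) * g (z - u))).
    by apply: cint_ext => b; rewrite -mulrA.
  rewrite (cintZr _ Iu) rgauss_stft_inversion; ring.
pose h (u : G * D) := rgauss z * (g u * (rgauss u)^*).
have Ih : @cinteg _ (bGD) R mu2 (fun u => g u * (rgauss u)^*) := nice_mul_conj ng nice_rgauss.
have mh : @cmeasurable _ (bGD) R h by apply: cmeasM; [exact: cmeas_cst|case: Ih].
transitivity (cintegral mu2 (fun u => h (z - u))); first by [].
have e2 : cintegral mu2 (fun u => h (z - u)) = cintegral mu2 h.
  rewrite -(cint_opp hG2 mh) -(cint_shift hG2 (- z) (f := fun u => h (- u))).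
    by apply: cint_ext => u; rewrite opprD opprK addrC.
  exact: (cmeas_comp (measurable_opp hG2) mh).
by rewrite e2 /h (cintZ _ Ih) mulrC.
Qed.

(** By [synth_rgauss], [rgauss] is a superposition of shifts of [g] with the integrable coefficients
    [rgauss_stft]; it therefore lies in S_0, and [dual_synth_le] moves [sigma] under the integral.
    The displacement [v0] keeps the normalizing factor away from 0. *)
Lemma window_change sigma g v0 : S0_dual (P := P2) sigma -> nwin (P := P2) g ->
  L2_inner mu2 (tfs2 v0 g) rgauss != 0 ->
  S0 (P := P2) rgauss /\ exists2 C : R, 0 <= C & forall v, ((normc (sigma (tfs2 v rgauss)))%:E <=
    C%:E * \int[prodm mu2 nu2]_w (gprod (pi / 2) w * normc (sigma (tfs2 (v + w + v0) g)))%:E)%E.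
Proof.
move=> Ss ng; set c := L2_inner _ _ _ => cn0.
have nv : nwin (P := P2) (tfs2 v0 g) by exact: (nwin_tfshift hP2).
have Sg := nwin_S0 hP2 gP2 ng; have [nv1 _] := nv.
have nc0 : 0 < normc c by rewrite lt_neqAle normc_ge0 eq_sym normc_eq0 cn0.
have sE := synth_rgauss nv1; rewrite -/c in sE.
have Sr : S0 (P := P2) (synth (P := P2) rgauss_stft (tfs2 v0 g)) := S0_synth hP2 gP2 nv cinteg_rgauss_stft.
have rE : rgauss = fun z => c^-1 * synth (P := P2) rgauss_stft (tfs2 v0 g) z.
  by apply/funext => z; rewrite sE mulrA mulVf// mul1r.
split; first by rewrite rE; exact: (S0Z hP2 gP2).
exists ((normc c)^-1 * cst); first by rewrite mulr_ge0// invr_ge0 ltW.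
move=> v; have Sv := S0_dual_tfshift hP2 gP2 v Ss.
have := dual_synth_le hP2 gP2 Sv nv cinteg_rgauss_stft.
rewrite {1}rE (S0_dualZ hP2 gP2 Sv _ Sr) normcM' normc_conj.
set u := normc (sigma _) => h.
have nci : normc c^-1 = (normc c)^-1.
  by apply: (mulfI (lt0r_neq0 nc0)); rewrite -normcM' mulfV// mulfV ?gt_eqF// normc1.
rewrite nci EFinM [X in (_ <= X * _)%E]EFinM -muleA; apply: lee_wpmul2l; first by rewrite lee_fin invr_ge0 ltW.
apply: (le_trans h).
have cu := dual_stft_continuous hP2 gP2 Sv nv.
rewrite -ge0_intZ//; last 2 first.
- by move=> w _; rewrite lee_fin mulr_ge0 ?gprod_ge0 ?normc_ge0.
- apply/mEFinP; apply: measurable_funM; first exact: measurable_gprod.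
  apply: mnormc.
  have mg : cmeasurable (fun w : bGD * bDG => sigma (tfs2 w g)).
    exact: (continuous_cmeas_prod (hg_csb hG2) (hg_csb hD2) (dual_stft_continuous hP2 gP2 Ss ng)).
  have := cmeas_comp (mshf2 hG2 hD2 (v + v0)) mg.
  by congr cmeasurable; apply/funext => w; rewrite addrA [w + v]addrC.
apply: eqW; apply: eq_integral => w _.
rewrite -EFinM rgauss_stft_gprod -mulrA; congr (_ * (_ * _))%:E.
by rewrite (normc_dual_tfshift hP2 gP2 w v0 Sv Sg) (normc_dual_tfshift hP2 gP2 v (w + v0) Ss Sg) addrA.
Qed.

Lemma gauss_finite_nbhs : exists U : set G, [/\ open U, U 0 & (mu U < +oo)%E].
Proof.
have [lG lc] := G_lca; have [C [cC nC]] := lc_compact_nbhs lc (0 : G).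
have oC : open C^° by exact: open_interior.
exists C^°; split => //; have [_ fin _] := mu_haar; apply: le_lt_trans (fin C cC).
have cl : open (~` C) by apply: closed_openC; exact: compact_closed.
apply: le_measure; rewrite ?inE; [exact: open_mborel| |exact: interior_subset].
by rewrite -[C]setCK; apply: measurableC; exact: open_mborel.
Qed.
Let fO := gauss_finite_nbhs.

Lemma sqn_gauss_gt0 : 0 < fine (sqn mu phi).
Proof.
have [_ fs] := nice_sqn (tg_nice gP1); apply: fine_gt0; rewrite fs andbT.
have cn : continuous (fun x : G => normc (phi x)) by move=> x; exact: (ccont_normc (@tg_cont _ _ gP1 x)).
apply: (@continuous_integral_gt0 R G mu (fun x => normc (phi x) ^+ 2) 0 hG) => [x|x|]; [exact: (cvgM (cn x) (cn x))|exact: sqr_ge0|].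
by rewrite gaussE (_ : EG pi 0 = 1) ?normc1 ?expr1n//; exact: (gE0 gsG).
Qed.
Let c0 := sqn_gauss_gt0.

(** * Integrability of the local maximal function for the starting exponent 2 *)

Definition gpair (k : R) (w : G * D) : R := EG k w.1 * ED k w.2.
Lemma gpair_ge0 k w : 0 <= gpair k w. Proof. by apply: mulr_ge0; [exact: EG_ge0|exact: ED_ge0]. Qed.
Lemma continuous_gpair k : continuous (gpair k).
Proof.
have -> : gpair k = fun z : G * D => 1 * EG k z.1 * ED k z.2 by apply/funext => w; rewrite mul1r.
exact: (@continuous_GD R G G_lca G_sc mu nu mu_haar nu_haar s lcD k k 1).
Qed.
Lemma measurable_gpair k : mfunT (gpair k : borel G * borel D -> R).
Proof. by case: (continuous_cmeas_prod (hg_csb hG) (hg_csb hD) (ccont_real (@continuous_gpair k))). Qed.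
Lemma gpair_lty k : 0 < k -> (\int[mu2]_w (gpair k w)%:E < +oo)%E.
Proof.
move=> kp; have := gauss_GD_lty G_lca G_sc mu_haar nu_haar mu2_prod s lcD kp kp ler01.
by congr (_ < _)%E; apply: eq_integral => w _; rewrite mul1r.
Qed.

Local Notation V := (stft (P := P1) phi).

Lemma continuous_normc_stft f : L2 (P := P1) f -> continuous (fun z : G * D => normc (V f z)).
Proof.
move=> Lf z; apply: ccont_normc.
exact: (@dual_stft_continuous R P1 hP1 gP1 _ _ (L2_functional_dual hP1 gP1 inversion fO c0 Lf) (nwin_gauss gP1) z).
Qed.

(** Moyal's formula is a reproducing formula for [V f], with the Gaussian transform of phi as
    kernel. Cauchy-Schwarz is applied after writing this kernel as a product of two Gaussians of
    half the parameter. *)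
Lemma stft_smoothing f : L2 (P := P1) f -> exists2 C : R, 0 <= C & forall z : G * D,
  ((normc (V f z) ^+ 2)%:E <= C%:E * \int[prodm mu nu]_v (normc (V f v) ^+ 2 * gpair (pi / 2) (v - z))%:E)%E.
Proof.
move=> Lf; have mV := cmeas_stft_L2 hP1 gP1 Lf; have sV := stft_sqn_lty hP1 gP1 Lf.
have p4 : 0 < (pi : R) / 4 by rewrite divr_gt0.
have sq w : gpair (pi / 4) w ^+ 2 = gpair (pi / 2) w.
  have e : 2 * (pi / 4) = pi / 2 :> R by field.
  rewrite /gpair exprMn -(powR_mulrn 2 (EG_ge0 s (pi / 4) w.1)) -(powR_mulrn 2 (ED_ge0 s (pi / 4) w.2)).
  by congr (_ * _); [rewrite (EG_powR _ _ (ltr0n R 2)) e|rewrite (ED_powR _ _ (ltr0n R 2)) e].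
have msh z k : mfunT (fun v : borel G * borel D => gpair k (v - z)).
  exact: (mcompT (measurable_gpair k) (mshf2 hG hD (- z))).
have IK : (\int[prodm mu nu]_v (gpair (pi / 2) v)%:E < +oo)%E.
  have h := gpair_lty ph; rewrite (ge0_integral_product mu2_prod) in h => //.
    by apply/mEFinP; exact: measurable_gpair.
  by move=> w; rewrite lee_fin gpair_ge0.
have mE k : mfunT (fun v : borel G * borel D => (gpair k v)%:E) by apply/mEFinP; exact: measurable_gpair.
have g0 k w : (0 <= (gpair k w)%:E)%E by rewrite lee_fin gpair_ge0.
set I2 := (\int[prodm mu nu]_v (gpair (pi / 2) v)%:E)%E in IK.
have I20 : (0 <= I2)%E by apply: integral_ge0.
pose cc := fine (sqn mu phi); pose k2 := cEG (2 * pi).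
have k20 : 0 <= k2 by exact: (ltW (cEG_gt0 G_lca G_sc mu_haar s p2)).
exists (k2 ^+ 2 / cc ^+ 2 * fine I2).
  by rewrite mulr_ge0 ?fine_ge0// divr_ge0 ?sqr_ge0.
move=> z; have Lz := L2_phi hP1 gP1 z; have mW := cmeas_stft_L2 hP1 gP1 Lz; have sW := stft_sqn_lty hP1 gP1 Lz.
pose F1 (v : borel G * borel D) : R[i] := (normc (V f v) * gpair (pi / 4) (v - z))%:C.
pose F2 (v : borel G * borel D) : R[i] := (gpair (pi / 4) (v - z))%:C.
have mF1 : cmeasurable F1 by apply: cmeas_real; apply: measurable_funM; [exact: mnormc|exact: msh].
have mF2 : cmeasurable F2 by apply: cmeas_real; exact: msh.
have n1 v : normc (F1 v) ^+ 2 = normc (V f v) ^+ 2 * gpair (pi / 2) (v - z).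
  by rewrite /F1 normc_real real_normK ?num_real// exprMn sq.
have n2 v : normc (F2 v) ^+ 2 = gpair (pi / 2) (v - z) by rewrite /F2 normc_real real_normK ?num_real// sq.
have gle1 w : gpair (pi / 4) w <= 1.
  by apply: mulr_ile1; [exact: EG_ge0|exact: ED_ge0|exact: (EG_le1 s w.1 (ltW p4))|exact: (ED_le1 s w.2 (ltW p4))].
have s1 : (sqn (prodm mu nu) F1 < +oo)%E.
  apply: le_lt_trans sV; apply: (sqn_le _ mF1 mV) => v.
  rewrite /F1 normc_real ger0_norm; last by rewrite mulr_ge0 ?normc_ge0 ?gpair_ge0.
  by rewrite ler_piMr ?normc_ge0.
have s2E : sqn (prodm mu nu) F2 = I2.
  rewrite /sqn; under eq_integral do rewrite n2.
  exact: (int_shift2 hG hD (- z) (f := fun v => (gpair (pi / 2) v)%:E) (mE _) (g0 _)).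
have s2 : (sqn (prodm mu nu) F2 < +oo)%E by rewrite s2E.
have [_ I12] := sqn_mul_conj mF1 mF2 s1 s2.
have cs := cauchy_schwarz mF1 mF2 s1 s2.
pose J := (\int[prodm mu nu]_v (normc (V f v) * gpair (pi / 2) (v - z))%:E)%E.
have JE : L2_inner (prodm mu nu) F1 F2 = (fine J)%:C.
  rewrite -(cint_realE (prodm mu nu) (fun v => normc (V f v) * gpair (pi / 2) (v - z))).
  by apply: cint_ext => v; rewrite /F1 /F2 conjRC -RCM -mulrA -expr2 sq.
have J0 : (0 <= J)%E by apply: integral_ge0 => v _; rewrite lee_fin mulr_ge0 ?normc_ge0 ?gpair_ge0.
have Jfin : (J < +oo)%E.
  move: I12; congr (_ < _)%E; apply: eq_integral => v _; rewrite normcM' normc_conj /F1 /F2 !normc_real !ger0_norm ?gpair_ge0//.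
    by rewrite -mulrA -expr2 sq.
  by rewrite mulr_ge0 ?normc_ge0 ?gpair_ge0.
have IVW := sqn_mul_conj mV mW sV sW.
have key : cc * normc (V f z) <= k2 * fine J.
  have cc0 : 0 <= cc by exact: ltW.
  rewrite -lee_fin EFinM; have -> : (cc%:E * (normc (V f z))%:E = (normc (cc%:C * V f z))%:E)%E.
    by rewrite normcM' normc_real ger0_norm// EFinM.
  rewrite [_ * V f z](esym (moyal hP1 gP1 inversion fO Lf Lz)).
  apply: (le_trans (normc_cintegral IVW)).
  have fJ : J \is a fin_num by rewrite ge0_fin_numE.
  have -> : (k2 * fine J)%:E = (k2%:E * J)%E by rewrite EFinM (fineK fJ).
  rewrite /J -ge0_intZ//; last 2 first.
  - by move=> v _; rewrite lee_fin mulr_ge0 ?normc_ge0 ?gpair_ge0.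
  - by apply/mEFinP; apply: measurable_funM; [exact: mnormc|exact: msh].
  apply: eqW; apply: eq_integral => v _.
  rewrite -EFinM normcM' normc_conj (normc_stft_tfshift hP1 gP1 z v (tg_nice gP1)).
  have -> : normc (V phi (v - z)) = k2 * gpair (pi / 2) (v - z).
    have := stft_gauss G_lca G_sc nu mu_haar s (v.1 - z.1) (v.2 - z.2).
    by rewrite /gpair /k2 => e; rewrite mulrCA -e.
  by congr EFin; ring.
rewrite JE normc_real (ger0_norm (fine_ge0 J0)) s2E in cs.
have s1E : sqn (prodm mu nu) F1 = (\int[prodm mu nu]_v (normc (V f v) ^+ 2 * gpair (pi / 2) (v - z))%:E)%E.
  by apply: eq_integral => v _; rewrite n1.
rewrite -s1E (sqn_fin s1) -EFinM lee_fin.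
have h : (cc * normc (V f z)) ^+ 2 <= (k2 * fine J) ^+ 2.
  apply: lerXn2r key; rewrite nnegrE; first by apply: mulr_ge0; [exact: (ltW c0)|exact: normc_ge0].
  by apply: mulr_ge0 => //; exact: fine_ge0.
rewrite exprMn [(k2 * _) ^+ 2]exprMn in h.
have cc2 : 0 < cc ^+ 2 by rewrite exprn_gt0.
rewrite -(ler_pM2l cc2); apply: (le_trans h).
have -> : cc ^+ 2 * (k2 ^+ 2 / cc ^+ 2 * fine I2 * fine (sqn (prodm mu nu) F1)) = k2 ^+ 2 * (fine (sqn (prodm mu nu) F1) * fine I2).
  by field; rewrite gt_eqF.
by rewrite ler_wpM2l ?sqr_ge0.
Qed.

(** By [stft_smoothing] the square of [V f] is dominated by a Gaussian average. A displacement
    within unit balls only widens the Gaussian, finitely many such balls cover [N], and the averages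
    [H] are integrable because [V f] is square integrable. *)
Lemma msup_stft_sqr_lty f N : L2 (P := P1) f -> compact N -> N 0 ->
  (\int[mu2]_z (msup N (fun z : G * D => normc (V f z)) z `^ 2)%:E < +oo)%E.
Proof.
move=> Lf kN N0; have Nn : N !=set0 by exists 0.
have [C C0 smooth] := stft_smoothing Lf; have [M HM] := stft_L2_bound hP1 gP1 Lf.
have mV := cmeas_stft_L2 hP1 gP1 Lf; have sV := stft_sqn_lty hP1 gP1 Lf.
have cV := continuous_normc_stft Lf.
pose W (c : G * D) : set (G * D) := [set k | ballG (k - c).1 /\ ballD (k - c).2].
have [l lP] : exists l : seq (G * D), forall k, N k -> exists2 c, c \in l & W c k.
  apply: compact_fcover kN _ => c _.
  exists ([set x | ballG (x - c.1)], [set xi | ballD (xi - c.2)]); last by move=> [x xi].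
  split; first exact: (nbhs_shift (hg_top hG) c.1 (gauss_ball_G G_lca mu_haar s)).
  exact: (nbhs_shift (hg_top hD) c.2 (gauss_ball_D G_lca G_sc nu_haar s lcD)).
pose H (z : G * D) := (\int[prodm mu nu]_v (normc (V f v) ^+ 2 * gpair (pi / 4) (v - z))%:E)%E.
have H0 z : (0 <= H z)%E.
  by apply: integral_ge0 => v _; rewrite lee_fin mulr_ge0 ?sqr_ge0// gpair_ge0.
pose K (p : bGD * (borel G * borel D)) := (normc (V f p.2) ^+ 2 * gpair (pi / 4) (p.2 - p.1))%:E.
have mK : mfunT K.
  apply/mEFinP; apply: measurable_funM.
    apply: measurable_funX; exact: (mcompT (mnormc mV) (@measurable_snd _ _ _ _)).
  have mg : mfunT (gpair (pi / 4) : bGD -> R) by apply: ccont_mR; exact: continuous_gpair.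
  apply: (mcompT mg); apply: (msubf (hg_top hG2) (hg_csb hG2)); last exact: measurable_fst.
  exact: (mcompT (mborel_of_prod (hg_csb hG) (hg_csb hD)) (@measurable_snd _ _ _ _)).
have K0 p : (0 <= K p)%E by rewrite lee_fin mulr_ge0 ?sqr_ge0// gpair_ge0.
have mH : mfunT (H : bGD -> \bar R).
  exact: (@mint1 _ _ (bGD) _ R (prodm mu nu) K mK K0).
have p4 : 0 < (pi : R) / 4 by rewrite divr_gt0.
have IH : (\int[mu2]_z H z < +oo)%E.
  have mE : mfunT (fun w : bGD => (gpair (pi / 4) w)%:E).
    by apply/mEFinP; apply: ccont_mR; exact: continuous_gpair.
  have [Q QE] : exists Q : R, (\int[mu2]_w (gpair (pi / 4) w)%:E)%E = Q%:E.
    exists (fine (\int[mu2]_w (gpair (pi / 4) w)%:E)%E); rewrite fineK// ge0_fin_numE ?gpair_lty//.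
    by apply: integral_ge0 => w _; rewrite lee_fin gpair_ge0.
  have gs (v : G * D) : (\int[mu2]_z (gpair (pi / 4) (v - z)%R)%:E = Q%:E)%E.
    rewrite -QE -(int_shift hG2 (- v) mE); last by move=> w; rewrite lee_fin gpair_ge0.
    apply: eq_integral => z _; rewrite -[v - z]opprB /gpair; congr (_ * _)%:E; [exact: (gEN gsG)|exact: (gEN gsD)].
  have e1 := @prodm_tonelli1 _ _ (bGD) _ R mu2 (prodm mu nu) K mK K0.
  have e2 := @prodm_tonelli2 _ _ (bGD) _ R mu2 (prodm mu nu) K mK K0.
  apply: (eq_ind_r (fun r => (r < +oo)%E) _ (etrans (esym e1) e2)).
  apply: (@le_lt_trans _ _ (Q%:E * sqn (prodm mu nu) (V f))%E).
    have Q0 : 0 <= Q by rewrite -lee_fin -QE; apply: integral_ge0 => w _; rewrite lee_fin gpair_ge0.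
    rewrite /sqn -ge0_intZ//; last 2 first.
    - by move=> v _; rewrite lee_fin sqr_ge0.
    - exact: msqn.
    apply: eqW; apply: eq_integral => v _.
    rewrite /K -(gs v) muleC -ge0_intZ ?sqr_ge0//.
    - by move=> z _; rewrite lee_fin gpair_ge0.
    - apply: (mcompT mE); apply: (msubf (hg_top hG2) (hg_csb hG2)); [exact: measurable_cst|exact: measurable_id].
  apply: lte_mul_pinfty => //; rewrite -QE; apply: integral_ge0 => w _; by rewrite lee_fin gpair_ge0.
pose C' := C * (expR (pi / 2) * expR (pi / 2)).
have C'0 : 0 <= C' by rewrite mulr_ge0// mulr_ge0 ?expR_ge0.
have E4 : (pi : R) / 2 / 2 = pi / 4 by field.
have loc z k : N k -> exists2 c, c \in l & ((normc (V f (z + k)) ^+ 2)%:E <= C'%:E * H (z + c)%R)%E.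
  move=> Nk; have [c cl [[K1 d1] [K2 d2]]] := lP k Nk; exists c => //.
  apply: (le_trans (smooth _)); rewrite /C' EFinM -muleA; apply: lee_wpmul2l; first by rewrite lee_fin.
  have mloc q (z' : G * D) : mfunT (fun v : borel G * borel D => (normc (V f v) ^+ 2 * gpair q (v - z'))%:E).
    apply/mEFinP; apply: measurable_funM; first by apply: measurable_funX; exact: mnormc.
    exact: (mcompT (measurable_gpair q) (mshf2 hG hD (- z'))).
  rewrite -ge0_intZ; last 4 first.
  - exact: measurableT.
  - by move=> v _; rewrite lee_fin mulr_ge0 ?sqr_ge0// gpair_ge0.
  - exact: mloc.
  - by rewrite mulr_ge0 ?expR_ge0.
  apply: ge0_le_int.
  - exact: mloc.
  - by apply: measurable_funeM; exact: mloc.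
  - by move=> v; rewrite lee_fin mulr_ge0 ?sqr_ge0// gpair_ge0.
  - move=> v; rewrite -EFinM lee_fin [leRHS]mulrCA; apply: ler_wpM2l; first exact: sqr_ge0.
    have h1 := gE_shift_le gsG (v.1 - (z.1 + k.1)) (ltW ph) K1 d1; have h2 := gE_shift_le gsD (v.2 - (z.2 + k.2)) (ltW ph) K2 d2.
    rewrite !E4 in h1 h2.
    have -> : expR (pi / 2) * expR (pi / 2) * gpair (pi / 4) (v - (z + c)) =
      (expR (pi / 2) * EG (pi / 4) (v.1 - (z.1 + k.1) + (k - c).1)) * (expR (pi / 2) * ED (pi / 4) (v.2 - (z.2 + k.2) + (k - c).2)).
      rewrite [RHS]mulrACA /gpair; congr (_ * (EG _ _ * ED _ _)).
        by change (v.1 - (z.1 + c.1) = v.1 - (z.1 + k.1) + (k.1 - c.1)); rewrite !opprD !addrA addrNK.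
      by change (v.2 - (z.2 + c.2) = v.2 - (z.2 + k.2) + (k.2 - c.2)); rewrite !opprD !addrA addrNK.
    by apply: ler_pM h1 h2; [exact: EG_ge0|exact: ED_ge0].
have mHc c : mfunT (fun z : bGD => (C'%:E * H (z + c)%R)%E).
  by apply: measurable_funeM; exact: (mcompT mH (mshf hG2 c)).
have Hc0 c z : (0 <= C'%:E * H (z + c)%R)%E by rewrite mule_ge0.
pose T z := (\sum_(c <- l) C'%:E * H (z + c)%R)%E.
have T0 z : (0 <= T z)%E by exact: sume_ge0.
apply: (@le_lt_trans _ _ (\int[mu2]_z T z)%E).
  apply: ge0_le_int.
  - apply/mEFinP; apply: (mcompT (measurable_powR 2)).
    apply: (measurable_msup (j := id : bGD -> G * D) _ (hg_top hG2) HM Nn cV) => U oU.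
    exact: open_mborel.
  - by apply: emeasurable_sum => c; exact: mHc.
  - by move=> z; rewrite lee_fin powR_ge0.
  - move=> z; have [fT|] := ltP (T z) +oo%E; last by rewrite leye_eq => /eqP ->; rewrite leey.
    have TE : T z = (fine (T z))%:E by rewrite fineK// ge0_fin_numE.
    have m0 : 0 <= msup N (fun z : G * D => normc (V f z)) z by apply: (msup_ge0 HM Nn) => w; exact: normc_ge0.
    rewrite TE lee_fin (powR_mulrn 2 m0).
    have le : msup N (fun z : G * D => normc (V f z)) z <= Num.sqrt (fine (T z)).
      apply: (msup_le HM Nn) => k Nk; have [c cl hc] := loc z k Nk.
      rewrite -[leLHS]ger0_norm ?normc_ge0// -sqrtr_sqr ler_wsqrtr// -lee_fin -TE.
      by apply: (le_trans hc); rewrite /T (big_rem c)//= leeDl// sume_ge0.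
    rewrite -[leRHS]sqr_sqrtr ?fine_ge0// lerXn2r ?nnegrE ?sqrtr_ge0//.
rewrite ge0_integral_sum//.
apply: lte_sum_pinfty => c _.
rewrite (ge0_intZ _ _ _ (mcompT mH (mshf hG2 c)))//; last by move=> w _; exact: H0.
by rewrite (int_shift hG2 c mH H0) lte_mul_pinfty.
Qed.

(** * The integral inequality for the transform of an eigenfunction *)

Section Eigenfunction.
Variables (sigma : (G * D -> R[i]) -> R[i]) (A : (G -> R[i]) -> (G -> R[i])).
Hypotheses (Ss : S0_dual (P := P2) sigma) (A_ext : bounded_extension_Op0 (P := P1) sigma A).
Variables (g2 : G * D -> R[i]) (v0 : (G * D) * (D * G)).
Hypotheses (ng2 : nwin (P := P2) g2) (g2v0 : L2_inner mu2 (tfs2 v0 g2) rgauss != 0).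

(** For phase-space points z and v, put b = (z.2 - v.2, v.1 - z.1), the frequency variable of the
    transform of the symbol. Then v = z + [shear b], and its time variable (z.1, v.2) is z -
    [lower b]. *)
Definition shear (b : D * G) : G * D := (b.2, - b.1).
Definition lower (b : D * G) : G * D := (0, b.1).
Definition symbol_stft (w : (G * D) * (D * G)) : R := normc (dual_stft (P := P2) g2 sigma (w + v0)).

Lemma continuous_shear : continuous shear.
Proof.
apply: (cpair (f := fun b : D * G => b.2) (g := fun b : D * G => - b.1)); first by move=> b; exact: cvg_snd.
by apply: (tgroup_oppf (hg_top hD)) => b; exact: cvg_fst.
Qed.
Lemma continuous_lower : continuous lower.
Proof.
by apply: (cpair (f := fun _ : D * G => 0 : G) (g := fun b : D * G => b.1)) => b; [exact: cvg_cst|exact: cvg_fst].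
Qed.
Lemma shearD : {morph shear : x y / x + y >-> x + y}.
Proof. by move=> [a b] [c d]; rewrite /shear /= opprD. Qed.
Lemma lowerD : {morph lower : x y / x + y >-> x + y}.
Proof. by move=> [a b] [c d]; rewrite /lower -[in LHS](addr0 0). Qed.

Lemma continuous_symbol_stft : continuous symbol_stft.
Proof.
move=> w; apply: (@ccont_normc R ((G * D) * (D * G))%type (fun w => dual_stft (P := P2) g2 sigma (w + v0)) w).
apply: (@continuous_comp _ _ _ (fun w => w + v0) (dual_stft (P := P2) g2 sigma : _ -> R[i]^o)); last exact: (dual_stft_continuous hP2 gP2 Ss ng2).
exact: (tgroup_shift (tgroup_prod (hg_top hG2) (hg_top hD2))).
Qed.

(** The kernel is [sigma] at a Rihaczek transform of two shifts of phi, which by covariance is a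
    shift of [rgauss]; [window_change] then passes to [g2]. *)
Lemma symbol_kernel : exists2 C : R, 0 <= C & forall (z : G * D) (b : D * G),
  ((normc (L2_inner mu (A (tfs1 (z + shear b) phi)) (tfs1 z phi)))%:E <=
   C%:E * \int[prodm mu2 nu2]_w (gprod (pi / 2) w * symbol_stft (z - lower b + w.1, (b + w.2)%R))%:E)%E.
Proof.
have [Sr [C C0 H]] := window_change Ss ng2 g2v0; exists C => // z b.
set v := z + shear b; have Sz w : S0 (P := P1) (tfs1 w phi) := nwin_S0 hP1 gP1 (nwin_tfshift hP1 gP1 w (nwin_gauss gP1)).
have e : L2_inner mu (A (tfs1 v phi)) (tfs1 z phi) =
  sigma (rihaczek (P := P1) (tfs1 z phi) (tfs1 v phi)) := A_ext.2 _ (Sz v) _ (Sz z).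
have [c c1 rE] := rihaczek_tfshift z v.
rewrite e rE (S0_dualZ hP2 gP2 Ss); last exact: (S0_tfshift hP2 gP2 _ Sr).1.
rewrite normcM' normc_conj c1 mul1r.
have -> : ((z.1, v.2), (z.2 - v.2, v.1 - z.1)) = (z - lower b, b) :> (G * D) * (D * G).
  rewrite /v /shear /lower; case: z b {v e rE} => [x xi] [eta y]; congr ((_, _), (_, _)).
  - by change (x = x - 0); rewrite subr0.
  - by change (xi - (xi - eta) = eta); rewrite opprB addrCA subrr addr0.
  - by change (x + y - x = y); rewrite addrAC subrr add0r.
exact: H.
Qed.

(** The substitution combines a reflection in the frequency, an exchange of the two factors and a
    translation, all of which preserve the measure. *)
Lemma integral_shear (H : G * D -> R) (z : G * D) : continuous H -> (forall w, 0 <= H w) ->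
  (\int[prodm mu nu]_v (H v)%:E = \int[nu2]_b (H (z + shear b))%:E)%E.
Proof.
move=> cH H0.
have mc (K : G * D -> R) : continuous K -> mfunT (fun w : borel G * borel D => (K w)%:E).
  move=> cK; apply/mEFinP; have c := ccont_real cK; by case: (continuous_cmeas_prod (hg_csb hG) (hg_csb hD) c).
have cHz : continuous (fun v => H (v + z)).
  by move=> v; apply: (@continuous_comp _ _ _ (fun v => v + z) H); [exact: (tgroup_shift (hg_top hG2))|exact: cH].
rewrite -(int_shift2 hG hD z (f := fun v => (H v)%:E) (mc _ cH)) => [|w]; last by rewrite lee_fin.
have H0' w : (0 <= (H w)%:E)%E by rewrite lee_fin.
rewrite (@prodm_tonelli2 _ _ (borel G) (borel D) R mu nu (fun v => (H (v + z))%:E) (mc _ cHz)) => [|w]; last exact: H0'.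
rewrite -(ge0_integral_opp hD (k := fun xi => \int[mu]_x (H ((x, xi) + z))%:E)%E); last 2 first.
- exact: (@mint2 _ _ (borel G) (borel D) R mu _ (mc _ cHz)).
- by move=> xi; apply: integral_ge0 => x _; exact: H0'.
have cS : continuous (fun b => H (z + shear b)).
  move=> b; apply: (@continuous_comp _ _ _ (fun b => z + shear b) H); last exact: cH.
  by apply: (tgroup_addf (hg_top hG2)); [exact: cst_continuous|exact: continuous_shear].
have mS : mfunT (fun b : borel D * borel G => (H (z + shear b))%:E).
  apply/mEFinP; have c := ccont_real cS; by case: (continuous_cmeas_prod (hg_csb hD) (hg_csb hG) c).
rewrite (ge0_integral_product nu2_prod mS) => [|b]; last exact: H0'.
rewrite (@prodm_tonelli1 _ _ (borel D) (borel G) R nu mu (fun b => (H (z + shear b))%:E) mS) => [|b]; last exact: H0'.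
by apply: eq_integral => xi _; apply: eq_integral => x _; rewrite addrC.
Qed.

(** The eigenvalue equation is paired with a shift of phi and divided by [lambda];
    [L2_operator_bound] and [symbol_kernel] then bound the transform of [f] by an integral of
    itself. *)
Lemma eigenfunction_stft_le (lambda : R[i]) f : lambda != 0 -> L2 (P := P1) f -> {ae mu, forall x, A f x = lambda * f x} ->
  exists2 C : R, 0 <= C & forall z : G * D, ((normc (V f z))%:E <= C%:E * \int[prodm nu2 (prodm mu2 nu2)]_x
    (normc (V f (z + shear x.1)) * (gprod (pi / 2) x.2 * symbol_stft (z - lower x.1 + x.2.1, (x.1 + x.2.2)%R)))%:E)%E.
Proof.
move=> l0 Lf Af; have [C C0 HC] := symbol_kernel.
have nl0 : 0 < normc lambda by rewrite lt_neqAle normc_ge0 eq_sym normc_eq0 l0.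
have [bA _] := A_ext; have [AL2 _ _] := bA.
have LA : L2 (P := P1) (A f) by apply/in_L2P; apply: AL2; apply/in_L2P.
pose cc := fine (sqn mu phi); have cc0 : 0 < cc by exact: c0.
have cN := continuous_normc_stft Lf.
exists ((normc lambda)^-1 * (cc^-1 * C)).
  by apply: mulr_ge0; rewrite ?invr_ge0 ?normc_ge0//; apply: mulr_ge0 => //; rewrite invr_ge0 ltW.
move=> z; have Lz := L2_phi hP1 gP1 z.
have [cW bnd] := L2_operator_bound hP1 gP1 inversion fO c0 bA Lf Lz.
pose W (v : G * D) := normc (L2_inner mu (A (tfs1 v phi)) (tfs1 z phi)).
have LW v : L2 (P := P1) (A (tfs1 v phi)) by apply/in_L2P; apply: AL2; apply/in_L2P; exact: (L2_phi hP1 gP1).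
have cWn : continuous W.
  have -> : W = fun v => normc (L2_inner mu (tfs1 z phi) (A (tfs1 v phi))).
    by apply/funext => v; rewrite /W (L2_inner_conj (LW v) Lz) normc_conj.
  by move=> v; apply: (@ccont_normc R (G * D)%type); exact: cW.
have lE : normc (L2_inner mu (A f) (tfs1 z phi)) = normc lambda * normc (V f z).
  rewrite -normcM' -(cintZ lambda (L2_mul_conj Lf Lz)); congr normc.
  have [[mA _] [mf _] [mz _]] := And3 LA Lf Lz.
  apply: ae_eq_cintegral.
  - by apply: cmeasM => //; exact: cmeas_conj.
  - by apply: cmeasM; [exact: cmeas_cst|apply: cmeasM => //; exact: cmeas_conj].
  - by apply: (negligibleS _ Af) => x /=; apply: contra_not => ->; rewrite mulrA.
have HV0 v : 0 <= normc (V f v) * W v by apply: mulr_ge0; exact: normc_ge0.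
have cHV : continuous (fun v => normc (V f v) * W v) by move=> v; apply: (@continuousM R (G * D)%type); [exact: cN|exact: cWn].
rewrite lE (integral_shear z cHV HV0) in bnd.
set J := (\int[prodm nu2 _]_x _)%E.
suff le : (\int[nu2]_b (normc (V f (z + shear b)) * W (z + shear b))%:E <= C%:E * J)%E.
  have e : (normc (V f z))%:E = ((normc lambda)^-1%:E * (normc lambda * normc (V f z))%:E)%E.
    by rewrite -EFinM mulKf// gt_eqF.
  rewrite e !EFinM -!muleA; apply: lee_wpmul2l; first by rewrite lee_fin invr_ge0 normc_ge0.
  apply: (le_trans bnd); apply: lee_wpmul2l => //; by rewrite lee_fin invr_ge0 ltW.
pose L (x : bDG * (bGD * bDG)) : \bar R :=
  (normc (V f (z + shear x.1)) * (gprod (pi / 2) x.2 * symbol_stft (z - lower x.1 + x.2.1, (x.1 + x.2.2)%R)))%:E.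
have S0 w : 0 <= symbol_stft w by exact: normc_ge0.
have L0 q : (0 <= L q)%E.
  rewrite lee_fin; apply: mulr_ge0; first exact: normc_ge0.
  by apply: mulr_ge0; [exact: gprod_ge0|exact: S0].
have mS : mfunT (symbol_stft : bGD * bDG -> R).
  have c := ccont_real continuous_symbol_stft; by case: (continuous_cmeas_prod (hg_csb hG2) (hg_csb hD2) c).
have mGS (d : measure_display) (T : measurableType d) (b : T -> bDG) (w1 : T -> bGD) (w2 : T -> bDG) :
    mfunT b -> mfunT w1 -> mfunT w2 ->
    mfunT (fun q : T => gprod (pi / 2) (w1 q, w2 q) * symbol_stft (z - lower (b q) + w1 q, (b q + w2 q)%R)).
  move=> mb m1 m2; apply: measurable_funM; first exact: (mcompT (measurable_gprod _) (measurable_fun_pair m1 m2)).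
  apply: (mcompT mS); apply: measurable_fun_pair; last exact: (maddf (hg_top hD2) (hg_csb hD2)).
  apply: (maddf (hg_top hG2) (hg_csb hG2)) => //; apply: (msubf (hg_top hG2) (hg_csb hG2)); first exact: measurable_cst.
  exact: (mcompT (ccont_mborel continuous_lower) mb).
have cF : continuous (fun b => normc (V f (z + shear b))).
  move=> b; apply: (@continuous_comp _ _ _ (fun b => z + shear b) (fun z : G * D => normc (V f z))); last exact: cN.
  by apply: (tgroup_addf (hg_top hG2)); [exact: cst_continuous|exact: continuous_shear].
have mF : mfunT (fun b : bDG => normc (V f (z + shear b))) by exact: ccont_mR.
have mL : mfunT L.
  apply/mEFinP; apply: measurable_funM; first exact: (mcompT mF measurable_fst).
  apply: (mGS _ _ fst (fun q => q.2.1) (fun q => q.2.2)) => //.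
    exact: (mcompT measurable_fst measurable_snd).
  exact: (mcompT measurable_snd measurable_snd).
have mI : mfunT (fun b : bDG => \int[prodm mu2 nu2]_w L (b, w))%E.
  exact: (@mint1 _ _ (bDG) _ R (prodm mu2 nu2) L mL L0).
rewrite /J (@prodm_tonelli1 _ _ (bDG) _ R nu2 (prodm mu2 nu2) L mL L0) -ge0_intZ//; last first.
  by move=> b _; apply: integral_ge0.
have cS : continuous (fun b => W (z + shear b)).
  move=> b; apply: (@continuous_comp _ _ _ (fun b => z + shear b) W); last exact: cWn.
  by apply: (tgroup_addf (hg_top hG2)); [exact: cst_continuous|exact: continuous_shear].
apply: ge0_le_int.
- apply/mEFinP; apply: measurable_funM => //; exact: ccont_mR.
- exact: measurable_funeM.
- by move=> b; rewrite lee_fin.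
- move=> b; rewrite EFinM; apply: (@le_trans _ _ ((normc (V f (z + shear b)))%:E * (C%:E * \int[prodm mu2 nu2]_w
      (gprod (pi / 2) w * symbol_stft (z - lower b + w.1, (b + w.2)%R))%:E))%E).
    by apply: lee_wpmul2l; [rewrite lee_fin normc_ge0|exact: HC].
  rewrite muleCA; apply: lee_wpmul2l; first by rewrite lee_fin.
  rewrite -ge0_intZ ?normc_ge0//.
  + by move=> w _; rewrite lee_fin; apply: mulr_ge0; [exact: gprod_ge0|exact: S0].
  + apply/mEFinP; exact: (mGS _ _ (fun=> b) fst snd (measurable_cst _) measurable_fst measurable_snd).
Qed.

(** [amalgam_iterate] is started at the exponent 2. The memberships of [sigma] for all gamma supply
    the mixed-norm bounds for whatever increment t it uses. *)
Lemma eigenfunction_msup_lty (Q2 : set ((G * D) * (D * G))) (p : R) (lambda : R[i]) f (r : R) N :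
  unit_neighbourhood (P := P2) Q2 -> 0 < p -> (forall t : R, 0 < t -> modulation (P := P2) g2 Q2 p%:E t%:E sigma) ->
  lambda != 0 -> L2 (P := P1) f -> {ae mu, forall x, A f x = lambda * f x} -> 0 < r -> compact N -> N 0 ->
  (\int[mu2]_z (msup N (fun z : G * D => normc (V f z)) z `^ r)%:E < +oo)%E.
Proof.
move=> Q2u p_gt0 Sm l0 Lf Af r0 kN N0.
have [C C0 FV] := eigenfunction_stft_le l0 Lf Af.
have [M HM] := stft_L2_bound hP1 gP1 Lf; have [MV HMV] := dual_stft_bounded hP2 gP2 Ss ng2.
have [CG [kCG nCG]] := lc_compact_nbhs G_lca.2 0; have [CD [kCD nCD]] := lcD.
(* Small enough for the displacement estimates of Gaussians, and contained in compact sets. *)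
pose UG := (ballG `&` CG)^°; pose UD := (ballD `&` CD)^°.
have UG0 : UG 0 by apply: nbhs_singleton; apply: nbhs_interior; apply: filterI => //; exact: (gauss_ball_G G_lca mu_haar s).
have UD0 : UD 0 by apply: nbhs_singleton; apply: nbhs_interior; apply: filterI => //; exact: (gauss_ball_D G_lca G_sc nu_haar s lcD).
have UGs x : UG x -> ballG x /\ CG x by exact: interior_subset.
have UDs xi : UD xi -> ballD xi /\ CD xi by exact: interior_subset.
have oUG : open UG := @open_interior _ _; have oUD : open UD := @open_interior _ _.
(* The constant of [gprod_shift] for k = pi / 2. *)
pose K := (expR ((pi : R) / 2) * expR (pi / 2 / 2)) ^+ 4.
have K0 : 0 <= K by apply: exprn_ge0; apply: mulr_ge0; exact: expR_ge0.
have p8 : 0 < (pi : R) / 2 / 4 by rewrite divr_gt0.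
have mG2 : mfunT (fun w : bGD * bDG => K * gprod (pi / 2 / 4) w).
  by apply: measurable_funM; [exact: measurable_cst|exact: measurable_gprod].
apply: (amalgam_iterate hG2 hD2 continuous_lower continuous_shear lowerD shearD (continuous_normc_stft Lf) continuous_symbol_stft
  (fun z => normc_ge0 _) HM (fun w => normc_ge0 _) (fun w => HMV _) (measurable_gprod _) mG2 (gprod_ge0 (pi / 2)) C0 p_gt0
  (open_setX oUG oUD) (open_setX oUD oUG) _ _ _ _ (compact_setX kCG kCD) (compact_setX kCD kCG) _ _ FV _ (q := 2)) => //.
- by move=> z [/UGs[_ h1] /UDs[_ h2]].
- by move=> z [/UDs[_ h1] /UGs[_ h2]].
- move=> w w0 [/UGs[b1 _] /UDs[b2 _]] [/UDs[b3 _] /UGs[b4 _]].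
  exact: (gprod_shift w (ltW ph) b1 b2 b3 b4).
- move=> t t0; have E w : (K * gprod (pi / 2 / 4) w) `^ t = K `^ t * gprod (t * (pi / 2 / 4)) w.
    by rewrite (powRM t K0 (gprod_ge0 _ w)) (gprod_powR _ _ t0).
  under eq_integral do rewrite E EFinM.
  rewrite ge0_intZ ?powR_ge0//.
  + by apply: lte_mul_pinfty; [rewrite lee_fin powR_ge0|by []|apply: gprod_lty; rewrite mulr_gt0].
  + by move=> w _; rewrite lee_fin gprod_ge0.
  + by apply/mEFinP; exact: measurable_gprod.
- by move=> N' kN' N'0 t t0; exact: (msup_dual_stft_lty hP2 gP2 v0 ng2 Q2u p_gt0 t0 (Sm t t0) kN' N'0).
- by move=> N' kN' N'0; exact: msup_stft_sqr_lty.
Qed.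
End Eigenfunction.

(** A window in S_C is a finite combination of shifts of phi, so its transform on w + Q is
    controlled by the maximal function of [V f] over a compact set built from [Q] and these shifts.
    As both exponents equal r, the mixed norm reduces to a plain integral. *)
Lemma modulation_L2_functional g Q f (r : R) : S_C (P := P1) g -> unit_neighbourhood (P := P1) Q -> L2 (P := P1) f -> 0 < r ->
  (forall N, compact N -> N 0 -> (\int[mu2]_z (msup N (fun z : G * D => normc (V f z)) z `^ r)%:E < +oo)%E) ->
  modulation (P := P1) g Q r%:E r%:E (L2_functional (P := P1) f).
Proof.
move=> Sg [mQ pQ nQ] Lf r0 H; have Su := L2_functional_dual hP1 gP1 inversion fO c0 Lf; set u := L2_functional f in Su *.
have ng := S_C_nwin hP1 gP1 Sg; have cF := dual_stft_continuous hP1 gP1 Su ng.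
have Sge := local_sup_ge hP1 cF; have mS := measurable_local_sup hP1 cF mQ.
set S := local_sup Q (dual_stft g u) in mS *.
have Q0 : Q^° 0 by exact: nbhs_singleton (nbhs_interior nQ).
have S0 w : (0 <= S w)%E by apply: le_trans (Sge Q w w _); rewrite ?lee_fin ?normc_ge0// subrr.
have [n [c [z gE]]] := Sg; have [M HM] := stft_L2_bound hP1 gP1 Lf.
pose F (w : G * D) := normc (V f w).
(* 0 is adjoined to the shifts so that [N] contains 0, also for an empty combination. *)
pose N := [set w.1 + w.2 | w in closure Q `*` ([set 0] `|` range z)].
have clQ0 : closure Q 0 by apply: subset_closure; exact: nbhs_singleton nQ.
have N0 : N 0 by exists (0, 0); [split => //; left|rewrite addr0].
have kN : compact N.
  have cadd : continuous (fun w : (G * D) * (G * D) => w.1 + w.2).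
    by apply: (tgroup_addf (hg_top hG2)) => w; [exact: cvg_fst|exact: cvg_snd].
  apply: continuous_compact; first exact: continuous_subspaceT.
  apply: compact_setX; first by rewrite -precompactE.
  by apply: finite_compact; rewrite finite_setU; split; [exact: finite_set1|apply: finite_image; exact: finite_finset].
have Nn : N !=set0 by exists 0.
pose m := \sum_(k < n) normc (c k).
have m0 : 0 <= m by apply: sumr_ge0 => k _; exact: normc_ge0.
have le (w y : G * D) : Q (y - w) -> normc (dual_stft g u y) <= m * msup N F w.
  move=> Qy; have nk (k : 'I_n) : nwin (P := P1) (tfs1 y (tfs1 (z k) phi)).
    by apply: (nwin_tfshift hP1 gP1); apply: (nwin_tfshift hP1 gP1); exact: (nwin_gauss gP1).
  have -> : dual_stft g u y = \sum_(k < n) (c k)^* * u (tfs1 y (tfs1 (z k) phi)).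
    rewrite /dual_stft gE -(S0_dual_sum hP1 gP1 Su c nk); congr u.
    by rewrite tfshift_sum; apply/funext => x; apply: eq_bigr => k _; rewrite tfshiftZ.
  rewrite mulr_suml; elim/big_ind2: _ => [|a a' b b' ha hb|k _]; first by rewrite normc0.
    by apply: (le_trans (le_normcD _ _)); exact: lerD.
  rewrite normcM' normc_conj; apply: ler_wpM2l; first exact: normc_ge0.
  rewrite (normc_dual_tfshift hP1 gP1 _ _ Su (nwin_S0 hP1 gP1 (nwin_gauss gP1))).
  have -> : y + z k = w + ((y - w) + z k) by rewrite addrA [w + _]addrC subrK.
  apply: (le_msup (F := F) HM Nn); exists (y - w, z k) => //; split; first exact: subset_closure.
  by right; exists k.
have Sle w : (S w <= (m * msup N F w)%:E)%E.
  apply: local_sup_le; last by move=> y; exact: le.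
  by apply: mulr_ge0 => //; apply: (msup_ge0 HM Nn) => y; exact: normc_ge0.
split => //; rewrite /mixed_norm; apply: ((mixed_Lnorm_lty mu nu _ S0 r0).2 _).
have mpow : mfunT (fun w : borel G * borel D => (S w `^ r)%E) by exact: (mcompT (measurable_poweR r) mS).
have P0 w : (0 <= S w `^ r)%E by exact: poweR_ge0.
under eq_integral do rewrite divff ?gt_eqF// poweRe1 ?integral_ge0//.
rewrite -(@prodm_tonelli2 _ _ (borel G) (borel D) R mu nu _ mpow P0).
have cN := continuous_normc_stft Lf.
have mM : mfunT (fun w : borel G * borel D => (msup N F w `^ r)%:E).
  apply/mEFinP; apply: (mcompT (measurable_powR r)).
  apply: (measurable_msup (j := id : borel G * borel D -> G * D) _ (hg_top hG2) HM Nn cN) => U oU.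
  exact: (open_mprod (hg_csb hG) (hg_csb hD)).
apply: (@le_lt_trans _ _ (\int[prodm mu nu]_w ((m `^ r)%:E * (msup N F w `^ r)%:E))%E).
  apply: ge0_le_int => //; first exact: measurable_funeM.
  move=> w; have M0 : 0 <= msup N F w by apply: (msup_ge0 HM Nn) => y; exact: normc_ge0.
  by apply: (le_trans (poweR_le r0 (S0 w) (Sle w))); rewrite poweR_EFin -EFinM powRM.
rewrite ge0_intZ ?powR_ge0//; last by move=> w _; rewrite lee_fin powR_ge0.
apply: lte_mul_pinfty; [by rewrite lee_fin powR_ge0|by []|].
rewrite -(ge0_integral_product mu2_prod mM) => [|w]; last by rewrite lee_fin powR_ge0.
exact: H.
Qed.
End PhaseWindow.

Theorem proposition4p22 (R : realType) (G : topologicalZmodType)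
    (G_lca : is_lca G) (G_sc : @second_countable G) (G_sigma : sigma_compact G)
    (* Haar measures on G, its dual, the phase space and its dual *)
    (mu : {sigma_finite_measure set (borel G) -> \bar R})
    (nu : {sigma_finite_measure set (borel (dual R G)) -> \bar R})
    (mu2 : {sigma_finite_measure set (borel (G * dual R G)%type) -> \bar R})
    (nu2 : {sigma_finite_measure set (borel (dual R G * G)%type) -> \bar R})
    (mu_haar : is_haar mu) (nu_haar : is_haar nu)
    (mu2_prod : is_product_measure mu nu mu2)
    (nu2_prod : is_product_measure nu mu nu2)
    (* G ~ R^d x G_0, with the compact open subgroup K of G_0 *)
    (s : lca_structure R G)
    (mu_nu_dual : fourier_inversion (group_tf s mu nu))
    (* windows and unit neighbourhoods defining the modulation spaces *)
    (g : G -> R[i]) (Q : set (G * dual R G))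
    (g_window : window (P := group_tf s mu nu) g)
    (Q_unit : unit_neighbourhood (P := group_tf s mu nu) Q)
    (g2 : G * dual R G -> R[i])
    (Q2 : set ((G * dual R G) * (dual R G * G)))
    (g2_window : window (P := phase_tf s mu2 nu2) g2)
    (Q2_unit : unit_neighbourhood (P := phase_tf s mu2 nu2) Q2)
    (sigma : (G * dual R G -> R[i]) -> R[i]) (p : R) (p_gt0 : 0 < p)
    (sigma_mod : forall gamma : R, 0 < gamma ->
      modulation (P := phase_tf s mu2 nu2) g2 Q2 p%:E gamma%:E sigma)
    (A : (G -> R[i]) -> (G -> R[i]))
    (A_ext : bounded_extension_Op0 (P := group_tf s mu nu) sigma A)
    (lambda : R[i]) (lambda_spec : point_spectrum mu A lambda)
    (lambda_neq0 : lambda != 0)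
    (f : G -> R[i]) (f_eigen : eigenfunction mu A lambda f) :
  forall gamma : R, 0 < gamma ->
    modulation (P := group_tf s mu nu) g Q gamma%:E gamma%:E
      (L2_functional (P := group_tf s mu nu) f).
Proof.
move=> r r0.
(* [Q] is a unit neighbourhood with compact closure; projecting this closure gives a compact
   neighbourhood of 0 in the dual. *)
have lcD : exists C : set (dual R G), compact C /\ nbhs (0 : dual R G) C.
  have [_ pQ [[U W] [/= nU nW] UW]] := Q_unit; exists (snd @` closure Q); split.
    apply: continuous_compact; first by apply: continuous_subspaceT => z; exact: cvg_snd.
    by rewrite -precompactE.
  apply: filterS nW => xi Wxi; exists (0, xi) => //; apply: subset_closure.
  by apply: UW; split => //; exact: nbhs_singleton nU.
have [fL2 _ Af] := f_eigen; have Lf := (in_L2P _ _).1 fL2.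
have [Sg _] := g_window; have [Sg2 g2_neq0] := g2_window; have [Ss _ _] := sigma_mod 1 ltr01.
have hP2 := tf_group_phase G_lca G_sc mu_haar nu_haar mu2_prod nu2_prod s.
have gP2 := tf_gauss_phase G_lca G_sc mu_haar nu_haar mu2_prod nu2_prod mu_nu_dual lcD.
have [v0 g2v0] := inner_rgauss_neq0 G_lca G_sc mu_haar nu_haar mu2_prod nu2_prod mu_nu_dual lcD Sg2 g2_neq0.
apply: (modulation_L2_functional G_lca G_sc mu_haar nu_haar mu2_prod nu2_prod mu_nu_dual lcD Sg Q_unit Lf r0) => N kN N0.
exact: (eigenfunction_msup_lty G_lca G_sc mu_haar nu_haar mu2_prod nu2_prod mu_nu_dual lcD Ss A_ext
  (S_C_nwin hP2 gP2 Sg2) g2v0 Q2_unit p_gt0 sigma_mod lambda_neq0 Lf Af r0 kN N0).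
Qed.
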